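(* Let $M^4$ be a four-dimensional (self-crossing) stable generalized complex manifold. Then for every point $p\in D(2)$ there exist complex coordinates $(z_1,z_2)$ around $p$ in which the complex log divisor is the standard one, $\langle z_1z_2\rangle$, and such that a local trivialisation of the canonical line bundle is given by the pure spinor $$\rho=e^B(\lambda z_1z_2+dz_1\wedge dz_2)$$ for some $\lambda\in\mathbb{C}$ and some real two-form $B$.
   Context: A generalized complex structure on $M$ is a pair $(\mathbb{J},H)$ with $H\in\Omega^3(M)$ closed and $\mathbb{J}$ an endomorphism of $\mathbb{T}M=TM\oplus T^*M$, orthogonal for the natural pairing, with $\mathbb{J}^2=-\mathrm{Id}$, whose $+i$-eigenbundle $L\subset\mathbb{T}M\otimes\mathbb{C}$ is involutive for $[\![X+\xi,Y+\eta]\!]_H=[X,Y]+\mathcal{L}_X\eta-\iota_Yd\xi+\iota_X\iota_YH$. The canonical line bundle is the complex line bundle $K\subset\wedge^\bullet T^*_{\mathbb{C}}M$ annihilated by $L$ under $(X+\xi)\cdot\rho=\iota_X\rho+\xi\wedge\rho$; the anticanonical section is $s\in\Gamma(K^* )$, $s(\rho)=\rho_0$ (degree-zero part). A complex divisor is a complex line bundle $L'\to M$ with a section $\sigma$ with nowhere dense zero set, with ideal $I_\sigma=\sigma(\Gamma((L')^* ))\subset C^\infty(M;\mathbb{C})$. It is a smooth complex log divisor if $\sigma$ vanishes transversely, and a (self-crossing) complex log divisor if every point has a neighbourhood on which $I_\sigma=I_1\cdots I_j$ ($j\ge0$), where the $I_i$ are smooth complex log divisors with local generators $f_i$ satisfying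 $df_{i_1}\wedge d\bar f_{i_1}\wedge\cdots\wedge df_{i_k}\wedge d\bar f_{i_k}\ne0$ at the common zeros of $f_{i_1},\dots,f_{i_k}$ for every subset of indices. The minimal such $j$ is the intersection number of the point. The structure is (self-crossing) stable if $(K^*,s)$ is a complex log divisor; then $D=s^{-1}(0)$ and $D(2)\subset D$ is the set of points of intersection number at least two. ''Complex coordinates'' means smooth complex-valued coordinates $z_k=x_k+iy_k$ with $(x_1,y_1,x_2,y_2)$ a smooth chart. *)

(* Defs.v *)
From HB Require Import structures.
From mathcomp Require Import all_boot all_order all_algebra.
From mathcomp Require Import boolp classical_sets functions reals.
From mathcomp Require Import topology normedtype derive.
From mathcomp Require Import complex.

Set Implicit Arguments.
Unset Strict Implicit.
Unset Printing Implicit Defensive.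

Import Order.TTheory GRing.Theory Num.Theory.
Import numFieldNormedType.Exports.

Local Open Scope ring_scope.

(** * Exterior algebra of [(C^n)^*]

  An element is its family of coefficients [w K] on the basis
  [dx_K = dx_{k_1} /\ ... /\ dx_{k_r}], [K = {k_1 < ... < k_r}]. *)

Definition ext (R : realType) (n : nat) := {ffun {set 'I_n} -> R[i]}.

Section Exterior.
Context {R : realType} {n : nat}.
Local Notation C := R[i].
Local Notation ext := (ext R n).
Implicit Types (u v w : ext) (K I J : {set 'I_n}).

Definition ext1 : ext := [ffun K => (K == finset.set0)%:R].

Definition ext_scale (t : C) w : ext := [ffun K => t * w K].

Definition covec (xi : 'cV[C]_n) : ext :=
  [ffun K : {set 'I_n} => \sum_(i | K == [set i]) xi i 0].

(* dx_I /\ dx_J = ext_sign I J * dx_(I :|: J) for disjoint I and J: the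
   exponent is the number of inversions. *)
Definition ext_sign I J : C :=
  (-1) ^+ #|[set ij : 'I_n * 'I_n |
             [&& ij.1 \in I, ij.2 \in J & (ij.2 < ij.1)%N]]|.

Definition wedge u v : ext :=
  [ffun K : {set 'I_n} => \sum_(I : {set 'I_n} | I \subset K)
               ext_sign I (K :\: I) * u I * v (K :\: I)].

Definition wedges (s : seq ext) : ext := foldr wedge ext1 s.

(* interior product iota_X w *)
Definition contract (X : 'cV[C]_n) w : ext :=
  [ffun K : {set 'I_n} => \sum_(i | i \notin K)
     ext_sign [set i] K * X i 0 * w (i |: K)].

(* e^w; for w of positive degree all the omitted terms vanish *)
Definition ext_exp w : ext :=
  \sum_(k < n.+1) ext_scale (k`!%:R)^-1 (iter k (wedge w) ext1).

(* The algebra morphism sending dx_i to sum_j A_ij dx_j. *)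
Definition ext_pull (A : 'M[C]_n) w : ext :=
  \sum_(I : {set 'I_n})
     ext_scale (w I) (wedges [seq covec (row i A)^T | i <- enum I]).

(* v = col_mx X xi encodes X + xi; this is iota_X w + xi /\ w. *)
Definition clifford (v : 'cV[C]_(n + n)) w : ext :=
  contract (usubmx v) w + wedge (covec (dsubmx v)) w.

End Exterior.

Local Open Scope classical_set_scope.

(** * Smooth manifolds *)

(* all iterated partial derivatives of f are differentiable on W (W open) *)
Definition smooth_rV (R : realType) (n : nat)
    (W : set 'rV[R]_n) (f : 'rV[R]_n -> R) : Prop :=
  forall (s : seq 'I_n) (x : 'rV[R]_n), W x ->
    differentiable
      (foldr (fun i (g : 'rV[R]_n -> R) => 'D_(delta_mx 0 i) g) f s) x.

(* The values of chart_map outside chart_dom, and of chart_inv outside the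
   image of chart_dom, are irrelevant. *)
Record chart (R : realType) (n : nat) (T : topologicalType) := Chart {
  chart_dom : set T;
  chart_map : T -> 'rV[R]_n;
  chart_inv : 'rV[R]_n -> T }.

Definition chart_img (R : realType) (n : nat) (T : topologicalType)
    (c : chart R n T) : set 'rV[R]_n := chart_map c @` chart_dom c.

Definition is_chart (R : realType) (n : nat) (T : topologicalType)
    (c : chart R n T) : Prop :=
  [/\ open (chart_dom c), open (chart_img c),
      forall q, chart_dom c q -> chart_inv c (chart_map c q) = q,
      {within chart_dom c, continuous (chart_map c)} &
      {within chart_img c, continuous (chart_inv c)}].

Definition smooth_transition (R : realType) (n : nat) (T : topologicalType)
    (c d : chart R n T) : Prop :=
  forall j : 'I_n,
    smooth_rV (chart_map c @` (chart_dom c `&` chart_dom d))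
              (fun x => chart_map d (chart_inv c x) 0 j).

(* The smooth structure is a maximal atlas, so that "smooth chart" means
   "element of the atlas". *)
Record smooth_manifold (R : realType) (n : nat) := SmoothManifold {
  carrier :> topologicalType;
  carrier_hausdorff : hausdorff_space carrier;
  carrier_second_countable : @second_countable carrier;
  atlas : set (chart R n carrier);
  atlas_chart : forall c, atlas c -> is_chart c;
  atlas_cover : forall q, exists2 c, atlas c & chart_dom c q;
  atlas_smooth : forall c d, atlas c -> atlas d -> smooth_transition c d;
  atlas_maximal : forall c, is_chart c ->
    (forall d, atlas d -> smooth_transition c d /\ smooth_transition d c) ->
    atlas c }.

Definition mchart (R : realType) (n : nat) (M : smooth_manifold R n) :=
  chart R n (carrier M).

(** * Calculus on manifolds

  Functions on an open set [U] of [M] are total functions on [M] whose values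
  outside [U] are irrelevant.  A tensor field is given by its components in
  every chart, as functions of the point: [t c q] is only relevant for
  [atlas c] and [chart_dom c q], and components in different charts are related
  by the Jacobian matrices. *)

Section Calculus.
Context {R : realType} {n : nat} {M : smooth_manifold R n}.
Local Notation C := R[i].
Local Notation ext := (ext R n).
Local Notation mchart := (mchart M).
Implicit Types (c d : mchart) (q : M) (U : set M).

Definition smooth_on U (f : M -> R) : Prop :=
  forall c, atlas c ->
    smooth_rV (chart_map c @` (U `&` chart_dom c)) (f \o chart_inv c).

Definition smoothC_on U (f : M -> C) : Prop :=
  smooth_on U (fun q => complex.Re (f q)) /\
  smooth_on U (fun q => complex.Im (f q)).

(* partial derivative with respect to the i-th coordinate of the chart c *)
Definition pderiv c (i : 'I_n) (f : M -> R) q : R :=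
  'D_(delta_mx 0 i) (f \o chart_inv c) (chart_map c q).

Definition pderivC c (i : 'I_n) (f : M -> C) q : C :=
  (pderiv c i (fun x => complex.Re (f x)) q +i*
   pderiv c i (fun x => complex.Im (f x)) q)%C.

(* d x_d^i / d x_c^j *)
Definition jac c d q : 'M[R]_n :=
  \matrix_(i, j) pderiv c j (fun x => chart_map d x 0 i) q.

Definition cplx_mx (k l : nat) (A : 'M[R]_(k, l)) : 'M[C]_(k, l) :=
  map_mx (real_complex R) A.

(* change of components, from c to d, of the elements of TM + T^*M *)
Definition jacTT c d q : 'M[R]_(n + n) :=
  block_mx (jac c d q) 0 0 (jac d c q)^T.

(* complex-valued forms of mixed degree *)
Definition diff_form := mchart -> M -> ext.

Definition is_form U (w : diff_form) : Prop :=
  (forall c (K : {set 'I_n}), atlas c ->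
     smoothC_on (U `&` chart_dom c) (fun q => w c q K)) /\
  (forall c d q, atlas c -> atlas d -> U q -> chart_dom c q ->
     chart_dom d q -> w c q = ext_pull (cplx_mx (jac c d q)) (w d q)).

Definition is_kform (k : nat) U (w : diff_form) : Prop :=
  is_form U w /\
  forall c q (K : {set 'I_n}), atlas c -> U q -> chart_dom c q ->
    #|K| != k -> w c q K = 0.

Definition real_form U (w : diff_form) : Prop :=
  forall c q (K : {set 'I_n}), atlas c -> U q -> chart_dom c q ->
    complex.Im (w c q K) = 0.

(* the differentials of a form and of a function, in the chart c *)
Definition dext c (w : M -> ext) q : ext :=
  [ffun K : {set 'I_n} => \sum_(i in K)
     ext_sign [set i]%SET (K :\ i) * pderivC c i (fun x => w x (K :\ i)) q].

Definition dfun c (f : M -> C) q : ext := covec (\col_i pderivC c i f q).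

Definition closed_form (w : diff_form) : Prop :=
  forall c q, atlas c -> chart_dom c q -> dext c (w c) q = 0.

(** ** Dorfman bracket of complex sections of [TM + T^*M], in the chart c *)

Definition lie_bracket c (X Y : M -> 'cV[C]_n) q : 'cV[C]_n :=
  \col_i \sum_j (X q j 0 * pderivC c j (fun x => Y x i 0) q
                 - Y q j 0 * pderivC c j (fun x => X x i 0) q).

Definition lie_derivative c (X : M -> 'cV[C]_n) (w : M -> ext) q : ext :=
  contract (X q) (dext c w q) + dext c (fun x => contract (X x) (w x)) q.

Definition dorfman c (H : M -> ext) (u v : M -> 'cV[C]_(n + n)) q :
    'cV[C]_(n + n) :=
  let X x := usubmx (u x) in let xi x := covec (dsubmx (u x)) in
  let Y x := usubmx (v x) in let eta x := covec (dsubmx (v x)) in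
  let w := lie_derivative c X eta q - contract (Y q) (dext c xi q)
           + contract (X q) (contract (Y q) (H q)) in
  col_mx (lie_bracket c X Y q) (\col_i w [set i]%SET).

End Calculus.

Arguments diff_form {R n} M.

(** * Generalized complex structures *)

(* <X + xi, Y + eta> = (xi(Y) + eta(X)) / 2 *)
Definition pairing (R : realType) (n : nat) (u v : 'cV[R]_(n + n)) : R :=
  2^-1 * \sum_i (dsubmx u i 0 * usubmx v i 0 + dsubmx v i 0 * usubmx u i 0).

(* v lies in the +i-eigenspace of J *)
Definition in_eigen (R : realType) (m : nat) (J : 'M[R]_m) (v : 'cV[R[i]]_m) :
    Prop := cplx_mx J *m v = ('i%C : R[i]) *: v.

Record gen_complex_structure (R : realType) (n : nat)
    (M : smooth_manifold R n) := GenComplexStructure {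
  gcs_H : diff_form M;
  gcs_H_form : is_kform 3 setT gcs_H;
  gcs_H_real : real_form setT gcs_H;
  gcs_H_closed : closed_form gcs_H;
  gcs_J : mchart M -> M -> 'M[R]_(n + n);
  gcs_J_smooth : forall (c : mchart M) i j, atlas c ->
    smooth_on (chart_dom c) (fun q => gcs_J c q i j);
  gcs_J_compat : forall (c d : mchart M) (q : M), atlas c -> atlas d ->
    chart_dom c q -> chart_dom d q ->
    gcs_J d q *m jacTT c d q = jacTT c d q *m gcs_J c q;
  gcs_J_orthogonal : forall (c : mchart M) (q : M) u v, atlas c ->
    chart_dom c q -> pairing (gcs_J c q *m u) (gcs_J c q *m v) = pairing u v;
  gcs_J_square : forall (c : mchart M) (q : M), atlas c -> chart_dom c q ->
    gcs_J c q *m gcs_J c q = - 1%:M;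
  gcs_involutive :
    forall (c : mchart M) (U : set M) (u v : M -> 'cV[R[i]]_(n + n)),
    atlas c -> open U -> U `<=` chart_dom c ->
    (forall i, smoothC_on U (fun q => u q i 0)) ->
    (forall i, smoothC_on U (fun q => v q i 0)) ->
    (forall q, U q -> in_eigen (gcs_J c q) (u q)) ->
    (forall q, U q -> in_eigen (gcs_J c q) (v q)) ->
    forall q, U q -> in_eigen (gcs_J c q) (dorfman c (gcs_H c) u v q) }.

(** * Complex line bundles and complex log divisors *)

Section Divisors.
Context {R : realType} {n : nat} {M : smooth_manifold R n}.
Local Notation C := R[i].
Implicit Types (U V : set M) (q p : M).

(* A line bundle with frames e_a over lb_dom a and lb_trans a b the cocycle
   g_ab for which the components of a section satisfy s_a = g_ab s_b.  The type
   of the section fields depends only on the index type. *)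
Record line_bundle := LineBundle {
  lb_ix : Type;
  lb_dom : lb_ix -> set M;
  lb_trans : lb_ix -> lb_ix -> M -> C }.

Definition lb_section (E : line_bundle) := lb_ix E -> M -> C.

Definition is_line_bundle U (E : line_bundle) : Prop :=
  [/\ forall a : lb_ix E, open (lb_dom a),
      \bigcup_(a in [set: lb_ix E]) lb_dom a = U,
      forall a b : lb_ix E,
        smoothC_on (lb_dom a `&` lb_dom b) (lb_trans a b),
      forall (a : lb_ix E) q, lb_dom a q -> lb_trans a a q = 1 &
      forall (a b e : lb_ix E) q, lb_dom a q -> lb_dom b q -> lb_dom e q ->
        lb_trans a b q * lb_trans b e q = lb_trans a e q].

(* smooth sections over U of E and of its dual *)
Definition is_section U (E : line_bundle) (s : lb_section E) : Prop :=
  (forall a : lb_ix E, smoothC_on (U `&` lb_dom a) (s a)) /\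
  (forall (a b : lb_ix E) q, U q -> lb_dom a q -> lb_dom b q ->
     s a q = lb_trans a b q * s b q).

Definition is_dual_section U (E : line_bundle) (t : lb_section E) : Prop :=
  (forall a : lb_ix E, smoothC_on (U `&` lb_dom a) (t a)) /\
  (forall (a b : lb_ix E) q, U q -> lb_dom a q -> lb_dom b q ->
     t b q = lb_trans a b q * t a q).

Definition zero_locus (E : line_bundle) (s : lb_section E) : set M :=
  [set q | exists2 a : lb_ix E, lb_dom a q & s a q = 0].

(* the ideal s(Gamma(V, E^* )) of functions on V *)
Definition divisor_ideal V (E : line_bundle) (s : lb_section E) :
    set (M -> C) :=
  [set h | exists2 t : lb_section E, is_dual_section V t &
     forall (a : lb_ix E) q, V q -> lb_dom a q -> h q = s a q * t a q].

Definition complex_divisor U (E : line_bundle) (s : lb_section E) : Prop :=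
  [/\ is_line_bundle U E, is_section U s &
      interior (closure (zero_locus s)) = set0].

(* d_q f : T_q M -> C is onto *)
Definition submersive_at (f : M -> C) q : Prop :=
  forall c : mchart M, atlas c -> chart_dom c q ->
  forall w : C, exists X : 'I_n -> R,
    \sum_i (X i)%:C%C * pderivC c i f q = w.

Definition smooth_log_divisor U (E : line_bundle) (s : lb_section E) : Prop :=
  complex_divisor U s /\
  forall (a : lb_ix E) q, lb_dom a q -> s a q = 0 -> submersive_at (s a) q.

(* I_1 ... I_j on V; the coefficients make this the unit ideal for j = 0 *)
Definition prod_ideal V (j : nat) (I : 'I_j -> set (M -> C)) : set (M -> C) :=
  [set h | exists (m : nat) (a : 'I_m -> M -> C) (g : 'I_m -> 'I_j -> M -> C),
     [/\ forall k, smoothC_on V (a k),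
         forall k i, I i (g k i) &
         forall q, V q -> h q = \sum_k a k q * \prod_i g k i q]].

Definition principal_ideal V (f : M -> C) : set (M -> C) :=
  [set h | exists2 g : M -> C, smoothC_on V g &
     forall q, V q -> h q = g q * f q].

(* Near p the ideal of s is a product of j smooth complex log divisors with
   normal crossings.  The component of a section in a local frame is a local
   generator of its ideal, and at a common zero the wedge product is, up to a
   nonzero factor, independent of the choice of local generators. *)
Definition log_decomposition (E : line_bundle) (s : lb_section E) p (j : nat) :
    Prop :=
  exists (V : set M) (F : 'I_j -> line_bundle)
         (t : forall i, lb_section (F i)),
  [/\ open V, V p,
      forall i, smooth_log_divisor V (t i),
      divisor_ideal V s = prod_ideal V (fun i => divisor_ideal V (t i)) &
      forall (S : {set 'I_j}) (c : mchart M) q (a : forall i, lb_ix (F i)),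
        atlas c -> chart_dom c q -> V q ->
        (forall i, i \in S -> lb_dom (a i) q /\ t i (a i) q = 0) ->
        wedges [seq wedge (dfun c (t i (a i)) q)
                          (dfun c (fun x => (t i (a i) x)^*%C) q)
               | i <- enum S] != 0].

(* (self-crossing) complex log divisor on M *)
Definition log_divisor (E : line_bundle) (s : lb_section E) : Prop :=
  complex_divisor setT s /\ forall p, exists j, log_decomposition s p j.

Definition intersection_number (E : line_bundle) (s : lb_section E) p
    (j : nat) : Prop :=
  log_decomposition s p j /\
  forall k, log_decomposition s p k -> (j <= k)%N.

End Divisors.

Arguments line_bundle {R n} M.

(** * The canonical line bundle *)

Section Canonical.
Context {R : realType} {n : nat} {M : smooth_manifold R n}.
Variable G : gen_complex_structure M.
Local Notation C := R[i].

Definition in_canonical (c : mchart M) (q : M) (w : ext R n) : Prop :=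
  forall v, in_eigen (gcs_J G c q) v -> clifford v w = 0.

Definition canonical_section (U : set M) (rho : diff_form M) : Prop :=
  is_form U rho /\
  forall (c : mchart M) q, atlas c -> U q -> chart_dom c q ->
    in_canonical c q (rho c q).

Definition canonical_trivialisation (U : set M) (rho : diff_form M) : Prop :=
  canonical_section U rho /\
  forall (c : mchart M) q, atlas c -> U q -> chart_dom c q -> rho c q != 0.

(* the degree-zero part of a form; it has the same value in all charts *)
Definition form0 (w : diff_form M) (q : M) : C :=
  xget 0 [set z | forall c : mchart M, atlas c -> chart_dom c q ->
                    w c q finset.set0 = z].

(* The anticanonical bundle K^*, presented by all the local trivialisations
   rho_a of K.  A section of K^* has components s_a = s(rho_a), and
   rho_a = g_ab rho_b. *)
Definition canonical_frame : Type :=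
  {F : set M * diff_form M | open F.1 /\ canonical_trivialisation F.1 F.2}.

Definition anticanonical_bundle : line_bundle M :=
  @LineBundle R n M canonical_frame
    (fun a => (sval a).1)
    (fun a b q => xget 0 [set z : C | forall c : mchart M, atlas c ->
       chart_dom c q -> (sval a).2 c q = ext_scale z ((sval b).2 c q)]).

Definition anticanonical_section : lb_section anticanonical_bundle :=
  fun a => form0 (sval a).2.

Definition stable : Prop := log_divisor anticanonical_section.

(* D(2) *)
Definition crossing_locus : set M :=
  [set p | zero_locus anticanonical_section p /\
     exists2 j, intersection_number anticanonical_section p j & (2 <= j)%N].

End Canonical.

Arguments anticanonical_section {R n M} G.

(** * Complex coordinates in dimension four

  A smooth chart [(x_1, y_1, x_2, y_2)] yields [z_1 = x_1 + i y_1] and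
  [z_2 = x_2 + i y_2]. *)

Section ComplexCoordinates.
Context {R : realType} {M : smooth_manifold R 4}.

Definition zcoord1 (c : mchart M) (q : M) : R[i] :=
  (chart_map c q 0 (inord 0) +i* chart_map c q 0 (inord 1))%C.

Definition zcoord2 (c : mchart M) (q : M) : R[i] :=
  (chart_map c q 0 (inord 2) +i* chart_map c q 0 (inord 3))%C.

(* e^B (l z_1 z_2 + dz_1 /\ dz_2), where z_1, z_2 come from the chart z; the
   chart c is the one in which the components are taken *)
Definition normal_spinor (z : mchart M) (l : R[i]) (B : diff_form M) : diff_form M :=
  fun c q =>
    wedge (ext_exp (B c q))
      (ext_scale (l * zcoord1 z q * zcoord2 z q) ext1
       + wedge (dfun c (zcoord1 z) q) (dfun c (zcoord2 z) q)).

End ComplexCoordinates.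

(* Main.v *)
(* Near [p] a local section of the canonical bundle is [rho = rho_0 + rho_2 + rho_4] with
   [rho_0 = g f_1 f_2], and [(f_1, f_2)] is a chart [w].  Where [rho_0 <> 0] the spinor is
   [rho_0 exp eps] with [eps = rho_2 / rho_0], and involutivity says [d eps = H], so that
   [omega = Im eps] is closed.  Clearing denominators in [d eps = H] and dividing by [w_1] and
   [w_2] shows that [omega] is a logarithmic symplectic form: in the frame of the
   [r d/dr] and [d/dtheta] of [w_1] and [w_2] its matrix is smooth, and invertible at [p] since
   [rho_2 = g c dw_1 /\ dw_2] there with [c <> 0].  So there is a smooth vector field [E] with
   [i_E omega = Im (c (dw_2 / w_2 - dw_1 / w_1))], and [E] is an Euler field to first order.
   In coordinates [z] that linearise [E] the functions [w_i] become [z_i] times units, and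
   [omega] is homogeneous of degree zero because [L_E omega = d i_E omega = 0]; hence
   [omega = Im (c dz_1 /\ dz_2 / (z_1 z_2))].  The remaining part [b] of [eps] is real away from
   the divisor, and smooth because [z_1 z_2 b] is smooth and [b] is real.  Then
   [rho = u (z_1 z_2 + c dz_1 /\ dz_2 + ...) = c u e^b (z_1 z_2 / c + dz_1 /\ dz_2)] off the
   divisor, and everywhere by continuity. *)
From HB Require Import structures.
Require Import Defs.
From mathcomp Require Import all_boot all_order all_algebra.
From mathcomp Require Import boolp classical_sets functions reals.
From mathcomp Require Import constructive_ereal ereal topology normedtype landau derive realfun.
From mathcomp Require Import measure lebesgue_measure lebesgue_integral ftc.
From mathcomp Require Import sequences exp trigo complex ring lra.

Set Implicit Arguments.
Unset Strict Implicit.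
Unset Printing Implicit Defensive.

Import Order.TTheory GRing.Theory Num.Theory.
Import numFieldNormedType.Exports.
Local Open Scope classical_set_scope.
Local Open Scope ring_scope.

(** * Integrals depending on parameters *)

(** Linearising E means solving s dx/ds = E(x), which is singular at s = 0. The substitution x = s y
    gives dy/ds = (E(s y) - s y) / s^2, regular because E minus the identity vanishes to second
    order; the time-one map of this flow is the linearisation. Hence a flow depending smoothly on
    its initial value is needed. It is built from functions that are C^k in the point and merely
    continuous in the time, with Hadamard kernels in place of Gronwall estimates. Linearising the
    field with dw(E) = w also proves the inverse function theorem.

    The second obstacle is division by z: a smooth function vanishing on z = 0 is only z A + zbar B.
    An identity zbar^m S = z T with smooth T forces B to vanish there too, so that S = z A_N +
    zbar^N B_N for every N, and zbar^N / z is as regular as wanted for large N. Both the logarithmic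
    form of rho_2 and the smoothness of b rest on such identities.

    In linear coordinates the components of omega have degree -2, so t^2 omega(t v) is constant in t
    and is found from its limit at t = 0, where only rho_2 at p enters. *)

Section Prim.
Context {R : realType}.
Implicit Types (f g : R -> R) (s t : R).

(** Clamping makes every function of time total while only [0,1] matters, so that bounds and
    uniqueness statements can be given for all real times. *)
Definition clamp s : R := Num.max 0 (Num.min 1 s).

Lemma clamp_ge0 s : 0 <= clamp s.
Proof. by rewrite /clamp le_max lexx. Qed.

Lemma clamp_le1 s : clamp s <= 1.
Proof. by rewrite /clamp ge_max ler01/= ge_min lexx. Qed.

Lemma clamp_id s : 0 <= s <= 1 -> clamp s = s.
Proof. by case/andP=> s0 s1; rewrite /clamp (min_idPr s1) (max_idPr s0). Qed.

Lemma clamp_clamp s : clamp (clamp s) = clamp s.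
Proof. by rewrite clamp_id// clamp_ge0 clamp_le1. Qed.

Lemma continuous_clamp : continuous clamp.
Proof.
move=> s; apply: (@continuous_max _ _ (fun=> 0) (fun s => Num.min 1 s)).
  exact: cvg_cst.
by apply: (@continuous_min _ _ (fun=> 1) id); [exact: cvg_cst|exact: cvg_id].
Qed.

(** The integrals start at -1 so that 0 is an interior point, where the fundamental theorem gives a
    two-sided derivative. *)
Definition prim f s : R :=
  (\int[lebesgue_measure]_(x in `[(-1)%R, s]) f x
   - \int[lebesgue_measure]_(x in `[(-1)%R, 0%R]) f x)%R.

Lemma prim0 f : prim f 0 = 0. Proof. by rewrite /prim subrr. Qed.

Lemma is_derive_prim f s : continuous f -> -1 < s -> is_derive s 1 (prim f) (f s).
Proof.
move=> cf s1.
have intf : lebesgue_measure.-integrable `[(-1)%R, (s+1)%R] (EFin \o f).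
  apply: continuous_compact_integrable; first exact: segment_compact.
  by apply: continuous_subspaceT.
have ss : s < s + 1 by rewrite ltrDl.
have [df e] := @continuous_FTC1_closed R f (-1) s (s + 1) ss intf s1 (cf s).
rewrite /prim.
have -> : f s = f s - 0 by rewrite subr0.
apply: is_deriveB.
by apply: DeriveDef; [exact: df|rewrite -derive1E].
Qed.

Definition ip f s : R := prim f (clamp s).

Lemma derivable_prim f s : continuous f -> -1 < s -> derivable (prim f) s 1.
Proof. by move=> cf s1; have [] := is_derive_prim cf s1. Qed.

Lemma continuous_prim f s : continuous f -> -1 < s -> {for s, continuous (prim f)}.
Proof.
move=> cf s1; apply/differentiable_continuous/derivable1_diffP.
exact: derivable_prim.
Qed.

Lemma continuous_ip f : continuous f -> continuous (ip f).
Proof.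
move=> cf s; apply: (@continuous_comp _ _ _ clamp (prim f)).
  exact: continuous_clamp.
by apply: continuous_prim => //; rewrite (lt_le_trans _ (clamp_ge0 s))//; lra.
Qed.

(** [g - prim f] has zero derivative inside the interval and is constant by the mean value theorem.
    No derivative of [g] is asked for at the end points, so that [g] may itself be built from
    clamped primitives. *)
Lemma ip_FTC f g s : continuous f ->
  (forall x : R, 0 < x < 1 -> is_derive x 1 g (f x)) -> {within `[0, 1], continuous g} ->
  0 <= s <= 1 -> g s - g 0 = ip f s.
Proof.
move=> cf dg cg /andP[s0 s1].
rewrite /ip clamp_id ?s0//.
apply/eqP; rewrite -subr_eq0; apply/eqP.
have [||c _] := @MVT_segment _ (fun x => g x - prim f x) (fun=> 0) 0 s s0.
- move=> x; rewrite in_itv/= => /andP[x0 xs].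
  have -> : 0 = f x - f x by rewrite subrr.
  apply: is_deriveB.
  + by apply: dg; rewrite x0 (lt_le_trans xs).
  + by apply: is_derive_prim => //; lra.
- have cg' : {within `[0, s], continuous g}.
    by apply: continuous_subspaceW cg => x/=; rewrite !in_itv/= => /andP[-> /le_trans]; apply.
  move=> x; apply: continuousB; first exact: cg'.
  have : {within `[0, s], continuous (prim f)}.
    apply: continuous_in_subspaceT => y; rewrite inE/= in_itv/= => /andP[y0 _].
    by apply: continuous_prim => //; lra.
  exact.
by rewrite mul0r prim0 subr0 => /eqP; rewrite subr_eq0 => /eqP <-; rewrite addrAC subrr.
Qed.

Lemma is_derive_ip f s : continuous f -> 0 < s < 1 -> is_derive s 1 (ip f) (f s).
Proof.
move=> cf /andP[s0 s1].
apply: (@near_eq_is_derive _ _ _ (prim f)); last by apply: is_derive_prim => //; lra.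
near=> x; rewrite /ip clamp_id//; apply/andP; split; near: x.
  by apply: filterS (lt_nbhsr s0) => y /ltW.
by apply: filterS (lt_nbhsl s1) => y /ltW.
Unshelve. all: by end_near. Qed.

Lemma ip0 f : ip f 0 = 0.
Proof. by rewrite /ip clamp_id ?prim0// lexx ler01. Qed.

Lemma ip_clamp f s : ip f (clamp s) = ip f s.
Proof. by rewrite /ip clamp_clamp. Qed.

Lemma ip_lin f g (a : R) s : continuous f -> continuous g ->
  ip (fun t => a * f t + g t) s = a * ip f s + ip g s.
Proof.
move=> cf cg; rewrite -ip_clamp -[ip f s]ip_clamp -[ip g s]ip_clamp.
have h : 0 <= clamp s <= 1 by rewrite clamp_ge0 clamp_le1.
have cl : continuous (fun t => a * f t + g t).
  by move=> x; apply: cvgD; [apply: cvgM; [exact: cvg_cst|exact: cf]|exact: cg].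
suff : a * ip f (clamp s) + ip g (clamp s) - (a * ip f 0 + ip g 0)
       = ip (fun t => a * f t + g t) (clamp s).
  by rewrite !ip0 mulr0 addr0 subr0.
apply: (@ip_FTC _ (fun s => a * ip f s + ip g s)) => //.
- move=> x hx.
  apply: (@is_deriveD _ _ _ (fun s => a * ip f s)); last exact: is_derive_ip.
  by have := is_deriveZ a (is_derive_ip cf hx).
- apply: continuous_subspaceT => x.
  apply: cvgD; last exact: continuous_ip.
  by apply: cvgM; [exact: cvg_cst|exact: continuous_ip].
Qed.

Lemma le_ip f M s s' : continuous f -> (forall t, 0 <= t <= 1 -> `|f t| <= M) ->
  `|ip f s - ip f s'| <= M * `|clamp s - clamp s'|.
Proof.
move=> cf fM.
wlog ss : s s' / clamp s' <= clamp s.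
  move=> H; case: (leP (clamp s') (clamp s)) => [|/ltW] /H//.
  by rewrite distrC [X in _ <= _ * X]distrC.
have [||c ch ->] := @MVT_segment _ (prim f) f (clamp s') (clamp s) ss.
- move=> x; rewrite in_itv/= => /andP[x0 xs]; apply: is_derive_prim => //.
  by have := clamp_ge0 s'; lra.
- apply: continuous_in_subspaceT => y; rewrite inE/= in_itv/= => /andP[y0 _].
  by apply: continuous_prim => //; have := clamp_ge0 s'; lra.
rewrite normrM ler_wpM2r//; apply: fM.
move: ch; rewrite in_itv/= => /andP[c0 c1].
by rewrite (le_trans (clamp_ge0 _) c0) (le_trans c1 (clamp_le1 _)).
Qed.

Lemma norm_ip f M s : continuous f -> (forall t, 0 <= t <= 1 -> `|f t| <= M) ->
  `|ip f s| <= M.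
Proof.
move=> cf fM.
have M0 : 0 <= M by apply: le_trans (fM 0 _) => //; rewrite lexx ler01.
have := le_ip s 0 cf fM; rewrite ip0 subr0 (@clamp_id 0) ?lexx ?ler01// subr0.
move=> /le_trans; apply; rewrite ger0_norm ?clamp_ge0//.
by rewrite ler_piMr// clamp_le1.
Qed.

Lemma eq_ip f g s : continuous f -> continuous g ->
  (forall t, 0 <= t <= 1 -> f t = g t) -> ip f s = ip g s.
Proof.
move=> cf cg fg; apply/eqP; rewrite -subr_eq0 -normr_le0.
have -> : ip f s - ip g s = ip (fun t => (-1) * g t + f t) s.
  by rewrite ip_lin//; ring.
apply: norm_ip.
  by move=> x; apply: cvgD; [apply: cvgM; [exact: cvg_cst|exact: cg]|exact: cf].
by move=> t /fg ->; rewrite mulN1r addNr normr0.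
Qed.

Lemma ip_cst (a : R) s : ip (fun=> a) s = a * clamp s.
Proof.
have h : 0 <= clamp s <= 1 by rewrite clamp_ge0 clamp_le1.
rewrite -ip_clamp; suff : a * clamp s - a * 0 = ip (fun=> a) (clamp s).
  by rewrite mulr0 subr0.
apply: (@ip_FTC _ (fun s => a * s)) => //.
- by move=> x; exact: cvg_cst.
- move=> x _; have := is_deriveZ a (is_derive_id x 1).
  by rewrite /GRing.scale/= mulr1.
- by apply: continuous_subspaceT => x; apply: cvgM; [exact: cvg_cst|exact: cvg_id].
Qed.

End Prim.

(** * Joint continuity in the time and a parameter *)

Section JC.
Context {R : realType}.

Lemma cvg_rV (T : Type) (F : set_system T) {FF : Filter F} n (f : T -> 'rV[R]_n)
    (l : 'rV[R]_n) :
  (forall j, f p 0 j @[p --> F] --> l 0 j) -> f p @[p --> F] --> l.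
Proof.
move=> h A [P hP PA].
have : \forall p \near F, forall j, P 0 j (f p 0 j).
  by apply: filter_forall => j; apply: (h j); exact: hP.
by apply: filterS => p hp; apply: PA => i j; rewrite ord1.
Qed.

Lemma cvg_pr (T : Type) (F : set_system T) {FF : Filter F} (U V : topologicalType)
    (f : T -> U) (g : T -> V) (u : U) (v : V) :
  f x @[x --> F] --> u -> g x @[x --> F] --> v -> (f x, g x) @[x --> F] --> (u, v).
Proof. by move=> hf hg; exact: (cvg_pair hf hg). Qed.

Lemma near_fst (U V : topologicalType) (u : U) (v : V) (P : set U) :
  (\forall x \near u, P x) -> \forall p \near (u, v), P p.1.
Proof. by move=> h; exact: (cvg_fst h). Qed.

Lemma near_snd (U V : topologicalType) (u : U) (v : V) (P : set V) :
  (\forall x \near v, P x) -> \forall p \near (u, v), P p.2.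
Proof. by move=> h; exact: (cvg_snd h). Qed.

(** Joint rather than separate continuity is what passes to integrals over the time, through the
    compactness of [0,1]. The set [D] restricts the parameter only, never the time. *)
Definition jc (L : topologicalType) (D : set L) (F : R -> L -> R) :=
  forall s x, D x -> F p.1 p.2 @[p --> (s, x)] --> F s x.

Section jc.
Context {L : topologicalType} (D : set L).
Implicit Types F G : R -> L -> R.

Lemma jc_sl F x : jc D F -> D x -> continuous (F^~ x).
Proof.
move=> h Dx s; apply: (cvg_comp (fun s => (s, x)) _ _ (h s x Dx)).
by apply: cvg_pr; [exact: cvg_id|exact: cvg_cst].
Qed.

Lemma jc_sr F s x : jc D F -> D x -> {for x, continuous (F s)}.
Proof.
move=> h Dx; apply: (cvg_comp (fun x => (s, x)) _ _ (h s x Dx)).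
by apply: cvg_pr; [exact: cvg_cst|exact: cvg_id].
Qed.

Lemma jc_cst (a : R) : jc D (fun _ _ => a).
Proof. by move=> s x _; exact: cvg_cst. Qed.

Lemma jc_t (f : R -> R) : continuous f -> jc D (fun s _ => f s).
Proof. by move=> cf s x _; apply: (cvg_comp fst f cvg_fst); exact: cf. Qed.

Lemma jc_x (f : L -> R) : (forall x, D x -> {for x, continuous f}) -> jc D (fun _ x => f x).
Proof. by move=> cf s x Dx; apply: (cvg_comp snd f cvg_snd); exact: cf. Qed.

Lemma jc_add F G : jc D F -> jc D G -> jc D (fun s x => F s x + G s x).
Proof. by move=> hF hG s x Dx; apply: cvgD; [exact: hF|exact: hG]. Qed.

Lemma jc_mul F G : jc D F -> jc D G -> jc D (fun s x => F s x * G s x).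
Proof. by move=> hF hG s x Dx; apply: cvgM; [exact: hF|exact: hG]. Qed.

Lemma jc_opp F : jc D F -> jc D (fun s x => - F s x).
Proof. by move=> hF s x Dx; apply: cvgN; exact: hF. Qed.

Lemma jc_inv F : (forall s x, D x -> F s x != 0) -> jc D F -> jc D (fun s x => (F s x)^-1).
Proof. by move=> h hF s x Dx; apply: cvgV; [exact: h|exact: hF]. Qed.

Lemma jc_sum (I : Type) (r : seq I) (P : pred I) (F : I -> R -> L -> R) :
  (forall i, P i -> jc D (F i)) -> jc D (fun s x => \sum_(i <- r | P i) F i s x).
Proof.
move=> h; elim: r => [|i r IH].
  by under eq_fun do under eq_fun do rewrite big_nil; exact: jc_cst.
have [Pi|Pi] := boolP (P i); last first.
  by under eq_fun do under eq_fun do rewrite big_cons (negbTE Pi).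
under eq_fun do under eq_fun do rewrite big_cons Pi.
by apply: jc_add => //; exact: h.
Qed.

Lemma jc_ext F G : open D -> (forall s x, D x -> F s x = G s x) -> jc D F -> jc D G.
Proof.
move=> oD e h s x Dx; rewrite -(e s x Dx); apply: cvg_trans (h s x Dx).
apply: near_eq_cvg; near=> p.
by rewrite -e//; near: p; apply: (cvg_snd (open_nbhs_nbhs (conj oD Dx))).
Unshelve. all: by end_near. Qed.

Lemma jc_comp (L' : topologicalType) (D' : set L') (phi : R -> R) (Y : R -> L -> L')
    (F : R -> L' -> R) :
  continuous phi -> (forall s x, D x -> Y p.1 p.2 @[p --> (s, x)] --> Y s x) ->
  (forall s x, D x -> D' (Y s x)) -> jc D' F -> jc D (fun s x => F (phi s) (Y s x)).
Proof.
move=> cphi cY YD h s x Dx.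
apply: (cvg_comp (fun p => (phi p.1, Y p.1 p.2)) _ _ (h (phi s) (Y s x) (YD _ _ Dx))).
apply: cvg_pr; last exact: cY.
by apply: (cvg_comp fst phi cvg_fst); exact: cphi.
Qed.

(** Tube lemma: each time has a product neighbourhood on which the estimate holds, and compactness
    of [0,1] leaves a single neighbourhood of [x0]. *)
Lemma jc_near F x0 (e : R) : 0 < e -> jc D F -> D x0 ->
  \forall x \near x0, forall t, 0 <= t <= 1 -> `|F t x - F t x0| <= e.
Proof.
move=> e0 h Dx.
have /compact_near_coveringP/(_ L (nbhs x0)
    (fun x t => `|F t x - F t x0| <= e)) : compact `[(0:R), 1].
  exact: segment_compact.
have H : forall t, `[(0:R), 1]%classic t -> \forall t' \near t & x \near x0,
    `|F t' x - F t' x0| <= e.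
  move=> t _.
  have e2 : 0 < e / 2 by rewrite divr_gt0.
  have /cvgrPdist_le/(_ _ e2) h1 := h t x0 Dx.
  have /cvgrPdist_le/(_ _ e2) h2 := (jc_sl h Dx : continuous _) t.
  have h3 : \forall p \near (t, x0), `|F t x0 - F p.1 x0| <= e / 2.
    exact: near_fst h2.
  near=> p => /=.
  rewrite (splitr e) -(subrKA (F t x0)) (le_trans (ler_normD _ _))// lerD//.
    by rewrite distrC; near: p.
  by near: p.
move=> /(_ _ H) hh; apply: filterS hh => x hx t ht; apply: hx.
by rewrite /= in_itv.
Unshelve. all: by end_near. Qed.

Lemma jc_ip F : open D -> jc D F -> jc D (fun s x => ip (F^~ x) s).
Proof.
move=> oD h s0 x0 Dx; apply/cvgrPdist_le => e e0.
have e2 : 0 < e / 2 by rewrite divr_gt0.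
have /cvgrPdist_le/(_ _ e2) h2 := continuous_ip (jc_sl h Dx) (x := s0).
have h3 := near_fst x0 h2.
have h4 := near_snd s0 (jc_near e2 h Dx).
have h5 := near_snd s0 (open_nbhs_nbhs (conj oD Dx)).
near=> p.
(* The time is moved with the parameter fixed at [x0]; then the parameter is moved, where the
   integrands are uniformly close by [jc_near]. *)
rewrite (splitr e) -(subrKA (ip (F^~ x0) p.1)) (le_trans (ler_normD _ _))// lerD//.
  by near: p.
have Dp : D p.2 by near: p.
have -> : ip (F^~ x0) p.1 - ip (F^~ p.2) p.1
        = ip (fun t => (-1) * F t p.2 + F t x0) p.1.
  by rewrite ip_lin; [ring|exact: jc_sl|exact: jc_sl].
apply: norm_ip.
  by move=> t; apply: cvgD; [apply: cvgM; [exact: cvg_cst|exact: (jc_sl h Dp)]|exact: jc_sl].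
move=> t ht; rewrite mulN1r addrC distrC.
by move: t ht; near: p.
Unshelve. all: by end_near. Qed.

End jc.
End JC.

Lemma cvg_sumR {R : realType} (T : Type) (F : set_system T) {FF : Filter F} (I : Type)
    (r : seq I) (P : pred I) (f : I -> T -> R) (l : I -> R) :
  (forall i, P i -> f i x @[x --> F] --> l i) ->
  \sum_(i <- r | P i) f i x @[x --> F] --> \sum_(i <- r | P i) l i.
Proof.
move=> h; elim: r => [|i r IH].
  by under eq_fun do rewrite big_nil; rewrite big_nil; exact: cvg_cst.
rewrite big_cons; have [Pi|Pi] := boolP (P i); last first.
  by under eq_fun do rewrite big_cons (negbTE Pi).
under eq_fun do rewrite big_cons Pi.
by apply: cvgD => //; exact: h.
Qed.

(** * Differentiability by explicit estimates and by continuous slopes *)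

Section DiffChar.
Context {R : realType} {V W : normedModType R}.

Lemma near_translate (x : V) (P : set V) : (\forall y \near x, P y) ->
  \forall h \near 0, P (h + x).
Proof. by rewrite (near_shift 0) subr0. Qed.

Lemma differentiable_of (f : V -> W) (df : {linear V -> W}) x : continuous df ->
  (forall e, 0 < e -> \forall h \near 0, `|f (h + x) - f x - df h| <= e * `|h|) ->
  differentiable f x /\ 'd f x = df :> (V -> W).
Proof.
move=> dc h.
have key : f \o shift x = cst (f x) + df +o_ 0 id.
  apply/eqaddoP => e e0; apply: filterS (h e e0) => y.
  by rewrite -[(f \o shift x - _) y]/(f (y + x) - (f x + df y)) opprD addrA.
have e := diff_unique dc key.
by split=> //; apply/diff_locallyP; rewrite e.
Qed.

Lemma differentiable_est (f : V -> W) x e : differentiable f x -> 0 < e ->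
  \forall h \near 0, `|f (h + x) - f x - 'd f x h| <= e * `|h|.
Proof.
move=> /diff_locallyP[_ /eqaddoP h] e0; apply: filterS (h e e0) => y.
by rewrite -[(f \o shift x - _) y]/(f (y + x) - (f x + 'd f x y)) opprD addrA.
Qed.

Lemma near_eq_differentiable (f g : V -> W) x : (\near x, f x = g x) ->
  differentiable f x -> differentiable g x.
Proof.
move=> fg df.
have dc : continuous ('d f x) by case/diff_locallyP : df.
have gf : g x = f x by rewrite (nbhs_singleton fg).
apply: (differentiable_of dc _).1 => e e0.
have fg' : \forall h \near (0 : V), f (h + x) = g (h + x).
  exact: near_translate fg.
apply: filterS2 (differentiable_est df e0) fg' => y + e1.
by rewrite gf e1.
Qed.

End DiffChar.

Section Diff.
Context {R : realType} {n : nat}.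
Implicit Types (f : 'rV[R]_n -> R) (x y : 'rV[R]_n).

Lemma coord_le_norm x j : `|x 0 j| <= `|x|.
Proof.
rewrite [leRHS]/Num.Def.normr/= mx_normrE.
by apply: le_trans; last exact: (le_bigmax _ _ (0, j)).
Qed.

Lemma norm_rV_le x (e : R) : 0 <= e -> (forall j, `|x 0 j| <= e) -> `|x| <= e.
Proof.
move=> e0 h; rewrite [leLHS]/Num.Def.normr/= mx_normrE bigmax_le// => -[i j] _.
by rewrite ord1; exact: h.
Qed.

(** The error of the linear approximation is the sum of the (Phi_j(y) - Phi_j(x)) (y_j - x_j), which
    is small by continuity of the slopes at [x]. Derivatives of integrals and of solutions with
    respect to parameters are found below by exhibiting such slopes. *)
Lemma caratheodory f x (Phi : 'I_n -> 'rV[R]_n -> R) :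
  (forall j, {for x, continuous (Phi j)}) ->
  (\forall y \near x, f y = f x + \sum_j Phi j y * (y 0 j - x 0 j)) ->
  differentiable f x /\ forall j, 'D_(delta_mx 0 j) f x = Phi j x.
Proof.
move=> cP hf.
pose g (h : 'rV[R]_n) : R := \sum_j Phi j x * h 0 j.
have glin : linear g.
  move=> a u v; rewrite /g /GRing.scale/= mulr_sumr -big_split/=.
  by apply: eq_bigr => j _; rewrite !mxE; ring.
pose glM := GRing.isLinear.Build _ _ _ _ _ glin.
pose gL : {linear 'rV[R]_n -> R} := HB.pack g glM.
have gc : continuous gL.
  move=> u; rewrite /gL /=.
  apply: (@cvg_sumR _ _ (nbhs (u : 'rV[R]_n))) => j _; apply: cvgM; first exact: cvg_cst.
  exact: coord_continuous.
have [df e] : differentiable f x /\ 'd f x = gL :> ('rV[R]_n -> R).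
  apply: (differentiable_of gc) => e e0.
  (* The denominator is positive even for n = 0, and n errors of this size add up to at most [e]. *)
  have e' : 0 < e / (n%:R + 1) by rewrite divr_gt0// ltr_wpDl.
  have h0 j : \forall h \near (0 : 'rV[R]_n), `|Phi j (h + x) - Phi j x| <= e / (n%:R + 1).
    have /cvgrPdist_le/(_ _ e') /near_translate := cP j.
    by apply: filterS => h; rewrite distrC.
  have h1 := filter_forall (nbhs_filter _) h0.
  have h2 : \forall h \near (0 : 'rV[R]_n), f (h + x) = f x + \sum_j Phi j (h + x) * ((h + x) 0 j - x 0 j).
    exact: near_translate hf.
  near=> h => /=.
  have -> : f (h + x) - f x - gL h = \sum_j (Phi j (h + x) - Phi j x) * h 0 j.
    rewrite -[LHS]/(f (h + x) - f x - g h) (near h2)// /g [f x + _]addrC addrK.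
    rewrite -sumrB; apply: eq_bigr => j _; rewrite !mxE; ring.
  apply: (le_trans (ler_norm_sum _ _ _)).
  apply: (@le_trans _ _ (\sum_(j < n) e / (n%:R + 1) * `|h|)).
    apply: ler_sum => j _; rewrite normrM ler_pM//; last exact: coord_le_norm.
    by move: j; near: h.
  rewrite sumr_const card_ord -mulrnAl ler_wpM2r//.
  have d0 : 0 < n%:R + 1 :> R by rewrite ltr_wpDl.
  rewrite -mulr_natr -[leRHS](divfK (lt0r_neq0 d0)).
  by apply: ler_wpM2l; [exact: ltW|rewrite lerDl].
split=> // j; rewrite deriveE// e /= /g (bigD1 j)//= mxE !eqxx mulr1 big1 ?addr0//.
by move=> k kj; rewrite !mxE eqxx/= (negbTE kj) mulr0.
Unshelve. all: by end_near. Qed.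

Lemma diff_coordE f x h : differentiable f x ->
  'd f x h = \sum_j h 0 j * 'D_(delta_mx 0 j) f x.
Proof.
move=> df; rewrite {1}(row_sum_delta h) linear_sum/=.
by apply: eq_bigr => j _; rewrite linearZ/= deriveE.
Qed.

Lemma is_derive_line f x h (u : R) : differentiable f (x + u *: h) ->
  is_derive u 1 (fun u : R => f (x + u *: h))
    (\sum_j h 0 j * 'D_(delta_mx 0 j) f (x + u *: h)).
Proof.
move=> df.
pose l (u : R) : 'rV[R]_n := x + u *: h.
have dl : is_diff u l (fun t => t *: h).
  have -> : (fun t : R => t *: h) = (cst 0 : R -> 'rV[R]_n) + (fun t => t *: h).
    by rewrite add0r.
  have -> : l = cst x + (fun t => t *: h) by apply/funext.
  exact: is_diffD.
have df' : is_diff (l u) f ('d f (l u)) by apply: DiffDef.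
have [dc ec] : is_diff u (f \o l) ('d f (l u) \o (fun t : R => t *: h)) by exact: is_diff_comp.
apply: DeriveDef; first exact/derivable1_diffP.
by rewrite deriveE// ec/= scale1r diff_coordE.
Qed.

End Diff.

(** * Functions of class C^k in the point and continuous in the time *)

Section Ck.
Context {R : realType}.

(* [F s] is of class C^k on [W] and its derivatives are jointly continuous with [s]. *)
Fixpoint ck n (k : nat) (W : set 'rV[R]_n) (F : R -> 'rV[R]_n -> R) : Prop :=
  jc W F /\
  if k is k'.+1 then
    (forall s x, W x -> differentiable (F s) x) /\
    forall i, ck k' W (fun s => 'D_(delta_mx 0 i) (F s))
  else True.

Section one.
Context {n : nat} (W : set 'rV[R]_n).
Hypothesis oW : open W.
Implicit Types F G : R -> 'rV[R]_n -> R.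

Lemma ckSP k F : ck k.+1 W F <-> [/\ jc W F,
  forall s x, W x -> differentiable (F s) x &
  forall i, ck k W (fun s => 'D_(delta_mx 0 i) (F s))].
Proof. by split=> [[? []]|[]]. Qed.

Lemma ck_jc k F : ck k W F -> jc W F.
Proof. by case: k => [|k] []. Qed.

Lemma ckS k F : ck k.+1 W F -> ck k W F.
Proof.
elim: k F => [|k IH] F; first by case.
by case=> hj [hd hk]; split=> //; split=> // i; apply: IH; exact: hk.
Qed.

Lemma near_open x (P : set 'rV[R]_n) : W x -> (forall y, W y -> P y) -> \forall y \near x, P y.
Proof. by move=> Wx h; apply: filterS (open_nbhs_nbhs (conj oW Wx)) => y /h. Qed.

Lemma ck_ext k F G : (forall s x, W x -> F s x = G s x) -> ck k W F -> ck k W G.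
Proof.
elim: k F G => [|k IH] F G e; first by case=> h _; split=> //; exact: jc_ext h.
case=> hj [hd hk]; split; first exact: jc_ext hj.
have e' s x : W x -> \near x, F s x = G s x by move=> Wx; apply: near_open => // y /e.
split=> [s x Wx|i].
  by apply: near_eq_differentiable (hd s x Wx); exact: e'.
apply: IH (hk i) => s x Wx; apply: near_eq_derive; exact: e'.
Qed.

Lemma ck_cstR k (a : R) : ck k W (fun _ _ => a).
Proof.
elim: k a => [|k IH] a; first by split=> //; exact: jc_cst.
split; first exact: jc_cst.
split=> [s x _|i]; first exact: differentiable_cst.
apply: ck_ext (IH 0) => s x _; by rewrite derive_cst.
Qed.

Lemma ck_t k (f : R -> R) : continuous f -> ck k W (fun s _ => f s).
Proof.
move=> cf; case: k => [|k]; first by split=> //; exact: jc_t.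
split; first exact: jc_t.
split=> [s x _|i]; first exact: differentiable_cst.
by apply: ck_ext (ck_cstR k 0) => s x _; rewrite derive_cst.
Qed.

Lemma ck_coord k j : ck k W (fun _ x => x 0 j).
Proof.
have hj : jc W (fun _ (x : 'rV[R]_n) => x 0 j).
  by apply: jc_x => x _; exact: coord_continuous.
case: k => [|k]; split=> //; split=> [s x _|i]; first exact: differentiable_coord.
apply: ck_ext (ck_cstR k ((delta_mx 0 i : 'rV[R]_n) 0 j)) => s x _.
rewrite deriveE; last exact: differentiable_coord.
pose g (h : 'rV[R]_n) : R := h 0 j.
have glin : linear g by move=> a u v; rewrite /g /GRing.scale/= !mxE.
pose glM := GRing.isLinear.Build _ _ _ _ _ glin.
pose gL : {linear 'rV[R]_n -> R} := HB.pack g glM.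
by rewrite -[fun x : 'rV_n => x 0 j]/(gL : _ -> _) diff_lin//; exact: coord_continuous.
Qed.

Lemma ck_add k F G : ck k W F -> ck k W G -> ck k W (fun s x => F s x + G s x).
Proof.
elim: k F G => [|k IH] F G; first by move=> [? _] [? _]; split=> //; exact: jc_add.
move=> [Fj [Fd Fk]] [Gj [Gd Gk]]; split; first exact: jc_add.
split=> [s x Wx|i]; first by apply: differentiableD; [exact: Fd|exact: Gd].
apply: ck_ext (IH _ _ (Fk i) (Gk i)) => s x Wx.
by rewrite deriveD//; apply: diff_derivable; [exact: Fd|exact: Gd].
Qed.

Lemma ck_mul k F G : ck k W F -> ck k W G -> ck k W (fun s x => F s x * G s x).
Proof.
elim: k F G => [|k IH] F G; first by move=> [? _] [? _]; split=> //; exact: jc_mul.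
move=> hF hG; have F' := ckS hF; have G' := ckS hG.
move: hF hG => [Fj [Fd Fk]] [Gj [Gd Gk]]; split; first exact: jc_mul.
split=> [s x Wx|i]; first by apply: differentiableM; [exact: Fd|exact: Gd].
apply: ck_ext (ck_add (IH _ _ F' (Gk i)) (IH _ _ G' (Fk i))) => s x Wx.
by rewrite deriveM//; apply: diff_derivable; [exact: Fd|exact: Gd].
Qed.

Lemma ck_scale k (a : R) F : ck k W F -> ck k W (fun s x => a * F s x).
Proof. by apply: ck_mul; exact: ck_cstR. Qed.

Lemma ck_opp k F : ck k W F -> ck k W (fun s x => - F s x).
Proof. by move=> h; apply: ck_ext (ck_scale (-1) h) => s x _; rewrite mulN1r. Qed.

Lemma ck_sub k F G : ck k W F -> ck k W G -> ck k W (fun s x => F s x - G s x).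
Proof. by move=> hF hG; apply: ck_add => //; exact: ck_opp. Qed.

Lemma ck_sum k (I : Type) (r : seq I) (P : pred I) (F : I -> R -> 'rV[R]_n -> R) :
  (forall i, P i -> ck k W (F i)) -> ck k W (fun s x => \sum_(i <- r | P i) F i s x).
Proof.
move=> h; elim: r => [|i r IH].
  by apply: ck_ext (ck_cstR k 0) => s x _; rewrite big_nil.
have [Pi|Pi] := boolP (P i).
  by apply: ck_ext (ck_add (h _ Pi) IH) => s x _; rewrite big_cons Pi.
by apply: ck_ext IH => s x _; rewrite big_cons (negbTE Pi).
Qed.

Lemma ck_prod k (I : Type) (r : seq I) (P : pred I) (F : I -> R -> 'rV[R]_n -> R) :
  (forall i, P i -> ck k W (F i)) -> ck k W (fun s x => \prod_(i <- r | P i) F i s x).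
Proof.
move=> h; elim: r => [|i r IH].
  by apply: ck_ext (ck_cstR k 1) => s x _; rewrite big_nil.
have [Pi|Pi] := boolP (P i).
  by apply: ck_ext (ck_mul (h _ Pi) IH) => s x _; rewrite big_cons Pi.
by apply: ck_ext IH => s x _; rewrite big_cons (negbTE Pi).
Qed.

Lemma ck_inv k F : (forall s x, W x -> F s x != 0) -> ck k W F ->
  ck k W (fun s x => (F s x)^-1).
Proof.
elim: k F => [|k IH] F h0; first by move=> [? _]; split=> //; exact: jc_inv.
move=> hF; have F' := ckS hF; move: hF => [Fj [Fd Fk]]; split; first exact: jc_inv.
split=> [s x Wx|i]; first by apply: differentiableV; [exact: Fd|exact: h0].
have I1 := IH _ h0 F'.
apply: ck_ext (ck_opp (ck_mul (ck_mul I1 I1) (Fk i))) => s x Wx.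
rewrite deriveV ?h0//; last by apply: diff_derivable; exact: Fd.
by rewrite /GRing.scale/= -exprVn expr2 mulNr.
Qed.

End one.

Lemma ck_sub_dom n k (W W' : set 'rV[R]_n) F : W' `<=` W -> ck k W F -> ck k W' F.
Proof.
move=> WW'; elim: k F => [|k IH] F; first by move=> [h _]; split=> // s x /WW'; exact: h.
move=> /ckSP[h1 h2 h3]; apply/ckSP; split; first by move=> s x /WW'; exact: h1.
  by move=> s x /WW'; exact: h2.
by move=> i; exact: IH.
Qed.

Lemma differentiable_rV n m (Y : 'rV[R]_n -> 'rV[R]_m) x :
  (forall j, differentiable (fun x => Y x 0 j) x) -> differentiable Y x.
Proof.
move=> h; have -> : Y = \sum_j (fun x => Y x 0 j *: (delta_mx 0 j : 'rV[R]_m)).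
  by apply/funext => y; rewrite fct_sumE {1}(row_sum_delta (Y y)).
by apply: differentiable_sum => j; exact: differentiableZl.
Qed.

Lemma derive_comp_rV n m (f : 'rV[R]_m -> R) (Y : 'rV[R]_n -> 'rV[R]_m) x v :
  differentiable f (Y x) -> (forall j, differentiable (fun x => Y x 0 j) x) ->
  'D_v (f \o Y) x = \sum_j 'D_(delta_mx 0 j) f (Y x) * 'D_v (fun x => Y x 0 j) x.
Proof.
move=> df dY; have dY' := differentiable_rV dY.
rewrite deriveE; last exact: differentiable_comp.
rewrite diff_comp//= diff_coordE//; apply: eq_bigr => j _.
rewrite mulrC; congr (_ * _).
rewrite -(deriveE _ dY') -[fun y : 'rV_n => _]/((fun M : 'rV[R]_m => M 0 j) \o Y).
rewrite [RHS]deriveE; last exact: dY.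
rewrite diff_comp//; last exact: differentiable_coord.
pose g (h : 'rV[R]_m) : R := h 0 j.
have glin : linear g by move=> a u w; rewrite /g /GRing.scale/= !mxE.
pose glM := GRing.isLinear.Build _ _ _ _ _ glin.
pose gL : {linear 'rV[R]_m -> R} := HB.pack g glM.
have -> : 'd (fun M : 'rV[R]_m => M 0 j) (Y x) = gL :> (_ -> _).
  by rewrite -[fun x : 'rV_m => x 0 j]/(gL : _ -> _) diff_lin//; exact: coord_continuous.
by rewrite /= deriveE.
Qed.

(** No derivative in the time is ever taken, so [phi] need only be continuous; this admits clamped,
    reversed and frozen times. *)
Lemma ck_comp n m k (W : set 'rV[R]_n) (W' : set 'rV[R]_m) (phi : R -> R)
    (Y : R -> 'rV[R]_n -> 'rV[R]_m) F : open W -> open W' ->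
  continuous phi -> (forall s x, W x -> W' (Y s x)) ->
  (forall j, ck k W (fun s x => Y s x 0 j)) -> ck k W' F ->
  ck k W (fun s x => F (phi s) (Y s x)).
Proof.
move=> oW oW' cphi WW'; elim: k F => [|k IH] F hY hF.
  split=> //; apply: (jc_comp cphi) (ck_jc hF) => // s x Wx.
  by apply: cvg_rV => j; exact: (ck_jc (hY j)).
have hY' j := ckS (hY j).
split.
  apply: (jc_comp cphi) (ck_jc hF) => // s x Wx.
  by apply: cvg_rV => j; exact: (ck_jc (hY j)).
case/ckSP: hF => _ Fd Fk.
have Yd s x j : W x -> differentiable (fun x => Y s x 0 j) x.
  move=> Wx; by case/ckSP: (hY j) => _ h _; exact: h.
split=> [s x Wx|i].
  apply: (differentiable_comp (f := Y s) (g := F (phi s))).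
    by apply: differentiable_rV => j; exact: Yd.
  by apply: Fd; exact: WW'.
have hYi j : ck k W (fun s => 'D_(delta_mx 0 i) (fun x => Y s x 0 j)).
  by case/ckSP: (hY j).
apply: (ck_ext oW _ (ck_sum oW (P := predT) (index_enum _)
   (fun j _ => ck_mul oW (IH _ hY' (Fk j)) (hYi j)))) => // s x Wx.
by rewrite (derive_comp_rV (f := F (phi s)))//; [apply: Fd; exact: WW'|move=> j; exact: Yd].
Qed.

End Ck.

Section IpExtra.
Context {R : realType}.

Lemma continuous_addR (f g : R -> R) : continuous f -> continuous g ->
  continuous (fun t => f t + g t).
Proof. by move=> cf cg x; apply: cvgD; [exact: cf|exact: cg]. Qed.

Lemma continuous_mulR (f g : R -> R) : continuous f -> continuous g ->
  continuous (fun t => f t * g t).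
Proof. by move=> cf cg x; apply: cvgM; [exact: cf|exact: cg]. Qed.

Lemma continuous_sumR (I : Type) (r : seq I) (P : pred I) (f : I -> R -> R) :
  (forall i, continuous (f i)) -> continuous (fun t => \sum_(i <- r | P i) f i t).
Proof. by move=> h x; apply: cvg_sumR => i _; exact: h. Qed.

Lemma ip_scale (f : R -> R) a s : continuous f -> ip (fun t => a * f t) s = a * ip f s.
Proof.
move=> cf; have := @ip_lin R f (fun=> 0) a s cf (fun x => cvg_cst _).
rewrite [X in _ + X]ip_cst mul0r addr0 => <-; congr (ip _ _).
by apply/funext => t; rewrite addr0.
Qed.

Lemma ip_add (f g : R -> R) s : continuous f -> continuous g ->
  ip (fun t => f t + g t) s = ip f s + ip g s.
Proof.
move=> cf cg; have := @ip_lin R f g 1 s cf cg; rewrite mul1r => <-.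
by congr (ip _ _); apply/funext => t; rewrite mul1r.
Qed.

Lemma ip_sub (f g : R -> R) s : continuous f -> continuous g ->
  ip (fun t => f t - g t) s = ip f s - ip g s.
Proof.
move=> cf cg; have := @ip_lin R g f (-1) s cg cf; rewrite mulN1r addrC => <-.
by congr (ip _ _); apply/funext => t; rewrite mulN1r addrC.
Qed.

Lemma ip_sum (I : Type) (r : seq I) (P : pred I) (f : I -> R -> R) s :
  (forall i, continuous (f i)) ->
  ip (fun t => \sum_(i <- r | P i) f i t) s = \sum_(i <- r | P i) ip (f i) s.
Proof.
move=> cf; elim: r => [|i r IH].
  rewrite big_nil -[RHS](mul0r (clamp s)) -(ip_cst 0); congr (ip _ _).
  by apply/funext => t; rewrite big_nil.
rewrite big_cons -IH; case: ifP => Pi.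
  rewrite -ip_add//; last by apply: continuous_sumR.
  by congr (ip _ _); apply/funext => t; rewrite big_cons Pi.
by congr (ip _ _); apply/funext => t; rewrite big_cons Pi.
Qed.

End IpExtra.

Lemma normR_sum_le {R : realType} n (a : R) (f g : 'I_n -> R) (e : R) :
  (forall i, `|f i| <= e) -> (forall i, `|g i| <= a) -> 
  `|\sum_i f i * g i| <= n%:R * a * e.
Proof.
move=> hf hg; apply: (le_trans (ler_norm_sum _ _ _)).
apply: (@le_trans _ _ (\sum_(i < n) e * a)).
  by apply: ler_sum => i _; rewrite normrM ler_pM.
by rewrite sumr_const card_ord -[leLHS]mulr_natl [e * a]mulrC mulrA.
Qed.

(** * Hadamard kernels and differentiation under the integral sign *)

Section Kernel.
Context {R : realType} {n : nat}.
Implicit Types (W : set 'rV[R]_n) (F : R -> 'rV[R]_n -> R).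

Definition cvx W := forall x y (u : R), W x -> W y -> 0 <= u <= 1 -> W (x + u *: (y - x)).

Definition bal (r : R) : set 'rV[R]_n := [set x | `|x| < r].

Lemma open_bal r : open (bal r).
Proof.
have -> : bal r = (fun x => `|x|) @^-1` [set t | t < r] by [].
apply: open_comp; last exact: open_lt.
by move=> x _; exact: norm_continuous.
Qed.

Lemma cvx_bal r : cvx (bal r).
Proof.
move=> x y u; rewrite /bal /= => hx hy /andP[u0 u1].
have -> : x + u *: (y - x) = (1 - u) *: x + u *: y.
  by rewrite scalerBr scalerBl scale1r addrA addrAC.
apply: (le_lt_trans (ler_normD _ _)).
rewrite !normrZ (ger0_norm u0) ger0_norm ?subr_ge0//.
pose m := Num.max `|x| `|y|.
have mr : m < r by rewrite /m gt_max hx.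
apply: le_lt_trans mr.
have hxm : `|x| <= m by rewrite /m le_max lexx.
have hym : `|y| <= m by rewrite /m le_max lexx orbT.
by nra.
Qed.

(** Hadamard's kernel, the slope of [F s] between [x] and [y] in the direction [j]. It is jointly
    continuous, and on the diagonal it is the partial derivative: the two properties that
    [caratheodory] asks of a slope. *)
Definition ker (j : 'I_n) F s x y : R :=
  ip (fun u => 'D_(delta_mx 0 j) (F s) (x + clamp u *: (y - x))) 1.

Definition clampE := (@clamp_ge0 R, @clamp_le1 R).

Lemma clamp01 (u : R) : 0 <= clamp u <= 1.
Proof. by rewrite !clampE. Qed.

Lemma jc_kerv (L : topologicalType) (D : set L) W F j (X Y : R -> L -> 'rV[R]_n) :
  open D -> cvx W -> ck 1 W F ->
  (forall s l, D l -> W (X s l) /\ W (Y s l)) ->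
  (forall i, jc D (fun s l => X s l 0 i)) -> (forall i, jc D (fun s l => Y s l 0 i)) ->
  jc D (fun s l => ker j F s (X s l) (Y s l)).
Proof.
move=> oD cW /ckSP[_ _ /(_ j) Fj] XYW cX cY s l Dl.
have Fj' := ck_jc Fj.
(* The integration variable [u] along the segment takes the role of the time in [jc_ip]; the genuine
   time [s] becomes part of the parameter. *)
pose D' : set (R * L) := [set p | D p.2].
have oD' : open D'.
  have -> : D' = snd @^-1` D by [].
  by apply: open_comp => // p _; exact: cvg_snd.
have H : jc D' (fun u (p : R * L) => 'D_(delta_mx 0 j) (F p.1)
     (X p.1 p.2 + clamp u *: (Y p.1 p.2 - X p.1 p.2))).
  move=> u [s' l'] Dl'.
  have cXY (Z : R -> L -> 'rV[R]_n) : (forall i, jc D (fun s l => Z s l 0 i)) ->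
      Z q.2.1 q.2.2 @[q --> (u, (s', l'))] --> Z s' l'.
    move=> cZ; apply: cvg_rV => i.
    by apply: (cvg_comp snd (fun p : R * L => Z p.1 p.2 0 i) cvg_snd); exact: cZ.
  apply: (cvg_comp (fun q : R * (R * L) =>
      (q.2.1, X q.2.1 q.2.2 + clamp q.1 *: (Y q.2.1 q.2.2 - X q.2.1 q.2.2)))
     (fun q => 'D_(delta_mx 0 j) (F q.1) q.2)
     (G := nbhs (s', X s' l' + clamp u *: (Y s' l' - X s' l')))).
    apply: cvg_pr.
      apply: (cvg_comp snd fst cvg_snd); exact: cvg_fst.
    apply: cvgD; first exact: cXY.
    apply: cvgZ.
      by apply: (cvg_comp fst clamp cvg_fst); exact: continuous_clamp.
    by apply: cvgB; exact: cXY.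
  have [WX WY] := XYW s' l' Dl'.
  by apply: Fj' => /=; apply: cW => //; exact: clamp01.
have /(jc_sr (s := 1) (x := (s, l))) := jc_ip oD' H.
by apply.
Qed.

Lemma jc_ker W F j x : open W -> cvx W -> W x -> ck 1 W F ->
  jc W (fun s y => ker j F s x y).
Proof.
move=> oW cW Wx F1; apply: (@jc_kerv _ _ W F j (fun _ _ => x) (fun _ y => y)) => //.
  by move=> i; exact: jc_cst.
by move=> i; apply: (ck_jc (k := 0)); exact: ck_coord.
Qed.

Lemma ker_eq W F s x y : open W -> cvx W -> ck 1 W F -> W x -> W y ->
  F s y = F s x + \sum_j ker j F s x y * (y 0 j - x 0 j).
Proof.
move=> oW cW /ckSP[Fc Fd Fk] Wx Wy.
pose h := y - x.
have Wl u : 0 <= u <= 1 -> W (x + u *: h) by exact: cW.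
have cl : continuous (fun u : R => x + clamp u *: h).
  move=> u; apply: cvgD; first exact: cvg_cst.
  by apply: cvgZr_tmp; exact: continuous_clamp.
have cD j : continuous (fun u => 'D_(delta_mx 0 j) (F s) (x + clamp u *: h)).
  move=> u; apply: (cvg_comp (fun u : R => x + clamp u *: h) ('D_(delta_mx 0 j) (F s)) (cl u)).
  by apply: (jc_sr (ck_jc (Fk j))); apply: Wl; exact: clamp01.
have cS : continuous (fun u => \sum_j h 0 j * 'D_(delta_mx 0 j) (F s) (x + clamp u *: h)).
  by apply: continuous_sumR => j; apply: continuous_mulR => // t; exact: cvg_cst.
have key : F s (x + 1 *: h) - F s (x + 0 *: h) =
    ip (fun u => \sum_j h 0 j * 'D_(delta_mx 0 j) (F s) (x + clamp u *: h)) 1.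
  apply: (@ip_FTC _ _ (fun u => F s (x + u *: h))) => //.
  - move=> u /andP[u0 u1]; rewrite clamp_id ?ltW//.
    by apply: is_derive_line; apply: Fd; apply: Wl; rewrite !ltW.
  - apply: continuous_in_subspaceT => u; rewrite inE/= in_itv/= => hu.
    apply/differentiable_continuous/derivable1_diffP.
    by case: (@is_derive_line _ _ (F s) x h u (Fd _ _ (Wl _ hu))).
  - by rewrite ler01 lexx.
move: key; rewrite scale1r scale0r addr0 /h addrCA subrr addr0 ip_sum; last first.
  by move=> j; apply: continuous_mulR => // t; exact: cvg_cst.
move/eqP; rewrite subr_eq => /eqP ->; rewrite addrC; congr (_ + _).
apply: eq_bigr => j _; rewrite ip_scale; last exact: cD.
by rewrite mulrC !mxE.
Qed.

Lemma ker_diag F j s x : ker j F s x x = 'D_(delta_mx 0 j) (F s) x.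
Proof.
rewrite /ker subrr; under [X in ip X _]eq_fun do rewrite scaler0 addr0.
by rewrite ip_cst clamp_id ?mulr1// ler01 lexx.
Qed.

(** The time integrals of the Hadamard kernels of [F] are continuous slopes for the integral of
    [F]. *)
Lemma ip_diff W F s x : open W -> cvx W -> ck 1 W F -> W x ->
  differentiable (fun x => ip (F^~ x) s) x /\
  forall j, 'D_(delta_mx 0 j) (fun x => ip (F^~ x) s) x =
    ip (fun t => 'D_(delta_mx 0 j) (F t) x) s.
Proof.
move=> oW cW F1 Wx.
have Fj := ck_jc F1.
have kj j := @jc_ker W F j x oW cW Wx F1.
have [||hd hD] := @caratheodory R n (fun x => ip (F^~ x) s) x
    (fun j y => ip (fun t => ker j F t x y) s).
- by move=> j; exact: (jc_sr (jc_ip oW (kj j))).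
- apply: (near_open oW Wx) => y Wy.
  have -> : F^~ y = fun t => F t x + \sum_j (y 0 j - x 0 j) * ker j F t x y.
    apply/funext => t; rewrite (ker_eq t oW cW F1 Wx Wy); congr (_ + _).
    by apply: eq_bigr => j _; rewrite mulrC.
  have ck' j : continuous (fun t => (y 0 j - x 0 j) * ker j F t x y).
    apply: continuous_mulR; first by move=> t; exact: cvg_cst.
    exact: (jc_sl (kj j)).
  rewrite ip_add; [|exact: (jc_sl Fj)|exact: continuous_sumR].
  congr (_ + _); rewrite ip_sum//; apply: eq_bigr => j _.
  by rewrite ip_scale; [rewrite mulrC|exact: (jc_sl (kj j))].
split; first exact: hd.
by move=> j; rewrite hD; congr (ip _ _); apply/funext => t; rewrite ker_diag.
Qed.

Lemma ck_ip k W F : open W -> cvx W -> ck k W F -> ck k W (fun s x => ip (F^~ x) s).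
Proof.
move=> oW cW; elim: k F => [|k IH] F hF; first by split=> //; apply: jc_ip => //; case: hF.
have F1 : ck 1 W F by elim: k {IH} hF => // k IH /ckS.
have [Fj Fd Fk] := (ckSP _ _ _).1 hF.
apply/ckSP; split; first exact: jc_ip.
  by move=> s x Wx; case: (ip_diff s oW cW F1 Wx).
move=> j; apply: ck_ext (IH _ (Fk j)) => // s x Wx.
by rewrite (ip_diff s oW cW F1 Wx).2.
Qed.

Lemma ck_le k k' W F : (k <= k')%N -> ck k' W F -> ck k W F.
Proof.
move=> /subnK <-; elim: (k' - k)%N => [|m IH]; rewrite ?add0n// addSn => /ckS; exact: IH.
Qed.

End Kernel.
Arguments open_bal {R n} r.
Arguments cvx_bal {R n} r.

(** * Differential equations depending on parameters *)

Section Geometric.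
Context {R : realType}.

Lemma geom_small (C e : R) : 0 <= C -> 0 < e -> exists N, forall k, (N <= k)%N -> C * 2^-1 ^+ k <= e.
Proof.
move=> C0 e0.
have [N hN] : exists N, C / e <= N%:R.
  by exists (Num.truncn (C / e)).+1; rewrite ltW// truncnS_gt.
exists N => k Nk.
rewrite exprVn ler_pdivrMr ?exprn_gt0// mulrC -ler_pdivrMr//.
apply: (le_trans hN); apply: (@le_trans _ _ k%:R); first by rewrite ler_nat.
by rewrite -natrX ler_nat ltnW// ltn_expl.
Qed.

Lemma geom_dist (u : nat -> R) (C : R) : 0 <= C ->
  (forall k, `|u k.+1 - u k| <= C * 2^-1 ^+ k) ->
  forall k m, `|u (k + m)%N - u k| <= 2 * C * 2^-1 ^+ k.
Proof.
move=> C0 h k m.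
suff : `|u (k + m)%N - u k| <= 2 * C * 2^-1 ^+ k - 2 * C * 2^-1 ^+ (k + m).
  move=> /le_trans; apply; rewrite lerBlDr lerDl.
  by rewrite !mulr_ge0// exprn_ge0// invr_ge0.
elim: m => [|m IH]; first by rewrite addn0 !subrr normr0.
rewrite addnS -(subrKA (u (k + m)%N)) (le_trans (ler_normD _ _))//.
apply: (le_trans (lerD (h _) IH)).
rewrite exprS; set x := 2^-1 ^+ (k + m); set y := 2^-1 ^+ k.
have -> : 2 * C * (2^-1 * x) = C * x by rewrite [2 * C]mulrC -mulrA [2 * _]mulrA divff// mul1r.
by rewrite le_eqVlt; apply/orP; left; apply/eqP; ring.
Qed.

Lemma geom_cvg (u : nat -> R) (C : R) : 0 <= C ->
  (forall k, `|u k.+1 - u k| <= C * 2^-1 ^+ k) ->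
  forall k, `|lim (u @ \oo) - u k| <= 2 * C * 2^-1 ^+ k.
Proof.
move=> C0 h.
have hd := geom_dist C0 h.
have C2 : 0 <= 2 * C by rewrite mulr_ge0.
have cu : cvgn u.
  apply/cauchy_cvgP/cauchy_exP => e e0.
  have e2 : 0 < e / 2 by rewrite divr_gt0.
  have [N hN] := geom_small C2 e2.
  exists (u N); exists N => // k /= Nk.
  rewrite /ball/= distrC -(subnKC Nk) (le_lt_trans (hd _ _))//.
  by rewrite (le_lt_trans (hN N (leqnn _)))// gtr_pMr// invf_lt1// ltr1n.
move=> k.
have hc : `|u m - u k| @[m --> \oo] --> `|lim (u @ \oo) - u k|.
  by apply: cvg_norm; apply: cvgB => //; exact: cvg_cst.
apply: (cvgr_to_le hc); by exists k => // m /= km; rewrite -(subnKC km).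
Qed.

Lemma le_geom0 (x C : R) : (forall k, x <= C * 2^-1 ^+ k) -> 0 <= C -> x <= 0.
Proof.
move=> h C0; apply/ler_addgt0Pl => e e0.
have [N hN] := geom_small C0 e0.
by rewrite addr0 (le_trans (h N))// hN.
Qed.

End Geometric.

(** * Picard iteration with parameters *)

Section Picard.
Context {R : realType} {n : nat}.
Local Notation V := 'rV[R]_n.

Definition jcv (L : topologicalType) (D : set L) (X : R -> L -> V) :=
  forall j, jc D (fun s l => X s l 0 j).

Lemma jcv_sl (L : topologicalType) (D : set L) (X : R -> L -> V) l j :
  jcv D X -> D l -> continuous (fun s => X s l 0 j).
Proof. by move=> h Dl; apply: jc_sl (h j) Dl. Qed.

Lemma continuous_subc (X Y : R -> V) j : continuous (fun s => X s 0 j) ->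
  continuous (fun s => Y s 0 j) -> continuous (fun s => (X s - Y s) 0 j).
Proof.
move=> cX cY; have -> : (fun s => (X s - Y s) 0 j) = (fun s => X s 0 j + - Y s 0 j).
  by apply/funext => s; rewrite !mxE.
by move=> s; apply: cvgD; [exact: cX|apply: cvgN; exact: cY].
Qed.

Lemma continuous_subv (L : topologicalType) (D : set L) (X Y : R -> L -> V) l j :
  jcv D X -> jcv D Y -> D l -> continuous (fun s => (X s l - Y s l) 0 j).
Proof.
move=> cX cY Dl; apply: (@continuous_subc (X^~ l) (Y^~ l)); exact: jcv_sl Dl.
Qed.

(** The bound can be halved for ever. This is the uniqueness argument for integral equations with
    contraction factor 1/2. *)
Lemma contraction0 (u : R -> V) (M : R) : 0 <= M ->
  (forall s, `|u s| <= M) ->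
  (forall K, 0 <= K -> (forall s, `|u s| <= K) -> forall s, `|u s| <= K / 2) ->
  forall s, u s = 0.
Proof.
move=> M0 uM h s.
have H k : forall s, `|u s| <= M * 2^-1 ^+ k.
  elim: k => [|k IH] t; first by rewrite expr0 mulr1.
  rewrite exprSr mulrA; apply: h => //.
  by rewrite mulr_ge0// exprn_ge0// invr_ge0.
by apply/eqP; rewrite -normr_le0 (le_geom0 (fun k => H k s)).
Qed.

Section def.
Context {L : Type} (G : R -> L -> V -> V) (b : R -> L -> V).

(** Picard iteration for X(s) = b(s) + int_0^s G(t, X(t)) dt. A path [b] in place of an initial
    value lets the same iteration solve the inhomogeneous equations satisfied by derivatives in the
    parameters. *)
Fixpoint pic k s l : V :=
  if k is k'.+1 then
    \row_j (b (clamp s) l 0 j + ip (fun t => G t l (pic k' t l) 0 j) s)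
  else b (clamp s) l.

Definition sol s l : V := \row_j lim ((fun k => pic k s l 0 j) @ \oo).

End def.

Section spec.
Context {L : topologicalType} (D : set L) (G : R -> L -> V -> V) (b : R -> L -> V).
Context (rho kappa : R).
Hypothesis oD : open D.
Hypothesis kr : kappa < rho.
Hypothesis cb : jcv D b.
Hypothesis bk : forall s l, D l -> `|b (clamp s) l| <= kappa / 2.
Hypothesis cG : forall j, jc [set p : L * V | D p.1 /\ `|p.2| < rho] (fun s p => G s p.1 p.2 0 j).
Hypothesis Gk : forall s l y, D l -> `|y| <= kappa -> `|G s l y| <= kappa / 2.
Hypothesis Glip : forall s l y y', D l -> `|y| <= kappa -> `|y'| <= kappa ->
  `|G s l y - G s l y'| <= 2^-1 * `|y - y'|.

Lemma cG_comp (X : R -> L -> V) : jcv D X -> (forall s l, D l -> `|X s l| <= kappa) ->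
  jcv D (fun s l => G s l (X s l)).
Proof.
move=> cX Xk j.
apply: (@jc_comp _ _ _ _ [set p : L * V | D p.1 /\ `|p.2| < rho] id
  (fun s l => (l, X s l)) (fun s p => G s p.1 p.2 0 j)) => //.
- by move=> s; exact: cvg_id.
- move=> s l Dl; apply: cvg_pr; first exact: cvg_snd.
  by apply: cvg_rV => i; exact: cX.
- by move=> s l Dl; split=> //=; rewrite (le_lt_trans (Xk s l Dl)).
Qed.

Lemma jcv_b : jcv D (fun s l => b (clamp s) l).
Proof.
move=> j.
apply: (@jc_comp _ _ D _ D clamp (fun _ l => l) (fun s l => b s l 0 j)) => //.
  exact: continuous_clamp.
by move=> s x _; exact: cvg_snd.
Qed.

Lemma le_kappa x y : `|x| <= kappa / 2 -> `|y| <= kappa / 2 -> `|x + y : V| <= kappa.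
Proof. by move=> hx hy; rewrite (le_trans (ler_normD _ _))// [leRHS]splitr lerD. Qed.

Lemma norm_ipv (f : R -> V) (M : R) s : (forall j, continuous (fun t => f t 0 j)) ->
  0 <= M -> (forall t, 0 <= t <= 1 -> `|f t| <= M) ->
  `|\row_j ip (fun t => f t 0 j) s| <= M.
Proof.
move=> cf M0 fM; apply: norm_rV_le => // j; rewrite mxE.
by apply: norm_ip => // t ht; apply: le_trans (coord_le_norm _ _) (fM t ht).
Qed.

Lemma picS k s l : pic G b k.+1 s l =
  b (clamp s) l + \row_j ip (fun t => G t l (pic G b k t l) 0 j) s.
Proof. by apply/rowP => j; rewrite !mxE. Qed.

Lemma kappa_ge0 l : D l -> 0 <= kappa / 2.
Proof. by move=> Dl; apply: le_trans (bk 0 Dl). Qed.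

(** The free term and the integral each use up half of [kappa], so the iterates never leave the ball
    where [G] is bounded and contracts. The time interval has the fixed length 1, hence smallness is
    required of [G] and not of the interval. *)
Lemma pic_ok k : (forall s l, D l -> `|pic G b k s l| <= kappa) /\ jcv D (pic G b k).
Proof.
elim: k => [|k [IHb IHc]].
  split; last exact: jcv_b.
  move=> s l Dl; apply: le_trans (bk s Dl) _.
  have := kappa_ge0 Dl; lra.
split=> [s l Dl|j].
  rewrite picS; apply: le_kappa; first exact: bk.
  apply: norm_ipv; [|exact: kappa_ge0 Dl|].
    by move=> j; exact: (jcv_sl (cG_comp IHc IHb)).
  by move=> t _; apply: Gk => //; exact: IHb.
have H : jc D (fun s l => b (clamp s) l 0 j + ip (fun t => G t l (pic G b k t l) 0 j) s).
  apply: jc_add; first exact: jcv_b.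
  have cH : jcv D _ := cG_comp IHc IHb.
  exact: jc_ip oD (cH j).
by apply: jc_ext H => // s l Dl; rewrite picS !mxE.
Qed.

Lemma pic_step k s l : D l -> `|pic G b k.+1 s l - pic G b k s l| <= kappa / 2 * 2^-1 ^+ k.
Proof.
move=> Dl; elim: k s => [|k IH] s.
  rewrite picS addrAC subrr add0r expr0 mulr1.
  have [IHb IHc] := pic_ok 0.
  apply: norm_ipv; [|exact: kappa_ge0 Dl|].
    by move=> j; exact: (jcv_sl (cG_comp IHc IHb)).
  by move=> t _; apply: Gk => //; exact: IHb.
have [b1 c1] := pic_ok k.+1; have [b0 c0] := pic_ok k.
rewrite [in X in X - _]picS [in X in _ - X]picS opprD addrACA subrr add0r.
have -> : (\row_j ip (fun t => G t l (pic G b k.+1 t l) 0 j) s -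
    \row_j ip (fun t => G t l (pic G b k t l) 0 j) s : V) =
   \row_j ip (fun t => (G t l (pic G b k.+1 t l) - G t l (pic G b k t l)) 0 j) s.
  apply/rowP => j; rewrite !mxE -ip_sub; last 2 first.
  - exact: (jcv_sl (cG_comp c1 b1)).
  - exact: (jcv_sl (cG_comp c0 b0)).
  by congr (ip _ _); apply/funext => t; rewrite !mxE.
apply: norm_ipv.
- by move=> j; apply: (continuous_subv (cG_comp c1 b1) (cG_comp c0 b0)).
- by rewrite mulr_ge0 ?exprn_ge0 ?invr_ge0//; exact: kappa_ge0 Dl.
move=> t _; apply: (le_trans (Glip _ _ _ _)) => //; [exact: b1|exact: b0|].
by rewrite exprS mulrCA ler_wpM2l// invr_ge0.
Qed.

Lemma sol_dist k s l : D l -> `|sol G b s l - pic G b k s l| <= kappa * 2^-1 ^+ k.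
Proof.
move=> Dl.
have k0 := kappa_ge0 Dl.
apply: norm_rV_le.
  by rewrite mulr_ge0 ?exprn_ge0 ?invr_ge0//; lra.
move=> j; rewrite !mxE.
have h m : `|pic G b m.+1 s l 0 j - pic G b m s l 0 j| <= kappa / 2 * 2^-1 ^+ m.
  by apply: le_trans (pic_step m s Dl); apply: le_trans (coord_le_norm _ j); rewrite !mxE.
have := geom_cvg k0 h k.
by have -> : 2 * (kappa / 2) = kappa by lra.
Qed.

Lemma sol_bound s l : D l -> `|sol G b s l| <= kappa.
Proof.
move=> Dl; have k0 : 0 <= kappa by have := kappa_ge0 Dl; lra.
rewrite -subr_le0; apply: (le_geom0 (C := kappa)) => // k.
rewrite lerBlDl -[X in `|X|](subrK (pic G b k s l)) (le_trans (ler_normD _ _))// addrC.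
by rewrite lerD//; [exact: (pic_ok k).1|exact: sol_dist].
Qed.

Lemma jcv_sol : jcv D (sol G b).
Proof.
move=> j s l Dl; apply/cvgrPdist_le => e e0.
have k0 : 0 <= kappa by have := kappa_ge0 Dl; lra.
have e3 : 0 < e / 3 by rewrite divr_gt0.
have [N /(_ _ (leqnn N)) hN] := geom_small k0 e3.
have /cvgrPdist_le/(_ _ e3) hc := (pic_ok N).2 j s l Dl.
have hD := near_snd s (open_nbhs_nbhs (conj oD Dl)).
have hd s' l' : D l' -> `|sol G b s' l' 0 j - pic G b N s' l' 0 j| <= e / 3.
  move=> Dl'; apply: le_trans (le_trans (sol_dist N s' Dl') hN).
  by apply: le_trans (coord_le_norm _ j); rewrite !mxE.
near=> p.
have h1 := hd s l Dl.
have h2 : `|pic G b N s l 0 j - pic G b N p.1 p.2 0 j| <= e / 3 by near: p.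
have h3 : `|sol G b p.1 p.2 0 j - pic G b N p.1 p.2 0 j| <= e / 3 by apply: hd; near: p.
move: h1 h2 h3; rewrite !ler_norml => /andP[? ?] /andP[? ?] /andP[? ?].
by apply/andP; split; lra.
Unshelve. all: by end_near. Qed.

Lemma sol_eq s l : D l ->
  sol G b s l = b (clamp s) l + \row_j ip (fun t => G t l (sol G b t l) 0 j) s.
Proof.
move=> Dl; have k0 : 0 <= kappa by have := kappa_ge0 Dl; lra.
apply/eqP; rewrite -subr_eq0 -normr_le0.
apply: (le_geom0 (C := kappa)) => // k.
have [bk' ck'] := pic_ok k.
have cs := cG_comp jcv_sol sol_bound.
rewrite -(subrKA (pic G b k.+1 s l)) [X in _ + X](_ : _ =
   \row_j ip (fun t => (G t l (pic G b k t l) - G t l (sol G b t l)) 0 j) s); last first.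
  apply/rowP => j; rewrite picS !mxE opprD addrACA subrr add0r -ip_sub; last 2 first.
  - exact: (jcv_sl (cG_comp ck' bk')).
  - exact: (jcv_sl cs).
  by congr (ip _ _); apply/funext => t; rewrite !mxE.
rewrite (le_trans (ler_normD _ _))//.
rewrite [leRHS](_ : _ = kappa * 2^-1 ^+ k.+1 + 2^-1 * (kappa * 2^-1 ^+ k)); last first.
  by rewrite exprS; field.
rewrite lerD//; first exact: sol_dist.
apply: norm_ipv.
- by move=> j; apply: (continuous_subv (cG_comp ck' bk') cs).
- by rewrite !mulr_ge0 ?exprn_ge0 ?invr_ge0.
move=> t _; apply: (le_trans (Glip _ _ _ _)) => //; [exact: bk'|exact: sol_bound|].
by rewrite ler_wpM2l ?invr_ge0// distrC sol_dist.
Qed.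

End spec.
End Picard.

(** * Linear integral equations and their dependence on parameters *)

Section LinearODE.
Context {R : realType} {n : nat}.
Local Notation V := 'rV[R]_n.

Definition ipv (f : R -> V) s : V := \row_j ip (fun t => f t 0 j) s.

Lemma bounded_path (f : R -> V) : (forall j, continuous (fun s => f s 0 j)) ->
  exists2 M, 0 <= M & forall s, `|f (clamp s)| <= M.
Proof.
move=> cf.
have H j : exists M, forall s, `|f (clamp s) 0 j| <= M.
  have [c _ hc] := @EVT_max R (fun s => `|f s 0 j|) 0 1 ler01
    (continuous_subspaceT (fun s => cvg_norm (cf j s))).
  by exists `|f c 0 j| => s; apply: hc; rewrite in_itv/= clamp01.
have [M hM] := choice H.
exists (\sum_j `|M j|); first by apply: sumr_ge0.
move=> s; apply: norm_rV_le; first by apply: sumr_ge0.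
move=> j; rewrite (bigD1 j)//= (le_trans (hM j s))// (le_trans (ler_norm _))// lerDl.
by apply: sumr_ge0.
Qed.

Lemma ipv_clamp (f : R -> V) s : ipv f (clamp s) = ipv f s.
Proof. by apply/rowP => j; rewrite !mxE ip_clamp. Qed.

Section mat.
Variable a : R.
Hypothesis na : n%:R * a <= 2^-1.

Lemma norm_mulmx (y : V) (A : 'M[R]_n) : (forall i j, `|A i j| <= a) ->
  `|y *m A| <= 2^-1 * `|y|.
Proof.
move=> hA; apply: norm_rV_le; first by rewrite mulr_ge0// invr_ge0.
move=> j; rewrite mxE; apply: le_trans (normR_sum_le (e := `|y|) (a := a) _ _) _ => //.
  by move=> i; exact: coord_le_norm.
by rewrite ler_wpM2r.
Qed.

Definition linsol (L : Type) (A : R -> L -> 'M[R]_n) (b : R -> L -> V) :=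
  sol (fun s l y => y *m A s l) b.

Lemma continuous_mulA (u : R -> V) (A : R -> 'M[R]_n) j :
  (forall i, continuous (fun s => u s 0 i)) ->
  (forall i j, continuous (fun s => A s i j)) ->
  continuous (fun t => (u t *m A t) 0 j).
Proof.
move=> cu cA; have -> : (fun t => (u t *m A t) 0 j) = (fun t => \sum_i u t 0 i * A t i j).
  by apply/funext => t; rewrite mxE.
by apply: continuous_sumR => i; apply: continuous_mulR.
Qed.

Lemma lin_unique (u : R -> V) (A : R -> 'M[R]_n) :
  (forall j, continuous (fun s => u s 0 j)) ->
  (forall i j, continuous (fun s => A s i j)) ->
  (forall s i j, `|A s i j| <= a) ->
  (forall s, u s = ipv (fun t => u t *m A t) s) -> forall s, u s = 0.
Proof.
move=> cu cA hA hu.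
have uc s : u s = u (clamp s) by rewrite hu [in RHS]hu ipv_clamp.
have [M M0 hM] := bounded_path cu.
apply: (contraction0 M0) => [s|K K0 hK s]; first by rewrite uc.
rewrite hu; apply: norm_ipv; first by move=> j; exact: continuous_mulA.
  by rewrite divr_ge0.
move=> t _; apply: le_trans (norm_mulmx _ (hA t)) _.
by rewrite mulrC ler_wpM2r ?invr_ge0.
Qed.

Section spec.
Context {L : topologicalType} (D : set L) (A : R -> L -> 'M[R]_n) (b : R -> L -> V).
Hypothesis oD : open D.
Hypothesis cA : forall i j, jc D (fun s l => A s l i j).
Hypothesis hA : forall s l i j, D l -> `|A s l i j| <= a.
Hypothesis cb : jcv D b.

(** A linear equation has no preferred ball: [kappa] must dominate the free term, which is bounded
    only near a given parameter. Hence the properties are proved locally in [l]; [linsol] itself, a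
    limit of iterates at [l], does not depend on these choices. *)
Lemma lin_local l0 : D l0 -> exists D0 : set L, [/\ open D0, D0 l0, D0 `<=` D,
  jcv D0 (linsol A b) & forall s l, D0 l ->
    linsol A b s l = b (clamp s) l + ipv (fun t => linsol A b t l *m A t l) s].
Proof.
move=> Dl0.
have [M M0 hM] := bounded_path (fun j => jcv_sl (j := j) cb Dl0).
have H j : \forall l \near l0, forall t : R, 0 <= t <= 1 -> `|b t l 0 j - b t l0 0 j| <= 1.
  have h : jc D (fun s l => b s l 0 j) by exact: cb.
  have := jc_near ltr01 h Dl0.
  by [].
have H' := filter_forall (nbhs_filter _) H.
pose D0 := D `&` [set l | forall j t, 0 <= t <= 1 -> `|b t l 0 j - b t l0 0 j| <= 1]°.
have oD0 : open D0 by apply: openI => //; exact: open_interior.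
have D0D : D0 `<=` D by move=> l [].
(* [M] bounds [b] at [l0], the summand 1 allows for its variation nearby, and the factor 2 leaves
   half of [kappa] to the integral. *)
pose kappa := 2 * (M + 1).
have kr : kappa < kappa + 1 by rewrite ltrDl.
have cb0 : jcv D0 b by move=> j s l /D0D; exact: cb.
have bk s l : D0 l -> `|b (clamp s) l| <= kappa / 2.
  move=> [_ /interior_subset hl].
  have -> : kappa / 2 = M + 1 by rewrite /kappa mulrAC divff ?mul1r.
  rewrite -(subrK (b (clamp s) l0) (b (clamp s) l)) addrC (le_trans (ler_normD _ _))// lerD//.
  by apply: norm_rV_le => // j; rewrite !mxE; apply: hl; exact: clamp01.
have cG j : jc [set p : L * V | D0 p.1 /\ `|p.2| < kappa + 1] (fun s p => (p.2 *m A s p.1) 0 j).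
  have -> : (fun s (p : L * V) => (p.2 *m A s p.1) 0 j) =
            (fun s p => \sum_i p.2 0 i * A s p.1 i j).
    by apply/funext => s; apply/funext => p; rewrite mxE.
  apply: jc_sum => i _; apply: jc_mul.
    apply: jc_x => p _; apply: (cvg_comp snd (fun y : V => y 0 i) cvg_snd).
    exact: coord_continuous.
  apply: (@jc_comp _ _ _ _ D id (fun _ p => p.1) (fun s l => A s l i j)) => //.
  - by move=> s; exact: cvg_id.
  - by move=> s p _; apply: (cvg_comp snd fst cvg_snd); exact: cvg_fst.
  - by move=> s p [/D0D].
have Gl s l (y y' : V) : D0 l -> `|y *m A s l - y' *m A s l| <= 2^-1 * `|y - y'|.
  by move=> /D0D Dl; rewrite -mulmxBl norm_mulmx// => i j; exact: hA.
have Gk s l (y : V) : D0 l -> `|y| <= kappa -> `|y *m A s l| <= kappa / 2.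
  move=> /D0D Dl hy; apply: le_trans (norm_mulmx _ (fun i j => hA s i j Dl)) _.
  by rewrite mulrC ler_wpM2r// invr_ge0.
exists D0; split=> //.
- by apply: (@jcv_sol _ _ _ D0 (fun s l y => y *m A s l) b (kappa + 1) kappa) => // *; exact: Gl.
- move=> s l Dl.
  by apply: (@sol_eq _ _ _ D0 (fun s l y => y *m A s l) b (kappa + 1) kappa) => // *; exact: Gl.
Qed.

Lemma lin_jcv : jcv D (linsol A b).
Proof. by move=> j s l /lin_local[D0 [_ D0l _ h _]]; exact: h. Qed.

Lemma lin_eq s l : D l ->
  linsol A b s l = b (clamp s) l + ipv (fun t => linsol A b t l *m A t l) s.
Proof. by move=> /lin_local[D0 [_ D0l _ _ h]]; exact: h. Qed.

End spec.

(** The iteration at [l] involves no other parameter, so it is enough that the free terms agree at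
    this one [l]. *)
Lemma linsol_ext (L : topologicalType) (D : set L) (A : R -> L -> 'M[R]_n) (b b' : R -> L -> V) s l :
  open D -> (forall i j, jc D (fun s l => A s l i j)) ->
  (forall s l i j, D l -> `|A s l i j| <= a) -> jcv D b -> jcv D b' -> D l ->
  (forall s, b s l = b' s l) -> linsol A b s l = linsol A b' s l.
Proof.
move=> oD cA hA cb cb' Dl bb'; rewrite /linsol /sol; apply/rowP => j; rewrite !mxE.
suff H k t : pic (fun s l y => y *m A s l) b k t l = pic (fun s l y => y *m A s l) b' k t l.
  have e : (fun k => pic (fun s l y => y *m A s l) b k s l 0 j) =
           (fun k => pic (fun s l y => y *m A s l) b' k s l 0 j).
    by apply/funext => k; rewrite H.
  by rewrite e.
elim: k t => [|k IH] t /=; first exact: bb'.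
by apply/rowP => i; rewrite !mxE bb'; congr (_ + ip _ _); apply/funext => u; rewrite IH.
Qed.

Lemma continuous_subcol (u v : R -> V) j : (forall j, continuous (fun s => u s 0 j)) ->
  (forall j, continuous (fun s => v s 0 j)) -> continuous (fun s => (u s - v s) 0 j).
Proof. by move=> cu cv; apply: continuous_subc. Qed.

Section lindiff.
Context {m : nat} (W : set 'rV[R]_m) (A : R -> 'rV[R]_m -> 'M[R]_n)
  (beta : 'I_m -> R -> 'rV[R]_m -> V) (X : R -> 'rV[R]_m -> V) (l : 'rV[R]_m).
Hypothesis oW : open W.
Hypothesis Wl : W l.
Hypothesis cA : forall i j, jc W (fun s l => A s l i j).
Hypothesis hA : forall s l i j, W l -> `|A s l i j| <= a.
Hypothesis cbeta : forall k, jcv W (beta k).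
Hypothesis cX : jcv W X.
Hypothesis hX : forall s y, W y -> X s y - X s l =
  \sum_k (y - l) 0 k *: beta k (clamp s) y + ipv (fun t => (X t y - X t l) *m A t y) s.

(** By linearity both sides solve the same equation, and [lin_unique] identifies them. The
    [linsol A (beta k)] are continuous in [y], so they are slopes for [caratheodory]; no Gronwall
    estimate is needed. *)
Lemma lindiff_eq s y : W y -> X s y - X s l = \sum_k (y - l) 0 k *: linsol A (beta k) s y.
Proof.
move=> Wy; apply/eqP; rewrite -subr_eq0; apply/eqP; move: s.
pose Z k s := linsol A (beta k) s y.
have cZ k j : continuous (fun s => Z k s 0 j) by exact: (jcv_sl (lin_jcv oW cA hA (@cbeta k))).
have cXy j : continuous (fun s => (X s y - X s l) 0 j).
  by apply: continuous_subc; [exact: jcv_sl Wy|exact: jcv_sl Wl].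
have cAy i j : continuous (fun s => A s y i j) := jc_sl (@cA i j) Wy.
have cS j : continuous (fun s => (\sum_k (y - l) 0 k *: Z k s) 0 j).
  have -> : (fun s => (\sum_k (y - l) 0 k *: Z k s) 0 j) =
            (fun s => \sum_k (y - l) 0 k * Z k s 0 j).
    by apply/funext => s; rewrite summxE; apply: eq_bigr => k _; rewrite mxE.
  by apply: continuous_sumR => k; apply: continuous_mulR => // t; exact: cvg_cst.
apply: (lin_unique (A := fun s => A s y)) => //.
- by move=> j; exact: continuous_subcol.
- by move=> s i j; exact: hA.
move=> s; rewrite hX//.
under [in X in _ - X]eq_bigr => k _ do rewrite (lin_eq oW cA hA (@cbeta k) s Wy) scalerDr.
rewrite big_split/= opprD addrACA subrr add0r; apply/rowP => j; rewrite !mxE summxE.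
have -> : (fun t => ((X t y - X t l - \sum_k (y - l) 0 k *: Z k t) *m A t y) 0 j) =
  (fun t => ((X t y - X t l) *m A t y) 0 j - \sum_k (y - l) 0 k * (Z k t *m A t y) 0 j).
  apply/funext => t; rewrite mulmxBl mulmx_suml !mxE; congr (_ - _).
  by rewrite summxE; apply: eq_bigr => k _; rewrite -scalemxAl !mxE.
have cZA k : continuous (fun t => (Z k t *m A t y) 0 j) by exact: continuous_mulA.
rewrite ip_sub.
- congr (_ - _); rewrite ip_sum; last first.
    by move=> k; apply: continuous_mulR => // t; exact: cvg_cst.
  by apply: eq_bigr => k _; rewrite ip_scale// !mxE.
- exact: (continuous_mulA (u := fun t => X t y - X t l)).
- by apply: continuous_sumR => k; apply: continuous_mulR => // t; exact: cvg_cst.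
Qed.

Lemma lindiff s j : differentiable (fun y => X s y 0 j) l /\
  forall k, 'D_(delta_mx 0 k) (fun y => X s y 0 j) l = linsol A (beta k) s l 0 j.
Proof.
apply: (caratheodory (Phi := fun k y => linsol A (beta k) s y 0 j)).
  by move=> k; have h := lin_jcv oW cA hA (@cbeta k); exact: (jc_sr (h j)).
apply: (near_open oW Wl) => y Wy.
have /rowP/(_ j) := lindiff_eq s Wy; rewrite !mxE summxE => /eqP.
rewrite subr_eq => /eqP ->; rewrite addrC; congr (_ + _).
by apply: eq_bigr => k _; rewrite !mxE mulrC.
Qed.

End lindiff.

Section linreg.
Context {m : nat} (W : set 'rV[R]_m) (A : R -> 'rV[R]_m -> 'M[R]_n).
Hypothesis oW : open W.
Hypothesis cW : cvx W.
Hypothesis hA : forall s l i j, W l -> `|A s l i j| <= a.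

Definition ckv k (b : R -> 'rV[R]_m -> V) := forall j, ck k W (fun s l => b s l 0 j).

Lemma ckv_jcv k b : ckv k b -> jcv W b.
Proof. by move=> h j; exact: ck_jc (h j). Qed.

Lemma ck_clamp p k (W' : set 'rV[R]_p) F : open W' -> ck k W' F -> ck k W' (fun s x => F (clamp s) x).
Proof.
move=> oW' h; apply: (@ck_comp _ _ _ _ W' W' clamp (fun _ x => x)) => //.
  exact: continuous_clamp.
by move=> j; exact: ck_coord.
Qed.

(** Induction on [k]: a parameter derivative of the solution solves the equation with the same
    matrix and with a free term one order less regular, to which the induction hypothesis
    applies. *)
Lemma linreg k b : (forall i j, ck k W (fun s l => A s l i j)) -> ckv k b -> ckv k (linsol A b).
Proof.
elim: k b => [|k IH] b kA kb.
  move=> j; split=> //; apply: lin_jcv => //; last exact: ckv_jcv kb.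
  by move=> i j'; exact: ck_jc (kA i j').
have kA' i j : ck k W (fun s l => A s l i j) by exact: ckS.
have A1 i j : ck 1 W (fun s l => A s l i j) by apply: ck_le (kA i j).
have b1 j : ck 1 W (fun s l => b s l 0 j) by apply: ck_le (kb j).
have cA i j : jc W (fun s l => A s l i j) by exact: ck_jc (kA i j).
have cb := ckv_jcv kb.
have kX : ckv k (linsol A b) by apply: IH => // j; exact: ckS.
set X := linsol A b in kX *.
(* The free term of the equation differentiated in the [q]-th parameter. It contains derivatives of
   [b] and [A], but of the solution only its values. *)
pose b' (q : 'I_m) s l : V := \row_j ('D_(delta_mx 0 q) (fun l => b (clamp s) l 0 j) l +
  ip (fun t => \sum_i X t l 0 i * 'D_(delta_mx 0 q) (fun l => A t l i j) l) s).
have kb' q : ckv k (b' q).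
  move=> j; have [_ _ /(_ q) h1] := (ckSP _ _ _).1 (kb j).
  have h2 : ck k W (fun t l => \sum_i X t l 0 i * 'D_(delta_mx 0 q) (fun l => A t l i j) l).
    apply: ck_sum => // i _; apply: ck_mul => //.
    by have [_ _ /(_ q)] := (ckSP _ _ _).1 (kA i j).
  by apply: ck_ext (ck_add oW (ck_clamp oW h1) (ck_ip oW cW h2)) => // s x _; rewrite !mxE.
have key s l j : W l -> differentiable (fun y => X s y 0 j) l /\
  forall q, 'D_(delta_mx 0 q) (fun y => X s y 0 j) l = linsol A (b' q) s l 0 j.
  move=> Wl.
  (* The free term for finite differences: Hadamard kernels between [l] and [y] replace the
     derivatives, and at y = l they give back [b']. *)
  pose beta (q : 'I_m) s y : V := \row_j (ker q (fun s l => b s l 0 j) (clamp s) l y +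
    ip (fun t => \sum_i X t l 0 i * ker q (fun t l => A t l i j) t l y) s).
  have cXl i : continuous (fun t => X t l 0 i) by exact: (jcv_sl (ckv_jcv kX)).
  have cXl' i : jc W (fun t (_ : 'rV[R]_m) => X t l 0 i) by apply: jc_t.
  have cki i j' q : jc W (fun t y => ker q (fun t l => A t l i j') t l y).
    exact: jc_ker.
  have cS j' q : jc W (fun t y => \sum_i X t l 0 i * ker q (fun t l => A t l i j') t l y).
    by apply: jc_sum => i _; apply: jc_mul.
  have cbeta q : jcv W (beta q).
    move=> j'.
    have h1 : jc W (fun s y => ker q (fun s l => b s l 0 j') (clamp s) l y).
      apply: (@jc_comp _ _ W _ W clamp (fun _ y => y) (fun s y => ker q (fun s l => b s l 0 j') s l y)) => //.
      - exact: continuous_clamp.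
      - by move=> *; exact: cvg_snd.
      - exact: jc_ker.
    by apply: jc_ext (jc_add h1 (jc_ip oW (cS j' q))) => // s' y _; rewrite !mxE.
  have hX s' y : W y -> X s' y - X s' l = \sum_q (y - l) 0 q *: beta q (clamp s') y +
      ipv (fun t => (X t y - X t l) *m A t y) s'.
    move=> Wy; rewrite [X s' y](lin_eq oW cA hA cb s' Wy) [X s' l](lin_eq oW cA hA cb s' Wl).
    rewrite opprD addrACA; apply/rowP => j'; rewrite !mxE summxE.
    have cXA z : W z -> continuous (fun t => (X t z *m A t z) 0 j').
      move=> Wz; apply: continuous_mulA => [i|i j'']; first exact: (jcv_sl (ckv_jcv kX)).
      exact: (jc_sl (cA i j'')).
    have cXAy : continuous (fun t => ((X t y - X t l) *m A t y) 0 j').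
      apply: (continuous_mulA (u := fun t => X t y - X t l)) => [i|i j''].
        by apply: continuous_subc; [exact: (jcv_sl (ckv_jcv kX) Wy)|].
      exact: (jc_sl (cA i j'')).
    have eb := ker_eq (clamp s') oW cW (b1 j') Wl Wy.
    rewrite eb [X in X - _ + _]addrC addrK.
    transitivity (\sum_q ker q (fun s0 l0 => b s0 l0 0 j') (clamp s') l y * (y 0 q - l 0 q) +
      \sum_q (y 0 q - l 0 q) * ip (fun t => \sum_i X t l 0 i * ker q (fun t l => A t l i j') t l y) s'
      + ip (fun t => ((X t y - X t l) *m A t y) 0 j') s').
      rewrite -[RHS]addrA; congr (_ + _).
      rewrite -ip_sub; [|exact: cXA|exact: cXA].
      transitivity (ip (fun t => \sum_q (y 0 q - l 0 q) *
          (\sum_i X t l 0 i * ker q (fun t l => A t l i j') t l y)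
          + ((X t y - X t l) *m A t y) 0 j') s').
        congr (ip _ _); apply/funext => t.
        under eq_bigr => q _ do rewrite mulr_sumr.
        rewrite exchange_big/= !mxE -sumrB -big_split/=; apply: eq_bigr => i _.
        rewrite (ker_eq t oW cW (A1 i j') Wl Wy).
        have -> : \sum_i0 (y 0 i0 - l 0 i0) * (X t l 0 i * ker i0 (fun t l => A t l i j') t l y)
          = X t l 0 i * (\sum_j ker j (fun t l => A t l i j') t l y * (y 0 j - l 0 j)).
          by rewrite mulr_sumr; apply: eq_bigr => q _; ring.
        rewrite !mxE; ring.
      rewrite ip_add//; last first.
        apply: continuous_sumR => q; apply: continuous_mulR; first by move=> t; exact: cvg_cst.
        exact: (jc_sl (cS j' q)).
      congr (_ + _); rewrite ip_sum; last first.
        move=> q; apply: continuous_mulR; first by move=> t; exact: cvg_cst.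
        exact: (jc_sl (cS j' q)).
      by apply: eq_bigr => q _; rewrite ip_scale//; exact: (jc_sl (cS j' q)).
    congr (_ + _); rewrite -big_split/=; apply: eq_bigr => q _.
    by rewrite !mxE clamp_clamp ip_clamp; ring.
  have [hd hD] := lindiff oW Wl cA hA cbeta (ckv_jcv kX) hX s j.
  split; first exact: hd.
  move=> q; rewrite hD.
  congr (fun_of_matrix _ 0 j).
  apply: (linsol_ext s oW cA hA (cbeta q) (ckv_jcv (kb' q)) Wl) => s'.
  apply/rowP => j'; rewrite !mxE; congr (_ + ip _ _); first exact: ker_diag.
  by apply/funext => t; apply: eq_bigr => i _; rewrite ker_diag.
move=> j; apply/ckSP; split.
- exact: (ck_jc (kX j)).
- by move=> s x Wx; case: (key s x j Wx).
- move=> q; have h := IH (b' q) kA' (kb' q).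
  by apply: ck_ext (h j) => // s x Wx; rewrite (key s x j Wx).2.
Qed.

End linreg.
End mat.
End LinearODE.

(** * Flows of small time-dependent vector fields *)

Section FlowSub.
Context {R : realType}.

Lemma ip_rev (f : R -> R) s : continuous f -> 0 <= s <= 1 ->
  ip (fun t => f (1 - t)) s = ip f 1 - ip f (1 - s).
Proof.
move=> cf hs.
have c1 : continuous (fun t : R => 1 - t).
  by move=> t; apply: cvgB; [exact: cvg_cst|exact: cvg_id].
have cf' : continuous (fun t : R => f (1 - t)).
  by move=> t; apply: (continuous_comp (c1 t)); exact: cf.
suff : - ip f (1 - s) - (- ip f (1 - 0)) = ip (fun t => f (1 - t)) s.
  by rewrite subr0 opprK addrC.
apply: (@ip_FTC _ _ (fun s => - ip f (1 - s)) _ cf') => //.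
- move=> x hx.
  have -> : f (1 - x) = - (f (1 - x) * (-1)) by rewrite mulrN1 opprK.
  apply: is_deriveN.
  apply: (@is_derive1_comp _ (ip f) (fun t : R => 1 - t)).
    by apply: is_derive_ip => //; lra.
  have h : is_derive x 1 (cst (1 : R) - (id : R -> R)) (0 - 1) by apply: is_deriveB.
  by move: h; rewrite sub0r.
- apply: continuous_subspaceT => t; apply: cvgN.
  by apply: (continuous_comp (c1 t)); exact: continuous_ip.
Qed.

Lemma ip_dilate (f : R -> R) c s : continuous f -> 0 <= c <= 1 -> 0 <= s <= 1 ->
  ip (fun t => c * f (c * t)) s = ip f (c * s).
Proof.
move=> cf hc hs.
have c1 : continuous (fun t : R => c * t).
  by move=> t; apply: cvgM; [exact: cvg_cst|exact: cvg_id].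
have cf0 : continuous (fun t => f (c * t)).
  by move=> t; apply: (continuous_comp (c1 t)); exact: cf.
have cf' : continuous (fun t => c * f (c * t)).
  by apply: continuous_mulR => // t; exact: cvg_cst.
(* For c = 0 the point c * x does not lie inside (0,1), where [ip f] is known to be
   differentiable. *)
have [c0|c0] := eqVneq c 0.
  rewrite c0 mul0r ip0; under [X in ip X _]eq_fun do rewrite mul0r.
  by rewrite ip_cst mul0r.
suff : ip f (c * s) - ip f (c * 0) = ip (fun t => c * f (c * t)) s.
  by rewrite mulr0 ip0 subr0.
apply: (@ip_FTC _ _ (fun s => ip f (c * s)) _ cf') => //.
- move=> x hx; rewrite mulrC.
  apply: (@is_derive1_comp _ (ip f) (fun t : R => c * t)).
    apply: is_derive_ip => //; apply/andP; split; first by rewrite mulr_gt0// ?lt_neqAle 1?eq_sym ?c0/=; lra.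
    by nra.
  have := is_deriveZ c (is_derive_id x (1 : R)).
  by rewrite /GRing.scale/= mulr1.
- apply: continuous_subspaceT => t.
  by apply: (continuous_comp (c1 t)); exact: continuous_ip.
Qed.

End FlowSub.

Section Flow.
Context {R : realType} {n : nat}.
Local Notation V := 'rV[R]_n.
Variables (rho kappa a : R) (G : R -> V -> V).

(** The bounds [ff_a] and [ff_der] make each [G s] a contraction with factor 1/2, and together with
    [ff_0] they bound it by kappa / 2 on the ball of radius [kappa], as the Picard iteration
    demands. *)
Record flow_field : Prop := FlowField {
  ff_kr : kappa < rho;
  ff_k0 : 0 < kappa;
  ff_a : n%:R * a <= 2^-1;
  ff_ck : forall k i, ck k (bal rho) (fun s y => G s y 0 i);
  ff_der : forall s y i j, bal rho y -> `|'D_(delta_mx 0 j) (fun y => G s y 0 i) y| <= a;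
  ff_0 : forall s, G s 0 = 0 }.

Hypothesis hG : flow_field.

Lemma bal0 r : 0 < r -> bal r (0 : V).
Proof. by rewrite /bal /= normr0. Qed.

Lemma ker_bound s i j x y : bal rho x -> bal rho y ->
  `|ker j (fun s y => G s y 0 i) s x y| <= a.
Proof.
case: hG => kr k0 na hk hd h0 bx by_.
have hl t : bal rho (x + clamp t *: (y - x)).
  by apply: cvx_bal => //; exact: clamp01.
apply: norm_ip; last by move=> t _; apply: hd.
have [_ _ /(_ j) h] := (ckSP _ _ _).1 (hk 1 i).
move=> t.
apply: (cvg_comp (fun u : R => x + clamp u *: (y - x)) ('D_(delta_mx 0 j) (fun y => G s y 0 i))).
  apply: cvgD; first exact: cvg_cst.
  by apply: cvgZr_tmp; exact: continuous_clamp.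
by apply: (jc_sr (ck_jc h)).
Qed.

Lemma G_lip s y y' : bal rho y -> bal rho y' -> `|G s y - G s y'| <= 2^-1 * `|y - y'|.
Proof.
case: (hG) => kr k0 na hk hd h0 b1 b2.
apply: norm_rV_le; first by rewrite mulr_ge0// invr_ge0.
move=> i; rewrite !mxE.
rewrite (ker_eq s (open_bal _) (cvx_bal _) (hk 1 i) b2 b1) [_ + \sum_j _]addrC addrK.
apply: (@le_trans _ _ (n%:R * a * `|y - y'|)); last by rewrite ler_wpM2r.
under eq_bigr => j _ do rewrite mulrC.
apply: normR_sum_le => j; last exact: ker_bound.
by apply: le_trans (coord_le_norm _ j); rewrite !mxE.
Qed.

(** The initial value is both the parameter of the iteration and its free term, constant in the
    time. *)
Definition flow (s : R) (v : V) : V := sol (fun s (_ : V) y => G s y) (fun _ v => v) s v.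

Lemma kbal y : `|y : V| <= kappa -> bal rho y.
Proof. by move=> h; rewrite /bal /= (le_lt_trans h)// (ff_kr hG). Qed.

Lemma G_bound s y : `|y| <= kappa -> `|G s y| <= kappa / 2.
Proof.
move=> yk; rewrite -[G s y]subr0 -(ff_0 hG s).
apply: le_trans (G_lip _ (kbal yk) _) _.
  by apply: bal0; apply: lt_trans (ff_k0 hG) (ff_kr hG).
by rewrite subr0 mulrC ler_wpM2r// invr_ge0.
Qed.

Let D : set V := bal (kappa / 2).

Lemma flow_spec : [/\ jcv D flow, forall s v, D v -> `|flow s v| <= kappa &
  forall s v, D v -> flow s v = v + ipv (fun t => G t (flow t v)) s].
Proof.
have oD : open D by exact: open_bal.
have cb : jcv D (fun (_ : R) (v : V) => v).
  by move=> j; apply: (ck_jc (k := 0)); apply: ck_coord.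
have bk (s : R) (l : V) : D l -> `|l| <= kappa / 2 by exact: ltW.
have cG j : jc [set p : V * V | D p.1 /\ `|p.2| < rho] (fun s p => G s p.2 0 j).
  apply: (@jc_comp _ _ _ _ (bal rho) id (fun _ p => p.2) (fun s y => G s y 0 j)).
  - by move=> s; exact: cvg_id.
  - by move=> s p _; apply: (cvg_comp snd snd cvg_snd); exact: cvg_snd.
  - by move=> s p [].
  - exact: (ck_jc (ff_ck hG 0 j)).
have Gk (s : R) (l y : V) : D l -> `|y| <= kappa -> `|G s y| <= kappa / 2.
  by move=> _; exact: G_bound.
have Gl (s : R) (l y y' : V) : D l -> `|y| <= kappa -> `|y'| <= kappa ->
    `|G s y - G s y'| <= 2^-1 * `|y - y'|.
  by move=> _ h1 h2; apply: G_lip; exact: kbal.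
have kr := ff_kr hG.
split.
- exact: (@jcv_sol _ _ _ D (fun s _ y => G s y) (fun _ v => v) rho kappa).
- by move=> s v Dv; exact: (@sol_bound _ _ _ D (fun s _ y => G s y) (fun _ v => v) rho kappa).
- by move=> s v Dv; exact: (@sol_eq _ _ _ D (fun s _ y => G s y) (fun _ v => v) rho kappa).
Qed.

Lemma continuous_G (u : R -> V) j : (forall i, continuous (fun s => u s 0 i)) ->
  (forall s, bal rho (u s)) -> continuous (fun s => G s (u s) 0 j).
Proof.
move=> cu bu s.
apply: (cvg_comp (fun s => (s, u s)) (fun p : R * V => G p.1 p.2 0 j) (G := nbhs (s, u s))).
  apply: cvg_pr; first exact: cvg_id.
  by apply: cvg_rV => i; exact: cu.
exact: (ck_jc (ff_ck hG 0 j)).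
Qed.

Lemma flow_unique (u u' : R -> V) v :
  (forall i, continuous (fun s => u s 0 i)) -> (forall s, `|u s| <= kappa) ->
  (forall s, u s = v + ipv (fun t => G t (u t)) s) ->
  (forall i, continuous (fun s => u' s 0 i)) -> (forall s, `|u' s| <= kappa) ->
  (forall s, u' s = v + ipv (fun t => G t (u' t)) s) ->
  forall s, u s = u' s.
Proof.
move=> cu bu eu cu' bu' eu' s; apply/eqP; rewrite -subr_eq0; apply/eqP; move: s.
have k0 := ff_k0 hG.
apply: (@contraction0 _ _ (fun s => u s - u' s) (kappa + kappa)).
- by rewrite addr_ge0// ltW.
- by move=> s; rewrite (le_trans (ler_normB _ _))// lerD.
move=> K K0 hK s.
rewrite eu eu' opprD addrACA subrr add0r.
have -> : ipv (fun t => G t (u t)) s - ipv (fun t => G t (u' t)) s =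
          \row_j ip (fun t => (G t (u t) - G t (u' t)) 0 j) s.
  apply/rowP => j; rewrite !mxE -ip_sub; last 2 first.
  - by apply: continuous_G => // t; exact: kbal.
  - by apply: continuous_G => // t; exact: kbal.
  by congr (ip _ _); apply/funext => t; rewrite !mxE.
apply: norm_ipv.
- by move=> j; apply: continuous_subcol => i; apply: continuous_G => // t; exact: kbal.
- by rewrite divr_ge0.
move=> t _; apply: le_trans (G_lip _ (kbal (bu t)) (kbal (bu' t))) _.
by rewrite mulrC ler_wpM2r// invr_ge0.
Qed.

Lemma flow0 v : D v -> flow 0 v = v.
Proof.
have [_ _ h] := flow_spec => Dv; rewrite (h 0 v Dv); apply/rowP => j.
by rewrite !mxE ip0 addr0.
Qed.

Lemma flow_fix0 s : flow s 0 = 0.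
Proof.
have D0 : D 0 by apply: bal0; rewrite divr_gt0// (ff_k0 hG).
have [h1 h2 h3] := flow_spec.
apply: (@flow_unique (fun s => flow s 0) (fun=> 0) 0).
- by move=> i; exact: (jcv_sl h1 D0).
- by move=> t; exact: h2.
- by move=> t; exact: h3.
- by move=> i t; exact: cvg_cst.
- by move=> t; rewrite normr0 ltW// (ff_k0 hG).
- move=> t; apply/rowP => j; rewrite !mxE.
  under [X in ip X _]eq_fun do rewrite (ff_0 hG) mxE.
  by rewrite ip_cst mul0r addr0.
Qed.

Lemma is_derive_flow (s : R) v j : D v -> 0 < s < 1 ->
  is_derive s 1 (fun s => flow s v 0 j) (G s (flow s v) 0 j).
Proof.
move=> Dv hs; have [h1 h2 h3] := flow_spec.
have -> : (fun s => flow s v 0 j) = (fun s => v 0 j + ip (fun t => G t (flow t v) 0 j) s).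
  by apply/funext => t; rewrite h3// !mxE.
rewrite -[G s _ 0 j]add0r.
apply: (@is_deriveD _ _ _ (cst (v 0 j)) (ip (fun t => G t (flow t v) 0 j))).
apply: is_derive_ip => //; apply: continuous_G => [i|t]; first exact: (jcv_sl h1 Dv).
by apply: kbal; exact: h2.
Qed.

Let dG s (y : V) : 'M[R]_n := \matrix_(j, i) 'D_(delta_mx 0 j) (fun y => G s y 0 i) y.

Let e_ (k : 'I_n) : R -> V -> V := fun _ _ => delta_mx 0 k.

(** The difference of two trajectories satisfies a linear equation whose matrix consists of the
    Hadamard kernels of [G] between them, so [lindiff] applies. On the diagonal this matrix is the
    Jacobian of [G] along the flow, and the result is the variational equation. *)
Lemma flow_diff s l j : D l -> ckv D 0 flow ->
  differentiable (fun y => flow s y 0 j) l /\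
  forall k, 'D_(delta_mx 0 k) (fun y => flow s y 0 j) l =
            linsol (fun s l => dG s (flow s l)) (e_ k) s l 0 j.
Proof.
move=> Dl c0; have [h1 h2 h3] := flow_spec.
have oD : open D by exact: open_bal.
pose A t y : 'M[R]_n := \matrix_(q, i) ker q (fun s y => G s y 0 i) t (flow t l) (flow t y).
have bf t y : D y -> bal rho (flow t y) by move=> Dy; apply: kbal; exact: h2.
have cA i q : jc D (fun t y => A t y i q).
  have := @jc_kerv R n _ D (bal rho) (fun s y => G s y 0 q) i (fun t _ => flow t l) flow
    oD (cvx_bal _) (ff_ck hG 1 q).
  move=> H; apply: jc_ext (H _ _ _) => //.
  - by move=> t y _; rewrite mxE.
  - by move=> t y Dy; split; exact: bf.
  - by move=> i'; apply: jc_t; exact: (jcv_sl h1 Dl).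
have hA t y i q : D y -> `|A t y i q| <= a.
  by move=> Dy; rewrite mxE; apply: ker_bound; exact: bf.
have ce k : jcv D (e_ k) by move=> i; exact: jc_cst.
have cG y i : D y -> continuous (fun t => G t (flow t y) 0 i).
  by move=> Dy; apply: continuous_G => [i'|t]; [exact: (jcv_sl h1 Dy)|exact: bf].
have hX t y : D y -> flow t y - flow t l =
    \sum_k (y - l) 0 k *: e_ k (clamp t) y + ipv (fun u => (flow u y - flow u l) *m A u y) t.
  move=> Dy; rewrite -row_sum_delta (h3 t y Dy) (h3 t l Dl) opprD addrACA; congr (_ + _).
  apply/rowP => i; rewrite !mxE -ip_sub; [|exact: cG|exact: cG].
  congr (ip _ _); apply/funext => u.
  rewrite (ker_eq u (open_bal _) (cvx_bal _) (ff_ck hG 1 i) (bf u l Dl) (bf u y Dy)).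
  rewrite [_ + \sum_j _]addrC addrK !mxE; apply: eq_bigr => q _.
  by rewrite !mxE mulrC.
have [hd hD] := lindiff (ff_a hG) oD Dl cA hA ce h1 hX s j.
split; first exact: hd.
move=> k; rewrite hD.
suff -> : linsol A (e_ k) s l = linsol (fun s l => dG s (flow s l)) (e_ k) s l by [].
have eA : forall t, A t l = dG t (flow t l).
  by move=> t; apply/matrixP => i q; rewrite !mxE ker_diag.
rewrite /linsol /sol; apply/rowP => i; rewrite [LHS]mxE [RHS]mxE.
suff H p t : pic (fun s l y => y *m A s l) (e_ k) p t l =
             pic (fun s l y => y *m dG s (flow s l)) (e_ k) p t l.
  have e : (fun p => pic (fun s l y => y *m A s l) (e_ k) p s l 0 i) =
           (fun p => pic (fun s l y => y *m dG s (flow s l)) (e_ k) p s l 0 i).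
    by apply/funext => p; rewrite H.
  by rewrite e.
elim: p t => [//|p IH] t /=; apply/rowP => i'; rewrite !mxE; congr (_ + ip _ _).
by apply/funext => u; rewrite IH eA.
Qed.

Lemma flow_dG k : ckv D k flow -> forall i j, ck k D (fun s l => dG s (flow s l) i j).
Proof.
move=> kf i j; have [h1 h2 h3] := flow_spec.
have [_ _ /(_ i) h] := (ckSP _ _ _).1 (ff_ck hG k.+1 j).
have H := @ck_comp R n n k D (bal rho) id flow _ (open_bal _) (open_bal _) _ _ kf h.
apply: ck_ext (H _ _) => //; first exact: open_bal.
- by move=> s x _; rewrite mxE.
- by move=> s; exact: cvg_id.
- by move=> s x Dx; apply: kbal; exact: h2.
Qed.

Lemma flow_dG_bound s l i j : D l -> `|dG s (flow s l) i j| <= a.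
Proof.
move=> Dl; have [h1 h2 h3] := flow_spec; rewrite mxE.
by apply: (ff_der hG); apply: kbal; exact: h2.
Qed.

(** Bootstrap: if the flow is of class C^k, so is the matrix of the variational equation, hence by
    [linreg] the first derivatives of the flow. *)
Lemma flow_smooth k : ckv D k flow.
Proof.
have oD : open D by exact: open_bal.
have c0 : ckv D 0 flow.
  by move=> j; split=> //; have [h1 _ _] := flow_spec; exact: h1.
elim: k => [//|k IH] j; apply/ckSP; split.
- by have [h1 _ _] := flow_spec; exact: h1.
- by move=> s x Dx; case: (flow_diff s j Dx c0).
move=> i.
have ke : ckv D k (e_ i) by move=> q; exact: ck_cstR.
have h := linreg (ff_a hG) oD (cvx_bal _) (fun s l i j => @flow_dG_bound s l i j) (flow_dG IH) ke.
by apply: ck_ext (h j) => // s x Dx; rewrite (flow_diff s j Dx c0).2.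
Qed.

(** Along the constant trajectory 0 the variational equation has zero matrix, so the differential
    keeps its initial value. *)
Lemma flow_der0 : (forall s i j, 'D_(delta_mx 0 j) (fun y => G s y 0 i) 0 = 0) ->
  forall s j k, 'D_(delta_mx 0 k) (fun y => flow s y 0 j) 0 = (j == k)%:R.
Proof.
move=> dG0 s j k.
have D0 : D 0 by apply: bal0; rewrite divr_gt0// (ff_k0 hG).
have oD : open D by exact: open_bal.
rewrite (flow_diff s j D0 (flow_smooth 0)).2.
have ce : jcv D (e_ k) by move=> i; exact: jc_cst.
have cA i q : jc D (fun t y => dG t (flow t y) i q).
  exact: ck_jc (flow_dG (flow_smooth 0) i q).
rewrite (lin_eq (ff_a hG) oD cA (fun s l i j => @flow_dG_bound s l i j) ce s D0) mxE.
rewrite [X in _ + X]mxE.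
under [X in ip X _]eq_fun => t.
  have -> : dG t (flow t 0) = 0.
    by rewrite flow_fix0; apply/matrixP => i q; rewrite mxE dG0 mxE.
  rewrite mulmx0 mxE; over.
by rewrite ip_cst mul0r addr0 mxE eqxx.
Qed.

End Flow.

(** * Linearisation of a vector field at a zero *)

Section Aux.
Context {R : realType}.

Lemma clamp0 : clamp (0 : R) = 0.
Proof. by rewrite clamp_id// lexx ler01. Qed.

Lemma clamp1 : clamp (1 : R) = 1.
Proof. by rewrite clamp_id// lexx ler01. Qed.

Lemma continuous_compR (f g : R -> R) : continuous f -> continuous g ->
  continuous (fun s => g (f s)).
Proof. by move=> cf cg s; apply: (@continuous_comp _ _ _ f g); [exact: cf|exact: cg]. Qed.

Lemma ipvE n (f : R -> 'rV[R]_n) s j : ipv f s 0 j = ip (fun t => f t 0 j) s.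
Proof. by rewrite mxE. Qed.

End Aux.

Section Smooth.
Context {R : realType} {n : nat}.
Local Notation V := 'rV[R]_n.
Implicit Types (W : set V) (f g : V -> R).

(** Smooth functions are treated as constant in the time, so that the closure properties of [ck] are
    inherited. *)
Definition smooth W f := forall k, ck k W (fun _ : R => f).

Lemma ck_fix k W (F : R -> V -> R) s : open W -> ck k W F -> ck k W (fun _ => F s).
Proof.
move=> oW h.
apply: (@ck_comp R n n k W W (fun=> s) (fun _ x => x) F oW oW) => //.
  by move=> t; exact: cvg_cst.
by move=> j; exact: ck_coord.
Qed.

Definition had j f y := ker j (fun _ : R => f) 0 0 y.

Lemma smooth_had r j f : 0 < r -> smooth (bal r) f -> smooth (bal r) (had j f).
Proof.
move=> r0 hf k.
have [_ _ /(_ j) h] := (ckSP _ _ _).1 (hf k.+1).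
have H : ck k (bal r) (fun u (y : V) => 'D_(delta_mx 0 j) f (0 + clamp u *: (y - 0))).
  apply: (@ck_comp R n n k (bal r) (bal r) (fun=> 0)
    (fun u y => 0 + clamp u *: (y - 0)) (fun _ : R => 'D_(delta_mx 0 j) f)) => //.
  - exact: open_bal.
  - exact: open_bal.
  - by move=> t; exact: cvg_cst.
  - move=> u y hy; apply: cvx_bal => //; first exact: bal0.
    exact: clamp01.
  - move=> i; have hc : ck k (bal r) (fun u (_ : V) => clamp u).
      by apply: ck_t; [exact: open_bal|exact: continuous_clamp].
    apply: ck_ext (ck_mul (open_bal r) hc (ck_coord (open_bal r) k i)); first exact: open_bal.
    by move=> s x _; rewrite !mxE subr0 add0r.
exact: (ck_fix 1 (open_bal r) (ck_ip (open_bal r) (cvx_bal r) H)).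
Qed.

Lemma had_eq r f y : smooth (bal r) f -> bal r y -> f y = f 0 + \sum_j had j f y * y 0 j.
Proof.
move=> hf hy; have h0 : bal r (0 : V) by apply: bal0; apply: le_lt_trans hy.
rewrite (ker_eq 0 (open_bal r) (cvx_bal r) (hf 1) h0 hy); congr (_ + _).
by apply: eq_bigr => j _; rewrite [in LHS]mxE subr0.
Qed.

Lemma had0 j f : had j f 0 = 'D_(delta_mx 0 j) f 0.
Proof. exact: ker_diag. Qed.

Lemma smooth_diff W f x : smooth W f -> W x -> differentiable f x.
Proof. by move=> /(_ 1) /ckSP[_ h _] /(h 0). Qed.

Lemma smooth_cont W f x : smooth W f -> W x -> {for x, continuous f}.
Proof. by move=> h Wx; exact: (differentiable_continuous (smooth_diff h Wx)). Qed.

Lemma smooth_der W f j : smooth W f -> smooth W ('D_(delta_mx 0 j) f).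
Proof. by move=> h k; have [_ _] := (ckSP _ _ _).1 (h k.+1). Qed.

End Smooth.

Definition smoothv {R : realType} {n m : nat} (W : set 'rV[R]_n) (F : 'rV[R]_n -> 'rV[R]_m) :=
  forall i, smooth W (fun x => F x 0 i).

Section Linearize.
Context {R : realType} {n : nat}.
Local Notation V := 'rV[R]_n.

Section G.
Variables (rho0 : R) (E : V -> V).
Hypothesis r0 : 0 < rho0.
Hypothesis sE : smoothv (bal rho0) E.
Hypothesis E0 : E 0 = 0.
Hypothesis dE0 : forall i j, 'D_(delta_mx 0 j) (fun x => E x 0 i) 0 = (i == j)%:R.

Let Q i (x : V) := E x 0 i - x 0 i.
Let h i j k := had k (had j (Q i)).

(** This is (E(s y) - s y) / s^2, the field obtained from s dx/ds = E(x) by x = s y. The second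
    Hadamard quotients [h] of E minus the identity express it without a division, hence smoothly
    across s = 0. *)
Let G (s : R) (y : V) : V := \row_i \sum_j (\sum_k h i j k (clamp s *: y) * y 0 k) * y 0 j.

Lemma bal_clamp r s (y : V) : bal r y -> bal r (clamp s *: y).
Proof.
rewrite /bal /= normrZ => hy; apply: le_lt_trans hy.
by rewrite ler_piMl// ger0_norm ?clamp_le1 ?clamp_ge0.
Qed.

Lemma sQ i : smooth (bal rho0) (Q i).
Proof.
move=> k; apply: ck_sub; [exact: open_bal|exact: sE|].
by apply: ck_coord; exact: open_bal.
Qed.

Lemma sh i j k : smooth (bal rho0) (h i j k).
Proof. by apply: smooth_had => //; apply: smooth_had => //; exact: sQ. Qed.

Lemma dQ0 i j : 'D_(delta_mx 0 j) (Q i) 0 = 0.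
Proof.
have b0 : bal rho0 (0 : V) by exact: bal0.
rewrite deriveB.
- have -> := dE0 i j.
  have d := differentiable_coord (0 : V) 0 i.
  rewrite deriveE//.
  pose g (h : V) : R := h 0 i.
  have glin : linear g by move=> c u w; rewrite /g /GRing.scale/= !mxE.
  pose glM := GRing.isLinear.Build _ _ _ _ _ glin.
  pose gL : {linear V -> R} := HB.pack g glM.
  rewrite -[fun x : V => x 0 i]/(gL : _ -> _) diff_lin; last exact: coord_continuous.
  by rewrite /= /g mxE eqxx/= subrr.
- by apply: diff_derivable; exact: smooth_diff (sE i) b0.
- by apply: diff_derivable; exact: differentiable_coord.
Qed.

Lemma Q_eq i x : bal rho0 x -> Q i x = \sum_j (\sum_k h i j k x * x 0 k) * x 0 j.
Proof.
move=> hx; rewrite (had_eq (sQ i) hx) {1}/Q E0 !mxE subrr add0r.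
apply: eq_bigr => j _; congr (_ * _).
rewrite (had_eq (smooth_had j r0 (sQ i)) hx) had0 dQ0 add0r.
by [].
Qed.

Lemma hs_ck k i j q : ck k (bal rho0) (fun s y => h i j q (clamp s *: y)).
Proof.
apply: (@ck_comp R n n k (bal rho0) (bal rho0) (fun=> 0)
    (fun u y => clamp u *: y) (fun _ : R => h i j q)).
- exact: open_bal.
- exact: open_bal.
- by move=> t; exact: cvg_cst.
- by move=> s y; exact: bal_clamp.
- move=> l; have hc : ck k (bal rho0) (fun u (_ : V) => clamp u).
    by apply: ck_t; [exact: open_bal|exact: continuous_clamp].
  apply: ck_ext (ck_mul (open_bal rho0) hc (ck_coord (open_bal rho0) k l)).
    exact: open_bal.
  by move=> s x _; rewrite mxE.
- exact: sh.
Qed.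

Lemma G_ck k i : ck k (bal rho0) (fun s y => G s y 0 i).
Proof.
have H : ck k (bal rho0) (fun s y => \sum_j (\sum_q h i j q (clamp s *: y) * y 0 q) * y 0 j).
  have oB := @open_bal R n rho0.
  apply: ck_sum => // j _; apply: ck_mul => //; last exact: ck_coord.
  apply: ck_sum => // q _; apply: ck_mul => //; last exact: ck_coord.
  exact: hs_ck.
apply: ck_ext H; first exact: open_bal.
by move=> s x _; rewrite mxE.
Qed.

Lemma G_0 s : G s 0 = 0.
Proof. by apply/rowP => i; rewrite !mxE big1// => j _; rewrite mxE mulr0. Qed.

Lemma G_clamp s : G (clamp s) = G s.
Proof. by rewrite /G clamp_clamp. Qed.

Lemma dG0 s i j : 'D_(delta_mx 0 j) (fun y => G s y 0 i) 0 = 0.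
Proof.
pose Phi j (y : V) := \sum_q h i j q (clamp s *: y) * y 0 q.
have [||_ ->] := @caratheodory R n (fun y => G s y 0 i) 0 Phi.
- move=> q.
  have oB := @open_bal R n rho0.
  have H : ck 0 (bal rho0) (fun s y => \sum_p h i q p (clamp s *: y) * y 0 p).
    apply: ck_sum => // p _; apply: ck_mul => //; last exact: ck_coord.
    exact: hs_ck.
  by apply: (jc_sr (ck_jc H)); exact: bal0.
- near=> y; rewrite G_0 !mxE add0r; apply: eq_bigr => q _.
  by rewrite mxE subr0.
by rewrite /Phi big1// => q _; rewrite mxE mulr0.
Unshelve. all: by end_near. Qed.

(** [h] sees only the product of time and point, so scaling the point is scaling the time.
    Consequently the curves c Y_{cs}(v) and Y_s(c v) solve the same equation. *)
Lemma G_hom (c s : R) (y : V) : 0 <= c <= 1 -> 0 <= s <= 1 ->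
  G s (c *: y) = c ^+ 2 *: G (c * s) y.
Proof.
move=> /andP[c0 c1] /andP[s0 s1]; apply/rowP => i; rewrite !mxE mulr_sumr.
have cs : 0 <= c * s <= 1 by rewrite mulr_ge0// mulr_ile1.
apply: eq_bigr => j _.
have e : \sum_k h i j k (clamp s *: (c *: y)) * (c *: y) 0 k =
         c * \sum_k h i j k (clamp (c * s) *: y) * y 0 k.
  rewrite mulr_sumr; apply: eq_bigr => q _.
  rewrite scalerA !clamp_id ?s0// [s * c]mulrC mxE; ring.
by rewrite e !mxE; ring.
Qed.

Lemma G_E s (y : V) i : 0 <= s <= 1 -> bal rho0 y ->
  s * y 0 i + s ^+ 2 * G s y 0 i = E (s *: y) 0 i.
Proof.
move=> hs hy; have hsy : bal rho0 (s *: y) by rewrite -(clamp_id hs); exact: bal_clamp.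
have -> : E (s *: y) 0 i = (s *: y) 0 i + Q i (s *: y) by rewrite /Q addrC subrK.
rewrite Q_eq// !mxE; congr (_ + _); rewrite mulr_sumr; apply: eq_bigr => j _.
have e : \sum_k h i j k (s *: y) * (s *: y) 0 k =
         s * \sum_k h i j k (clamp s *: y) * y 0 k.
  rewrite mulr_sumr; apply: eq_bigr => q _; rewrite clamp_id// mxE; ring.
by rewrite e !mxE; ring.
Qed.

(** The Jacobian bound for [flow_field]; n + 1 instead of n keeps it positive in dimension 0. *)
Definition lin_a : R := (2 * n.+1%:R)^-1.

Lemma lin_a_gt0 : 0 < lin_a.
Proof. by rewrite invr_gt0 mulr_gt0// ltr0Sn. Qed.

Lemma lin_a_le : n%:R * lin_a <= 2^-1.
Proof.
rewrite /lin_a invfM mulrCA ler_piMr ?invr_ge0//.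
by rewrite ler_pdivrMr ?ltr0Sn// mul1r ler_nat.
Qed.

(** The Jacobian of [G s] vanishes at 0 for every time, so by [jc_near] it is small on one ball for
    all times in [0,1]; [G_clamp] covers the others. *)
Lemma small_radius : exists rho, [/\ 0 < rho, rho <= rho0 & forall s y i j,
  bal rho y -> `|'D_(delta_mx 0 j) (fun y => G s y 0 i) y| <= lin_a].
Proof.
have b0 : bal rho0 (0 : V) by exact: bal0.
have H (ij : 'I_n * 'I_n) : \forall y \near (0 : V), forall t : R, 0 <= t <= 1 ->
    `|'D_(delta_mx 0 ij.2) (fun y => G t y 0 ij.1) y| <= lin_a.
  have [_ _ /(_ ij.2) hd] := (ckSP _ _ _).1 (G_ck 1 ij.1).
  have := jc_near lin_a_gt0 (ck_jc hd) b0.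
  apply: filterS => y hy t /hy; by rewrite dG0 subr0.
have /nbhs_normP[e /= e0 he] := filter_forall (nbhs_filter _) H.
exists (Num.min e rho0); split.
- by rewrite lt_min e0.
- by rewrite ge_min lexx orbT.
move=> s y i j; rewrite /bal /= lt_min => /andP[ye _].
rewrite -G_clamp; apply: (he y _ (i, j)); last exact: clamp01.
by rewrite /= sub0r normrN.
Qed.

Lemma linearize_aux : exists (r : R) (psi z : V -> V),
  [/\ 0 < r /\ r <= rho0, smoothv (bal r) psi, smoothv (bal r) z,
      [/\ forall v, bal r v -> bal rho0 (psi v),
          forall v, bal r v -> bal r (psi v) -> z (psi v) = v,
          forall x, bal r x -> bal r (z x) -> psi (z x) = x,
          psi 0 = 0 & z 0 = 0] &
      (forall i j, 'D_(delta_mx 0 j) (fun v => psi v 0 i) 0 = (i == j)%:R) /\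
      (forall v i, bal r v ->
        \sum_j v 0 j * 'D_(delta_mx 0 j) (fun v => psi v 0 i) v = E (psi v) 0 i)].
Proof.
have [rho [rho_gt0 rr hd]] := small_radius.
(* The flow is controlled for initial values of norm less than kappa / 2. *)
pose kappa := rho / 2; pose r := kappa / 2.
have k0 : 0 < kappa by rewrite divr_gt0.
have kr : kappa < rho by rewrite /kappa ltr_pdivrMr// ltr_pMr// ltr1n.
have rk : r < kappa by rewrite /r ltr_pdivrMr// ltr_pMr// ltr1n.
have r_gt0 : 0 < r by rewrite divr_gt0.
have sub : bal rho `<=` (bal rho0 : set V) by move=> y; rewrite /bal /= => /lt_le_trans; apply.
have hG : flow_field rho kappa lin_a G.
  split=> //.
  - exact: lin_a_le.
  - by move=> k i; apply: ck_sub_dom sub (G_ck k i).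
  - exact: G_0.
pose Gm (s : R) (y : V) : V := - G (1 - s) y.
have hGm : flow_field rho kappa lin_a Gm.
  have ck1 k i : ck k (bal rho) (fun s y => G (1 - s) y 0 i).
    apply: (@ck_comp R n n k (bal rho) (bal rho) (fun s => 1 - s) (fun _ y => y)
      (fun s y => G s y 0 i)) => //.
    - exact: open_bal.
    - exact: open_bal.
    - by move=> t; apply: cvgB; [exact: cvg_cst|exact: cvg_id].
    - by move=> j; apply: ck_coord; exact: open_bal.
    - by apply: ck_sub_dom sub (G_ck k i).
  split=> //.
  - exact: lin_a_le.
  - move=> k i; apply: ck_ext (ck_opp (open_bal rho) (ck1 k i)); first exact: open_bal.
    by move=> s y _; rewrite !mxE.
  - move=> s y i j hy.
    have -> : (fun y => Gm s y 0 i) = - (fun y => G (1 - s) y 0 i).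
      by apply/funext => y'; rewrite /Gm [LHS]mxE.
    rewrite deriveN ?normrN; first exact: hd.
    apply: diff_derivable; have [_ hdf _] := (ckSP _ _ _).1 (ck1 1 i).
    exact: (hdf s).
  - by move=> s; rewrite /Gm G_0 oppr0.
pose Y := flow G; pose Ym := flow Gm.
have [Y1 Y2 Y3] := flow_spec hG; have [M1 M2 M3] := flow_spec hGm.
rewrite -/Y in Y3.
have oB := @open_bal R n r.
have rho_k (y : V) : `|y| <= kappa -> bal rho y by move=> hy; rewrite /bal /= (le_lt_trans hy).
have crev : continuous (fun s : R => clamp (1 - clamp s)).
  move=> s; apply: (continuous_comp (f := fun s : R => 1 - clamp s)); last exact: continuous_clamp.
  by apply: cvgB; [exact: cvg_cst|exact: continuous_clamp].
(* running the flow backwards *)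
have rev (K K' : R -> V -> V) : flow_field rho kappa lin_a K -> flow_field rho kappa lin_a K' ->
    (forall s y, 0 <= s <= 1 -> K' s y = - K (1 - s) y) ->
    forall v, bal r v -> bal r (flow K 1 v) -> flow K' 1 (flow K 1 v) = v.
  move=> hK hK' KK' v bv bv1.
  have [K1 K2 K3] := flow_spec hK; have [K1' K2' K3'] := flow_spec hK'.
  have cK j : continuous (fun t => flow K t v 0 j) by exact: (jcv_sl K1 bv).
  have cKK j : continuous (fun t => K t (flow K t v) 0 j).
    by apply: (continuous_G hK) => // t; apply: rho_k; exact: K2.
  have cu j : continuous (fun s => flow K (clamp (1 - clamp s)) v 0 j).
    exact: (continuous_compR crev (cK j)).
  have := @flow_unique R n rho kappa lin_a K' hK' (fun s => flow K (clamp (1 - clamp s)) v)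
    (fun s => flow K' s (flow K 1 v)) (flow K 1 v) cu.
  move=> /(_ _ _ _ _ _ 1) <-.
  - by rewrite clamp1 subrr clamp0 (flow0 hK).
  - by move=> s; exact: K2.
  - move=> s; rewrite (K3 (clamp (1 - clamp s)) v bv) [in RHS](K3 1 v bv) -addrA; congr (_ + _).
    rewrite ipv_clamp; apply/rowP => j; rewrite [RHS]mxE !ipvE.
    have cKr : continuous (fun t : R => K (1 - t) (flow K (1 - t) v) 0 j).
      have c1 : continuous (fun t : R => 1 - t) by move=> t; apply: cvgB; [exact: cvg_cst|exact: cvg_id].
      exact: (continuous_compR c1 (cKK j)).
    have -> : ip (fun t => K' t (flow K (clamp (1 - clamp t)) v) 0 j) s =
              - ip (fun t => K (1 - t) (flow K (1 - t) v) 0 j) s.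
      rewrite -mulN1r -ip_scale//; apply: eq_ip.
      + by apply: (continuous_G hK') => // t; apply: rho_k; exact: K2.
      + by apply: continuous_mulR => // t; exact: cvg_cst.
      + move=> t ht; have ht' : 0 <= 1 - t <= 1 by lra.
        by rewrite KK'// !clamp_id// mxE mulN1r.
    rewrite -(ip_clamp _ s) (@ip_rev _ (fun t => K t (flow K t v) 0 j))//; last exact: clamp01.
    by rewrite opprB addrC subrK.
  - by move=> j; exact: (jcv_sl K1' bv1).
  - by move=> s; exact: K2'.
  - by move=> s; exact: K3'.
(* By [G_hom] and [ip_dilate] the curve c Y_{cs}(v) is a solution with initial value c v, and
   solutions are unique. This is what turns the flow in time into the radial derivative of [Y 1]. *)
have psi_hom (c : R) v : 0 <= c <= 1 -> bal r v -> Y 1 (c *: v) = c *: Y c v.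
  move=> hc bv.
  have bcv : bal r (c *: v) by rewrite -(clamp_id hc); exact: bal_clamp.
  have cl : continuous (fun s : R => clamp (c * clamp s)).
    move=> s; apply: (continuous_comp (f := fun s : R => c * clamp s)); last exact: continuous_clamp.
    by apply: cvgM; [exact: cvg_cst|exact: continuous_clamp].
  have cY j : continuous (fun t => Y t v 0 j) by exact: (jcv_sl Y1 bv).
  have cY' j : continuous (fun s => (c *: Y (clamp (c * clamp s)) v) 0 j).
    have -> : (fun s => (c *: Y (clamp (c * clamp s)) v) 0 j) =
              (fun s => c * Y (clamp (c * clamp s)) v 0 j) by apply/funext => s; rewrite mxE.
    apply: continuous_mulR => s; first exact: cvg_cst.
    exact: (continuous_compR cl (cY j)).
  have cYb s : `|c *: Y (clamp (c * clamp s)) v| <= kappa.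
    case/andP: hc => c0 c1; rewrite normrZ ger0_norm//.
    by apply: le_trans (Y2 (clamp (c * clamp s)) v bv); rewrite ler_piMl.
  have := @flow_unique R n rho kappa lin_a G hG (fun s => c *: Y (clamp (c * clamp s)) v)
    (fun s => Y s (c *: v)) (c *: v) cY'.
  move=> /(_ _ _ _ _ _ 1) <-.
  - by rewrite clamp1 mulr1 clamp_id.
  - exact: cYb.
  - move=> s; rewrite (Y3 (clamp (c * clamp s)) v bv) scalerDr ipv_clamp; congr (_ + _).
    apply/rowP => j; rewrite [LHS]mxE !ipvE.
    have cG : continuous (fun t => G t (Y t v) 0 j).
      by apply: (continuous_G hG) => // t; apply: rho_k; exact: Y2.
    rewrite -[in RHS]ip_clamp -(ip_dilate cG hc (clamp01 s)) -ip_scale; last first.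
      apply: continuous_mulR => t; first exact: cvg_cst.
      have c1 : continuous (fun t : R => c * t).
        by move=> t'; apply: cvgM; [exact: cvg_cst|exact: cvg_id].
      exact: (continuous_compR c1 cG).
    apply: eq_ip.
    + apply: continuous_mulR => [t|]; first exact: cvg_cst.
      apply: continuous_mulR => [t|t]; first exact: cvg_cst.
      have c1 : continuous (fun t : R => c * t).
        by move=> t'; apply: cvgM; [exact: cvg_cst|exact: cvg_id].
      exact: (continuous_compR c1 cG).
    + by apply: (continuous_G hG) => // t; exact: rho_k.
    + move=> t ht; have hct : 0 <= c * t <= 1.
        by case/andP: hc => c0 c1; case/andP: ht => t0 t1; rewrite mulr_ge0// mulr_ile1.
      by rewrite (clamp_id ht) (clamp_id hct) (G_hom _ hc ht) [RHS]mxE expr2 mulrA.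
  - by move=> j; exact: (jcv_sl Y1 bcv).
  - by move=> s; exact: Y2.
  - by move=> s; exact: Y3.
have sY : smoothv (bal r) (Y 1) by move=> i k; exact: (ck_fix 1 oB (flow_smooth hG k i)).
exists r, (Y 1), (Ym 1); split.
- by split=> //; apply: le_trans rr; apply: ltW; apply: lt_trans kr.
- exact: sY.
- by move=> i k; exact: (ck_fix 1 oB (flow_smooth hGm k i)).
- split.
  + by move=> v bv; apply: sub; apply: rho_k; exact: Y2.
  + exact: (rev G Gm hG hGm (fun s y _ => erefl)).
  + apply: (rev Gm G hGm hG) => s y hs.
    have e : 1 - (1 - s) = s by ring.
    by rewrite /Gm opprK e.
  + exact: flow_fix0 hG 1.
  + exact: flow_fix0 hGm 1.
split; first by move=> i j; apply: (flow_der0 hG); exact: dG0.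
move=> v i bv.
(* differentiate [psi (c u) = c Y c u] in [c], with [v = c u] and [c < 1] *)
have [c [c0 c1 bu]] : exists c : R, [/\ 0 < c, c < 1 & bal r (c^-1 *: v)].
  (* The midpoint of |v| / r and 1: below 1, where the flow is differentiable in the time, and large
     enough for c^-1 v to stay in the ball. *)
  pose c := (1 + `|v| / r) / 2.
  have vr : `|v| / r < 1 by rewrite ltr_pdivrMr// mul1r.
  have vr0 : 0 <= `|v| / r by rewrite divr_ge0// ltW.
  exists c; split; [by rewrite /c; lra|by rewrite /c; lra|].
  have c0 : 0 < c by rewrite /c; lra.
  rewrite /bal /= normrZ normfV (gtr0_norm c0) mulrC ltr_pdivrMr//.
  have -> : `|v| = `|v| / r * r by rewrite divfK// gt_eqF.
  by rewrite [r * c]mulrC ltr_pM2r// /c; lra.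
pose u := c^-1 *: v.
have vE : v = c *: u by rewrite /u scalerA divff ?scale1r// gt_eqF.
have d1 : is_derive c 1 (fun t : R => Y 1 (0 + t *: u) 0 i)
   (\sum_j u 0 j * 'D_(delta_mx 0 j) (fun v => Y 1 v 0 i) (0 + c *: u)).
  apply: (@is_derive_line R n (fun v => Y 1 v 0 i)).
  by apply: smooth_diff (sY i) _; rewrite add0r -vE.
have hc : 0 < c < 1 by rewrite c0.
have d2 : is_derive c 1 (fun t : R => t * Y t u 0 i) (c * G c (Y c u) 0 i + Y c u 0 i * 1).
  have H := is_deriveM (f := id) (g := fun t => Y t u 0 i) (is_derive_id c 1) (is_derive_flow hG i bu hc).
  exact: H.
have d3 : is_derive c 1 (fun t : R => Y 1 (0 + t *: u) 0 i) (c * G c (Y c u) 0 i + Y c u 0 i * 1).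
  apply: near_eq_is_derive d2; near=> t.
  rewrite add0r psi_hom//; first by rewrite [RHS]mxE.
  by apply/andP; split; apply: ltW; near: t; [exact: lt_nbhsr|exact: lt_nbhsl].
have e1 : \sum_j u 0 j * 'D_(delta_mx 0 j) (fun v => Y 1 v 0 i) (0 + c *: u)
    = c * G c (Y c u) 0 i + Y c u 0 i * 1.
  by case: d1 => _ <-; case: d3 => _ <-.
have hc' : 0 <= c <= 1 by rewrite !ltW.
transitivity (c * (c * G c (Y c u) 0 i + Y c u 0 i * 1)).
  rewrite -e1 mulr_sumr; apply: eq_bigr => j _.
  by rewrite add0r -vE mulrA; congr (_ * _); rewrite vE mxE.
have -> : Y 1 v = c *: Y c u by rewrite vE psi_hom.
by rewrite -G_E//; [ring|apply: sub; apply: rho_k; exact: Y2].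
Unshelve. all: by end_near. Qed.

End G.
End Linearize.

Lemma ip_subc (R : realType) (f : R -> R) c : continuous f ->
  ip (fun t => f t - c) 1 = ip f 1 - c.
Proof.
move=> cf; rewrite (ip_sub 1 cf (fun u => cvg_cst _)); congr (_ - _).
by rewrite ip_cst clamp1 mulr1.
Qed.

(** * Smooth functions on open subsets of [R^n] *)

Section SmoothClosure.
Context {R : realType} {n : nat} (W : set 'rV[R]_n).
Hypothesis oW : open W.
Local Notation V := 'rV[R]_n.
Implicit Types f g : V -> R.

Lemma smooth_ext f g : (forall x, W x -> f x = g x) -> smooth W f -> smooth W g.
Proof. by move=> e h k; apply: ck_ext (h k) => // s x /e. Qed.

Lemma smooth_cst a : smooth W (fun=> a).
Proof. by move=> k; exact: ck_cstR. Qed.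

Lemma smooth_coord j : smooth W (fun x => x 0 j).
Proof. by move=> k; exact: ck_coord. Qed.

Lemma smooth_add f g : smooth W f -> smooth W g -> smooth W (fun x => f x + g x).
Proof. by move=> hf hg k; exact: ck_add. Qed.

Lemma smooth_sub f g : smooth W f -> smooth W g -> smooth W (fun x => f x - g x).
Proof. by move=> hf hg k; exact: ck_sub. Qed.

Lemma smooth_opp f : smooth W f -> smooth W (fun x => - f x).
Proof. by move=> hf k; exact: ck_opp. Qed.

Lemma smooth_mul f g : smooth W f -> smooth W g -> smooth W (fun x => f x * g x).
Proof. by move=> hf hg k; exact: ck_mul. Qed.

Lemma smooth_inv f : (forall x, W x -> f x != 0) -> smooth W f -> smooth W (fun x => (f x)^-1).
Proof. by move=> h hf k; apply: ck_inv => // s x; exact: h. Qed.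

Lemma smooth_sum (I : Type) (r : seq I) (P : pred I) (f : I -> V -> R) :
  (forall i, P i -> smooth W (f i)) -> smooth W (fun x => \sum_(i <- r | P i) f i x).
Proof. by move=> h k; apply: ck_sum => // i /h. Qed.

Lemma smooth_prod (I : Type) (r : seq I) (P : pred I) (f : I -> V -> R) :
  (forall i, P i -> smooth W (f i)) -> smooth W (fun x => \prod_(i <- r | P i) f i x).
Proof. by move=> h k; apply: ck_prod => // i /h. Qed.

Lemma smooth_comp m (W' : set 'rV[R]_m) (F : V -> 'rV[R]_m) (g : 'rV[R]_m -> R) :
  open W' -> (forall x, W x -> W' (F x)) -> smoothv W F -> smooth W' g ->
  smooth W (fun x => g (F x)).
Proof.
move=> oW' WW' hF hg k.
apply: (@ck_comp R n m k W W' (fun=> 0) (fun _ => F) (fun _ => g)) => //.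
- by move=> t; exact: cvg_cst.
- by move=> j; exact: hF.
Qed.

Lemma smooth_det m (A : V -> 'M[R]_m) : (forall i j, smooth W (fun x => A x i j)) ->
  smooth W (fun x => \det (A x)).
Proof.
move=> hA; apply: smooth_sum => s _; apply: smooth_mul; first exact: smooth_cst.
by apply: smooth_prod => i _; exact: hA.
Qed.

Lemma smooth_invmx m (A : V -> 'M[R]_m) : (forall i j, smooth W (fun x => A x i j)) ->
  (forall x, W x -> A x \in unitmx) ->
  forall i j, smooth W (fun x => invmx (A x) i j).
Proof.
move=> hA uA i j.
have H : smooth W (fun x => (\det (A x))^-1 * ((-1) ^+ (j + i) * \det (row' j (col' i (A x))))).
  apply: smooth_mul.
    by apply: smooth_inv => [x /uA|]; [rewrite unitmxE unitfE|exact: smooth_det].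
  apply: smooth_mul; first exact: smooth_cst.
  apply: smooth_det => k l; apply: (smooth_ext _ (hA (lift j k) (lift i l))) => x _.
  by rewrite !mxE.
apply: (smooth_ext _ H) => x Wx.
by rewrite /invmx uA// !mxE.
Qed.

End SmoothClosure.

Lemma smooth_subset (R : realType) n (W W' : set 'rV[R]_n) f :
  W' `<=` W -> smooth W f -> smooth W' f.
Proof. by move=> h hf k; exact: ck_sub_dom h (hf k). Qed.

Lemma derive_coord (R : realType) n (i j : 'I_n) (x : 'rV[R]_n) :
  'D_(delta_mx 0 i) (fun y : 'rV[R]_n => y 0 j) x = (j == i)%:R.
Proof.
have d := differentiable_coord x 0 j.
rewrite deriveE//.
pose g (h : 'rV[R]_n) : R := h 0 j.
have glin : linear g by move=> c u w; rewrite /g /GRing.scale/= !mxE.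
pose glM := GRing.isLinear.Build _ _ _ _ _ glin.
pose gL : {linear 'rV[R]_n -> R} := HB.pack g glM.
rewrite -[fun x : 'rV[R]_n => x 0 j]/(gL : _ -> _) diff_lin; last exact: coord_continuous.
by rewrite /= /g mxE eqxx.
Qed.

Lemma derive_shiftv (R : realType) (V W : normedModType R) (f : V -> W) x a v :
  'D_v (fun y => f (y + a)) x = 'D_v f (x + a).
Proof.
have e : (fun h : R => h^-1 *: (((fun y => f (y + a)) \o shift x) (h *: v) - f (x + a))) =
         (fun h => h^-1 *: ((f \o shift (x + a)) (h *: v) - f (x + a))).
  by apply/funext => h /=; rewrite addrA.
by rewrite /derive e.
Qed.

Lemma derivable_shiftv (R : realType) (V W : normedModType R) (f : V -> W) x a v :
  derivable f (x + a) v -> derivable (fun y => f (y + a)) x v.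
Proof.
have e : (fun h : R => h^-1 *: (((fun y => f (y + a)) \o shift x) (h *: v) - f (x + a))) =
         (fun h => h^-1 *: ((f \o shift (x + a)) (h *: v) - f (x + a))).
  by apply/funext => h /=; rewrite addrA.
by rewrite /derivable e.
Qed.

(** * Symmetry of second derivatives *)

Section Schwarz.
Context {R : realType} {n : nat}.
Local Notation V := 'rV[R]_n.

Definition tbal (x : V) r : set V := [set y | bal r (y - x)].

Lemma open_tbal x r : open (tbal x r).
Proof.
apply: (open_comp (f := fun y : V => y - x)); last exact: open_bal.
move=> y _; have h : z @[z --> (y : V)] --> y by apply: cvg_id.
exact: cvgB h (cvg_cst _).
Qed.

Lemma cvx_tbal x r : cvx (tbal x r).
Proof.
move=> y y' u hy hy' hu; rewrite /tbal /=.
have -> : y + u *: (y' - y) - x = (y - x) + u *: ((y' - x) - (y - x)).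
  by rewrite opprB addrA subrK addrAC.
exact: cvx_bal.
Qed.

Lemma open_tbalP (W : set V) x : open W -> W x -> exists2 r, 0 < r & tbal x r `<=` W.
Proof.
move=> oW Wx; have /nbhs_normP[e /= e0 he] := open_nbhs_nbhs (conj oW Wx).
exists e => // y hy; apply: he; rewrite /= distrC; exact: hy.
Qed.

(* [f(y + t e_i) - f(y)] is an integral of [D_i f]; differentiate in direction [j],
   then in [t]. *)
Lemma schwarz (W : set V) (f : V -> R) x i j : open W -> smooth W f -> W x ->
  'D_(delta_mx 0 i) ('D_(delta_mx 0 j) f) x = 'D_(delta_mx 0 j) ('D_(delta_mx 0 i) f) x.
Proof.
move=> oW sf Wx.
have [r r0 rW] := open_tbalP oW Wx.
pose e : V := delta_mx 0 i.
have ne : `|e| <= 1.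
  apply: norm_rV_le => // k; rewrite /e mxE eqxx/=; case: eqP => _; by rewrite ?normr1 ?normr0.
(* Half of the radius is for the base point, the other half for the displacement t e. *)
pose B := tbal x (r / 2).
have r2 : 0 < r / 2 by rewrite divr_gt0.
have oB : open B by exact: open_tbal.
have cB : cvx B by exact: cvx_tbal.
have Bx : B x by rewrite /B /tbal /= subrr; exact: bal0.
have BW y (t : R) : B y -> `|t| < r / 2 -> W (y + t *: e).
  rewrite /B /tbal /bal /= => hy ht; apply: rW; rewrite /tbal /bal /= addrAC.
  apply: (le_lt_trans (ler_normD _ _)); rewrite [r]splitr ltrD//.
  by rewrite normrZ (le_lt_trans _ ht)// ler_piMr.
have BW0 y : B y -> W y.
  by move=> hy; rewrite -[y]addr0 -(scale0r e); apply: BW => //; rewrite normr0.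
have clt (t : R) u : `|t| < r / 2 -> `|clamp u * t| < r / 2.
  by move=> ht; rewrite normrM (le_lt_trans _ ht)// ler_piMl// ger0_norm ?clamp_ge0 ?clamp_le1.
pose F t (u : R) (y : V) := 'D_e f (y + (clamp u * t) *: e).
have kF t k : `|t| < r / 2 -> ck k B (F t).
  move=> ht.
  apply: (@ck_comp R n n k B W (fun=> 0) (fun u y => y + (clamp u * t) *: e) (fun _ => 'D_e f)) => //.
  - by move=> u; exact: cvg_cst.
  - by move=> u y hy; apply: BW => //; exact: clt.
  - move=> l; have hc : ck k B (fun u (_ : V) => clamp u * (t * e 0 l)).
      apply: ck_t => //; apply: continuous_mulR => [|u]; first exact: continuous_clamp.
      exact: cvg_cst.
    by apply: ck_ext (ck_add oB (ck_coord oB k l) hc) => // s y _; rewrite !mxE mulrA.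
  - exact: (smooth_der i sf k).
have eqF t y : `|t| < r / 2 -> B y -> f (y + t *: e) - f y = t * ip (fun u => F t u y) 1.
  move=> ht hy.
  have cF : continuous (fun u => F t u y) by exact: (jc_sl (ck_jc (kF t 0 ht))).
  rewrite -ip_scale// -[X in _ - f X]addr0 -(scale0r e).
  have -> : y + t *: e = y + (1 * t) *: e by rewrite mul1r.
  have -> : y + 0 *: e = y + (0 * t) *: e by rewrite mul0r.
  have dl (u : R) : 0 <= u <= 1 -> is_derive u 1 (fun u : R => f (y + (u * t) *: e)) (t * F t u y).
    move=> hu.
    have d : differentiable f (y + u *: (t *: e)).
      apply: smooth_diff sf _; rewrite scalerA; apply: BW => //; rewrite -(clamp_id hu); exact: clt.
    have := is_derive_line d.
    under [X in is_derive _ _ X _ -> _]eq_fun do rewrite scalerA.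
    have -> // : \sum_k (t *: e) 0 k * 'D_(delta_mx 0 k) f (y + u *: (t *: e)) = t * F t u y.
    rewrite -diff_coordE// linearZ/= /F -deriveE ?scalerA ?clamp_id//.
    by rewrite -scalerA.
  apply: (@ip_FTC R _ (fun u => f (y + (u * t) *: e))).
  - by apply: continuous_mulR => // u; exact: cvg_cst.
  - by move=> u /andP[u0 u1]; apply: dl; rewrite !ltW.
  - apply: continuous_in_subspaceT => u; rewrite inE/= in_itv/= => hu.
    by apply/differentiable_continuous/derivable1_diffP; case: (dl u hu).
  - by rewrite ler01 lexx.
pose g := 'D_(delta_mx 0 j) f.
have sg : smooth W g by exact: smooth_der.
have eqg t : `|t| < r / 2 -> g (x + t *: e) - g x = t * ip (fun u => 'D_(delta_mx 0 j) (F t u) x) 1.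
  move=> ht.
  have [hd hD] := ip_diff 1 oB cB (kF t 1 ht) Bx.
  rewrite -hD.
  have L : 'D_(delta_mx 0 j) (fun y => f (y + t *: e) - f y) x = t * 'D_(delta_mx 0 j) (fun y => ip (fun u => F t u y) 1) x.
    transitivity ('D_(delta_mx 0 j) (fun y => t * ip (fun u => F t u y) 1) x).
      apply: near_eq_derive; apply: (near_open oB Bx) => y hy; exact: eqF.
    by rewrite (deriveZ t (diff_derivable hd)).
  rewrite -L.
  have d1 : differentiable f x by exact: smooth_diff sf _.
  have d2 : differentiable f (x + t *: e) by apply: smooth_diff sf _; exact: BW.
  have -> : (fun y => f (y + t *: e) - f y) = (fun y => f (y + t *: e)) - f by [].
  rewrite deriveB; [by rewrite derive_shiftv| |exact: diff_derivable].
  exact: (derivable_shiftv (diff_derivable d2)).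
have dF t u : `|t| < r / 2 -> 'D_(delta_mx 0 j) (F t u) x = 'D_(delta_mx 0 j) ('D_e f) (x + (clamp u * t) *: e).
  by move=> _; exact: derive_shiftv.
(* the difference quotients of [g] along [e] converge to both sides *)
have sgx : smooth W ('D_(delta_mx 0 j) ('D_e f)) by apply: smooth_der; exact: smooth_der.
have lim1 : t^-1 *: (g (t *: e + x) - g x) @[t --> 0^'] --> 'D_e g x.
  by have := diff_derivable (v := e) (smooth_diff sg Wx); exact.
have lim2 : t^-1 *: (g (t *: e + x) - g x) @[t --> 0^'] --> 'D_(delta_mx 0 j) ('D_e f) x.
  apply/cvgrPdist_le => eps eps0.
  have /cvgrPdist_le/(_ _ eps0)/near_translate/nbhs_normP[d /= d0 hd] := smooth_cont sgx Wx.
  near=> t.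
  have t0 : t != 0 by near: t; exact: nbhs_dnbhs_neq.
  have tr : `|t| < r / 2 by near: t; exact: dnbhs0_lt.
  have td : `|t| < d by near: t; exact: dnbhs0_lt.
  rewrite addrC [t *: e + x]addrC eqg// /GRing.scale/= mulKf//.
  rewrite addrC -opprB normrN.
  have cc : continuous (fun u => 'D_(delta_mx 0 j) (F t u) x).
    by have [_ _ /(_ j) h] := (ckSP _ _ _).1 (kF t 1 tr); exact: (jc_sl (ck_jc h)).
  have -> : ip (fun u => 'D_(delta_mx 0 j) (F t u) x) 1 - 'D_(delta_mx 0 j) ('D_e f) x =
     ip (fun u => 'D_(delta_mx 0 j) (F t u) x - 'D_(delta_mx 0 j) ('D_e f) x) 1.
    by rewrite ip_subc.
  apply: norm_ip.
    by apply: continuous_addR => // u; exact: cvg_cst.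
  move=> u _; rewrite (dF t u tr) distrC.
  have := hd ((clamp u * t) *: e); rewrite [_ *: e + x]addrC; apply.
  rewrite /= sub0r normrN normrZ (le_lt_trans _ td)//.
  apply: (@le_trans _ _ `|clamp u * t|); first by rewrite ler_piMr.
  by rewrite normrM ler_piMl// ger0_norm ?clamp_ge0 ?clamp_le1.
exact: (cvg_unique _ lim1 lim2).
Unshelve. all: by end_near. Qed.

End Schwarz.

(** * Composition with functions of one variable, and bump functions *)

Section Chain1.
Context {R : realType} {n : nat}.
Local Notation V := 'rV[R]_n.

Lemma is_derive_chain1 (f : V -> R) (g : R -> R) (dg : R) x v :
  differentiable f x -> is_derive (f x) 1 g dg ->
  differentiable (fun y => g (f y)) x /\ 'D_v (fun y => g (f y)) x = dg * 'D_v f x.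
Proof.
move=> df hg; have d1 : differentiable g (f x) by apply/derivable1_diffP; case: hg.
have d2 : differentiable (g \o f) x by exact: differentiable_comp.
split=> //; rewrite -[fun y => _]/(g \o f) deriveE// diff_comp//= -(deriveE _ df).
have -> : 'd g (f x) ('D_v f x) = 'd g (f x) ('D_v f x *: (1 : R)).
  by rewrite /GRing.scale/= mulr1.
by rewrite linearZ/= -deriveE// derive_val /GRing.scale/= mulrC.
Qed.

(** The induction on the order runs over a whole family closed under derivation, because the chain
    rule replaces a function by its derivative. The families used are the exponential alone, the
    combinations of sine and cosine, and the functions [bumpf p]. *)
Lemma smooth_1d (Gs : set (R -> R)) (W : set V) f : open W ->
  (forall g, Gs g -> exists2 g', Gs g' & forall x : R, is_derive x 1 g (g' x)) ->
  smooth W f -> forall g, Gs g -> smooth W (fun x => g (f x)).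
Proof.
move=> oW hG sf g Gg k; elim: k g Gg => [|k IH] g Gg.
  split=> //; apply: jc_x => x Wx; have [g' _ hg] := hG g Gg.
  have [h _] := is_derive_chain1 0 (smooth_diff sf Wx) (hg (f x)).
  exact: differentiable_continuous.
have [g' Gg' hg] := hG g Gg.
have H (x v : V) (Wx : W x) := is_derive_chain1 v (smooth_diff sf Wx) (hg (f x)).
apply/ckSP; split.
- by apply: jc_x => x Wx; exact: (differentiable_continuous (H x 0 Wx).1).
- by move=> _ x Wx; exact: (H x 0 Wx).1.
- move=> i; apply: (ck_ext oW _ (ck_mul oW (IH _ Gg') (smooth_der i sf k))) => s x Wx.
  by rewrite (H x _ Wx).2.
Qed.

Lemma smooth_expR (W : set V) f : open W -> smooth W f -> smooth W (fun x => expR (f x)).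
Proof.
move=> oW sf; apply: (@smooth_1d [set expR] W f oW _ sf) => // g ->.
by exists expR => // x; exact: is_derive_expR.
Qed.

Lemma smooth_trig (W : set V) f : open W -> smooth W f ->
  smooth W (fun x => cos (f x)) /\ smooth W (fun x => sin (f x)).
Proof.
move=> oW sf.
pose Gs : set (R -> R) := [set g | exists a b, g = (fun x => a * cos x + b * sin x)].
have H g : Gs g -> exists2 g', Gs g' & forall x : R, is_derive x 1 g (g' x).
  move=> [a [b ->]]; exists (fun x => b * cos x + (- a) * sin x); first by exists b, (- a).
  move=> x.
  have h1 := is_deriveZ a (is_derive_cos x).
  have h2 := is_deriveZ b (is_derive_sin x).
  have := is_deriveD h1 h2; rewrite /GRing.scale/=.
  by have -> // : a * - sin x + b * cos x = b * cos x + - a * sin x by ring.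
have S := smooth_1d oW H sf.
split; [apply: (smooth_ext oW _ (S _ (ex_intro _ 1 (ex_intro _ 0 erefl))))
       |apply: (smooth_ext oW _ (S _ (ex_intro _ 0 (ex_intro _ 1 erefl))))] => x _ /=.
  by rewrite mul1r mul0r addr0.
by rewrite mul1r mul0r add0r.
Qed.

End Chain1.

Section Bump.
Context {R : realType}.
Implicit Types p : {poly R}.

(** The polynomial factor makes the family closed under derivation, as [smooth_1d] requires. *)
Definition bumpf p (x : R) : R := if 0 < x then p.[x^-1] * expR (- x^-1) else 0.

(** exp(1/x) is at least x^-(i+1) / (i+1)!, so x^-i exp(-1/x) is at most (i+1)! x. *)
Lemma bumpf_bound p : exists2 C, 0 <= C & forall x, `|bumpf p x| <= C * `|x|.
Proof.
exists (\sum_(i < size p) `|p`_i| * (i.+1`!%:R)).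
  by apply: sumr_ge0 => i _; rewrite mulr_ge0.
move=> x; rewrite /bumpf; case: ifPn => x0; last first.
  rewrite normr0 mulr_ge0//; apply: sumr_ge0 => i _; by rewrite mulr_ge0.
have e0 := expR_gt0 (x^-1).
rewrite horner_coef mulr_suml mulr_suml (gtr0_norm x0).
apply: le_trans (ler_norm_sum _ _ _) _; apply: ler_sum => i _.
rewrite !normrM normrX (gtr0_norm (expR_gt0 _)) -!mulrA ler_wpM2l//.
rewrite gtr0_norm ?invr_gt0// expRN ler_pdivrMr//.
have := expR_ge1Dxn (x := x^-1) i; rewrite invr_ge0 => /(_ (ltW x0)) h.
have {}h : x^-1 ^+ i.+1 / i.+1`!%:R <= expR x^-1 by apply: le_trans h; rewrite lerDr.
have f0 : 0 < i.+1`!%:R :> R by rewrite ltr0n fact_gt0.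
move: h; rewrite ler_pdivrMr// exprS ler_pdivrMl// => h.
by rewrite [_ * x]mulrC -mulrA [_%:R * _]mulrC.
Qed.

Lemma is_derive_bumpf p (x : R) :
  is_derive x 1 (bumpf p) (bumpf ('X^2 * (p - p^`())) x).
Proof.
have [x0|x0|->] := ltgtP x 0.
- rewrite {2}/bumpf ltNge (ltW x0)/=.
  apply: (near_eq_is_derive (f := cst 0)).
  near=> y; rewrite /bumpf ifF//; apply/negbTE; rewrite -leNgt ltW//.
  by near: y; exact: lt_nbhsl.
- have xn : x != 0 by rewrite gt_eqF.
  rewrite {2}/bumpf x0.
  have hp : is_derive x 1 (fun y : R => p.[y^-1]) (p^`().[x^-1] * - x ^- 2).
    apply: (@is_derive1_comp _ (fun y : R => p.[y]) (fun y : R => y^-1)).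
      exact: is_derive_poly.
    have := is_deriveV xn (is_derive_id x (1 : R)).
    by rewrite /GRing.scale/= mulr1.
  have he : is_derive x 1 (fun y : R => expR (- y^-1)) (expR (- x^-1) * x ^- 2).
    apply: (@is_derive1_comp _ expR (fun y : R => - y^-1)).
    have := is_deriveN (is_deriveV xn (is_derive_id x (1 : R))).
    by rewrite /GRing.scale/= mulr1 opprK.
  have := is_deriveM hp he; rewrite /GRing.scale/=.
  have -> : p.[x^-1] * (expR (- x^-1) * x ^- 2) + expR (- x^-1) * (p^`().[x^-1] * - x ^- 2) =
    ('X^2 * (p - p^`())).[x^-1] * expR (- x^-1).
    rewrite hornerM hornerXn hornerD hornerN exprVn.
    by move: (p.[_]) (p^`().[_]) (expR _) (x ^- 2) => a b c d; ring.
  apply: near_eq_is_derive.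
  near=> y; rewrite /bumpf ifT//=.
  by near: y; exact: lt_nbhsr.
- have b0 q : bumpf q 0 = 0 by rewrite /bumpf ltxx.
  rewrite b0.
  (* The difference quotient at 0 is itself a member of the family, with polynomial X p, and tends
     to 0 by the bound. *)
  have [C C0 hC] := bumpf_bound ('X * p).
  have L : h^-1 *: ((bumpf p \o shift 0) (h *: 1) - bumpf p 0) @[h --> (0 : R)^'] --> (0 : R).
    apply/cvgrPdist_le => e e0; near=> h.
    have h0 : h != 0 by near: h; exact: nbhs_dnbhs_neq.
    have -> : h^-1 *: ((bumpf p \o shift 0) (h *: 1) - bumpf p 0) = bumpf ('X * p) h.
      rewrite /= addr0 b0 subr0 /GRing.scale/= mulr1 /bumpf; case: ifP => _; last by rewrite mulr0.
      by rewrite hornerM hornerX mulrA.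
    rewrite sub0r normrN (le_trans (hC h))//.
    have hh : `|h| < e / (C + 1) by near: h; apply: dnbhs0_lt; rewrite divr_gt0// ltr_wpDl.
    have := ltW hh; rewrite ler_pdivlMr ?ltr_wpDl// => hh'.
    by apply: le_trans hh'; rewrite mulrC ler_wpM2l// lerDl.
  split; [by apply/cvg_ex; exists 0|exact: (cvg_lim _ L)].
Unshelve. all: by end_near. Qed.

End Bump.

Lemma smooth_bump (R : realType) n (W : set 'rV[R]_n) f : open W -> smooth W f ->
  smooth W (fun x => bumpf 1 (f x)).
Proof.
move=> oW sf; pose Gs : set (R -> R) := [set g | exists p, g = bumpf p].
apply: (@smooth_1d R n Gs W f oW _ sf); last by exists 1.
move=> _ [p ->]; exists (bumpf ('X^2 * (p - p^`()))); first by exists ('X^2 * (p - p^`())).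
exact: is_derive_bumpf.
Qed.

(** * Functions along rays *)

Section Ray.
Context {R : realType} {n : nat}.
Local Notation V := 'rV[R]_n.

Lemma ray_const (F : R -> R) (L : R) : (forall t : R, 0 < t <= 1 -> is_derive t 1 F 0) ->
  F t @[t --> 0^'+] --> L -> F 1 = L.
Proof.
move=> hF hL; suff h s : 0 < s <= 1 -> F s = F 1.
  suff hF1 : F t @[t --> 0^'+] --> F 1 by exact: (cvg_unique _ hF1 hL).
  apply: (@cvg_trans _ ((fun=> F 1) s @[s --> (0 : R)^'+])); last exact: cvg_cst.
  apply: near_eq_cvg; near=> s; apply/esym/h.
  apply/andP; split; first by near: s; exact: nbhs_right_gt.
  by near: s; exact: nbhs_right_le.
move=> /andP[s0]; rewrite le_eqVlt => /predU1P[->//|s1].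
have cF t : 0 < t <= 1 -> {for t, continuous F}.
  by move=> /hF[h _]; apply/differentiable_continuous/derivable1_diffP.
have [t|t'|t _] := @MVT R F (fun=> 0) s 1 s1.
- by rewrite in_itv/= => /andP[st t1]; apply: hF; rewrite (lt_trans s0 st) ltW.
- apply: continuous_in_subspaceT => {}t'; rewrite inE/= in_itv/= => /andP[st t1].
  by apply: cF; rewrite (lt_le_trans s0 st).
- by move/eqP; rewrite mul0r subr_eq0 => /eqP.
Unshelve. all: by end_near. Qed.

Lemma is_derive_ray (f : V -> R) v (t : R) : differentiable f (t *: v) ->
  is_derive t 1 (fun t : R => f (t *: v)) (\sum_j v 0 j * 'D_(delta_mx 0 j) f (t *: v)).
Proof.
move=> d; have := @is_derive_line R n f 0 v t; rewrite add0r => /(_ d).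
by under [X in is_derive _ _ X _ -> _]eq_fun do rewrite add0r.
Qed.

Lemma bal_ray r (v : V) (t : R) : bal r v -> 0 <= t <= 1 -> bal r (t *: v).
Proof.
move=> hv /andP[t0 t1]; rewrite /bal /= normrZ (le_lt_trans _ hv)// ler_piMl//.
by rewrite ger0_norm.
Qed.

(** By Euler's equation f(t v) / t is constant on (0,1]; by smoothness at the origin it tends to the
    differential at 0 applied to v. *)
Lemma euler_linear r (f : V -> R) : smooth (bal r) f ->
  (forall v, bal r v -> \sum_j v 0 j * 'D_(delta_mx 0 j) f v = f v) ->
  forall v, bal r v -> f v = \sum_j 'D_(delta_mx 0 j) f 0 * v 0 j.
Proof.
move=> sf hE v hv.
have r0 : 0 < r by apply: le_lt_trans hv.
have f0 : f 0 = 0.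
  by rewrite -hE ?big1// => [j _|]; [rewrite mxE mul0r|exact: bal0].
have hq (t : R) : 0 <= t <= 1 -> f (t *: v) = t * \sum_j had j f (t *: v) * v 0 j.
  move=> ht; rewrite (had_eq sf (bal_ray hv ht)) f0 add0r mulr_sumr.
  by apply: eq_bigr => j _; rewrite [in LHS]mxE mulrCA.
pose F (t : R) := t^-1 * f (t *: v).
have -> : f v = F 1 by rewrite /F invr1 mul1r scale1r.
apply: (@ray_const F) => [t ht|].
  have /andP[t0 t1] := ht; have tn : t != 0 by rewrite gt_eqF.
  have hb : bal r (t *: v) by apply: bal_ray => //; rewrite ltW.
  have := is_deriveM (is_deriveV tn (is_derive_id t (1 : R))) (is_derive_ray (smooth_diff sf hb)).
  rewrite /GRing.scale/= mulr1.
  have -> : \sum_j v 0 j * 'D_(delta_mx 0 j) f (t *: v) = t^-1 * f (t *: v).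
    rewrite -(hE _ hb) mulr_sumr; apply: eq_bigr => j _.
    by rewrite [in RHS]mxE mulrA mulrA mulVf// mul1r.
  by have -> // : t^-1 * (t^-1 * f (t *: v)) + f (t *: v) * - t ^- 2 = 0 by field.
apply: (@cvg_trans _ (\sum_j had j f (t *: v) * v 0 j @[t --> 0^'+])).
  apply: near_eq_cvg; near=> t.
  have t0 : 0 < t by near: t; exact: nbhs_right_gt.
  have t1 : t <= 1 by near: t; exact: nbhs_right_le.
  by rewrite /F hq ?ltW// mulrA mulVf ?mul1r// gt_eqF.
apply: cvg_sumR => j _; apply: cvgMl; rewrite -had0.
have c0 : had j f x @[x --> (0 : V)] --> had j f 0.
  by exact: (smooth_cont (smooth_had j r0 sf) (bal0 r0)).
have cz : (t *: v) @[t --> (0 : R)^'+] --> (0 : V).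
  apply: cvg_at_right_filter; rewrite -[X in _ --> X](scale0r v).
  by apply: cvgZr_tmp; exact: cvg_id.
exact: (cvg_comp _ _ cz c0).
Unshelve. all: by end_near. Qed.

End Ray.

(** * Diffeomorphisms and the inverse function theorem *)

Section Diffeo.
Context {R : realType} {n : nat}.
Local Notation V := 'rV[R]_n.

Record diffeo (O O' : set V) (f g : V -> V) : Prop := Diffeo {
  dif_o : open O; dif_o' : open O'; dif_s : smoothv O f; dif_s' : smoothv O' g;
  dif_f : forall x, O x -> O' (f x); dif_g : forall y, O' y -> O (g y);
  dif_gf : forall x, O x -> g (f x) = x; dif_fg : forall y, O' y -> f (g y) = y }.

Lemma diffeo_sym O O' f g : diffeo O O' f g -> diffeo O' O g f.
Proof. by case. Qed.

Lemma diffeo_comp O1 O2 O3 f g f' g' : diffeo O1 O2 f g -> diffeo O2 O3 f' g' ->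
  diffeo O1 O3 (f' \o f) (g \o g').
Proof.
case=> o1 o2 s1 s1' f1 g1 gf1 fg1 [_ o3 s2 s2' f2 g2 gf2 fg2]; split=> //=.
- by move=> i; exact: (smooth_comp o1 o2 f1 s1 (s2 i)).
- by move=> i; exact: (smooth_comp o3 o2 g2 s2' (s1' i)).
- by move=> x /f1/f2.
- by move=> x /g2/g1.
- by move=> x O1x; rewrite gf2 ?gf1//; exact: f1.
- by move=> x O1x; rewrite fg1 ?fg2//; exact: g2.
Qed.

Lemma smoothv_cvg W m (F : V -> 'rV[R]_m) x : smoothv W F -> W x -> F y @[y --> x] --> F x.
Proof. move=> sF Wx; apply: (@cvg_rV R _ (nbhs x) (nbhs_filter x)) => j.
exact: (smooth_cont (sF j) Wx). Qed.

Lemma open_preimage W m (F : V -> 'rV[R]_m) O : open W -> open O -> smoothv W F ->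
  open (W `&` F @^-1` O).
Proof.
move=> oW oO sF; rewrite openE => x [Wx Ox]; rewrite /interior.
apply: filterI; first exact: open_nbhs_nbhs.
exact: (smoothv_cvg sF Wx (open_nbhs_nbhs (conj oO Ox))).
Qed.

Lemma diffeo_restr O O' f g (W : set V) : diffeo O O' f g -> open W -> W `<=` O' ->
  diffeo (O `&` f @^-1` W) W f g.
Proof.
case=> o1 o2 s1 s1' f1 g1 gf1 fg1 oW WO; split=> //.
- exact: open_preimage.
- by move=> i; apply: smooth_subset (s1 i) => x [].
- by move=> i; exact: smooth_subset (s1' i).
- by move=> x [].
- by move=> x Wx; split; [exact/g1/WO|rewrite /= fg1//; exact: WO].
- by move=> x [/gf1].
- by move=> x /WO/fg1.
Qed.

(** The maps of [linearize_aux] invert each other only while the points stay in the ball. The radius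
    is shrunk until [psi] maps into that ball, and [O] becomes the image. *)
Lemma linearize rho0 (E : V -> V) : 0 < rho0 -> smoothv (bal rho0) E -> E 0 = 0 ->
  (forall i j, 'D_(delta_mx 0 j) (fun x => E x 0 i) 0 = (i == j)%:R) ->
  exists (r : R) (O : set V) psi z, [/\ 0 < r, diffeo (bal r) O psi z,
    O `<=` bal rho0 /\ psi 0 = 0,
    forall i j, 'D_(delta_mx 0 j) (fun v => psi v 0 i) 0 = (i == j)%:R &
    forall v i, bal r v ->
      \sum_j v 0 j * 'D_(delta_mx 0 j) (fun v => psi v 0 i) v = E (psi v) 0 i].
Proof.
move=> r0 sE E0 dE0.
have [r [psi [z [[r_gt0 rr] spsi sz [pb zp pz p0 z0] [dp hE]]]]] := linearize_aux r0 sE E0 dE0.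
have c := smoothv_cvg spsi (bal0 r_gt0); rewrite p0 in c.
have /nbhs_normP[r' /= r'0 hr'] := c _ (open_nbhs_nbhs (conj (open_bal r) (bal0 r_gt0))).
pose r2 := Num.min r r'.
have r20 : 0 < r2 by rewrite lt_min r_gt0.
have r2r : bal r2 `<=` (bal r : set V) by move=> v; rewrite /bal /= lt_min => /andP[].
have pr v : bal r2 v -> bal r (psi v).
  rewrite /bal /= lt_min => /andP[_ vr']; apply: hr' => /=; by rewrite sub0r normrN.
exists r2, (bal r `&` (z @^-1` (bal r2) `&` (psi \o z) @^-1` bal r)), psi, z.
have zpsi v : bal r2 v -> z (psi v) = v by move=> hv; apply: zp; [exact: r2r|exact: pr].
have rO x : bal r x -> bal r2 (z x) -> psi (z x) = x.
  by move=> hx hz; apply: pz => //; exact: r2r.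
split=> //.
- split.
  + exact: open_bal.
  + rewrite (_ : _ `&` _ = bal r `&` z @^-1` bal r2).
      by apply: open_preimage => //; exact: open_bal.
    apply/seteqP; split=> [x [hx [hz _]]//|x [hx hz]]; split=> //; split=> //.
    by rewrite /= rO.
  + by move=> i; apply: smooth_subset r2r (spsi i).
  + by move=> i; apply: smooth_subset (sz i) => x [].
  + move=> v hv; split; first exact: pr.
    by rewrite /= zpsi//; split=> //; exact: pr.
  + by move=> x [_ []].
  + exact: zpsi.
  + by move=> x [hx [hz _]]; exact: rO.
- split=> // x [hx [hz _]]; rewrite -(rO x hx hz); apply: pb; exact: r2r.
- by move=> v i hv; apply: hE; exact: r2r.
Qed.

End Diffeo.

Section IFT.
Context {R : realType} {n : nat}.
Local Notation V := 'rV[R]_n.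

Definition jacmx (w : V -> V) x : 'M[R]_n :=
  \matrix_(i, j) 'D_(delta_mx 0 j) (fun y => w y 0 i) x.

Lemma smooth_jacmx W w i j : smoothv W w -> smooth W (fun x => jacmx w x i j).
Proof.
move=> sw; have -> : (fun x => jacmx w x i j) = 'D_(delta_mx 0 j) (fun y => w y 0 i).
  by apply/funext => x; rewrite mxE.
exact: smooth_der.
Qed.

(* [w] is linearised by the vector field [E] with [dw(E) = w]. *)
Lemma inverse_function (W : set V) (w : V -> V) x0 : open W -> W x0 -> smoothv W w ->
  w x0 = 0 -> jacmx w x0 \in unitmx ->
  exists (r : R) O phi, [/\ 0 < r, O x0, O `<=` W & diffeo O (bal r) w phi].
Proof.
move=> oW Wx0 sw w0 uJ.
pose sh (x : V) : V := x + x0.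
have ssh U : open U -> smoothv U sh.
  move=> oU i; apply: (smooth_ext oU _ (smooth_add oU (smooth_coord oU i) (smooth_cst oU (x0 0 i)))).
  by move=> x _; rewrite mxE.
have [r1 r10 r1W] := open_tbalP oW Wx0.
have shW x : bal r1 x -> W (sh x) by move=> hx; apply: r1W; rewrite /tbal /= addrK.
pose w' x := w (sh x).
have sw1 : smoothv (bal r1) w'.
  by move=> i; exact: (smooth_comp (open_bal r1) oW shW (ssh _ (open_bal r1)) (sw i)).
pose J x := jacmx w' x.
have J0 : J 0 = jacmx w x0.
  by apply/matrixP => i j; rewrite !mxE (derive_shiftv (fun y => w y 0 i)) add0r.
have sdet : smooth (bal r1) (fun x => \det (J x)).
  by apply: smooth_det => [|i j]; [exact: open_bal|exact: smooth_jacmx].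
have d0 : \det (J 0) != 0 by rewrite J0 -unitfE -unitmxE.
have cd := smooth_cont sdet (bal0 r10).
have /nbhs_normP[r2 /= r20 hr2] := cd _ (open_nbhs_nbhs (conj (@open_neq _ 0) d0)).
pose rho := Num.min r1 r2.
have rho_gt0 : 0 < rho by rewrite lt_min r10.
have rr1 : bal rho `<=` (bal r1 : set V) by move=> v; rewrite /bal /= lt_min => /andP[].
have uJx x : bal rho x -> J x \in unitmx.
  rewrite /bal /= lt_min => /andP[_ xr]; rewrite unitmxE unitfE; apply: hr2.
  by rewrite /= sub0r normrN.
have oR := open_bal rho : open (bal rho : set V).
pose E x := w' x *m (invmx (J x))^T.
have sw' : smoothv (bal rho) w' by move=> i; exact: smooth_subset rr1 (sw1 i).
have si i k : smooth (bal rho) (fun x => (invmx (J x)) i k).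
  by apply: smooth_invmx => // a b; exact: smooth_jacmx.
have EE i x : E x 0 i = \sum_k w' x 0 k * (invmx (J x)) i k.
  by rewrite mxE; apply: eq_bigr => k _; rewrite [in LHS]mxE.
have sE : smoothv (bal rho) E.
  move=> i; apply: (smooth_ext oR _ (smooth_sum oR (P := predT) (index_enum _)
    (fun k _ => smooth_mul oR (sw' k) (si i k)))) => x _; exact/esym/EE.
have w'0 : w' 0 = 0 by rewrite /w' /sh add0r.
have E0 : E 0 = 0 by rewrite /E w'0 mul0mx.
have b0 : bal rho (0 : V) by exact: bal0.
have dE i j : 'D_(delta_mx 0 j) (fun x => E x 0 i) 0 = (i == j)%:R.
  have -> : (fun x => E x 0 i) = \sum_k (fun x => w' x 0 k * (invmx (J x)) i k).
    by apply/funext => x; rewrite fct_sumE EE.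
  rewrite derive_sum; last first.
    by move=> k; apply: diff_derivable; exact: smooth_diff (smooth_mul oR (sw' k) (si i k)) b0.
  transitivity ((invmx (J 0) *m J 0) i j); last by rewrite mulVmx ?uJx// mxE.
  rewrite [RHS]mxE; apply: eq_bigr => k _.
  rewrite (deriveM (diff_derivable (smooth_diff (sw' k) b0)) (diff_derivable (smooth_diff (si i k) b0))).
  by rewrite w'0 [(0 : 'rV__) _ _]mxE scale0r add0r [J 0 k j]mxE /GRing.scale/=.
case: (linearize rho_gt0 sE E0 dE) => r [] O [] psi [] z [] r_gt0 dpsi [Orho psi0] dp0 hE.
have [_ oO spsi _ fO _ _ _] := dpsi.
(* In the coordinates [v] the field E is the Euler field, so dw(E) = w makes w' o psi homogeneous of
   degree one; [euler_linear] shows that it is linear. *)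
have wl v i : bal r v -> w' (psi v) 0 i = (v *m (J 0)^T) 0 i.
  move=> hv; have fr x : bal r x -> bal rho (psi x) by move/fO/Orho.
  pose h v := w' (psi v) 0 i.
  have sh' : smooth (bal r) h by exact: (smooth_comp (open_bal r) oR fr spsi (sw' i)).
  have dh u j : bal r u -> 'D_(delta_mx 0 j) h u =
      \sum_k J (psi u) i k * 'D_(delta_mx 0 j) (fun v => psi v 0 k) u.
    move=> hu; rewrite -[h]/((fun x => w' x 0 i) \o psi) derive_comp_rV.
    - by apply: eq_bigr => k _; rewrite [in RHS]mxE.
    - by apply: smooth_diff (sw' i) _; exact: fr.
    - by move=> k; exact: smooth_diff (spsi k) _.
  rewrite -/(h v) (euler_linear sh' _ hv).
    rewrite [RHS]mxE; apply: eq_bigr => j _; rewrite mulrC; congr (_ * _).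
    rewrite (dh _ _ (bal0 r_gt0)) psi0 (bigD1 j)//= dp0 eqxx mulr1 big1 ?addr0.
      by rewrite [RHS]mxE.
    by move=> k kj; rewrite dp0 (negbTE kj) mulr0.
  move=> u hu; have bu := fr _ hu.
  transitivity (\sum_k J (psi u) i k * E (psi u) 0 k).
    rewrite (eq_bigr _ (fun j _ => congr1 (fun x => u 0 j * x) (dh u j hu))).
    under eq_bigr do rewrite mulr_sumr.
    rewrite exchange_big/=; apply: eq_bigr => k _.
    rewrite -(hE u k hu) mulr_sumr; apply: eq_bigr => j _; by rewrite mulrCA.
  have -> : h u = (J (psi u) *m (E (psi u))^T) i 0.
    by rewrite /E trmx_mul trmxK mulmxA mulmxV ?uJx// mul1mx [RHS]mxE.
  by rewrite [RHS]mxE; apply: eq_bigr => k _; congr (_ * _); rewrite [RHS]mxE.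
have uJ0 := uJx 0 b0.
(* chain of diffeomorphisms: translation, psi^-1, then the linear map J0 *)
pose L (v : V) := v *m (J 0)^T; pose L' (v : V) := v *m (invmx (J 0))^T.
have slin U (A : 'M[R]_n) : open U -> smoothv U (fun v : V => v *m A).
  move=> oU i; apply: (smooth_ext oU _ (smooth_sum oU (P := predT) (index_enum _)
    (fun k _ => smooth_mul oU (smooth_coord oU k) (smooth_cst oU (A k i))))) => x _.
  by rewrite mxE.
have LK v : L' (L v) = v by rewrite /L /L' -mulmxA -trmx_mul mulVmx// trmx1 mulmx1.
have L'K v : L (L' v) = v by rewrite /L /L' -mulmxA -trmx_mul mulmxV// trmx1 mulmx1.
pose O2 := [set: V] `&` L' @^-1` bal r.
have oO2 : open O2 by apply: open_preimage; [exact: openT|exact: open_bal|exact/slin/openT].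
have D1 : diffeo (bal r) O2 L L'.
  split=> //.
  - exact: open_bal.
  - exact/slin/open_bal.
  - exact/slin.
  - by move=> x hx; split=> //=; rewrite LK.
  - by move=> x [].
have D2 : diffeo O O2 (L \o z) (psi \o L').
  by apply: diffeo_comp D1; exact: diffeo_sym.
pose un (x : V) : V := x - x0.
have sun U : open U -> smoothv U un.
  move=> oU i; apply: (smooth_ext oU _ (smooth_sub oU (smooth_coord oU i) (smooth_cst oU (x0 0 i)))).
  by move=> x _; rewrite !mxE.
pose O3 := [set: V] `&` un @^-1` O.
have D3 : diffeo O3 O un sh.
  split=> //.
  - by apply: open_preimage => //; [exact: openT|exact/sun/openT].
  - by apply: (sun _ _); apply: open_preimage => //; [exact: openT|exact/sun/openT].
  - exact: ssh.
  - by move=> x [].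
  - by move=> x Ox; split=> //=; rewrite /sh /un addrK.
  - by move=> x _; rewrite /sh /un subrK.
  - by move=> x _; rewrite /sh /un addrK.
have D4 : diffeo O3 O2 (L \o z \o un) (sh \o (psi \o L')) by exact: diffeo_comp D3 D2.
have z0 : z 0 = 0 by rewrite -{1}psi0; case: dpsi => _ _ _ _ _ _ h _; apply: h; exact: bal0.
have O20 : O2 0 by split=> //=; rewrite /L' mul0mx; exact: bal0.
have /nbhs_normP[r4 /= r40 hr4] := open_nbhs_nbhs (conj oO2 O20).
have r4O : bal r4 `<=` O2 by move=> v hv; apply: hr4; rewrite /= sub0r normrN.
case: (diffeo_restr D4 (open_bal r4) r4O) => o1 o2 s1 s1' f1 g1 gf1 fg1.
have ww x : O3 x -> w x = L (z (un x)).
  move=> [_ Ox]; have [_ _ _ _ _ zO _ pz] := dpsi.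
  have {1}-> : x = sh (psi (z (un x))) by rewrite pz// /sh /un subrK.
  by apply/rowP => i; rewrite -/(w' _) wl//; exact: zO.
exists r4, (O3 `&` (L \o z \o un) @^-1` bal r4), (sh \o (psi \o L')).
have OW x : O3 x -> W x.
  by move=> [_ /Orho/rr1/shW]; rewrite /sh /un subrK.
split=> //.
- have O0 : O 0 by rewrite -psi0; apply: fO; exact: bal0.
  split; first by split=> //=; rewrite /un subrr.
  by rewrite /= /un subrr z0 /L mul0mx; exact: bal0.
- by move=> x [/OW].
split=> //.
- by move=> i; apply: (smooth_ext o1 _ (s1 i)) => x [/ww ->].
- by move=> x hx; rewrite (ww x hx.1); exact: f1.
- by move=> x hx; rewrite (ww x hx.1); exact: gf1.
- by move=> y hy; have [h _] := g1 y hy; rewrite (ww _ h); exact: fg1.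
Qed.

End IFT.

(** * Complex-valued functions and division by a complex coordinate *)

Section Cplx.
Context {R : realType} {n : nat}.
Local Notation V := 'rV[R]_n.
Local Notation C := R[i].
Local Notation Re := complex.Re.
Local Notation Im := complex.Im.
Implicit Types (W : set V) (f g : V -> C) (x : V).

Definition smoothc W f := smooth W (fun x => Re (f x)) /\ smooth W (fun x => Im (f x)).

Definition dc j f x : C :=
  ('D_(delta_mx 0 j) (fun y => Re (f y)) x +i* 'D_(delta_mx 0 j) (fun y => Im (f y)) x)%C.

Lemma cReD (a b : C) : Re (a + b) = Re a + Re b. Proof. by case: a; case: b. Qed.
Lemma cImD (a b : C) : Im (a + b) = Im a + Im b. Proof. by case: a; case: b. Qed.
Lemma cReN (a : C) : Re (- a) = - Re a. Proof. by case: a. Qed.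
Lemma cImN (a : C) : Im (- a) = - Im a. Proof. by case: a. Qed.
Lemma cReM (a b : C) : Re (a * b) = Re a * Re b - Im a * Im b. Proof. by case: a; case: b. Qed.
Lemma cImM (a b : C) : Im (a * b) = Re a * Im b + Im a * Re b. Proof. by case: a; case: b. Qed.
Lemma cReV (a : C) : Re a^-1 = Re a / (Re a ^+ 2 + Im a ^+ 2). Proof. by case: a. Qed.
Lemma cImV (a : C) : Im a^-1 = - (Im a / (Re a ^+ 2 + Im a ^+ 2)).
Proof. by case: a => u v /=. Qed.

Lemma cReS (I : Type) (r : seq I) (P : pred I) (F : I -> C) :
  Re (\sum_(i <- r | P i) F i) = \sum_(i <- r | P i) Re (F i).
Proof. by apply: (big_morph _ cReD). Qed.
Lemma cImS (I : Type) (r : seq I) (P : pred I) (F : I -> C) :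
  Im (\sum_(i <- r | P i) F i) = \sum_(i <- r | P i) Im (F i).
Proof. by apply: (big_morph _ cImD). Qed.

Lemma sqr_norm_eq0 (a : C) : (Re a ^+ 2 + Im a ^+ 2 == 0) = (a == 0).
Proof.
case: a => u v; rewrite eq_complex /= paddr_eq0 ?sqr_ge0//.
by rewrite !sqrf_eq0.
Qed.

Lemma eqReIm (a b : C) : Re a = Re b -> Im a = Im b -> a = b.
Proof. by case: a; case: b => ? ? ? ? /= -> ->. Qed.

Section ops.
Variable W : set V.
Hypothesis oW : open W.

Lemma smoothc_ext f g : (forall x, W x -> f x = g x) -> smoothc W f -> smoothc W g.
Proof.
move=> e [h1 h2]; split; [apply: smooth_ext h1|apply: smooth_ext h2] => // x Wx; by rewrite e.
Qed.

Lemma smoothc_cst a : smoothc W (fun=> a).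
Proof. by split; exact: smooth_cst. Qed.

Lemma smoothc_real (f : V -> R) : smooth W f -> smoothc W (fun x => (f x)%:C%C).
Proof. by move=> h; split=> //; exact: smooth_cst. Qed.

Lemma smoothc_add f g : smoothc W f -> smoothc W g -> smoothc W (fun x => f x + g x).
Proof.
move=> [f1 f2] [g1 g2]; split.
  by apply: (smooth_ext oW _ (smooth_add oW f1 g1)) => x _; rewrite cReD.
by apply: (smooth_ext oW _ (smooth_add oW f2 g2)) => x _; rewrite cImD.
Qed.

Lemma smoothc_opp f : smoothc W f -> smoothc W (fun x => - f x).
Proof.
move=> [f1 f2]; split.
  by apply: (smooth_ext oW _ (smooth_opp oW f1)) => x _; rewrite cReN.
by apply: (smooth_ext oW _ (smooth_opp oW f2)) => x _; rewrite cImN.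
Qed.

Lemma smoothc_sub f g : smoothc W f -> smoothc W g -> smoothc W (fun x => f x - g x).
Proof. by move=> hf hg; apply: smoothc_add hf (smoothc_opp hg). Qed.

Lemma smoothc_mul f g : smoothc W f -> smoothc W g -> smoothc W (fun x => f x * g x).
Proof.
move=> [f1 f2] [g1 g2]; split.
  apply: (smooth_ext oW _ (smooth_sub oW (smooth_mul oW f1 g1) (smooth_mul oW f2 g2))) => x _.
  by rewrite cReM.
apply: (smooth_ext oW _ (smooth_add oW (smooth_mul oW f1 g2) (smooth_mul oW f2 g1))) => x _.
by rewrite cImM.
Qed.

Lemma smoothc_conj f : smoothc W f -> smoothc W (fun x => (f x)^*%C).
Proof.
move=> [f1 f2]; split; first by apply: (smooth_ext oW _ f1) => x _; case: (f x).
by apply: (smooth_ext oW _ (smooth_opp oW f2)) => x _; case: (f x).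
Qed.

Lemma smoothc_inv f : (forall x, W x -> f x != 0) -> smoothc W f -> smoothc W (fun x => (f x)^-1).
Proof.
move=> f0 [f1 f2].
have N : smooth W (fun x => (Re (f x) ^+ 2 + Im (f x) ^+ 2)^-1).
  apply: smooth_inv => // [x /f0|]; first by rewrite sqr_norm_eq0.
  by apply: smooth_add => //; apply: smooth_mul.
split.
  by apply: (smooth_ext oW _ (smooth_mul oW f1 N)) => x _; rewrite cReV.
by apply: (smooth_ext oW _ (smooth_opp oW (smooth_mul oW f2 N))) => x _; rewrite cImV.
Qed.

Lemma smoothc_sum (I : Type) (r : seq I) (P : pred I) (F : I -> V -> C) :
  (forall i, P i -> smoothc W (F i)) -> smoothc W (fun x => \sum_(i <- r | P i) F i x).
Proof.
move=> h; split.
  apply: (smooth_ext oW _ (smooth_sum oW r (fun i Pi => (h i Pi).1))) => x _; by rewrite cReS.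
apply: (smooth_ext oW _ (smooth_sum oW r (fun i Pi => (h i Pi).2))) => x _; by rewrite cImS.
Qed.

Lemma smoothc_prod (I : Type) (r : seq I) (P : pred I) (F : I -> V -> C) :
  (forall i, P i -> smoothc W (F i)) -> smoothc W (fun x => \prod_(i <- r | P i) F i x).
Proof.
move=> h; elim: r => [|i r IH].
  by apply: (smoothc_ext _ (smoothc_cst 1)) => x _; rewrite big_nil.
case Pi: (P i).
  by apply: (smoothc_ext _ (smoothc_mul (h i Pi) IH)) => x _; rewrite big_cons Pi.
by apply: (smoothc_ext _ IH) => x _; rewrite big_cons Pi.
Qed.

Lemma smoothc_exp f k : smoothc W f -> smoothc W (fun x => f x ^+ k).
Proof.
move=> h; elim: k => [|k IH]; first by apply: smoothc_cst.
by apply: (smoothc_ext _ (smoothc_mul h IH)) => x _; rewrite exprS.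
Qed.

Lemma smoothc_dc f j : smoothc W f -> smoothc W (dc j f).
Proof. by move=> [h1 h2]; split; exact: smooth_der. Qed.

Section derivatives.
Variable x : V.
Hypothesis Wx : W x.

Lemma dc_ext j f g : (forall y, W y -> f y = g y) -> dc j f x = dc j g x.
Proof.
move=> e; rewrite /dc.
by congr (_ +i* _)%C; apply: near_eq_derive; apply: (near_open oW Wx) => y Wy; rewrite e.
Qed.

Let dr (f : V -> R) j : smooth W f -> derivable f x (delta_mx 0 j) :=
  fun h => diff_derivable (smooth_diff h Wx).

Lemma dc_add j f g : smoothc W f -> smoothc W g ->
  dc j (fun y => f y + g y) x = dc j f x + dc j g x.
Proof.
move=> [f1 f2] [g1 g2]; rewrite /dc; congr (_ +i* _)%C.
  by under eq_fun do rewrite cReD; rewrite -deriveD//; exact: dr.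
by under eq_fun do rewrite cImD; rewrite -deriveD//; exact: dr.
Qed.

Lemma dc_opp j f : smoothc W f -> dc j (fun y => - f y) x = - dc j f x.
Proof.
move=> [f1 f2]; rewrite /dc; apply: eqReIm => /=.
  by under eq_fun do rewrite cReN; rewrite -deriveN//; exact: dr.
by under eq_fun do rewrite cImN; rewrite -deriveN//; exact: dr.
Qed.

Lemma dc_sub j f g : smoothc W f -> smoothc W g ->
  dc j (fun y => f y - g y) x = dc j f x - dc j g x.
Proof. by move=> hf hg; rewrite (dc_add _ hf (smoothc_opp hg)) dc_opp. Qed.

Lemma dc_mul j f g : smoothc W f -> smoothc W g ->
  dc j (fun y => f y * g y) x = f x * dc j g x + dc j f x * g x.
Proof.
move=> [f1 f2] [g1 g2].
have M (a b : V -> R) : smooth W a -> smooth W b ->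
    'D_(delta_mx 0 j) (fun y => a y * b y) x =
    a x * 'D_(delta_mx 0 j) b x + b x * 'D_(delta_mx 0 j) a x.
  move=> ha hb; have da : derivable a x (delta_mx 0 j) by exact: dr.
  have db : derivable b x (delta_mx 0 j) by exact: dr.
  by have := deriveM da db.
rewrite /dc; apply: eqReIm; rewrite /= ?cReD ?cImD ?cReM ?cImM /=.
  have -> : 'D_(delta_mx 0 j) (fun y => Re (f y * g y)) x =
     'D_(delta_mx 0 j) ((fun y => Re (f y) * Re (g y)) - (fun y => Im (f y) * Im (g y))) x.
    by apply: near_eq_derive; apply: (near_open oW Wx) => y Wy; rewrite cReM.
  by rewrite deriveB ?M//; [ring|apply: dr; exact: smooth_mul..].
have -> : 'D_(delta_mx 0 j) (fun y => Im (f y * g y)) x =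
   'D_(delta_mx 0 j) ((fun y => Re (f y) * Im (g y)) + (fun y => Im (f y) * Re (g y))) x.
  by apply: near_eq_derive; apply: (near_open oW Wx) => y Wy; rewrite cImM.
by rewrite deriveD ?M//; [ring|apply: dr; exact: smooth_mul..].
Qed.

Lemma dc_cst j a : dc j (fun=> a) x = 0.
Proof. by rewrite /dc !derive_cst. Qed.

Lemma dc_conj j f : smoothc W f -> dc j (fun y => (f y)^*%C) x = (dc j f x)^*%C.
Proof.
move=> [f1 f2]; rewrite /dc; apply: eqReIm => /=.
  by apply: near_eq_derive; apply: (near_open oW Wx) => y Wy; case: (f y).
rewrite -deriveN; last exact: dr.
by apply: near_eq_derive; apply: (near_open oW Wx) => y Wy; rewrite fctE; case: (f y).
Qed.

Lemma dc_sum j (I : Type) (r : seq I) (P : pred I) (F : I -> V -> C) :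
  (forall i, P i -> smoothc W (F i)) ->
  dc j (fun y => \sum_(i <- r | P i) F i y) x = \sum_(i <- r | P i) dc j (F i) x.
Proof.
move=> h; elim: r => [|i r IH].
  by rewrite big_nil -[RHS](dc_cst j 0); apply: dc_ext => y _; rewrite big_nil.
rewrite big_cons; case: ifPn => Pi.
  rewrite -IH -dc_add; [|exact: h|exact: smoothc_sum].
  by apply: dc_ext => y _; rewrite big_cons Pi.
by rewrite -IH; apply: dc_ext => y _; rewrite big_cons (negbTE Pi).
Qed.

Lemma dc_scale j a f : smoothc W f -> dc j (fun y => a * f y) x = a * dc j f x.
Proof. by move=> h; rewrite (dc_mul _ (smoothc_cst a) h) dc_cst mul0r addr0. Qed.

Lemma dc_exp j f k : smoothc W f -> dc j (fun y => f y ^+ k) x = k%:R * f x ^+ k.-1 * dc j f x.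
Proof.
move=> h; elim: k => [|k IH]; first by rewrite (dc_cst j 1) !mul0r.
rewrite (dc_ext j (g := fun y => f y * f y ^+ k)) => [|y _]; last by rewrite exprS.
rewrite (dc_mul _ h (smoothc_exp k h)) IH/= -[k.+1]addn1 natrD mulrDl mul1r.
case: k {IH} => [|k]; first by rewrite !mul0r mulr0 !expr0 add0r add0r mulr1 mul1r.
by rewrite /= [f x ^+ k.+1]exprS; ring.
Qed.

Lemma dc_inv j f : (forall y, W y -> f y != 0) -> smoothc W f ->
  dc j (fun y => (f y)^-1) x = - (f x)^-2 * dc j f x.
Proof.
move=> f0 h; have := dc_mul j h (smoothc_inv f0 h).
rewrite (dc_ext j (g := fun=> 1)) => [|y Wy]; last by rewrite divff// f0.
rewrite dc_cst => /eqP; rewrite eq_sym addr_eq0 => /eqP e.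
apply: (mulfI (f0 x Wx)); rewrite e; field; exact: f0.
Qed.

Lemma dc_schwarz i j f : smoothc W f -> dc i (dc j f) x = dc j (dc i f) x.
Proof. move=> [f1 f2]; apply: eqReIm; first exact: (schwarz i j oW f1 Wx).
exact: (schwarz i j oW f2 Wx). Qed.

End derivatives.

Lemma dlog_closed i j f x : (forall y, W y -> f y != 0) -> smoothc W f -> W x ->
  dc i (fun y => dc j f y / f y) x = dc j (fun y => dc i f y / f y) x.
Proof.
move=> f0 h Wx.
have hi := smoothc_inv f0 h.
rewrite (dc_mul Wx _ (smoothc_dc j h) hi) (dc_mul Wx _ (smoothc_dc i h) hi).
by rewrite (dc_inv Wx i f0 h) (dc_inv Wx j f0 h) (dc_schwarz Wx i j h); ring.
Qed.

End ops.

Lemma smoothc_subset W W' f : W' `<=` W -> smoothc W f -> smoothc W' f.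
Proof. by move=> h [h1 h2]; split; exact: smooth_subset h _. Qed.

Definition zc (a b : 'I_n) x : C := (x 0 a +i* x 0 b)%C.

Lemma smoothc_zc W a b : open W -> smoothc W (zc a b).
Proof. by move=> oW; split; exact: smooth_coord. Qed.

Lemma dc_zc a b j x : dc j (zc a b) x = ((a == j)%:R +i* (b == j)%:R)%C.
Proof. by rewrite /dc /= !derive_coord. Qed.

Lemma smoothc_lim0 W f x : smoothc W f -> W x ->
  (forall U, open U -> U x -> exists2 y, U y & f y = 0) -> f x = 0.
Proof.
move=> [f1 f2] Wx h.
have key (g : V -> R) : smooth W g -> (forall y, f y = 0 -> g y = 0) -> g x = 0.
  move=> sg e; apply/eqP; apply/negPn/negP => gx.
  have := smooth_cont sg Wx (open_nbhs_nbhs (conj (@open_neq _ 0) gx)).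
  rewrite /= nbhsE => -[U [oU Ux] hU]; have [y Uy /e gy] := h U oU Ux.
  by have := hU y Uy; rewrite /= gy eqxx.
by apply: eqReIm; [apply: (key _ f1) => y ->|apply: (key _ f2) => y ->].
Qed.

(** The point is moved in the coordinate [a] only, so that any other complex coordinate keeps its
    value. *)
Lemma dense_zc (a b : 'I_n) (U : set V) x : open U -> U x ->
  exists y, [/\ U y, zc a b y != 0 & forall k, k != a -> y 0 k = x 0 k].
Proof.
move=> oU Ux; have [r r0 hr] := open_tbalP oU Ux.
have [z0|z0] := eqVneq (zc a b x) 0; last by exists x.
exists (x + (r / 2) *: delta_mx 0 a); split.
- apply: hr; rewrite /tbal /bal /= addrAC subrr add0r normrZ gtr0_norm ?divr_gt0//.
  have ne : `|delta_mx 0 a : V| <= 1.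
    apply: norm_rV_le => // k; rewrite mxE eqxx/=; case: eqP => _; by rewrite ?normr1 ?normr0.
  apply: (@le_lt_trans _ _ (r / 2)); first by rewrite ler_piMr// ltW// divr_gt0.
  by rewrite ltr_pdivrMr// ltr_pMr// ltr1n.
- case: z0 => xa _; rewrite /zc eq_complex /= negb_and !mxE xa !eqxx mulr1 add0r.
  by rewrite gt_eqF// divr_gt0.
- by move=> k /negbTE ka; rewrite !mxE ka andbF mulr0 addr0.
Qed.

End Cplx.

(** * Division of smooth functions by a complex coordinate *)

Section Division.
Context {R : realType} {n : nat}.
Local Notation V := 'rV[R]_n.
Local Notation C := R[i].
Local Notation Re := complex.Re.
Local Notation Im := complex.Im.
Variables (a b : 'I_n) (r : R).
Hypothesis ab : a != b.
Hypothesis r0 : 0 < r.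
Local Notation W := (bal r : set V).
Local Notation z := (zc a b).
Let oW : open W := open_bal r.

Definition pr0 (x : V) : V := \row_k (if (k == a) || (k == b) then 0 else x 0 k).

Lemma pr0_bal x : W x -> W (pr0 x).
Proof.
rewrite /bal /= => h; apply: le_lt_trans h; apply: norm_rV_le => // j; rewrite mxE.
by case: ifP => _; [rewrite normr0|exact: coord_le_norm].
Qed.

Lemma zc_pr0 x : z (pr0 x) = 0.
Proof. by rewrite /zc !mxE !eqxx/= orbT. Qed.

(** Hadamard's kernel between [y] and its projection to z = 0; the remaining coordinates act as
    parameters. *)
Definition hadp j (f : V -> R) y := ker j (fun _ : R => f) 0 (pr0 y) y.

Lemma smooth_hadp j f : smooth W f -> smooth W (hadp j f).
Proof.
move=> hf k.
have [_ _ /(_ j) h] := (ckSP _ _ _).1 (hf k.+1).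
have H : ck k W (fun u (y : V) => 'D_(delta_mx 0 j) f (pr0 y + clamp u *: (y - pr0 y))).
  apply: (@ck_comp R n n k W W (fun=> 0)
    (fun u y => pr0 y + clamp u *: (y - pr0 y)) (fun _ : R => 'D_(delta_mx 0 j) f)) => //.
  - by move=> t; exact: cvg_cst.
  - by move=> u y hy; apply: cvx_bal => //; [exact: pr0_bal|exact: clamp01].
  - move=> i; have hc : ck k W (fun u (_ : V) => clamp u).
      by apply: ck_t; [exact: oW|exact: continuous_clamp].
    have hp : ck k W (fun _ y => pr0 y 0 i).
      case e : ((i == a) || (i == b)).
        by apply: (ck_ext oW _ (ck_cstR oW k 0)) => s x _; rewrite mxE e.
      by apply: (ck_ext oW _ (ck_coord oW k i)) => s x _; rewrite mxE e.
    apply: (ck_ext oW _ (ck_add oW hp (ck_mul oW hc (ck_sub oW (ck_coord oW k i) hp)))).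
    by move=> s x _; rewrite [in RHS]mxE; congr (_ + _); rewrite [in RHS]mxE; congr (_ * _); rewrite [in RHS]mxE; congr (_ + _); rewrite [in RHS]mxE.
exact: (ck_fix 1 oW (ck_ip oW (cvx_bal r) H)).
Qed.

Lemma hadp_eq f y : smooth W f -> W y ->
  f y = f (pr0 y) + (hadp a f y * y 0 a + hadp b f y * y 0 b).
Proof.
move=> hf hy; rewrite (ker_eq 0 oW (cvx_bal r) (hf 1) (pr0_bal hy) hy); congr (_ + _).
have e j : y 0 j - pr0 y 0 j = if (j == a) || (j == b) then y 0 j else 0.
  by rewrite [pr0 y 0 j]mxE; case: ifP => _; rewrite ?subr0 ?subrr.
rewrite (bigD1 a)//= (bigD1 b) ?(eq_sym b a)//= !e !eqxx orbT big1 ?addr0// => j.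
by rewrite e => /andP[/negbTE-> /negbTE->]; rewrite mulr0.
Qed.

Lemma had_pair (f : V -> R) : smooth W f -> exists A B : V -> R,
  [/\ smooth W A, smooth W B & forall x, W x -> f x = f (pr0 x) + (A x * x 0 a + B x * x 0 b)].
Proof.
move=> sf; exists (hadp a f), (hadp b f).
by split; [exact: smooth_hadp|exact: smooth_hadp|move=> x; exact: hadp_eq].
Qed.

(** Hadamard's lemma in the real coordinates x_a = (z + zbar) / 2 and x_b = (z - zbar) / (2i),
    rewritten in z and zbar. *)
Lemma hadC (f : V -> C) : smoothc W f -> (forall x, W x -> z x = 0 -> f x = 0) ->
  exists A B, [/\ smoothc W A, smoothc W B &
    forall x, W x -> f x = z x * A x + (z x)^*%C * B x].
Proof.
move=> [f1 f2] h.
have [A1 [B1 [sA1 sB1 e1]]] := had_pair f1; have [A2 [B2 [sA2 sB2 e2]]] := had_pair f2.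
pose H1 x : C := (A1 x +i* A2 x)%C; pose H2 x : C := (B1 x +i* B2 x)%C.
have sH1 : smoothc W H1 by [].
have sHi c : smoothc W (fun x => c * H2 x).
  by apply: smoothc_mul => //; exact: smoothc_cst.
exists (fun x => 2^-1 * (H1 x - 'i%C * H2 x)), (fun x => 2^-1 * (H1 x + 'i%C * H2 x)); split.
- by apply: smoothc_mul => //; [exact: smoothc_cst|exact: smoothc_sub].
- by apply: smoothc_mul => //; [exact: smoothc_cst|exact: smoothc_add].
- move=> x Wx.
  have E : f x = (x 0 a)%:C%C * H1 x + (x 0 b)%:C%C * H2 x.
    have fp := h _ (pr0_bal Wx) (zc_pr0 x).
    have mR (u : R) (c : C) : Re (u%:C%C * c) = u * Re c by rewrite cReM /= mul0r subr0.
    have mI (u : R) (c : C) : Im (u%:C%C * c) = u * Im c by rewrite cImM /= mul0r addr0.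
    apply: eqReIm.
      by rewrite cReD !mR (e1 x Wx) fp add0r /H1 /H2 /= mulrC; congr (_ + _); rewrite mulrC.
    by rewrite cImD !mI (e2 x Wx) fp add0r /H1 /H2 /= mulrC; congr (_ + _); rewrite mulrC.
  have ii : ('i%C : C) * 'i%C = -1 by rewrite -expr2 sqr_i.
  have za : z x = (x 0 a)%:C%C + 'i%C * (x 0 b)%:C%C by apply: eqReIm; rewrite ?cReD ?cImD ?cReM ?cImM /=; ring.
  have zb : (z x)^*%C = (x 0 a)%:C%C - 'i%C * (x 0 b)%:C%C.
    by apply: eqReIm; rewrite ?cReD ?cImD ?cReN ?cImN ?cReM ?cImM /=; ring.
  rewrite zb za E; move: ii (x 0 a)%:C%C (x 0 b)%:C%C (H1 x) (H2 x) => ii u v p q.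
  have -> : (u + 'i%C * v) * (2^-1 * (p - 'i%C * q)) + (u - 'i%C * v) * (2^-1 * (p + 'i%C * q)) =
    u * p - ('i%C * 'i%C) * (v * q) by field.
  by rewrite ii mulN1r opprK.
Qed.

(* The Wirtinger derivative [d/d zbar]. *)
Definition dbar (f : V -> C) x := 2^-1 * (dc a f x + 'i%C * dc b f x).

(** Applying [dbar] lowers the power of zbar by one and keeps the factor z, since z is holomorphic.
    On z = 0 the new [G] is a nonzero multiple of the old one, so induction applies. *)
Lemma flat k (G T : V -> C) : smoothc W G -> smoothc W T ->
  (forall x, W x -> ((z x)^*)%C ^+ k * G x = z x * T x) ->
  forall x, W x -> z x = 0 -> G x = 0.
Proof.
have sz : smoothc W z by exact: smoothc_zc.
have szc : smoothc W (fun x => (z x)^*%C) by exact: smoothc_conj.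
elim: k G T => [|k IH] G T sG sT e x Wx zx; first by have := e x Wx; rewrite expr0 mul1r zx mul0r.
have sd f : smoothc W f -> smoothc W (dbar f).
  move=> sf; apply: smoothc_mul => //; first exact: smoothc_cst.
  apply: smoothc_add => //; first exact: smoothc_dc.
  by apply: smoothc_mul => //; [exact: smoothc_cst|exact: smoothc_dc].
have ii : ('i%C : C) * 'i%C = -1 by rewrite -expr2 sqr_i.
have E y : W y -> ((z y)^*)%C ^+ k * (k.+1%:R * G y + (z y)^*%C * dbar G y) = z y * dbar T y.
  move=> Wy.
  have D j : dc j (fun x => ((z x)^*)%C ^+ k.+1 * G x) y = dc j (fun x => z x * T x) y.
    exact: (dc_ext oW Wy).
  have L j : ((z y)^*)%C ^+ k.+1 * dc j G y +
     k.+1%:R * ((z y)^*)%C ^+ k * (dc j z y)^*%C * G y = z y * dc j T y + dc j z y * T y.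
    rewrite -(dc_mul oW Wy j sz sT) -D (dc_mul oW Wy _ (smoothc_exp oW k.+1 szc) sG).
    by rewrite (dc_exp oW Wy _ k.+1 szc) (dc_conj oW Wy j sz).
  have La := L a; have Lb := L b; rewrite !dc_zc !eqxx (negbTE ab) (eq_sym b a) (negbTE ab) in La Lb.
  have e1 : ((true%:R : R) +i* false%:R)%C = 1 by [].
  have e2 : ((false%:R : R) +i* true%:R)%C = 'i%C by [].
  rewrite e1 e2 in La Lb.
  have e3 : (1 : C)^*%C = 1 by exact: conjc1.
  have e4 : ('i%C : C)^*%C = - 'i%C by apply: eqReIm; rewrite /= ?oppr0.
  rewrite e3 exprS in La; rewrite e4 exprS in Lb; rewrite /dbar.
  apply: (mulfI (_ : 2 != 0 :> C)); first by rewrite pnatr_eq0.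
  move: (z y) ((z y)^*%C) La Lb => zz zb.
  move: (zb ^+ k) (dc a G y) (dc b G y) (dc a T y) (dc b T y) (G y) (T y) (k.+1%:R : C) => p Ga Gb Ta Tb g t q La Lb.
  have -> : 2 * (p * (q * g + zb * (2^-1 * (Ga + 'i%C * Gb)))) =
    (zb * p * Ga + q * p * 1 * g) + 'i%C * (zb * p * Gb + q * p * - 'i%C * g) + (1 + 'i%C * 'i%C) * (q * p * g).
    by field.
  rewrite La Lb ii.
  have -> : zz * Ta + 1 * t + 'i%C * (zz * Tb + 'i%C * t) + (1 + -1) * (q * p * g) =
    zz * Ta + 'i%C * (zz * Tb) + (1 + 'i%C * 'i%C) * t by ring.
  by rewrite ii; field.
have sG' : smoothc W (fun y => k.+1%:R * G y + (z y)^*%C * dbar G y).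
  by apply: smoothc_add => //; apply: smoothc_mul => //; [exact: smoothc_cst|exact: sd].
have := IH _ _ sG' (sd _ sT) E x Wx zx; rewrite zx conjc0 mul0r addr0 => /eqP.
by rewrite mulf_eq0 pnatr_eq0/= => /eqP.
Qed.

Definition ckc k (f : V -> C) :=
  ck k W (fun _ x => Re (f x)) /\ ck k W (fun _ x => Im (f x)).

(** Since 0^-1 = 0, this vanishes on z = 0 as soon as N > 0. Derivatives are sums of terms of the
    same kind with N - l lowered by at most one, so it is of class C^k when l + k < N. *)
Definition quo N l (f : V -> C) x : C := ((z x)^*)%C ^+ N * (z x)^-1 ^+ l * f x.

Lemma normc_zc (x y : V) : z x = 0 -> Normc.normc (z y) <= 2 * `|y - x|.
Proof.
case=> xa xb.
have e j : `|y 0 j - x 0 j| <= `|y - x|.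
  by have := coord_le_norm (y - x) j; rewrite mxE [X in _ + X]mxE.
have -> : z y = (y 0 a +i* 0)%C + (0 +i* y 0 b)%C by apply: eqReIm; rewrite /= ?addr0 ?add0r.
apply: le_trans (le_normcD _ _) _.
have e1 : Normc.normc (y 0 a +i* 0)%C = `|y 0 a| by rewrite /Normc.normc expr0n addr0 sqrtr_sqr.
have e2 : Normc.normc (0 +i* y 0 b)%C = `|y 0 b| by rewrite /Normc.normc expr0n add0r sqrtr_sqr.
have := e a; have := e b; rewrite xa xb !subr0 e1 e2; lra.
Qed.

Lemma normcX (c : C) k : Normc.normc (c ^+ k) = Normc.normc c ^+ k.
Proof.
elim: k => [|k IH]; first by rewrite !expr0 Normc.normc1.
by rewrite !exprS Normc.normcM IH.
Qed.

Lemma normc_ge (c : C) : `|Re c| <= Normc.normc c /\ `|Im c| <= Normc.normc c.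
Proof.
have [u2 v2] : 0 <= Re c ^+ 2 /\ 0 <= Im c ^+ 2 by rewrite !sqr_ge0.
by case: c u2 v2 => u v /= u2 v2; rewrite -!sqrtr_sqr !ler_sqrt ?lerDl ?lerDr ?addr_ge0.
Qed.

Lemma normc_le (c : C) : Normc.normc c <= `|Re c| + `|Im c|.
Proof.
case: c => u v /=; rewrite -[X in _ <= X]ger0_norm ?addr_ge0// -sqrtr_sqr ler_sqrt ?sqr_ge0//.
rewrite sqrrD !real_normK ?num_real//.
have := mulr_ge0 (normr_ge0 u) (normr_ge0 v); lra.
Qed.

Lemma normcJ' (c : C) : Normc.normc c^*%C = Normc.normc c.
Proof. by case: c => u v /=; rewrite sqrrN. Qed.

Lemma normc_ge0 (c : C) : 0 <= Normc.normc c.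
Proof. by case: c => u v; exact: sqrtr_ge0. Qed.

Lemma near_dist (x : V) (e : R) : 0 < e -> \forall y \near x, `|y - x| <= e.
Proof. by move=> e0; apply/nbhs_normP; exists e => // y /= /ltW; rewrite distrC. Qed.

Lemma near_norm (e : R) : 0 < e -> \forall y \near (0 : V), `|y| <= e.
Proof. by move=> e0; apply: filterS (near_dist 0 e0) => y; rewrite subr0. Qed.

(** As |zbar| = |z|, the quotient has the size of |z|^(N - l) |f|. Near [x] the function f is
    bounded and |z(y)| is at most 2 |y - x|. *)
Lemma quo_bound N l f x : (l < N)%N -> smoothc W f -> W x -> z x = 0 ->
  exists2 M, 0 <= M & \forall y \near x, Normc.normc (quo N l f y) <= M * `|y - x| ^+ (N - l).
Proof.
move=> lN [f1 f2] Wx zx.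
have bd (g : V -> R) : smooth W g -> \forall y \near x, `|g y| <= `|g x| + 1.
  move=> sg; have /cvgrPdist_le/(_ 1 ltr01) h := smooth_cont sg Wx.
  apply: filterS h => y h; rewrite -lerBlDl; apply: le_trans h.
  by rewrite distrC (le_trans (lerB_dist _ _))// distrC.
pose M := `|Re (f x)| + 1 + (`|Im (f x)| + 1).
have M0 : 0 <= M by rewrite !addr_ge0.
exists (2 ^+ (N - l) * M); first by rewrite mulr_ge0// exprn_ge0.
have h1 := bd _ f1; have h2 := bd _ f2; near=> y.
have hM : Normc.normc (f y) <= M.
  apply: le_trans (normc_le _) _; apply: lerD; near: y; [exact: h1|exact: h2].
have ht := normc_zc y zx.
have t0 : 0 <= Normc.normc (z y) by exact: normc_ge0.
rewrite /quo !Normc.normcM !normcX normcJ' Normc.normcV.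
rewrite [X in _ <= X]mulrAC; apply: ler_pM => //.
- by rewrite mulr_ge0// exprn_ge0// invr_ge0.
- exact: normc_ge0.
rewrite -exprMn.
have [e|tn] := eqVneq (Normc.normc (z y)) 0.
  by rewrite e expr0n (gtn_eqF (leq_ltn_trans (leq0n _) lN)) mul0r exprn_ge0// mulr_ge0.
rewrite -{1}(subnK (ltnW lN)) exprD -mulrA exprVn mulfV ?mulr1 ?expf_neq0//.
by rewrite lerXn2r ?nnegrE ?mulr_ge0.
Unshelve. all: by end_near. Qed.

Lemma open_nz : open (W `&` [set x | z x != 0]).
Proof.
pose W' := W `&` [set x | z x != 0].
have e : W' = W `&` (fun x => (x 0 a ^+ 2 + x 0 b ^+ 2)) @^-1` [set u | u != 0].
  by apply/seteqP; split=> x [Wx h]; split=> //; move: h; rewrite /= -sqr_norm_eq0.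
rewrite -/W' e openE => x [Wx h]; rewrite /interior; apply: filterI; first exact: open_nbhs_nbhs.
have s : smooth W (fun x => x 0 a ^+ 2 + x 0 b ^+ 2).
  by apply: smooth_add => //; apply: smooth_mul => //; exact: smooth_coord.
exact: (smooth_cont s Wx (open_nbhs_nbhs (conj (@open_neq _ 0) h))).
Qed.

Lemma quo_smooth N l f : smoothc W f -> smoothc (W `&` [set x | z x != 0]) (quo N l f).
Proof.
move=> sf; pose W' := W `&` [set x | z x != 0].
have oW' : open W' by exact: open_nz.
have sz : smoothc W' z by exact: smoothc_zc.
rewrite -/W'; apply: smoothc_mul => //; last by apply: smoothc_subset sf => x [].
apply: smoothc_mul => //; apply: smoothc_exp => //; first exact: smoothc_conj.
by apply: smoothc_inv => // x [].
Qed.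

Lemma quo_dc N l f j x : smoothc W f -> W x -> z x != 0 ->
  dc j (quo N l f) x = quo N.-1 l (fun y => N%:R * (dc j z x)^*%C * f y) x
     - quo N l.+1 (fun y => l%:R * dc j z x * f y) x + quo N l (dc j f) x.
Proof.
move=> sf Wx zx; pose W' := W `&` [set x | z x != 0].
have oW' : open W' by exact: open_nz.
have W'x : W' x by [].
have sz : smoothc W' z by exact: smoothc_zc.
have szc := smoothc_conj oW' sz.
have z0 y : W' y -> z y != 0 by case.
have szi := smoothc_inv oW' z0 sz.
have s1 := smoothc_exp oW' N szc; have s2 := smoothc_exp oW' l szi.
have sf' : smoothc W' f by apply: smoothc_subset sf => y [].
rewrite (dc_mul oW' W'x j (smoothc_mul oW' s1 s2) sf') (dc_mul oW' W'x j s1 s2).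
rewrite (dc_exp oW' W'x j N szc) (dc_exp oW' W'x j l szi) (dc_conj oW' W'x j sz).
rewrite (dc_inv oW' W'x j z0 sz) /quo.
have e : (z x)^-1 ^+ l.+1 * l%:R = l%:R * ((z x)^-1 ^+ l.-1 * (z x)^-2).
  case: (l) => [|m]; first by rewrite mulr0 mul0r.
  by rewrite mulrC; congr (_ * _); rewrite /= !exprVn -invfM -exprD addn2.
have -> : (z x)^*%C ^+ N * (z x)^-1 ^+ l.+1 * (l%:R * dc j z x * f x) =
  (z x)^*%C ^+ N * ((z x)^-1 ^+ l.+1 * l%:R) * (dc j z x * f x) by rewrite !mulrA.
by rewrite e; move: (_ ^+ N) (_ ^+ N.-1) (_ ^+ l) (_ ^+ l.-1) (_ ^- 2) => A B D E F; ring.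
Qed.

(** [P] stands for the real or the imaginary part, so that both are treated at once. *)
Section part.
Variable P : C -> R.
Hypothesis Pn : forall c, `|P c| <= Normc.normc c.
Hypothesis PD : forall c c', P (c + c') = P c + P c'.
Hypothesis PN : forall c, P (- c) = - P c.
Hypothesis Ps : forall (W : set V) f, smoothc W f -> smooth W (fun x => P (f x)).
Hypothesis Pd : forall j (f : V -> C) x, 'D_(delta_mx 0 j) (fun y => P (f y)) x = P (dc j f x).

Let P0 : P 0 = 0.
Proof. by have := PD 0 0; rewrite addr0 => /eqP; rewrite -subr_eq subrr eq_sym => /eqP. Qed.

Lemma quo0 N l f x : (0 < N)%N -> z x = 0 -> quo N l f x = 0.
Proof. by move=> N0 zx; rewrite /quo zx conjc0 expr0n gtn_eqF// !mul0r. Qed.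

Lemma quo_cont N l f x : (l < N)%N -> smoothc W f -> W x ->
  {for x, continuous (fun x => P (quo N l f x))}.
Proof.
move=> lN sf Wx; have [zx|zx] := eqVneq (z x) 0; last first.
  by apply: (smooth_cont (Ps (quo_smooth N l sf))); split.
have [M M0 hM] := quo_bound lN sf Wx zx.
apply/(cvgrPdist_le (FF := nbhs_filter x)) => e e0.
have N0 : (0 < N)%N by exact: leq_ltn_trans lN.
have k0 : (0 < N - l)%N by rewrite subn_gt0.
near=> y; rewrite (quo0 _ _ N0 zx) P0 sub0r normrN (le_trans (Pn _))//.
apply: (@le_trans _ _ (M * `|y - x| ^+ (N - l))); first by near: y; exact: hM.
have h1 : `|y - x| <= 1.
  by near: y; exact: near_dist.
have h2 : `|y - x| <= e / (M + 1).
  by near: y; apply: near_dist; rewrite divr_gt0// ltr_wpDl.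
apply: (@le_trans _ _ (M * `|y - x|)).
  rewrite ler_wpM2l// -[X in _ <= X]expr1.
  by apply: ler_wiXn2l => //.
move: h2; rewrite ler_pdivlMr ?ltr_wpDl// => h2; apply: le_trans h2.
by rewrite mulrC ler_wpM2l// lerDl.
Unshelve. all: by end_near. Qed.

(** N - l is at least 2, so the function is of second order at [x] and its differential is zero. *)
Lemma quo_diff0 N l f x : (l.+1 < N)%N -> smoothc W f -> W x -> z x = 0 ->
  differentiable (fun x => P (quo N l f x)) x /\
  forall v, 'D_v (fun x => P (quo N l f x)) x = 0.
Proof.
move=> lN sf Wx zx.
have [M M0 hM] := quo_bound (ltnW lN) sf Wx zx.
have N0 : (0 < N)%N by exact: leq_ltn_trans lN.
pose g (h : V) : R := 0.
have glin : linear g by move=> c u w; rewrite /g scaler0 addr0.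
pose glM := GRing.isLinear.Build _ _ _ _ _ glin.
pose gL : {linear V -> R} := HB.pack g glM.
have gc : continuous g := @cst_continuous V R 0.
have [d e] : differentiable (fun x => P (quo N l f x)) x /\
    'd (fun x => P (quo N l f x)) x = gL :> (V -> R).
  apply: (differentiable_of (df := gL)); first exact: gc.
  move=> e e0; have := near_translate hM; rewrite /= => hM'; near=> h.
  rewrite /= /g subr0 (quo0 _ _ N0 zx) P0 subr0 (le_trans (Pn _))//.
  apply: (@le_trans _ _ (M * `|h| ^+ (N - l))).
    by have := near hM' h; rewrite addrK; apply.
  have h1 : `|h| <= 1 by near: h; exact: near_norm.
  have h2 : `|h| <= e / (M + 1) by near: h; apply: near_norm; rewrite divr_gt0// ltr_wpDl.
  apply: (@le_trans _ _ (M * `|h| ^+ 2)).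
    by rewrite ler_wpM2l//; apply: ler_wiXn2l => //; rewrite ltn_subRL addn1.
  rewrite expr2 mulrA ler_wpM2r//.
  move: h2; rewrite ler_pdivlMr ?ltr_wpDl// => h2; apply: le_trans h2.
  by rewrite mulrC ler_wpM2l// lerDl.
by split=> // v; rewrite deriveE// e.
Unshelve. all: by end_near. Qed.

Lemma ck_quo k N l f : (l + k < N)%N -> smoothc W f -> ck k W (fun _ x => P (quo N l f x)).
Proof.
elim: k N l f => [|k IH] N l f lkN sf.
  by split=> //; apply: jc_x => x Wx; apply: quo_cont => //; rewrite addn0 in lkN.
have lN : (l < N)%N by apply: leq_ltn_trans lkN; exact: leq_addr.
have lN1 : (l.+1 < N)%N by apply: leq_ltn_trans lkN; rewrite addnS ltnS leq_addr.
have N1 : (0 < N.-1)%N by case: (N) lN1 => // -[].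
have N0 : (0 < N)%N by exact: leq_ltn_trans lN.
apply/ckSP; split.
- by apply: jc_x => x Wx; exact: quo_cont.
- move=> _ x Wx; have [zx|zx] := eqVneq (z x) 0.
    by case: (quo_diff0 lN1 sf Wx zx).
  by apply: (smooth_diff (Ps (quo_smooth N l sf))); split.
(* z is a linear coordinate: its derivative is a constant, which can be absorbed into the smooth
   factor. *)
move=> j; pose c : C := dc j (z : V -> C) 0.
have dz x : dc j z x = c by rewrite /c !dc_zc.
have s1 : smoothc W (fun y => N%:R * c^*%C * f y) by apply: smoothc_mul => //; exact: smoothc_cst.
have s2 : smoothc W (fun y => l%:R * c * f y) by apply: smoothc_mul => //; exact: smoothc_cst.
have l1 : (l + k < N.-1)%N by case: (N) lkN => //= m; rewrite addnS ltnS.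
have l2 : (l.+1 + k < N)%N by rewrite addSnnS.
have l3 : (l + k < N)%N by apply: ltn_trans lkN; rewrite addnS.
apply: (ck_ext oW _ (ck_add oW (ck_sub oW (IH _ _ _ l1 s1) (IH _ _ _ l2 s2))
  (IH _ _ _ l3 (smoothc_dc j sf)))) => s x Wx.
have [zx|zx] := eqVneq (z x) 0.
  have [_ ->] := quo_diff0 lN1 sf Wx zx.
  by rewrite !quo0// P0 subr0 addr0.
by rewrite Pd (quo_dc _ _ _ sf Wx zx) !PD PN dz.
Qed.

End part.

Lemma ckc_quo k N l f : (l + k < N)%N -> smoothc W f -> ckc k (quo N l f).
Proof.
move=> lkN sf; split.
  apply: ck_quo => //.
  - by move=> c; case: (normc_ge c).
  - exact: cReD.
  - exact: cReN.
  - by move=> ? ? [].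
apply: ck_quo => //.
- by move=> c; case: (normc_ge c).
- exact: cImD.
- exact: cImN.
- by move=> ? ? [].
Qed.

(* [S = z A_N + zbar^N B_N] for every [N], so that [S/z] is of class C^k for every [k]. *)
Lemma division m (al S T : V -> C) : smoothc W al -> smoothc W S -> smoothc W T ->
  (forall x, W x -> ((z x)^*)%C ^+ m * (al x * S x) = z x * T x) ->
  (forall x U, W x -> z x = 0 -> open U -> U x -> exists y, [/\ U y, z y = 0 & al y != 0]) ->
  exists2 q, smoothc W q & forall x, W x -> S x = z x * q x.
Proof.
move=> sal sS sT hST hal.
have sz : smoothc W z by exact: smoothc_zc.
have szc : smoothc W (fun x => (z x)^*%C) by exact: smoothc_conj.
have dec N : exists A B, [/\ smoothc W A, smoothc W B &
    forall x, W x -> S x = z x * A x + (z x)^*%C ^+ N * B x].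
  elim: N => [|N [A [B [sA sB e]]]].
    by exists (fun=> 0), S; split=> // [|x _]; [exact: smoothc_cst|rewrite mulr0 add0r expr0 mul1r].
  (* [flat] shows that al B vanishes on z = 0. Since [al] is nonzero at points of z = 0 arbitrarily
     near, B vanishes there too, and [hadC] then extracts one more factor zbar. *)
  have B0 x : W x -> z x = 0 -> B x = 0.
    move=> Wx zx.
    have F y : W y -> z y = 0 -> al y * B y = 0.
      apply: (@flat (m + N) (fun y => al y * B y) (fun y => T y - (z y)^*%C ^+ m * (al y * A y))).
      - exact: smoothc_mul.
      - apply: smoothc_sub => //; apply: smoothc_mul => //; last exact: smoothc_mul.
        exact: smoothc_exp.
      - move=> {}y Wy; rewrite mulrBr -hST// e// exprD; move: (_ ^+ m) (_ ^+ N) => u v; ring.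
    apply: (smoothc_lim0 sB Wx) => U oU Ux.
    have [y [[Uy Wy] zy aly]] := hal x (U `&` W) Wx zx (openI oU oW) (conj Ux Wx).
    by exists y => //; have /eqP := F y Wy zy; rewrite mulf_eq0 (negbTE aly)/= => /eqP.
  have [A' [B' [sA' sB' e']]] := hadC sB B0.
  exists (fun x => A x + (z x)^*%C ^+ N * A' x), B'; split=> //.
    by apply: smoothc_add => //; apply: smoothc_mul => //; exact: smoothc_exp.
  by move=> x Wx; rewrite e// e'// exprS; move: (_ ^+ N) => u; ring.
pose Q N A B x : C := A x + quo N 1 B x.
have QE N A B x : (1 < N)%N -> W x -> S x = z x * A x + (z x)^*%C ^+ N * B x -> S x = z x * Q N A B x.
  move=> N1 Wx ->; rewrite /Q /quo expr1 mulrDr; congr (_ + _).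
  have [zx|zx] := eqVneq (z x) 0; last by field.
  by rewrite zx conjc0 expr0n (gtn_eqF (ltnW N1)) !mul0r.
have Qk N A B k : smoothc W A -> smoothc W B -> (1 + k < N)%N -> ckc k (Q N A B).
  move=> [a1 a2] sB kN; have [b1 b2] := ckc_quo kN sB; split.
    by apply: (ck_ext oW _ (ck_add oW (a1 k) b1)) => s x _; rewrite /Q cReD.
  by apply: (ck_ext oW _ (ck_add oW (a2 k) b2)) => s x _; rewrite /Q cImD.
have [A2 [B2 [sA2 sB2 e2]]] := dec 2.
(* The quotient formed with N = k + 2 is of class C^k. It agrees with the one for N = 2 where z is
   nonzero, hence everywhere by continuity, so a single function is of every class. *)
have main k : ckc k (Q 2 A2 B2).
  have [A [B [sA sB e]]] := dec k.+2.
  have [c1 c2] := Qk _ _ _ k sA sB (ltnSn _).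
  have [d1 d2] := Qk _ _ _ 0%N sA2 sB2 (ltnSn _).
  have [c1' c2'] := Qk _ _ _ 0%N sA sB (isT : (1 + 0 < k.+2)%N).
  have E x : W x -> Q k.+2 A B x = Q 2 A2 B2 x.
    move=> Wx.
    have key (P : C -> R) : jc W (fun _ x => P (Q k.+2 A B x)) -> jc W (fun _ x => P (Q 2 A2 B2 x)) ->
        P (Q k.+2 A B x) = P (Q 2 A2 B2 x).
      move=> j1 j2; apply/eqP; rewrite -subr_eq0; apply/negPn/negP => ne.
      have := jc_sr (s := 0) (jc_add j1 (jc_opp j2)) Wx.
      move/(_ _ (open_nbhs_nbhs (conj (@open_neq _ 0) ne))).
      rewrite /= nbhsE => -[U [oU Ux] hU].
      have [y [[Uy Wy] zy _]] := dense_zc a b (openI oU oW) (conj Ux Wx).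
      have := hU y Uy; rewrite /= (_ : Q k.+2 A B y = Q 2 A2 B2 y) ?subrr ?eqxx//.
      by apply: (mulfI zy); rewrite -!QE//; [exact: e2|exact: e].
      apply: eqReIm.
      have := key (@complex.Re R); apply; first exact: (ck_jc c1').
      exact: (ck_jc d1).
    have := key (@complex.Im R); apply; first exact: (ck_jc c2').
    exact: (ck_jc d2).
  by split; [apply: (ck_ext oW _ c1)|apply: (ck_ext oW _ c2)] => s x Wx; rewrite E.
exists (Q 2 A2 B2); first by split=> k; case: (main k).
by move=> x Wx; apply: QE => //; exact: e2.
Qed.

End Division.

(** * Charts *)

Section SmoothRV.
Context {R : realType} {n : nat}.
Local Notation V := 'rV[R]_n.
Implicit Types (W : set V) (f : V -> R).

Lemma smooth_rVP W f : open W -> smooth_rV W f <-> smooth W f.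
Proof.
move=> oW; split=> [h k|h s x Wx]; last first.
  suff : smooth W (foldr (fun i g => 'D_(delta_mx 0 i) g) f s) by move=> /smooth_diff; apply.
  by elim: s => //= i s IH; exact: smooth_der.
elim: k f h => [|k IH] f h.
  by split=> //; apply: jc_x => x Wx; apply: differentiable_continuous; exact: (h [::] x Wx).
apply/ckSP; split.
- by apply: jc_x => x Wx; apply: differentiable_continuous; exact: (h [::] x Wx).
- by move=> _ x Wx; exact: (h [::] x Wx).
- move=> i; apply: IH => s x Wx.
  (* The derivative taken first is the last entry of the list. *)
  by have := h (rcons s i) x Wx; rewrite foldr_rcons.
Qed.

End SmoothRV.

Lemma continuousP_open (T U : topologicalType) (A : set T) (f : T -> U) (B : set U) : open A ->
  {within A, continuous f} -> open B -> open (A `&` f @^-1` B).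
Proof.
move=> oA cf oB; rewrite openE => x [Ax Bx]; rewrite /interior.
apply: filterI; first exact: open_nbhs_nbhs.
move: cf; rewrite continuous_open_subspace// => /(_ x); rewrite inE => /(_ Ax) cx.
by apply: cx; exact: open_nbhs_nbhs.
Qed.

Section Charts.
Context {R : realType} {n : nat} {T : topologicalType}.
Implicit Types (c : chart R n T).

Lemma chart_img_inv c x : is_chart c -> chart_img c x ->
  chart_dom c (chart_inv c x) /\ chart_map c (chart_inv c x) = x.
Proof. by case=> _ _ h _ _ [q cq <-]; rewrite h. Qed.

Lemma chart_imageE c U : is_chart c -> U `<=` chart_dom c ->
  chart_map c @` U = chart_img c `&` chart_inv c @^-1` U.
Proof.
move=> hc Uc; have [_ _ h _ _] := hc; apply/seteqP; split=> [_ [q Uq <-]|x [cx Ux]].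
  by split; [exists q => //; exact: Uc|rewrite /= h//; exact: Uc].
by exists (chart_inv c x) => //; case: (chart_img_inv hc cx).
Qed.

Lemma chart_image_open c U : is_chart c -> open U -> U `<=` chart_dom c ->
  open (chart_map c @` U).
Proof.
by move=> hc oU Uc; rewrite chart_imageE//; case: hc => *; exact: continuousP_open.
Qed.

Lemma chart_preimage_open c (W : set 'rV[R]_n) : is_chart c -> open W ->
  open (chart_dom c `&` chart_map c @^-1` W).
Proof. by move=> [*]; exact: continuousP_open. Qed.

Definition new_chart c (W : set 'rV[R]_n) f g : chart R n T :=
  Chart (chart_dom c `&` chart_map c @^-1` W) (f \o chart_map c) (chart_inv c \o g).

End Charts.

Section Manifold.
Context {R : realType} {n : nat} {M : smooth_manifold R n}.
Local Notation C := R[i].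
Implicit Types (c d : mchart M) (q : M) (U V : set M).

Lemma transition_smooth c d : atlas c -> atlas d ->
  smoothv (chart_map c @` (chart_dom c `&` chart_dom d)) (chart_map d \o chart_inv c).
Proof.
move=> ac ad j; apply/smooth_rVP; last exact: atlas_smooth.
apply: chart_image_open; first exact: atlas_chart.
- by apply: openI; case: (atlas_chart ac) => //; case: (atlas_chart ad).
- by move=> q [].
Qed.

Lemma dom_open c : atlas c -> open (chart_dom c).
Proof. by move=> /atlas_chart[]. Qed.

Lemma img_open c : atlas c -> open (chart_img c).
Proof. by move=> /atlas_chart[]. Qed.

Lemma invmapK c q : atlas c -> chart_dom c q -> chart_inv c (chart_map c q) = q.
Proof. by move=> /atlas_chart[_ _ h _ _] /h. Qed.

Lemma image_open c U : atlas c -> open U -> open (chart_map c @` (U `&` chart_dom c)).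
Proof.
move=> ac oU; apply: chart_image_open; first exact: atlas_chart.
- by apply: openI => //; exact: dom_open.
- by move=> q [].
Qed.

Lemma smooth_onE U (f : M -> R) : open U ->
  smooth_on U f <-> forall c, atlas c -> smooth (chart_map c @` (U `&` chart_dom c)) (f \o chart_inv c).
Proof.
move=> oU; split=> h c ac; [apply/smooth_rVP; last exact: h|apply/smooth_rVP; last exact: h];
  exact: image_open.
Qed.

Lemma smooth_on_local U (f : M -> R) :
  (forall q, U q -> exists2 V, V q & smooth_on V f) -> smooth_on U f.
Proof.
move=> h c ac s _ [q [Uq cq] <-]; have [V Vq hV] := h q Uq.
by apply: (hV c ac); exists q.
Qed.

Lemma smooth_on_subset U V (f : M -> R) : V `<=` U -> smooth_on U f -> smooth_on V f.
Proof. by move=> VU h; apply: smooth_on_local => q /VU Uq; exists U. Qed.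

(** One chart is enough, since the transitions to all others are smooth. *)
Lemma smooth_on_chart c U (f : M -> R) : atlas c -> open U -> U `<=` chart_dom c ->
  smooth_on U f <-> smooth (chart_map c @` U) (f \o chart_inv c).
Proof.
move=> ac oU Uc; have e : U `&` chart_dom c = U by apply/seteqP; split=> [q []|q Uq] //; split=> //; exact: Uc.
split=> [/(smooth_onE _ oU)/(_ c ac)|h]; first by rewrite e.
apply/smooth_onE => // d ad.
have oi := image_open ad oU.
have h1 : smoothv (chart_map d @` (U `&` chart_dom d)) (chart_map c \o chart_inv d).
  move=> i; apply: smooth_subset (transition_smooth ad ac i) => _ [q [Uq dq] <-].
  by exists q => //; split=> //; exact: Uc.
have h2 x : (chart_map d @` (U `&` chart_dom d)) x -> (chart_map c @` U) ((chart_map c \o chart_inv d) x).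
  by move=> [q [Uq dq] <-]; exists q => //=; rewrite invmapK.
have oc : open (chart_map c @` U) by rewrite -e; exact: image_open.
apply: (smooth_ext oi _ (smooth_comp oi oc h2 h1 h)) => _ [q [Uq dq] <-] /=.
by rewrite !invmapK//; exact: Uc.
Qed.

Lemma smoothC_onE U (f : M -> C) : open U ->
  smoothC_on U f <-> forall c, atlas c -> smoothc (chart_map c @` (U `&` chart_dom c)) (f \o chart_inv c).
Proof.
move=> oU; split=> [[/(smooth_onE _ oU) h1 /(smooth_onE _ oU) h2] c ac|h].
  by split; [exact: h1|exact: h2].
by split; apply/smooth_onE => // c /h[].
Qed.

Lemma smoothC_on_chart c U (f : M -> C) : atlas c -> open U -> U `<=` chart_dom c ->
  smoothC_on U f <-> smoothc (chart_map c @` U) (f \o chart_inv c).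
Proof.
move=> ac oU Uc; split=> [[/(smooth_on_chart _ ac oU Uc) h1 /(smooth_on_chart _ ac oU Uc) h2]|[h1 h2]].
  by split.
by split; apply/(smooth_on_chart _ ac oU Uc).
Qed.

Lemma smoothC_on_local U (f : M -> C) :
  (forall q, U q -> exists2 V, V q & smoothC_on V f) -> smoothC_on U f.
Proof. by move=> h; split; apply: smooth_on_local => q /h[V Vq []]; exists V. Qed.

Lemma smoothC_on_subset U V (f : M -> C) : V `<=` U -> smoothC_on U f -> smoothC_on V f.
Proof. by move=> VU h; apply: smoothC_on_local => q /VU Uq; exists U. Qed.

Section closure.
Variables (U : set M).
Hypothesis oU : open U.
Implicit Types f g : M -> C.

Lemma smoothC_on_ext f g : (forall q, U q -> f q = g q) -> smoothC_on U f -> smoothC_on U g.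
Proof.
move=> e /(smoothC_onE _ oU) h; apply/smoothC_onE => // c ac.
apply: (smoothc_ext _ _ (h c ac)); first exact: image_open.
by move=> _ [q [Uq cq] <-] /=; rewrite e// invmapK.
Qed.

Lemma smoothC_on_cst a : smoothC_on U (fun=> a).
Proof. by apply/smoothC_onE => // c ac; apply: smoothc_cst; exact: image_open. Qed.

Lemma smoothC_on_add f g : smoothC_on U f -> smoothC_on U g -> smoothC_on U (fun q => f q + g q).
Proof.
move=> /(smoothC_onE _ oU) h /(smoothC_onE _ oU) h'; apply/smoothC_onE => // c ac.
by apply: smoothc_add; [exact: image_open|exact: h|exact: h'].
Qed.

Lemma smoothC_on_mul f g : smoothC_on U f -> smoothC_on U g -> smoothC_on U (fun q => f q * g q).
Proof.
move=> /(smoothC_onE _ oU) h /(smoothC_onE _ oU) h'; apply/smoothC_onE => // c ac.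
by apply: smoothc_mul; [exact: image_open|exact: h|exact: h'].
Qed.

Lemma smoothC_on_opp f : smoothC_on U f -> smoothC_on U (fun q => - f q).
Proof.
move=> /(smoothC_onE _ oU) h; apply/smoothC_onE => // c ac.
by apply: smoothc_opp; [exact: image_open|exact: h].
Qed.

Lemma smoothC_on_inv f : (forall q, U q -> f q != 0) -> smoothC_on U f ->
  smoothC_on U (fun q => (f q)^-1).
Proof.
move=> f0 /(smoothC_onE _ oU) h; apply/smoothC_onE => // c ac.
apply: smoothc_inv; [exact: image_open| |exact: h].
by move=> _ [q [Uq cq] <-] /=; rewrite invmapK// f0.
Qed.

Lemma smoothC_on_sum (I : Type) (r : seq I) (P : pred I) (F : I -> M -> C) :
  (forall i, P i -> smoothC_on U (F i)) -> smoothC_on U (fun q => \sum_(i <- r | P i) F i q).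
Proof.
move=> h; apply/smoothC_onE => // c ac; apply: smoothc_sum; first exact: image_open.
by move=> i /h /(smoothC_onE _ oU)/(_ c ac).
Qed.

Lemma smoothC_on_prod (I : Type) (r : seq I) (P : pred I) (F : I -> M -> C) :
  (forall i, P i -> smoothC_on U (F i)) -> smoothC_on U (fun q => \prod_(i <- r | P i) F i q).
Proof.
move=> h; apply/smoothC_onE => // c ac; apply: smoothc_prod; first exact: image_open.
by move=> i /h /(smoothC_onE _ oU)/(_ c ac).
Qed.

End closure.

Lemma smoothC_on_real U (f : M -> R) : open U -> smooth_on U f ->
  smoothC_on U (fun q => (f q)%:C%C).
Proof.
by move=> oU h; split=> //; apply/smooth_onE => // c ac; apply: smooth_cst; exact: image_open.
Qed.

Lemma smooth_on_map c j : atlas c -> smooth_on (chart_dom c) (fun q => chart_map c q 0 j).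
Proof.
move=> ac; apply/(smooth_on_chart _ ac) => //; first exact: dom_open.
have oi := img_open ac.
apply: (smooth_ext oi _ (smooth_coord oi j)) => x cx /=.
by case: (chart_img_inv (atlas_chart ac) cx) => _ ->.
Qed.

Lemma atlas_new_chart c W O f g : atlas c -> W `<=` chart_img c -> diffeo W O f g ->
  atlas (new_chart c W f g) /\ chart_img (new_chart c W f g) = O.
Proof.
move=> ac Wc D; have hc := atlas_chart ac.
have [oD oI K cm ci] := hc.
have [oW oO sf sg fW gO gf fg] := D.
have iE : chart_img (new_chart c W f g) = O.
  apply/seteqP; split=> [_ [q [cq Wq] <-]|x Ox]; first exact: fW.
  have [h1 h2] := chart_img_inv hc (Wc _ (gO _ Ox)).
  exists (chart_inv c (g x)); first by split=> //=; rewrite h2; exact: gO.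
  by rewrite /= h2 fg.
split=> //; apply: atlas_maximal.
  split.
  - exact: chart_preimage_open.
  - by rewrite iE.
  - by move=> q [cq Wq] /=; rewrite gf// K.
  - rewrite continuous_open_subspace; last exact: chart_preimage_open.
    move=> q; rewrite inE => -[cq Wq].
    move: cm; rewrite continuous_open_subspace// => /(_ q); rewrite inE => /(_ cq) cm.
    exact: (cvg_comp _ _ cm (smoothv_cvg sf Wq)).
  - rewrite iE continuous_open_subspace// => x; rewrite inE => Ox.
    move: ci; rewrite continuous_open_subspace// => /(_ (g x)); rewrite inE => /(_ (Wc _ (gO _ Ox))) ci.
    exact: (cvg_comp _ _ (smoothv_cvg sg Ox) ci).
move=> d ad; split=> j.
  set X := _ @` _.
  have XE : X = O `&` g @^-1` (chart_map c @` (chart_dom c `&` chart_dom d)).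
    apply/seteqP; split=> [_ [q [[cq Wq] dq] <-]|x [Ox [q [cq dq] e]]].
      by split; [exact: fW|exists q => //=; rewrite gf].
    exists q; first by split=> //; split=> //=; rewrite e; exact: gO.
    by rewrite /= e fg.
  have oX' := transition_smooth ac ad.
  have oim : open (chart_map c @` (chart_dom c `&` chart_dom d)).
    by rewrite setIC; exact: image_open ac (dom_open ad).
  have oX : open X by rewrite XE; exact: open_preimage.
  apply/smooth_rVP => //.
  apply: (smooth_comp (F := g) oX oim _ _ (transition_smooth ac ad j)).
  - by rewrite XE => x [].
  - by move=> i; apply: smooth_subset (sg i); rewrite XE => x [].
set X := _ @` _.
have oN : open (chart_dom c `&` chart_map c @^-1` W) by exact: chart_preimage_open.
have oX : open X by rewrite /X setIC; exact: image_open.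
apply/smooth_rVP => //.
apply: (smooth_comp (F := chart_map c \o chart_inv d) oX oW _ _ (sf j)).
- by move=> _ [q [dq [cq Wq]] <-]; rewrite /= invmapK.
- move=> i; apply: smooth_subset (transition_smooth ad ac i) => _ [q [dq [cq _]] <-].
  by exists q.
Qed.

Lemma pderiv_chart c d U (f : M -> R) j q : atlas c -> atlas d -> open U -> U q ->
  chart_dom c q -> chart_dom d q -> smooth_on U f ->
  pderiv c j f q = \sum_i pderiv d i f q * jac c d q i j.
Proof.
move=> ac ad oU Uq cq dq sf.
have oV : open (chart_dom d `&` chart_dom c) by apply: openI; exact: dom_open.
have oUV : open (U `&` (chart_dom d `&` chart_dom c)) by exact: openI.
pose X := chart_map c @` (U `&` (chart_dom d `&` chart_dom c)).
have oX : open X by rewrite /X setIA; exact: image_open ac (openI oU (dom_open ad)).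
have Xq : X (chart_map c q) by exists q.
have fd : differentiable (f \o chart_inv d) (chart_map d q).
  have := (smooth_onE _ oU).1 sf d ad => /smooth_diff; apply; by exists q.
have td i : differentiable (fun x => (chart_map d \o chart_inv c) x 0 i) (chart_map c q).
  by apply: smooth_diff (transition_smooth ac ad i) _; exists q.
have dE : chart_map d q = (chart_map d \o chart_inv c) (chart_map c q) by rewrite /= invmapK.
rewrite dE in fd.
rewrite /pderiv.
transitivity ('D_(delta_mx 0 j) ((f \o chart_inv d) \o (chart_map d \o chart_inv c)) (chart_map c q)).
  apply: near_eq_derive; apply: (near_open oX Xq) => _ [y [Uy [dy cy]] <-] /=.
  by rewrite !invmapK.
rewrite derive_comp_rV//; apply: eq_bigr => i _.
by rewrite -dE [in RHS]mxE /pderiv.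
Qed.

Lemma jac_comp c d e q : atlas c -> atlas d -> atlas e ->
  chart_dom c q -> chart_dom d q -> chart_dom e q -> jac c e q = jac d e q *m jac c d q.
Proof.
move=> ac ad ae cq dq eq; apply/matrixP => i j; rewrite [LHS]mxE [RHS]mxE.
rewrite (pderiv_chart j ac ad (dom_open ae) eq cq dq (smooth_on_map i ae)).
by apply: eq_bigr => k _; rewrite [jac d e q i k]mxE.
Qed.

Lemma smooth_on_pderiv c U (f : M -> R) i : atlas c -> open U -> U `<=` chart_dom c ->
  smooth_on U f -> smooth_on U (pderiv c i f).
Proof.
move=> ac oU Uc /(smooth_on_chart _ ac oU Uc) sf; apply/(smooth_on_chart _ ac oU Uc).
have oi := chart_image_open (atlas_chart ac) oU Uc.
apply: (smooth_ext oi _ (smooth_der i sf)) => _ [q Uq <-] /=.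
by rewrite /pderiv invmapK//; exact: Uc.
Qed.

Lemma smooth_on_jac c d i j : atlas c -> atlas d ->
  smooth_on (chart_dom c `&` chart_dom d) (fun q => jac c d q i j).
Proof.
move=> ac ad.
have -> : (fun q => jac c d q i j) = pderiv c j (fun q => chart_map d q 0 i).
  by apply/funext => q; rewrite mxE.
apply: smooth_on_pderiv => //.
- by apply: openI; exact: dom_open.
- by apply: smooth_on_subset (smooth_on_map i ad) => q [].
Qed.

End Manifold.

Local Notation contract := Defs.contract.

(** * Exterior algebra in dimension four *)

Section ExtGeneral.
Context {R : realType} {n : nat}.
Local Notation C := R[i].
Local Notation ext := (ext R n).
Implicit Types (u v w : ext) (I J K : {set 'I_n}) (i j k : 'I_n) (X : 'cV[C]_n).

Lemma ext_sign0r I : ext_sign I finset.set0 = 1 :> C.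
Proof.
rewrite /ext_sign (_ : [set _ | _]%SET = finset.set0) ?cards0 ?expr0//.
by apply/setP => p; rewrite !inE andbF.
Qed.

Lemma ext_sign11 i j : ext_sign [set i]%SET [set j]%SET = (-1) ^+ (j < i)%N :> C.
Proof.
rewrite /ext_sign; congr (_ ^+ _); have [ji|ji] := boolP (j < i)%N.
  rewrite (_ : [set _ | _]%SET = [set (i, j)]%SET) ?cards1//.
  apply/setP => -[a b]; rewrite !inE xpair_eqE /=.
  by case: eqP => //= ->; case: eqP => //= ->; rewrite ji.
rewrite (_ : [set _ | _]%SET = finset.set0) ?cards0//.
apply/setP => -[a b]; rewrite !inE /=.
by case: eqP => //= ->; case: eqP => //= ->; rewrite (negbTE ji).
Qed.

(** The degree-two part as a skew matrix. Coefficients are indexed by unordered pairs, hence the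
    sign when j < i. *)
Definition cmp2 w : 'M[C]_n :=
  \matrix_(i, j) (if i == j then 0 else (-1) ^+ (j < i)%N * w [set i; j]%SET).

Lemma cmp2_skew w i j : cmp2 w j i = - cmp2 w i j.
Proof.
rewrite !mxE eq_sym; case: eqP => [_|/eqP ij]; first by rewrite oppr0.
rewrite finset.setUC; have [h|h|/val_inj h] := ltngtP i j.
- by rewrite expr0 expr1 mul1r mulN1r.
- by rewrite expr0 expr1 mul1r mulN1r opprK.
- by rewrite h eqxx in ij.
Qed.

Lemma cmp2_diag w i : cmp2 w i i = 0.
Proof. by rewrite mxE eqxx. Qed.

Lemma covec1 (xi : 'cV[C]_n) i : covec xi [set i]%SET = xi i 0.
Proof.
rewrite ffunE (bigD1 i)//= big1 ?addr0// => j /andP[/eqP/set1_inj ->].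
by rewrite eqxx.
Qed.

Lemma covec_card (xi : 'cV[C]_n) K : #|K| != 1%N -> covec xi K = 0.
Proof. by move=> h; rewrite ffunE big1// => i /eqP e; rewrite e cards1 eqxx in h. Qed.

Lemma ext_contract0 X w : contract X w finset.set0 = \sum_i X i 0 * w [set i]%SET.
Proof.
rewrite ffunE; apply: eq_big => [i|i _]; first by rewrite finset.inE.
by rewrite ext_sign0r mul1r finset.setU0.
Qed.

Lemma ext_contract1 X w k : contract X w [set k]%SET = \sum_i X i 0 * cmp2 w i k.
Proof.
rewrite ffunE [RHS](bigID (mem [set k]%SET) predT)/= [X in _ = X + _]big1 ?add0r => [|i].
  apply: eq_bigr => i; rewrite finset.inE => ik.
  by rewrite mxE (negbTE ik) ext_sign11 -mulrA mulrCA.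
by rewrite finset.inE => /eqP ->; rewrite cmp2_diag mulr0.
Qed.

Lemma wedge_covec0 xi w : wedge (covec xi) w finset.set0 = 0.
Proof.
by rewrite ffunE big1// => I; rewrite finset.subset0 => /eqP ->; rewrite covec_card ?cards0// mulr0 mul0r.
Qed.

Lemma wedge_covec1 xi w k : wedge (covec xi) w [set k]%SET = xi k 0 * w finset.set0.
Proof.
rewrite ffunE (bigD1 [set k]%SET)//= finset.setDv ext_sign0r mul1r covec1 big1 ?addr0// => I.
rewrite finset.subset1 => /andP[/orP[/eqP->|/eqP->]]; first by rewrite eqxx.
by rewrite covec_card ?cards0// mulr0 mul0r.
Qed.

Lemma clifford0 (v : 'cV[C]_(n + n)) w : clifford v w finset.set0 = \sum_i usubmx v i 0 * w [set i]%SET.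
Proof. by rewrite /clifford ffunE ext_contract0 wedge_covec0 addr0. Qed.

Lemma clifford1 (v : 'cV[C]_(n + n)) w k : clifford v w [set k]%SET =
  \sum_i usubmx v i 0 * cmp2 w i k + dsubmx v k 0 * w finset.set0.
Proof. by rewrite /clifford ffunE ext_contract1 wedge_covec1. Qed.

Definition homog (k : nat) w := forall K, #|K| != k -> w K = 0.

Lemma homog_wedge (k l : nat) u v : homog k u -> homog l v -> homog (k + l) (wedge u v).
Proof.
move=> hu hv K hK; rewrite ffunE big1// => I IK.
have [e|e] := eqVneq #|I| k; last by rewrite hu// mulr0 mul0r.
rewrite hv ?mulr0//; apply: contra hK => /eqP e'.
by rewrite -(finset.cardsID I K) finset.setIC (finset.setIidPl IK) e e' eqxx.
Qed.

Lemma homog_ext1 : homog 0 (ext1 : ext).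
Proof. by move=> K; rewrite cards_eq0 ffunE => /negbTE ->. Qed.

Lemma homog_covec xi : homog 1 (covec xi).
Proof. by move=> K; exact: covec_card. Qed.

Lemma homog_wedges (k : nat) (s : seq ext) : (forall u, u \in s -> homog k u) ->
  homog (size s * k) (wedges s).
Proof.
elim: s => [|u s IH] h; first exact: homog_ext1.
rewrite /= mulSn; apply: homog_wedge; first by apply: h; rewrite inE eqxx.
by apply: IH => v vs; apply: h; rewrite inE vs orbT.
Qed.

Lemma homog_top (k : nat) u : homog k u -> (n < k)%N -> u = 0.
Proof.
move=> hu nk; apply/ffunP => K; rewrite hu ?ffunE//.
by rewrite neq_ltn (leq_ltn_trans _ nk)// -[X in (_ <= X)%N]card_ord max_card.
Qed.

Lemma wedgeZl a u v : wedge (ext_scale a u) v = ext_scale a (wedge u v).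
Proof.
apply/ffunP => K; rewrite !ffunE mulr_sumr; apply: eq_bigr => I _.
by rewrite ffunE; ring.
Qed.

Lemma wedgeZr a u v : wedge u (ext_scale a v) = ext_scale a (wedge u v).
Proof.
apply/ffunP => K; rewrite !ffunE mulr_sumr; apply: eq_bigr => I _.
by rewrite ffunE; ring.
Qed.

Lemma ext_contractZ a X u : contract X (ext_scale a u) = ext_scale a (contract X u).
Proof.
apply/ffunP => K; rewrite !ffunE mulr_sumr; apply: eq_bigr => I _.
by rewrite ffunE; ring.
Qed.

Lemma ext_scaleD a u v : ext_scale a (u + v) = ext_scale a u + ext_scale a v.
Proof. by apply/ffunP => K; rewrite !ffunE mulrDr. Qed.

Lemma ext_scaleA a b u : ext_scale a (ext_scale b u) = ext_scale (a * b) u.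
Proof. by apply/ffunP => K; rewrite !ffunE mulrA. Qed.

Lemma cliffordZ a (v : 'cV[C]_(n + n)) w : clifford v (ext_scale a w) = ext_scale a (clifford v w).
Proof. by rewrite /clifford ext_contractZ wedgeZr ext_scaleD. Qed.

Lemma covecZ a (xi : 'cV[C]_n) : covec (a *: xi) = ext_scale a (covec xi).
Proof.
apply/ffunP => K; rewrite !ffunE mulr_sumr; apply: eq_bigr => i _.
by rewrite mxE.
Qed.

Lemma ext_pullZ A a w : ext_pull A (ext_scale a w) = ext_scale a (ext_pull A w).
Proof.
rewrite /ext_pull; apply/ffunP => K; rewrite ffunE !sum_ffunE mulr_sumr.
by apply: eq_bigr => I _; rewrite !ffunE mulrA.
Qed.

Lemma ext_pull_homog A w K : ext_pull A w K =
  \sum_(I : {set 'I_n} | #|I| == #|K|) w I * wedges [seq covec (row i A)^T | i <- enum I] K.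
Proof.
rewrite /ext_pull sum_ffunE (bigID (fun I : {set 'I_n} => #|I| == #|K|))/= [X in _ + X]big1 ?addr0.
  by apply: eq_bigr => I _; rewrite ffunE.
move=> I hI; rewrite ffunE.
have h : homog (#|I| * 1) (wedges [seq covec (row i A)^T | i <- enum I]).
  have := @homog_wedges 1%N [seq covec (row i A)^T | i <- enum I]; rewrite size_map -cardE; apply.
  by move=> u /mapP[i _ ->]; exact: homog_covec.
by rewrite h ?mulr0// muln1 eq_sym.
Qed.

Lemma ext_pull0 A w : ext_pull A w finset.set0 = w finset.set0.
Proof.
rewrite ext_pull_homog (bigD1 finset.set0)//= enum_set0/= ffunE eqxx mulr1 big1 ?addr0// => I.
by rewrite cards0 cards_eq0 => /andP[/eqP ->]; rewrite eqxx.
Qed.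

End ExtGeneral.

Section Ext4.
Context {R : realType}.
Local Notation C := R[i].
Local Notation ext := (ext R 4).

Definition o0 : 'I_4 := inord 0. Definition o1 : 'I_4 := inord 1.
Definition o2 : 'I_4 := inord 2. Definition o3 : 'I_4 := inord 3.

Lemma val_o : ((o0 : nat) = 0%N) * ((o1 : nat) = 1%N) * ((o2 : nat) = 2%N) * ((o3 : nat) = 3%N).
Proof. by rewrite /o0 /o1 /o2 /o3 !inordK. Qed.

Lemma ord4_cases (P : 'I_4 -> Prop) : P o0 -> P o1 -> P o2 -> P o3 -> forall i, P i.
Proof.
move=> p0 p1 p2 p3 i; have e k (h : (k < 4)%N) : nat_of_ord i = k -> i = inord k.
  by move=> ik; apply: val_inj; rewrite /= inordK.
by case: i e => -[|[|[|[|//]]]] h e; rewrite (e _ _ erefl).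
Qed.

Lemma enum4 : enum 'I_4 = [:: o0; o1; o2; o3].
Proof.
apply: (inj_map val_inj); rewrite val_enum_ord /=.
by rewrite !val_o.
Qed.

Lemma sum4 (V : nmodType) (F : 'I_4 -> V) : \sum_i F i = F o0 + F o1 + F o2 + F o3.
Proof. by rewrite -big_enum /= enum4 !big_cons big_nil addr0 !addrA. Qed.

(** Subsets encoded by four booleans: sums over subsets become sums over booleans, while unions,
    cardinals and signs become computable. *)
Definition st (b0 b1 b2 b3 : bool) : {set 'I_4} :=
  [set i : 'I_4 | nth false [:: b0; b1; b2; b3] i].

Lemma in_st b0 b1 b2 b3 : ((o0 \in st b0 b1 b2 b3) = b0) * ((o1 \in st b0 b1 b2 b3) = b1) *
  ((o2 \in st b0 b1 b2 b3) = b2) * ((o3 \in st b0 b1 b2 b3) = b3).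
Proof. by rewrite !finset.inE !val_o. Qed.

Lemma st_eta (K : {set 'I_4}) : K = st (o0 \in K) (o1 \in K) (o2 \in K) (o3 \in K).
Proof. by apply/setP; apply: ord4_cases; rewrite !in_st. Qed.

Lemma sum_st (V : nmodType) (F : {set 'I_4} -> V) :
  \sum_K F K = \sum_b0 \sum_b1 \sum_b2 \sum_b3 F (st b0 b1 b2 b3).
Proof.
rewrite !pair_bigA /= (reindex (fun p : bool * bool * bool * bool => st p.1.1.1 p.1.1.2 p.1.2 p.2)) /=.
  exact: eq_bigr.
exists (fun K : {set 'I_4} => (o0 \in K, o1 \in K, o2 \in K, o3 \in K)) => [[[[a b] c] d] _|K _] /=.
  by rewrite !in_st.
by rewrite -st_eta.
Qed.

Lemma subset_st a0 a1 a2 a3 b0 b1 b2 b3 : (st a0 a1 a2 a3 \subset st b0 b1 b2 b3) =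
  [&& a0 ==> b0, a1 ==> b1, a2 ==> b2 & a3 ==> b3].
Proof.
apply/fintype.subsetP/idP => [h|/and4P[/implyP h0 /implyP h1 /implyP h2 /implyP h3]].
  have := h o0; have := h o1; have := h o2; have := h o3; rewrite !in_st.
  by move=> /implyP-> /implyP-> /implyP-> /implyP->.
by apply: ord4_cases; rewrite !in_st.
Qed.

Lemma setD_st a0 a1 a2 a3 b0 b1 b2 b3 : st a0 a1 a2 a3 :\: st b0 b1 b2 b3 =
  st (~~ b0 && a0) (~~ b1 && a1) (~~ b2 && a2) (~~ b3 && a3).
Proof. by rewrite [LHS]st_eta !finset.in_setD !in_st. Qed.

Lemma sign_st a0 a1 a2 a3 b0 b1 b2 b3 : ext_sign (st a0 a1 a2 a3) (st b0 b1 b2 b3) =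
  (-1) ^+ (a1 && b0 + (a2 && b0 + a2 && b1) + (a3 && b0 + a3 && b1 + a3 && b2))%N :> C.
Proof.
rewrite /ext_sign; congr (_ ^+ _).
rewrite -sum1dep_card big_mkcond /= -(pair_bigA _ (fun i j : 'I_4 =>
  if [&& i \in st a0 a1 a2 a3, j \in st b0 b1 b2 b3 & (j < i)%N] then 1%N else 0%N)) /=.
have s4 (F : 'I_4 -> nat) : (\sum_i F i = F o0 + F o1 + F o2 + F o3)%N by exact: sum4.
rewrite !s4 !in_st !val_o /=.
by case: a0; case: a1; case: a2; case: a3; case: b0; case: b1; case: b2; case: b3.
Qed.

Lemma set1_st : ([set o0]%SET = st true false false false) * ([set o1]%SET = st false true false false) *
  ([set o2]%SET = st false false true false) * ([set o3]%SET = st false false false true).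
Proof.
have e (k l : 'I_4) : (k == l) = (k == l :> nat) by [].
by do ![split]; rewrite [LHS]st_eta !finset.in_set1 !e !val_o.
Qed.

Lemma set0_st : finset.set0 = st false false false false.
Proof. by rewrite [LHS]st_eta !finset.inE. Qed.

Lemma set2_st : ([set o0; o1]%SET = st true true false false) * ([set o0; o2]%SET = st true false true false) *
  ([set o0; o3]%SET = st true false false true) * ([set o1; o2]%SET = st false true true false) *
  ([set o1; o3]%SET = st false true false true) * ([set o2; o3]%SET = st false false true true).
Proof.
have e (k l : 'I_4) : (k == l) = (k == l :> nat) by [].
by do ![split]; rewrite [LHS]st_eta !finset.in_set2 !e !val_o.
Qed.

Lemma card_st b0 b1 b2 b3 : #|st b0 b1 b2 b3| = (b0 + b1 + b2 + b3)%N.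
Proof.
rewrite -sum1_card big_mkcond /=.
have s4 (F : 'I_4 -> nat) : (\sum_i F i = F o0 + F o1 + F o2 + F o3)%N by exact: sum4.
by rewrite s4 !in_st; case: b0; case: b1; case: b2; case: b3.
Qed.

Lemma enum_st b0 b1 b2 b3 : enum (st b0 b1 b2 b3) = mask [:: b0; b1; b2; b3] [:: o0; o1; o2; o3].
Proof.
have -> : enum (st b0 b1 b2 b3) = [seq i <- enum 'I_4 | i \in st b0 b1 b2 b3].
  by rewrite [enum 'I_4]enumT.
rewrite enum4 /= !in_st.
by case: b0; case: b1; case: b2; case: b3.
Qed.

(* the even form with components s, (a_ij)_{i<j} and t *)
Definition ev (s : C) (a : 'I_4 -> 'I_4 -> C) (t : C) : ext :=
  [ffun K : {set 'I_4} => (match o0 \in K, o1 \in K, o2 \in K, o3 \in K with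
   | false, false, false, false => s
   | true, true, false, false => a o0 o1 | true, false, true, false => a o0 o2
   | true, false, false, true => a o0 o3 | false, true, true, false => a o1 o2
   | false, true, false, true => a o1 o3 | false, false, true, true => a o2 o3
   | true, true, true, true => t | _, _, _, _ => 0 end : C)].

(** The top coefficient of the wedge of two two-forms; [pf2 a a] is twice the Pfaffian. *)
Definition pf2 (a b : 'I_4 -> 'I_4 -> C) : C :=
  a o0 o1 * b o2 o3 - a o0 o2 * b o1 o3 + a o0 o3 * b o1 o2
  + a o1 o2 * b o0 o3 - a o1 o3 * b o0 o2 + a o2 o3 * b o0 o1.

Lemma ext4P (u v : ext) : (forall b0 b1 b2 b3, u (st b0 b1 b2 b3) = v (st b0 b1 b2 b3)) -> u = v.
Proof. by move=> h; apply/ffunP => K; rewrite (st_eta K). Qed.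

Lemma wedge_st (u v : ext) k0 k1 k2 k3 : wedge u v (st k0 k1 k2 k3) =
  \sum_b0 \sum_b1 \sum_b2 \sum_b3
    (if [&& b0 ==> k0, b1 ==> k1, b2 ==> k2 & b3 ==> k3] then
      (-1) ^+ (b1 && (~~ b0 && k0) + (b2 && (~~ b0 && k0) + b2 && (~~ b1 && k1))
         + (b3 && (~~ b0 && k0) + b3 && (~~ b1 && k1) + b3 && (~~ b2 && k2)))%N
      * u (st b0 b1 b2 b3) * v (st (~~ b0 && k0) (~~ b1 && k1) (~~ b2 && k2) (~~ b3 && k3))
    else 0).
Proof.
rewrite ffunE big_mkcond sum_st.
by do 4![apply: eq_bigr => ? _]; rewrite subset_st setD_st sign_st.
Qed.

Lemma wedge_ev s a t s' a' t' : wedge (ev s a t) (ev s' a' t') =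
  ev (s * s') (fun i j => s * a' i j + a i j * s') (s * t' + t * s' + pf2 a a').
Proof.
apply: ext4P => k0 k1 k2 k3; rewrite wedge_st !big_bool /=.
by case: k0; case: k1; case: k2; case: k3; rewrite /= ?ffunE ?in_st /pf2 /=
  ?expr0 ?expr1 ?expr2; ring.
Qed.

Lemma covec_st (xi : 'cV[C]_4) b0 b1 b2 b3 : covec xi (st b0 b1 b2 b3) =
  match b0, b1, b2, b3 with
  | true, false, false, false => xi o0 0 | false, true, false, false => xi o1 0
  | false, false, true, false => xi o2 0 | false, false, false, true => xi o3 0
  | _, _, _, _ => 0 end.
Proof.
case: b0; case: b1; case: b2; case: b3; rewrite -?set1_st ?covec1//;
  by rewrite covec_card// card_st.
Qed.

Lemma ext1_ev : ext1 = ev 1 (fun _ _ => 0) 0.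
Proof.
apply: ext4P => b0 b1 b2 b3; rewrite !ffunE !in_st.
have -> : (st b0 b1 b2 b3 == finset.set0) = ~~ [|| b0, b1, b2 | b3].
  rewrite -cards_eq0 card_st.
  by case: b0; case: b1; case: b2; case: b3.
by case: b0; case: b1; case: b2; case: b3.
Qed.

Lemma ext_scale_ev x s a t : ext_scale x (ev s a t) = ev (x * s) (fun i j => x * a i j) (x * t).
Proof.
apply: ext4P => b0 b1 b2 b3; rewrite !ffunE !in_st.
by case: b0; case: b1; case: b2; case: b3; rewrite ?mulr0.
Qed.

Lemma ev_add s a t s' a' t' : ev s a t + ev s' a' t' = ev (s + s') (fun i j => a i j + a' i j) (t + t').
Proof.
apply: ext4P => b0 b1 b2 b3; rewrite !ffunE !in_st.
by case: b0; case: b1; case: b2; case: b3; rewrite ?addr0.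
Qed.

Lemma ev_ext s a t s' a' t' : s = s' -> (forall i j, a i j = a' i j) -> t = t' ->
  ev s a t = ev s' a' t'.
Proof.
by move=> -> h ->; apply: ext4P => b0 b1 b2 b3; rewrite !ffunE !in_st !h.
Qed.

Lemma ext_exp_ev b : ext_exp (ev 0 b 0) = ev 1 b (pf2 b b / 2).
Proof.
rewrite /ext_exp !big_ord_recr big_ord0 /= ext1_ev !wedge_ev !ext_scale_ev add0r !ev_add.
apply: ev_ext => [|i j|]; rewrite /pf2 ?factS ?fact0 ?muln1 ?invr1; [by field|by field|].
by field.
Qed.

Definition th (x y : 'cV[C]_4) (i j : 'I_4) : C := x i 0 * y j 0 - x j 0 * y i 0.

Lemma wedge_covec2 (x y : 'cV[C]_4) : wedge (covec x) (covec y) = ev 0 (th x y) 0.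
Proof.
apply: ext4P => k0 k1 k2 k3; rewrite wedge_st !big_bool /=.
by case: k0; case: k1; case: k2; case: k3; rewrite /= ?covec_st /= ffunE !in_st /th
  ?expr0 ?expr1 ?expr2; ring.
Qed.

Lemma spinor_ev b s (x y : 'cV[C]_4) :
  wedge (ext_exp (ev 0 b 0)) (ext_scale s ext1 + wedge (covec x) (covec y)) =
  ev s (fun i j => s * b i j + th x y i j) (s * (pf2 b b / 2) + pf2 b (th x y)).
Proof.
rewrite ext_exp_ev wedge_covec2 ext1_ev ext_scale_ev ev_add wedge_ev.
by apply: ev_ext => [|i j|]; rewrite /pf2; ring.
Qed.

Lemma cmp2_lt (w : ext) (i j : 'I_4) : (i < j)%N -> w [set i; j]%SET = cmp2 w i j.
Proof.
move=> ij; rewrite mxE ifN; last by rewrite -val_eqE neq_ltn ij.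
by rewrite ltnNge (ltnW ij) expr0 mul1r.
Qed.

Lemma cmp2_ev s a t : (forall i j, a j i = - a i j) -> forall i j, cmp2 (ev s a t) i j = a i j.
Proof.
move=> sk.
have d i : a i i = 0.
  by have /eqP := sk i i; rewrite -subr_eq0 opprK -mulr2n mulrn_eq0 => /eqP.
have L : forall i j : 'I_4, (i < j)%N -> cmp2 (ev s a t) i j = a i j.
  by apply: ord4_cases; apply: ord4_cases; rewrite !val_o// => _;
    rewrite -cmp2_lt ?val_o// set2_st ffunE !in_st.
move=> i j; have [h|h|/val_inj h] := ltngtP i j; first exact: L.
  by rewrite cmp2_skew L// sk opprK.
by rewrite h cmp2_diag d.
Qed.

Lemma ev_eta (w : ext) : (forall i, w [set i]%SET = 0) -> (forall K : {set 'I_4}, #|K| = 3%N -> w K = 0) ->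
  w = ev (w finset.set0) (cmp2 w) (w (st true true true true)).
Proof.
move=> h1 h3; apply: ext4P => b0 b1 b2 b3; rewrite ffunE !in_st.
by case: b0; case: b1; case: b2; case: b3; rewrite ?set0_st// -?set1_st ?h1//
  -?set2_st ?cmp2_lt ?val_o//; apply: h3; rewrite card_st.
Qed.

Lemma ext_pull2 (A : 'M[C]_4) w (k l : 'I_4) : (k < l)%N ->
  ext_pull A w [set k; l]%SET = \sum_i \sum_j A i k * cmp2 w i j * A j l.
Proof.
move=> kl; have kl' : k != l by rewrite -val_eqE neq_ltn kl.
rewrite ext_pull_homog cards2 kl' /= big_mkcond sum_st.
rewrite !big_bool /= !card_st /= !addr0 !add0r !enum_st /=.
have W (i j : 'I_4) : wedge (covec (row i A)^T) (wedge (covec (row j A)^T) ext1) [set k; l]%SET =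
    A i k * A j l - A i l * A j k.
  have -> : wedge (covec (row j A)^T) ext1 = covec (row j A)^T.
    apply: ext4P => k0 k1 k2 k3; rewrite wedge_st !big_bool /= ext1_ev !ffunE !in_st.
    by case: k0; case: k1; case: k2; case: k3; rewrite /= ?covec_st /= ?ffunE ?in_st /= ?expr0 ?expr1 ?expr2; ring.
  rewrite wedge_covec2 cmp2_lt// cmp2_ev /th => [|i' j']; last by ring.
  by rewrite !mxE.
rewrite !W -!set2_st !cmp2_lt ?val_o// !sum4 !cmp2_diag.
rewrite (cmp2_skew w o0 o1) (cmp2_skew w o0 o2) (cmp2_skew w o0 o3).
by rewrite (cmp2_skew w o1 o2) (cmp2_skew w o1 o3) (cmp2_skew w o2 o3); ring.
Qed.

Lemma cmp2_pull (A : 'M[C]_4) w : cmp2 (ext_pull A w) = A^T *m cmp2 w *m A.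
Proof.
have E k l : (A^T *m cmp2 w *m A) k l = \sum_i \sum_j A i k * cmp2 w i j * A j l.
  rewrite mxE exchange_big; apply: eq_bigr => j _; rewrite mxE mulr_suml.
  by apply: eq_bigr => i _; rewrite mxE.
have sk k l : (A^T *m cmp2 w *m A) l k = - (A^T *m cmp2 w *m A) k l.
  rewrite !E exchange_big -sumrN; apply: eq_bigr => i _; rewrite -sumrN; apply: eq_bigr => j _.
  by rewrite cmp2_skew; ring.
have L (k l : 'I_4) : (k < l)%N -> cmp2 (ext_pull A w) k l = (A^T *m cmp2 w *m A) k l.
  by move=> kl; rewrite -cmp2_lt// ext_pull2// E.
apply/matrixP => k l; have [h|h|/val_inj h] := ltngtP k l; first exact: L.
  by rewrite cmp2_skew L// sk opprK.
rewrite h cmp2_diag; have /eqP := sk l l.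
by rewrite -subr_eq0 opprK -mulr2n mulrn_eq0 => /eqP.
Qed.

Lemma ext_pull_ev (A : 'M[C]_4) a : (forall i j, a j i = - a i j) ->
  ext_pull A (ev 0 a 0) = ev 0 (A^T *m (\matrix_(i, j) a i j) *m A) 0.
Proof.
move=> sk; have e : cmp2 (ev 0 a 0) = \matrix_(i, j) a i j.
  by apply/matrixP => i j; rewrite cmp2_ev// mxE.
have Z (K : {set 'I_4}) : #|K| != 2%N -> ext_pull A (ev 0 a 0) K = 0.
  move=> hK; rewrite ext_pull_homog big1// => I /eqP IK.
  have : #|I| != 2%N by rewrite IK.
  rewrite (st_eta I) card_st ffunE !in_st.
  by case: (o0 \in I); case: (o1 \in I); case: (o2 \in I); case: (o3 \in I) => //= _; rewrite mul0r.
rewrite [LHS]ev_eta ?cmp2_pull ?e ?Z// ?cards0// ?card_st//.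
- by move=> i; rewrite Z// cards1.
- by move=> K hK; rewrite Z// hK.
Qed.

Lemma contract_delta (w : ext) i K : contract (delta_mx i 0) w K =
  if i \in K then 0 else ext_sign [set i]%SET K * w (i |: K).
Proof.
rewrite ffunE; case: ifPn => iK.
  by rewrite big1// => j jK; rewrite mxE andbT; case: eqP => [e|]; [rewrite e iK in jK|rewrite mulr0 mul0r].
rewrite (bigD1 i)//= mxE !eqxx mulr1 big1 ?addr0// => j /andP[_ /negbTE ji].
by rewrite mxE ji mulr0 mul0r.
Qed.

(* that is, [w = w_0 exp (w_2 / w_0)] *)
Lemma annihilated_ev (w : ext) (z : 'I_4 -> 'cV[C]_4) : w finset.set0 != 0 ->
  (forall i, clifford (col_mx (delta_mx i 0) (z i)) w = 0) ->
  (forall i k, z i k 0 = - cmp2 w i k / w finset.set0) /\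
  w = ev (w finset.set0) (cmp2 w) (pf2 (cmp2 w) (cmp2 w) / 2 / w finset.set0).
Proof.
move=> w0 hw.
have h1 i : w [set i]%SET = 0.
  have := congr1 (fun u : ext => u finset.set0) (hw i).
  rewrite clifford0 col_mxKu ffunE (bigD1 i)//= mxE !eqxx mul1r big1 ?addr0// => j /negbTE ji.
  by rewrite mxE ji mul0r.
have hz i k : z i k 0 = - cmp2 w i k / w finset.set0.
  have := congr1 (fun u : ext => u [set k]%SET) (hw i).
  rewrite clifford1 col_mxKu col_mxKd ffunE (bigD1 i)//= mxE !eqxx mul1r big1 ?addr0 => [|j /negbTE ji].
    by move/eqP; rewrite addrC addr_eq0 => /eqP e; rewrite -e mulfK.
  by rewrite mxE ji mul0r.
have C i K : contract (delta_mx i 0) w K + wedge (covec (z i)) w K = 0.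
  by have := congr1 (fun u : ext => u K) (hw i); rewrite /clifford col_mxKu col_mxKd !ffunE.
have S (b0 b1 b2 b3 c0 c1 c2 c3 : bool) :
    st b0 b1 b2 b3 :|: st c0 c1 c2 c3 = st (b0 || c0) (b1 || c1) (b2 || c2) (b3 || c3).
  by rewrite [LHS]st_eta !finset.in_setU !in_st.
have w1 : (w (st true false false false) = 0) * (w (st false true false false) = 0) *
    (w (st false false true false) = 0) * (w (st false false false true) = 0).
  by rewrite -!set1_st !h1.
(* In degree two of the Clifford action the contraction isolates one coefficient of degree three,
   while the covector meets only coefficients of degree one, which are zero by [h1]. *)
have h3 (K : {set 'I_4}) : #|K| = 3%N -> w K = 0.
  have c0 := C o0 (st false true true false); have c1 := C o0 (st false true false true).
  have c2 := C o0 (st false false true true); have c3 := C o1 (st false false true true).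
  rewrite !contract_delta !in_st !set1_st !S !sign_st !wedge_st !big_bool /= !covec_st !w1
    ?expr0 ?expr1 !(mulr0, mul0r, addr0, mul1r) in c0 c1 c2 c3.
  rewrite (st_eta K) card_st.
  by case: (o0 \in K); case: (o1 \in K); case: (o2 \in K); case: (o3 \in K).
split=> //; rewrite [LHS]ev_eta//; apply: ev_ext => //.
(* The coefficient on dx_1 dx_2 dx_3 of the action of the first frame vector determines the top
   coefficient as the Pfaffian divided by w_0. *)
have c4 := C o0 (st false true true true).
rewrite !contract_delta !in_st !set1_st !S !sign_st wedge_st !big_bool /= !covec_st
  ?expr0 ?expr1 ?expr2 !(mulr0, mul0r, addr0, add0r, mul1r) -!set2_st !hz !cmp2_lt ?val_o// in c4.
apply: (mulIf w0); rewrite divfK//.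
have {}c4 : w (st true true true true) * w finset.set0 = 
  cmp2 w o0 o1 * cmp2 w o2 o3 - cmp2 w o0 o2 * cmp2 w o1 o3 + cmp2 w o0 o3 * cmp2 w o1 o2.
  move/eqP: c4; rewrite addr_eq0 => /eqP ->; field; exact: w0.
by rewrite c4 /pf2; field.
Qed.

(** Entries indexed by natural numbers keep the same shape in the minors, so that the cofactor
    expansions can be evaluated. *)
Lemma det_minor n (f : nat -> nat -> C) (j0 : 'I_n.+1) :
  row' ord0 (col' j0 (\matrix_(i < n.+1, j < n.+1) f i j)) =
  \matrix_(i < n, j < n) f i.+1 (bump j0 j).
Proof. by apply/matrixP => i j; rewrite !mxE. Qed.

Lemma det_fun2 (f : nat -> nat -> C) :
  \det (\matrix_(i < 2, j < 2) f i j) = f 0%N 0%N * f 1%N 1%N - f 0%N 1%N * f 1%N 0%N.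
Proof.
rewrite (expand_det_row _ ord0) !big_ord_recl big_ord0 /cofactor !det_minor !det_mx11 !mxE /=.
by rewrite /bump /= expr0 expr1; ring.
Qed.

Lemma det_fun3 (f : nat -> nat -> C) :
  \det (\matrix_(i < 3, j < 3) f i j) =
  f 0%N 0%N * (f 1%N 1%N * f 2%N 2%N - f 1%N 2%N * f 2%N 1%N)
  - f 0%N 1%N * (f 1%N 0%N * f 2%N 2%N - f 1%N 2%N * f 2%N 0%N)
  + f 0%N 2%N * (f 1%N 0%N * f 2%N 1%N - f 1%N 1%N * f 2%N 0%N).
Proof.
rewrite (expand_det_row _ ord0) !big_ord_recl big_ord0 /cofactor !det_minor.
rewrite !(det_fun2 (fun i j => f i.+1 (bump _ j))) !mxE /=.
by rewrite /bump /= expr0 expr1 ?expr2; ring.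
Qed.

(** The Laplace expansion along the first two rows: the wedge of the four rows, grouped in pairs. *)
Lemma det4 (N : 'M[C]_4) : \det N =
  pf2 (th (row o0 N)^T (row o1 N)^T) (th (row o2 N)^T (row o3 N)^T).
Proof.
pose f (i j : nat) := N (inord i) (inord j).
have -> : \det N = \det (\matrix_(i < 4, j < 4) f i j).
  by congr (\det _); apply/matrixP => i j; rewrite mxE /f !inord_val.
rewrite (expand_det_row _ ord0) !big_ord_recl big_ord0 /cofactor !det_minor.
rewrite !(det_fun3 (fun i j => f i.+1 (bump _ j))) !mxE /=.
rewrite /pf2 /th !mxE /o0 /o1 /o2 /o3 /bump /= expr0 expr1 ?expr2.
have e i j : N (inord i) (inord j) = f i j by [].
by rewrite !e !exprS expr0; ring.
Qed.

End Ext4.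

(** * Local generators of the divisor *)

Section SmoothFunctions.
Context {R : realType} {n : nat} {M : smooth_manifold R n}.
Local Notation C := R[i].
Implicit Types (c : mchart M) (q : M) (U V : set M).

Lemma smooth_on_continuous U (f : M -> R) q : open U -> smooth_on U f -> U q ->
  {for q, continuous f}.
Proof.
move=> oU sf Uq; have [c ac cq] := atlas_cover q.
have W q' : (chart_map c @` (U `&` chart_dom c)) (chart_map c q') = (chart_map c @` (U `&` chart_dom c)) (chart_map c q') by [].
have cf := smooth_cont ((smooth_onE _ oU).1 sf c ac) (imageP _ (conj Uq cq)).
have cm : {for q, continuous (chart_map c)}.
  have [oD _ _ + _] := atlas_chart ac.
  by rewrite continuous_open_subspace// => /(_ q); rewrite inE => /(_ cq).
have cc : (f \o chart_inv c) (chart_map c q') @[q' --> q] --> (f \o chart_inv c) (chart_map c q).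
  exact: (cvg_comp _ _ cm cf).
rewrite /= invmapK// in cc; apply: cvg_trans cc; apply: near_eq_cvg.
apply: filterS (open_nbhs_nbhs (conj (dom_open ac) cq)) => q' cq' /=.
by rewrite invmapK.
Qed.

Lemma smooth_on_mul U (f g : M -> R) : open U -> smooth_on U f -> smooth_on U g ->
  smooth_on U (fun q => f q * g q).
Proof.
move=> oU /(smooth_onE _ oU) hf /(smooth_onE _ oU) hg; apply/smooth_onE => // c ac.
by apply: smooth_mul; [exact: image_open|exact: hf|exact: hg].
Qed.

Lemma smooth_on_add U (f g : M -> R) : open U -> smooth_on U f -> smooth_on U g ->
  smooth_on U (fun q => f q + g q).
Proof.
move=> oU /(smooth_onE _ oU) hf /(smooth_onE _ oU) hg; apply/smooth_onE => // c ac.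
by apply: smooth_add; [exact: image_open|exact: hf|exact: hg].
Qed.

Lemma open_neq0 U (f : M -> C) : open U -> smoothC_on U f -> open (U `&` [set q | f q != 0]).
Proof.
move=> oU [s1 s2].
pose g q := complex.Re (f q) * complex.Re (f q) + complex.Im (f q) * complex.Im (f q).
have sg : smooth_on U g by apply: smooth_on_add => //; exact: smooth_on_mul.
have e q : (f q != 0) = (g q != 0) by rewrite -sqr_norm_eq0.
rewrite openE => q [Uq fq]; rewrite /interior; apply: filterI; first exact: open_nbhs_nbhs.
have g0 : g q != 0 by rewrite -e.
have h := smooth_on_continuous oU sg Uq (open_nbhs_nbhs (conj (@open_neq _ 0) g0)).
suff -> : [set q | f q != 0] = g @^-1` [set x | x != 0] by exact: h.
by apply/funext => q'; rewrite /= e.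
Qed.

Section pderiv.
Variables (U : set M) (c : mchart M) (q : M).
Hypotheses (oU : open U) (ac : atlas c) (Uq : U q) (cq : chart_dom c q).
Implicit Types f g : M -> C.

Let X := chart_map c @` (U `&` chart_dom c).
Let oX : open X := image_open ac oU.
Let Xq : X (chart_map c q) := imageP _ (conj Uq cq).

Lemma pderivC_ext i f g : (forall q', U q' -> f q' = g q') -> pderivC c i f q = pderivC c i g q.
Proof.
by move=> h; apply: (dc_ext oX Xq) => _ [q' [Uq' cq'] <-] /=; rewrite invmapK// h.
Qed.

Lemma pderivC_mul i f g : smoothC_on U f -> smoothC_on U g ->
  pderivC c i (fun q => f q * g q) q = f q * pderivC c i g q + pderivC c i f q * g q.
Proof.
move=> /(smoothC_onE _ oU)/(_ c ac) sf /(smoothC_onE _ oU)/(_ c ac) sg.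
by have := dc_mul oX Xq i sf sg; rewrite /= invmapK.
Qed.

Lemma pderivC_conj i f : smoothC_on U f ->
  pderivC c i (fun q => (f q)^*%C) q = (pderivC c i f q)^*%C.
Proof. by move=> /(smoothC_onE _ oU)/(_ c ac) sf; have := dc_conj oX Xq i sf. Qed.

End pderiv.

Lemma compact_cball (x0 : 'rV[R]_n) r : compact [set x | `|x - x0| <= r].
Proof.
apply: bounded_closed_compact.
  exists (r + `|x0|); split; first exact: num_real.
  move=> m rm x /= hx; apply/ltW/(le_lt_trans _ rm).
  by rewrite -[x](subrK x0) (le_trans (ler_normD _ _))//; rewrite ?lerD2r//.
have : closed ((fun x => `|x - x0|) @^-1` [set t : R | t <= r]); last exact.
apply: preimage_closed => [x _|].
  have h : (fun y : 'rV[R]_n => y - x0) y @[y --> x] --> x - x0.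
    have hid : y @[y --> (x : 'rV[R]_n)] --> x by apply: cvg_id.
    exact: cvgB hid (cvg_cst _).
  exact: (cvg_norm h).
exact: closed_le.
Qed.

(** The ideals consist of functions given by dual sections over a whole open set, so a local frame
    must be cut off before it yields a member. Extension by zero is smooth because [K] is closed in
    M, being compact in a Hausdorff space. *)
Lemma bump_function p U : open U -> U p -> exists (chi : M -> R) (K : set M),
  [/\ smooth_on setT chi, chi p != 0, closed K, K `<=` U & forall q, ~ K q -> chi q = 0].
Proof.
move=> oU Up; have [c ac cp] := atlas_cover p.
have oX := image_open ac oU.
have [r0 r00 hr] := open_tbalP oX (imageP _ (conj Up cp)).
pose r := r0 / 2; have r_gt0 : 0 < r by rewrite divr_gt0.
pose x0 := chart_map c p.
pose B : set 'rV[R]_n := [set x | `|x - x0| <= r].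
have BX x : B x -> (chart_map c @` (U `&` chart_dom c)) x.
  move=> Bx; apply: hr; rewrite /tbal /bal /=; apply: (le_lt_trans Bx).
  by rewrite /r ltr_pdivrMr// ltr_pMr// ltr1n.
have hc := atlas_chart ac.
have Bc x : B x -> chart_img c x by move=> /BX[q [_ cq] <-]; exists q.
pose K := chart_inv c @` B.
have clK : closed K.
  apply: compact_closed; first exact: carrier_hausdorff.
  apply: continuous_compact; last exact: compact_cball.
  have [_ oI _ _ ci] := hc.
  apply: continuous_in_subspaceT => x; rewrite inE => Bx.
  by move: ci; rewrite continuous_open_subspace// => /(_ x); rewrite inE => /(_ (Bc x Bx)).
have KU : K `<=` U `&` chart_dom c.
  by move=> _ [x /BX[q [Uq cq] <-] <-]; rewrite invmapK.
(* Positive at [x0], and at most 0 outside the sup-norm ball [B], where some coordinate is off by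
   more than r. *)
pose h (x : 'rV[R]_n) := r * r - \sum_j (x 0 j - x0 0 j) * (x 0 j - x0 0 j).
pose f (x : 'rV[R]_n) := bumpf 1 (h x).
have hB x : ~ B x -> f x = 0.
  move=> nB; rewrite /f /bumpf ifN// -leNgt /h subr_le0.
  have : exists j, r < `|x 0 j - x0 0 j|.
    apply: contrapT => nj; apply: nB; rewrite /B /=; apply: norm_rV_le; first exact: ltW.
    move=> j; rewrite leNgt; apply/negP => hj; apply: nj; exists j.
    by rewrite mxE [X in _ + X]mxE in hj.
  move=> [j hj]; rewrite (bigD1 j)//=.
  apply: (@le_trans _ _ ((x 0 j - x0 0 j) * (x 0 j - x0 0 j))).
    move: (_ - _) hj => d hj; have -> : d * d = `|d| * `|d|.
      by rewrite -normrM ger0_norm// -expr2 sqr_ge0.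
    by apply: ler_pM; rewrite ltW.
  by rewrite lerDl; apply: sumr_ge0 => k _; rewrite -expr2 sqr_ge0.
pose chi q : R := if pselect (K q) then f (chart_map c q) else 0.
have chiK q : ~ K q -> chi q = 0 by rewrite /chi; case: pselect.
have chic q : chart_dom c q -> chi q = f (chart_map c q).
  move=> cq; rewrite /chi; case: pselect => // nK; rewrite hB// => Bq; apply: nK.
  by exists (chart_map c q) => //; exact: invmapK.
exists chi, K; split=> //; last by move=> q /KU[].
- apply: smooth_on_local => q _; have [cq|ncq] := pselect (chart_dom c q).
    exists (chart_dom c) => //; apply/(smooth_on_chart _ ac) => //; first exact: dom_open.
    have oI := img_open ac.
    have sf : smooth (chart_img c) f.
      apply: smooth_bump => //; apply: smooth_sub => //; first exact: smooth_cst.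
      apply: smooth_sum => // j _; apply: smooth_mul => //;
        by apply: smooth_sub => //; [exact: smooth_coord|exact: smooth_cst].
    apply: (smooth_ext oI _ sf) => x cx /=; have [d1 d2] := chart_img_inv hc cx.
    by rewrite chic ?d2.
  exists (~` K); first by move=> /KU[].
  apply/smooth_onE; first exact: closed_openC.
  move=> d ad; have oI := image_open ad (closed_openC clK).
  by apply: (smooth_ext oI _ (smooth_cst oI 0)) => _ [q' [nK dq'] <-] /=; rewrite invmapK// chiK.
- rewrite chic// /f /bumpf /h big1 => [|j _]; last by rewrite subrr mul0r.
  by rewrite subr0 mulr_gt0// hornerC mul1r gt_eqF// expR_gt0.
Qed.

End SmoothFunctions.

Section DualSections.
Context {R : realType} {n : nat} {M : smooth_manifold R n}.
Local Notation C := R[i].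
Implicit Types (c : mchart M) (q : M) (U V : set M) (E : line_bundle M).

Lemma dual_section_local U V E (a : lb_ix E) (phi : M -> C) : is_line_bundle U E -> open V ->
  V `<=` lb_dom a -> smoothC_on V phi ->
  is_dual_section V (fun b q => lb_trans a b q * phi q).
Proof.
move=> [oE _ sE E1 Ec] oV Va sphi; split=> [b|b b' q Vq bq b'q].
  have oW : open (V `&` lb_dom b) by apply: openI.
  apply: smoothC_on_mul => //; last by apply: smoothC_on_subset sphi => q [].
  by apply: smoothC_on_subset (sE a b) => q [/Va].
by rewrite -(Ec a b b' q)//; [ring|exact: Va].
Qed.

(** The dual frame over [lb_dom a], multiplied by [chi] and extended by zero. Away from [lb_dom a]
    smoothness holds since the complement of [K] is an open set on which the section vanishes. *)
Lemma bump_dual_section U V E (a : lb_ix E) (chi : M -> R) (K : set M) : is_line_bundle U E ->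
  open V -> smooth_on setT chi -> closed K -> K `<=` lb_dom a -> (forall q, ~ K q -> chi q = 0) ->
  is_dual_section V (fun b q => if pselect (lb_dom a q) then lb_trans a b q * (chi q)%:C%C else 0).
Proof.
move=> [oE _ sE E1 Ec] oV schi cK Ka chiK; split=> [b|b b' q Vq bq b'q].
  apply: smoothC_on_local => q [Vq bq].
  have [aq|naq] := pselect (lb_dom a q).
    exists (V `&` lb_dom b `&` lb_dom a) => //.
    have oW : open (V `&` lb_dom b `&` lb_dom a) by apply: openI => //; exact: openI.
    have h : smoothC_on (V `&` lb_dom b `&` lb_dom a) (fun q => lb_trans a b q * (chi q)%:C%C).
      apply: smoothC_on_mul => //.
        by apply: smoothC_on_subset (sE a b) => q' [[]].
      by apply: smoothC_on_real => //; exact: smooth_on_subset (@subsetT _ _) schi.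
    by apply: (smoothC_on_ext oW _ h) => q' [_ aq']; case: pselect.
  exists (~` K); first by move=> /Ka.
  have oW : open (~` K) by exact: closed_openC.
  apply: (smoothC_on_ext oW _ (smoothC_on_cst oW 0)) => q' nK.
  by case: pselect => // aq'; rewrite chiK// mulr0.
case: pselect => aq; last by rewrite mulr0.
by rewrite mulrA [_ * lb_trans a b q]mulrC Ec.
Qed.

Lemma bump_in_ideal U V E (a : lb_ix E) (s : lb_section E) (chi : M -> R) (K : set M) :
  is_line_bundle U E -> is_section V s -> open V -> smooth_on setT chi -> closed K ->
  K `<=` lb_dom a -> (forall q, ~ K q -> chi q = 0) ->
  divisor_ideal V s (fun q => if pselect (lb_dom a q) then s a q * (chi q)%:C%C else 0).
Proof.
move=> hE [_ hs] oV schi cK Ka chiK.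
exists (fun b q => if pselect (lb_dom a q) then lb_trans a b q * (chi q)%:C%C else 0).
  exact: (bump_dual_section hE oV schi cK Ka chiK).
move=> b q Vq bq; case: pselect => aq; last by rewrite mulr0.
by rewrite (hs a b)// mulrCA mulrA.
Qed.

End DualSections.

Section LocalGenerators.
Context {R : realType} {n : nat} {M : smooth_manifold R n}.
Local Notation C := R[i].
Implicit Types (c : mchart M) (q : M) (U V : set M).

Lemma zero_locus_dense U E (s : lb_section E) (a : lb_ix E) (O : set M) q : complex_divisor U s ->
  open O -> O q -> O `<=` lb_dom a -> exists2 q', O q' & s a q' != 0.
Proof.
move=> [_ _ hz] oO Oq Oa; apply: contrapT => h.
have : interior (closure (zero_locus s)) q.
  apply: filterS (open_nbhs_nbhs (conj oO Oq)) => q' Oq'; apply: subset_closure.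
  exists a; first exact: Oa.
  by apply/eqP/negPn/negP => ne; apply: h; exists q'.
by rewrite hz.
Qed.

(** The two inclusions of ideals, applied to cut-off generators, make s and the product of the t_i
    multiples of each other. The two factors are mutually inverse where s is nonzero, hence
    everywhere by density. *)
Lemma local_generators E (s : lb_section E) (a0 : lb_ix E) p j (V : set M)
    (F : 'I_j -> line_bundle M) (t : forall i, lb_section (F i)) (a : forall i, lb_ix (F i)) :
  complex_divisor setT s -> lb_dom a0 p -> open V -> V p ->
  (forall i, smooth_log_divisor V (t i)) -> (forall i, lb_dom (a i) p) ->
  divisor_ideal V s = prod_ideal V (fun i => divisor_ideal V (t i)) ->
  exists U (g : M -> C), [/\ open U /\ U p,
    U `<=` V /\ U `<=` lb_dom a0, forall i q, U q -> lb_dom (a i) q,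
    smoothC_on U g /\ (forall q, U q -> g q != 0) &
    forall q, U q -> s a0 q = g q * \prod_i t i (a i) q].
Proof.
move=> hs a0p oV Vp ht ap ideals.
have [hE [ss scomp] _] := hs; have [oE _ _ _ _] := hE.
have hF i : is_line_bundle V (F i) by case: (ht i) => -[].
have sF i : is_section V (t i) by case: (ht i) => -[].
have oF (i : 'I_j) (b : lb_ix (F i)) : open (lb_dom b : set M).
  by case: (hF i) => h _ _ _ _; exact: (h b).
have np : nbhs p [set q | (V q /\ lb_dom a0 q) /\ forall i, lb_dom (a i) q].
  apply: filterI; first by apply: filterI; apply: open_nbhs_nbhs.
  by apply: filter_forall => i; exact: (open_nbhs_nbhs (conj (oF i (a i)) (ap i))).
move: np; rewrite nbhsE => -[N [oN Np] hN].
have [chi [K [schi chip cK KN chiK]]] := bump_function oN Np.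
have Ka0 : K `<=` lb_dom a0 by move=> q /KN/hN[[]].
have Ka i : K `<=` lb_dom (a i) by move=> q /KN/hN[_].
have sx : smoothC_on setT (fun q => (chi q)%:C%C) by apply: smoothC_on_real => //; exact: openT.
pose X : set M := [set: M] `&` [set q | (chi q)%:C%C != 0 :> C].
have oX : open X by apply: open_neq0 => //; exact: openT.
have x0 : (chi p)%:C%C != 0 :> C by rewrite eq_complex /= negb_and chip.
pose U := N `&` X; have oU : open U by exact: openI.
have Up : U p by [].
have UV : U `<=` V by move=> q [/hN[[]]].
have Ua0 : U `<=` lb_dom a0 by move=> q [/hN[[]]].
have Ua i q : U q -> lb_dom (a i) q by move=> [/hN[_]].
have Ux q : U q -> (chi q)%:C%C != 0 :> C by case=> _ [].
have sxU : smoothC_on U (fun q => ((chi q)%:C%C)^-1).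
  by apply: smoothC_on_inv => //; exact: smoothC_on_subset sx.
(* the product of the generators is a multiple of s *)
have [tau [stau _] etau] : divisor_ideal V s (fun q => \prod_i
    (if pselect (lb_dom (a i) q) then t i (a i) q * (chi q)%:C%C else 0)).
  rewrite ideals; exists 1%N, (fun _ _ => 1).
  exists (fun _ i q => if pselect (lb_dom (a i) q) then t i (a i) q * (chi q)%:C%C else 0).
  split=> [_|_ i|q Vq]; first exact: smoothC_on_cst.
    exact: (bump_in_ideal (hF i) (sF i) oV schi cK (Ka i) chiK).
  by rewrite big_ord_recl big_ord0 addr0 mul1r.
(* Each of the [j] generators carried one cut-off factor. *)
pose tau' q := tau a0 q * ((chi q)%:C%C)^-1 ^+ j.
have stau' : smoothC_on U tau'.
  apply: smoothC_on_mul => //; first by apply: smoothC_on_subset (stau a0) => q Uq; split; [exact: UV|exact: Ua0].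
  have e q : (fun q => \prod_(i < j) ((chi q)%:C%C)^-1) q = ((chi q)%:C%C)^-1 ^+ j :> C.
    by rewrite prodr_const card_ord.
  by apply: (smoothC_on_ext oU (fun q _ => e q)); exact: smoothC_on_prod.
have e1 q : U q -> \prod_i t i (a i) q = s a0 q * tau' q.
  move=> Uq; rewrite /tau' mulrA -etau; [|exact: UV|exact: Ua0].
  transitivity (\prod_(i < j) (t i (a i) q * (chi q)%:C%C) * ((chi q)%:C%C)^-1 ^+ j).
    by rewrite big_split /= prodr_const card_ord -mulrA -exprMn divff ?expr1n ?mulr1// Ux.
  congr (_ * _); apply: eq_bigr => i _; case: pselect => // h; case: h; exact: Ua.
(* and s is a multiple of the product *)
have : divisor_ideal V s (fun q => if pselect (lb_dom a0 q) then s a0 q * (chi q)%:C%C else 0).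
  apply: (bump_in_ideal hE _ oV schi cK Ka0 chiK); split=> [b|b b' q Vq].
    by apply: smoothC_on_subset (ss b) => q [].
  exact: scomp.
rewrite ideals => -[m [b [h [sb hh hsum]]]].
have hh' k i : {th | is_dual_section V th & forall b q, V q -> lb_dom b q -> h k i q = t i b q * th b q}.
  apply: cid2; exact: hh.
pose th k i := s2val (hh' k i).
pose g q := ((chi q)%:C%C)^-1 * \sum_k b k q * \prod_i th k i (a i) q.
have sg : smoothC_on U g.
  apply: smoothC_on_mul => //; apply: smoothC_on_sum => // k _; apply: smoothC_on_mul => //.
    by apply: smoothC_on_subset (sb k).
  apply: smoothC_on_prod => // i _.
  have [sth _] := s2valP (hh' k i).
  by apply: smoothC_on_subset (sth (a i)) => q Uq; split; [exact: UV|exact: Ua].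
have e2 q : U q -> s a0 q = g q * \prod_i t i (a i) q.
  move=> Uq; have Vq := UV q Uq; have := hsum q Vq.
  case: pselect => [aq|naq] e; last by have := naq (Ua0 q Uq).
  rewrite /= in e; rewrite /g -mulrA; apply: (canRL (mulKf (Ux q Uq))).
  rewrite mulrC e mulr_suml.
  apply: eq_bigr => k _; rewrite -mulrA -big_split/=; congr (_ * _); apply: eq_bigr => i _.
  rewrite mulrC; apply: (s2valP' (hh' k i)) => //; exact: Ua.
exists U, g; split=> //; split=> // q Uq; apply/negP => /eqP gq0.
(* If [g] vanished at [q], this function would be nonzero near [q], although it vanishes wherever s
   does not. *)
pose psi q := 1 + - (g q * tau' q).
have spsi : smoothC_on U psi.
  apply: smoothC_on_add => //; first exact: smoothC_on_cst.
  by apply: smoothC_on_opp => //; exact: smoothC_on_mul.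
have oW := open_neq0 oU spsi.
have Wq : (U `&` [set q | psi q != 0]) q by split=> //=; rewrite /psi gq0 mul0r oppr0 addr0 oner_eq0.
have [q' [Uq' psi0] s0] := zero_locus_dense hs oW Wq (fun q h => Ua0 q h.1).
move/eqP: psi0; apply; apply: (mulfI s0); rewrite mulr0 /psi mulrBr mulr1 mulrCA -e1//.
by rewrite -e2// subrr.
Qed.

Lemma wedge_ext1r (u : ext R n) : wedge u ext1 = u.
Proof.
apply/ffunP => K; rewrite ffunE (bigD1 K)//= finset.setDv ext_sign0r mul1r ffunE eqxx mulr1.
rewrite big1 ?addr0// => I /andP[IK neI]; rewrite ffunE finset.setD_eq0.
rewrite (_ : (K \subset I) = false) ?mulr0//.
by apply/negP => KI; case/negP: neI; rewrite finset.eqEsubset IK.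
Qed.

Lemma dfun_scale c q U (f g h : M -> C) : open U -> U q -> atlas c -> chart_dom c q ->
  smoothC_on U f -> smoothC_on U g -> (forall q, U q -> h q = g q * f q) -> f q = 0 ->
  (forall i, pderivC c i h q = g q * pderivC c i f q) /\
  wedge (dfun c h q) (dfun c (fun x => (h x)^*%C) q) =
  ext_scale (g q * (g q)^*%C) (wedge (dfun c f q) (dfun c (fun x => (f x)^*%C) q)).
Proof.
move=> oU Uq ac cq sf sg hE f0.
have d i : pderivC c i h q = g q * pderivC c i f q.
  have -> : pderivC c i h q = pderivC c i (fun q => g q * f q) q by exact: (pderivC_ext oU ac Uq cq).
  by rewrite (pderivC_mul oU ac Uq cq)// f0 mulr0 addr0.
split=> //.
have sh : smoothC_on U h by apply: (smoothC_on_ext oU (fun q Uq => esym (hE q Uq))); exact: smoothC_on_mul.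
have e1 : dfun c h q = ext_scale (g q) (dfun c f q).
  by rewrite /dfun -covecZ; congr covec; apply/colP => i; rewrite !mxE d.
have e2 : dfun c (fun x => (h x)^*%C) q = ext_scale (g q)^*%C (dfun c (fun x => (f x)^*%C) q).
  rewrite /dfun -covecZ; congr covec; apply/colP => i.
  by rewrite !mxE (pderivC_conj oU ac Uq cq)// (pderivC_conj oU ac Uq cq)// d rmorphM.
by rewrite e1 e2 wedgeZl wedgeZr ext_scaleA.
Qed.

(** Serves to exclude points where only one generator vanishes: there s is itself a smooth log
    divisor, as a section of the trivial bundle, and the intersection number would be at most
    one. *)
Lemma log_decomposition1 E (s : lb_section E) (a0 : lb_ix E) p U (f g : M -> C) :
  complex_divisor setT s -> open U -> U p -> U `<=` lb_dom a0 ->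
  smoothC_on U f -> smoothC_on U g -> (forall q, U q -> g q != 0) ->
  (forall q, U q -> s a0 q = g q * f q) ->
  (forall q, U q -> f q = 0 -> submersive_at f q /\ forall c, atlas c -> chart_dom c q ->
     wedge (dfun c f q) (dfun c (fun x => (f x)^*%C) q) != 0) ->
  log_decomposition s p 1.
Proof.
move=> hs oU Up Ua sf sg g0 hE hf.
have [hEb [ss scomp] hz] := hs.
have f0 q : U q -> s a0 q = 0 -> f q = 0.
  by move=> Uq /eqP; rewrite hE// mulf_eq0 (negbTE (g0 q Uq))/= => /eqP.
pose L1 : line_bundle M := LineBundle (fun _ : unit => U) (fun _ _ _ => 1).
pose t1 : lb_section L1 := fun _ => s a0.
have s0 : smoothC_on U (s a0) by apply: smoothC_on_subset (ss a0) => q Uq; split=> //; exact: Ua.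
exists U, (fun _ => L1), (fun _ => t1); split=> //.
- move=> _; split.
    split.
    + split=> //=.
      * by apply/seteqP; split=> [q [_ _]//|q Uq]; exists tt.
      * by move=> _ _; rewrite setIid; exact: smoothC_on_cst.
      * by move=> _ _ _ q _ _ _; rewrite mul1r.
    + split=> [b|b b' q _ _ _]; last by rewrite mul1r.
      by rewrite setIid.
    + apply/seteqP; split=> // q; rewrite -hz; apply: interiorS; apply: closureS.
      by move=> q' [b /= Uq' e]; exists a0 => //; exact: Ua.
  move=> b q /= Uq sq c ac cq w.
  have fq := f0 q Uq sq; have [sub _] := hf q Uq fq.
  have [X hX] := sub c ac cq (w / g q); exists X.
  have [d _] := dfun_scale oU Uq ac cq sf sg hE fq.
  rewrite -[RHS](divfK (g0 q Uq)) -hX mulr_suml; apply: eq_bigr => i _.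
  by rewrite d; ring.
- apply/seteqP; split=> [h [tau [stau ctau] htau]|h [m [b [e [sb he hsum]]]]].
    exists 1%N, (fun _ _ => 1), (fun _ _ => h); split=> [_|_ _|q Uq].
    + exact: smoothC_on_cst.
    + exists (fun _ => tau a0); last by move=> b q Uq _; apply: htau => //; exact: Ua.
      split=> [b|b b' q _ _ _]; last by rewrite mul1r.
      by apply: smoothC_on_subset (stau a0) => q [Uq _]; split=> //; exact: Ua.
    + by rewrite !big_ord_recl !big_ord0 addr0 mul1r mulr1.
  have th k : {th | is_dual_section U th & forall (b : lb_ix L1) q, U q -> lb_dom b q ->
      e k ord0 q = t1 b q * th b q} by apply: cid2; exact: he.
  pose phi q := \sum_k b k q * s2val (th k) tt q.
  have sphi : smoothC_on U phi.
    apply: smoothC_on_sum => // k _; apply: smoothC_on_mul => //.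
    by have [h1 _] := s2valP (th k); have := h1 tt; rewrite setIid.
  exists (fun b q => lb_trans a0 b q * phi q); first exact: (dual_section_local hEb).
  move=> b' q Uq bq; rewrite hsum// mulrA [s b' q * _]mulrC -scomp//; last exact: Ua.
  rewrite mulr_sumr; apply: eq_bigr => k _; rewrite big_ord_recl big_ord0 mulr1.
  by rewrite (s2valP' (th k) tt q Uq Uq) /t1; ring.
- move=> S c q a ac cq Uq hS.
  have sz : size (enum S) = #|S| by rewrite cardE.
  have E1 : (ext1 : ext R n) != 0.
    by apply/eqP => /(congr1 (fun u : ext R n => u finset.set0)); rewrite !ffunE eqxx => /eqP; rewrite oner_eq0.
  have [S0|[i iS]] := set_0Vmem S; first by rewrite S0 enum_set0.
  have -> : S = [set i]%SET.
    have h k : k = i by rewrite (ord1 k) (ord1 i).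
    by apply/setP => k; rewrite finset.inE (h k) iS eqxx.
  rewrite enum_set1 /= wedge_ext1r.
  have [_ sq] := hS i iS; have fq := f0 q Uq sq.
  have [_ ne] := hf q Uq fq.
  have [_ ->] := dfun_scale oU Uq ac cq sf sg hE fq.
  have gg : g q * (g q)^*%C != 0 by rewrite mulf_eq0 conjc_eq0 (negbTE (g0 q Uq)).
  apply/eqP => e; case/eqP: (ne c ac cq); apply/ffunP => K.
  have := congr1 (fun u : ext R n => u K) e; rewrite !ffunE => /eqP.
  by rewrite mulf_eq0 (negbTE gg)/= => /eqP.
Qed.

End LocalGenerators.

(** * The two generators at a crossing point *)

Section Crossing.
Context {R : realType} {M : smooth_manifold R 4} (G : gen_complex_structure M).
Local Notation C := R[i].
Local Notation s := (anticanonical_section G).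

(** Let [S] index the generators that vanish at p. More than two are impossible, since their wedge
    would have degree above 4; none would give s(p) nonzero; one would contradict the intersection
    number. The generators outside [S] are units near p and join [g]. *)
Lemma crossing_generators p : stable G -> crossing_locus G p ->
  exists (a0 : lb_ix (anticanonical_bundle G)) (U : set M) (g f1 f2 : M -> C),
  [/\ [/\ open U, U p & U `<=` lb_dom a0],
      [/\ smoothC_on U g, smoothC_on U f1 & smoothC_on U f2],
      forall q, U q -> g q != 0,
      forall q, U q -> s a0 q = g q * (f1 q * f2 q) &
      [/\ f1 p = 0, f2 p = 0 & forall c, atlas c -> chart_dom c p ->
        wedge (wedge (dfun c f1 p) (dfun c (fun x => (f1 x)^*%C) p))
              (wedge (dfun c f2 p) (dfun c (fun x => (f2 x)^*%C) p)) != 0]].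
Proof.
move=> [hs _] [[b0 b0p sb0] [j [[V [F [t [oV Vp ht ideals hw]]]] jmin] j2]].
have [hE [ss scomp] _] := hs; have [oE cover _ _ _] := hE.
have [a0 _ a0p] : (\bigcup_(a in [set: lb_ix (anticanonical_bundle G)]) lb_dom a) p by rewrite cover.
have s0 : s a0 p = 0 by rewrite (scomp a0 b0 p I a0p b0p) sb0 mulr0.
have hF i : is_line_bundle V (F i) by case: (ht i) => -[].
have ha i : exists a : lb_ix (F i), lb_dom a p.
  have [_ cov _ _ _] := hF i.
  have [a _ ap] : (\bigcup_(a in [set: lb_ix (F i)]) lb_dom a) p by rewrite cov.
  by exists a.
pose a i := projT1 (cid (ha i)); have ap i : lb_dom (a i) p := projT2 (cid (ha i)).
have [U [g [[oU Up] [UV Ua0] Ua [sg g0] hsg]]] := local_generators hs a0p oV Vp ht ap ideals.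
pose f i := t i (a i).
have sf i : smoothC_on U (f i).
  case: (ht i) => -[_ [h _] _] _; apply: smoothC_on_subset (h (a i)) => q Uq.
  by split; [exact: UV|exact: Ua].
pose S := [set i | f i p == 0]%SET.
have fS i : (i \in S) = (f i p == 0) by rewrite finset.inE.
have [c0 ac0 c0p] := atlas_cover p.
have W c : atlas c -> chart_dom c p ->
    wedges [seq wedge (dfun c (f i) p) (dfun c (fun x => (f i x)^*%C) p) | i <- enum S] != 0.
  move=> ac cp; apply: hw => // i; rewrite fS => /eqP h; split=> //; exact: ap.
have hom c i : homog (1 + 1) (wedge (dfun c (f i) p) (dfun c (fun x => (f i x)^*%C) p)).
  by apply: homog_wedge; exact: homog_covec.
have S2 : (#|S| <= 2)%N.
  rewrite leqNgt; apply/negP => S3; case/eqP: (W c0 ac0 c0p).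
  set sq := map _ _; have hq : homog (size sq * 2) (wedges sq).
    by apply: homog_wedges => u /mapP[i _ ->]; exact: hom.
  apply: (homog_top hq); rewrite size_map -cardE.
  by rewrite (@leq_trans (3 * 2)) // leq_mul2r.
have prodE q : \prod_i t i (a i) q = \prod_(i in S) f i q * \prod_(i in ~: S) f i q.
  rewrite (bigID (mem S))/=; congr (_ * _).
  by apply: eq_bigl => i; rewrite finset.in_setC.
pose f' q := \prod_(i in ~: S) f i q.
have sf' : smoothC_on U f' by apply: smoothC_on_prod.
have f'p : f' p != 0.
  by apply/prodf_neq0 => i; rewrite finset.in_setC fS.
pose U1 := U `&` [set q | f' q != 0].
have oU1 : open U1 by exact: open_neq0.
have U1U : U1 `<=` U by move=> q [].
pose g1 q := g q * f' q.
have sg1 : smoothC_on U1 g1.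
  apply: smoothC_on_mul => //; first exact: smoothC_on_subset sg.
  exact: smoothC_on_subset sf'.
have g10 q : U1 q -> g1 q != 0.
  by move=> [Uq fq]; rewrite /g1 mulf_neq0// g0.
have sE q : U1 q -> s a0 q = g1 q * \prod_(i in S) f i q.
  by move=> [Uq _]; rewrite hsg// prodE /g1 /f'; ring.
have U1p : U1 p by [].
have sf1 i : smoothC_on U1 (f i) by exact: smoothC_on_subset (sf i).
case e : #|S| S2 => [|[|[|//]]] _.
- move: e => /eqP; rewrite cards_eq0 => /eqP e.
  have := sE p U1p; rewrite s0 e big_set0 mulr1 => /eqP; rewrite eq_sym => /eqP e'.
  by have := g10 p U1p; rewrite e' eqxx.
- move/eqP: e => /cards1P[i eS].
  have sE1 q : U1 q -> s a0 q = g1 q * f i q by move=> /sE ->; rewrite eS big_set1.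
  have D : log_decomposition s p 1.
    apply: (log_decomposition1 hs oU1 U1p _ (sf1 i) sg1 g10 sE1) => [q [/Ua0]//|q [Uq _] fq].
    split; first by case: (ht i) => _ h; apply: (h (a i)) => //; exact: Ua.
    move=> c ac cq.
    have := hw [set i]%SET c q a ac cq (UV q Uq); rewrite enum_set1 /= wedge_ext1r; apply.
    by move=> k; rewrite finset.inE => /eqP ->; split=> //; exact: Ua.
  by have := leq_trans j2 (jmin 1%N D).
- have [k1 [k2 [eE ek]]] : exists k1 k2, enum S = [:: k1; k2] /\ (forall q, \prod_(i in S) f i q = f k1 q * f k2 q).
    have : size (enum S) = 2%N by rewrite -cardE e.
    case eE : (enum S) => [|k1 [|k2 [|//]]] // _; exists k1, k2; split=> // q.
    by rewrite -big_enum /= eE !big_cons big_nil mulr1.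
  have k1S : k1 \in S by rewrite -mem_enum eE mem_head.
  have k2S : k2 \in S by rewrite -mem_enum eE in_cons mem_head orbT.
  move: k1S k2S; rewrite !fS => /eqP f1p /eqP f2p.
  exists a0, U1, g1, (f k1), (f k2); split=> //.
  + by split=> // q [/Ua0].
  + by move=> q /sE ->; rewrite ek.
  + split=> // c ac cp; have := W c ac cp; rewrite eE /=.
    by rewrite wedge_ext1r.
Qed.

End Crossing.


(** * Canonical sections and involutivity *)

Section Pointwise.
Context {R : realType} {n : nat} {M : smooth_manifold R n} (G : gen_complex_structure M).
Local Notation C := R[i].
Implicit Types (c : mchart M) (q : M).

Lemma cplx_mxM (k l m : nat) (A : 'M[R]_(k, l)) (B : 'M[R]_(l, m)) :
  cplx_mx (A *m B) = cplx_mx A *m cplx_mx B.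
Proof. exact: map_mxM. Qed.

(** This is twice the projection of [v] to the eigenspace, as J^2 = -1. *)
Lemma in_eigen_proj c q (v : 'cV[C]_(n + n)) : atlas c -> chart_dom c q ->
  in_eigen (gcs_J G c q) (v - 'i%C *: (cplx_mx (gcs_J G c q) *m v)).
Proof.
move=> ac cq; rewrite /in_eigen mulmxBr -scalemxAr mulmxA -cplx_mxM gcs_J_square//.
rewrite /cplx_mx map_mxN map_mx1 mulNmx mul1mx scalerBr scalerA scalerN opprK.
have -> : ('i%C : C) * 'i%C = -1 by rewrite -expr2 sqr_i.
by rewrite scaleN1r opprK addrC.
Qed.

Lemma in_eigenZ (J : 'M[R]_(n + n)) (a : C) v : in_eigen J v -> in_eigen J (a *: v).
Proof. by rewrite /in_eigen -scalemxAr => ->; rewrite !scalerA mulrC. Qed.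

(** The degree-one part of xi acting on w is w_0 xi. Thus L contains no nonzero covector off the
    divisor. *)
Lemma eigen_cotangent c q w (xi : 'cV[C]_n) : in_canonical G c q w -> w finset.set0 != 0 ->
  in_eigen (gcs_J G c q) (col_mx 0 xi) -> xi = 0.
Proof.
move=> hw w0 /hw h; apply/colP => k; rewrite mxE.
have := congr1 (fun u : ext R n => u [set k]%SET) h.
rewrite clifford1 col_mxKu col_mxKd ffunE big1 ?add0r => [|i _]; last by rewrite mxE mul0r.
by move/eqP; rewrite mulf_eq0 (negbTE w0) orbF => /eqP.
Qed.

(* Where the spinor has nonzero degree-zero part, [L] projects isomorphically onto [T]. *)
Lemma eigen_frame c q w : atlas c -> chart_dom c q -> in_canonical G c q w -> w finset.set0 != 0 ->
  exists z : 'I_n -> 'cV[C]_n, forall i, in_eigen (gcs_J G c q) (col_mx (delta_mx i 0) (z i)).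
Proof.
move=> ac cq hw w0; set J := gcs_J G c q.
pose P := ursubmx J; pose D := drsubmx J.
have JE (xi : 'cV[R]_n) : cplx_mx J *m col_mx 0 (cplx_mx xi) = col_mx (cplx_mx (P *m xi)) (cplx_mx (D *m xi)).
  have -> : col_mx 0 (cplx_mx xi) = cplx_mx (col_mx (0 : 'cV[R]_n) xi).
    by rewrite /cplx_mx map_col_mx map_mx0.
  rewrite -cplx_mxM -{1}(submxK J) mul_block_col !mulmx0 !add0r /cplx_mx.
  by rewrite map_col_mx.
(* If the block P of J from covectors to vectors kills a real [xi], the projection of [xi] to L is a
   covector, hence zero; its real part is [xi]. *)
have uP : P \in unitmx.
  rewrite -unitmx_tr unitmxE unitfE; apply/negP => /det0P[v v0 hv].
  have hv' : P *m v^T = 0 by rewrite -[P]trmxK -trmx_mul hv trmx0.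
  have := in_eigen_proj (col_mx 0 (cplx_mx v^T)) ac cq.
  rewrite JE hv' /cplx_mx map_mx0 scale_col_mx scaler0 opp_col_mx add_col_mx subr0.
  move=> /(eigen_cotangent hw w0) e.
  case/eqP: v0; apply/rowP => k.
  have := congr1 (fun u : 'cV[C]_n => complex.Re (u k 0)) e.
  rewrite !mxE /= => h; move: h; rewrite !mul0r !mul1r /= ?mulr0 ?subr0 ?oppr0 ?addr0.
  by [].
(* For the covector xi = P^-1 e_i, the vector i (xi - i J xi) = J xi + i xi of L has vector part e_i
   and this covector part. *)
exists (fun i => cplx_mx (D *m (invmx P *m delta_mx i 0)) + 'i%C *: cplx_mx (invmx P *m delta_mx i 0)) => i.
set xi := invmx P *m _.
have := in_eigenZ 'i%C (in_eigen_proj (col_mx 0 (cplx_mx xi)) ac cq).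
rewrite JE mulKVmx// scale_col_mx opp_col_mx add_col_mx add0r scale_col_mx.
have ii : ('i%C : C) * 'i%C = -1 by rewrite -expr2 sqr_i.
rewrite scalerN scalerA ii scaleN1r opprK scalerBr scalerA ii scaleN1r opprK addrC.
by have -> : cplx_mx (delta_mx i 0 : 'cV[R]_n) = delta_mx i 0 by rewrite /cplx_mx map_delta_mx.
Qed.

End Pointwise.

Section Dorfman.
Context {R : realType} {n : nat} {M : smooth_manifold R n}.
Local Notation C := R[i].
Implicit Types (c : mchart M) (q : M).

Lemma pderivC_opp c q U (f : M -> C) i : open U -> atlas c -> U q -> chart_dom c q ->
  smoothC_on U f -> pderivC c i (fun q => - f q) q = - pderivC c i f q.
Proof.
move=> oU ac Uq cq /(smoothC_onE _ oU)/(_ c ac) sf.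
by have := dc_opp (imageP _ (conj Uq cq)) i sf.
Qed.

Lemma pderivC_cst c i (a : C) q : pderivC c i (fun=> a) q = 0.
Proof. by rewrite /pderivC /pderiv !derive_cst. Qed.

Lemma cmp2_dext_covec c (xi : M -> 'cV[C]_n) q i k :
  cmp2 (dext c (fun x => covec (xi x)) q) i k =
  pderivC c i (fun x => xi x k 0) q - pderivC c k (fun x => xi x i 0) q.
Proof.
rewrite mxE; case: eqP => [->|/eqP ik]; first by rewrite subrr.
rewrite ffunE (bigD1 i) ?finset.set21//= (bigD1 k)/=; last by rewrite finset.set22 eq_sym.
rewrite big1 ?addr0 => [|l]; last first.
  by rewrite finset.in_set2 => /andP[/andP[/orP[/eqP->|/eqP->]]]; rewrite eqxx.
have e1 : [set i; k]%SET :\ i = [set k]%SET.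
  apply/setP => l; rewrite finset.in_setD1 finset.in_set2 finset.in_set1.
  by case: eqP => //= ->; rewrite (negbTE ik).
have e2 : [set i; k]%SET :\ k = [set i]%SET.
  apply/setP => l; rewrite finset.in_setD1 finset.in_set2 finset.in_set1.
  by rewrite orbC; case: eqP => //= ->; rewrite eq_sym (negbTE ik).
rewrite e1 e2 !ext_sign11.
under [X in pderivC c i X]eq_fun do rewrite covec1.
under [X in pderivC c k X]eq_fun do rewrite covec1.
have [h|h|/val_inj h] := ltngtP i k; last by rewrite h eqxx in ik.
- by rewrite !expr0 expr1; ring.
- by rewrite !expr1 expr0; ring.
Qed.

Lemma dext_fun1 c (w : M -> ext R n) q k : dext c w q [set k]%SET = pderivC c k (fun x => w x finset.set0) q.
Proof.
rewrite ffunE big_set1; have -> : [set k]%SET :\ k = finset.set0.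
  by apply/setP => l; rewrite finset.in_setD1 finset.in_set1 finset.inE; case: eqP.
by rewrite ext_sign0r mul1r.
Qed.

(** The vector parts are coordinate fields with zero Lie bracket, so only derivatives of the
    covector parts and a component of H remain. *)
Lemma dorfman_frame c (H : M -> ext R n) (z t : M -> 'cV[C]_n) i j q :
  dorfman c H (fun x => col_mx (delta_mx i 0) (z x)) (fun x => col_mx (delta_mx j 0) (t x)) q =
  col_mx 0 (\col_k (pderivC c i (fun x => t x k 0) q
    - (pderivC c j (fun x => z x k 0) q - pderivC c k (fun x => z x j 0) q)
    + contract (delta_mx i 0) (contract (delta_mx j 0) (H q)) [set k]%SET)).
Proof.
have sumd (F : 'I_n -> C) (l : 'I_n) : \sum_m (delta_mx l 0 : 'cV[C]_n) m 0 * F m = F l.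
  rewrite (bigD1 l)//= mxE !eqxx mul1r big1 ?addr0// => m /negbTE ml.
  by rewrite mxE ml mul0r.
rewrite /dorfman; congr col_mx.
  apply/colP => k; rewrite !mxE big1// => l _.
  under [X in pderivC c l X]eq_fun do rewrite col_mxKu.
  under [X in _ - _ * pderivC c l X q]eq_fun do rewrite col_mxKu.
  by rewrite !pderivC_cst !mulr0 subrr.
have eD (u v : ext R n) K : (u + v) K = u K + v K by rewrite ffunE.
have eN (u : ext R n) K : (- u) K = - u K by rewrite ffunE.
apply/colP => k; rewrite [LHS]mxE [RHS]mxE !eD eN.
congr (_ - _ + _).
- rewrite !col_mxKu ext_contract1 sumd dext_fun1.
  under [X in cmp2 (dext c X q)]eq_fun do rewrite col_mxKd.
  rewrite cmp2_dext_covec.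
  have -> : (fun x => contract (usubmx (col_mx (delta_mx i 0) (z x))) (covec (dsubmx (col_mx (delta_mx j 0) (t x)))) finset.set0) = (fun x => t x i 0).
    by apply/funext => x; rewrite col_mxKu col_mxKd ext_contract0 sumd covec1.
  by rewrite subrK.
- rewrite col_mxKu ext_contract1 sumd.
  under [X in cmp2 (dext c X q)]eq_fun do rewrite col_mxKd.
  by rewrite cmp2_dext_covec.
- by rewrite !col_mxKu.
Qed.

Lemma form0E U (rho : diff_form M) c q : is_form U rho -> atlas c -> chart_dom c q -> U q ->
  form0 rho q = rho c q finset.set0.
Proof.
move=> [_ hr] ac cq Uq; rewrite /form0.
apply: xget_unique => [d ad dq|z hz].
  by rewrite (hr d c q ad ac Uq dq cq) ext_pull0.
by rewrite (hz c ac cq).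
Qed.

End Dorfman.

Section Closed4.
Context {R : realType} {M : smooth_manifold R 4} (G : gen_complex_structure M).
Local Notation C := R[i].
Variables (c : mchart M) (U : set M) (rho : M -> ext R 4).
Hypotheses (ac : atlas c) (oU : open U) (Uc : U `<=` chart_dom c).
Hypothesis srho : forall K, smoothC_on U (fun q => rho q K).
Hypothesis crho : forall q, U q -> in_canonical G c q (rho q).

Lemma canonical_ev q : U q -> rho q finset.set0 != 0 ->
  (forall i, in_eigen (gcs_J G c q)
     (col_mx (delta_mx i 0) (\col_k (- cmp2 (rho q) i k / rho q finset.set0)))) /\
  rho q = ev (rho q finset.set0) (cmp2 (rho q))
    (pf2 (cmp2 (rho q)) (cmp2 (rho q)) / 2 / rho q finset.set0).
Proof.
move=> Uq r0; have [z hz] := eigen_frame ac (Uc Uq) (crho Uq) r0.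
have [hz' e] := annihilated_ev r0 (fun i => crho Uq (hz i)).
split=> // i; have -> : \col_k (- cmp2 (rho q) i k / rho q finset.set0) = z i; last exact: hz.
by apply/colP => k; rewrite mxE hz'.
Qed.

Lemma smoothC_cmp2 i j : smoothC_on U (fun q => cmp2 (rho q) i j).
Proof.
have [->|ij] := eqVneq i j.
  by apply: (smoothC_on_ext oU _ (smoothC_on_cst oU 0)) => q _; rewrite cmp2_diag.
apply: (smoothC_on_ext oU _ (smoothC_on_mul oU (smoothC_on_cst oU ((-1) ^+ (j < i)%N)) (srho [set i; j]%SET))).
by move=> q _; rewrite mxE (negbTE ij).
Qed.

(** A component of H up to sign. Its smoothness is needed for the divisions below, and its reality
    makes the imaginary part of rho_2 / rho_0 closed. *)
Definition hterm i j k q : C :=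
  contract (delta_mx i 0) (contract (delta_mx j 0) (gcs_H G c q)) [set k]%SET.

Lemma hterm_real i j k q : U q -> complex.Im (hterm i j k q) = 0.
Proof.
move=> Uq; have hH K := @gcs_H_real _ _ _ G c q K ac I (Uc Uq).
have sg (K L : {set 'I_4}) (x : C) : complex.Im x = 0 -> complex.Im (ext_sign K L * x) = 0.
  move=> h; rewrite /ext_sign; elim: #|_| => [|m IH]; first by rewrite expr0 mul1r.
  by rewrite exprS -mulrA mulN1r cImN IH oppr0.
rewrite /hterm contract_delta; case: ifP => // _.
by apply: (sg _ _); rewrite contract_delta; case: ifP => // _; apply: (sg _ _); exact: hH.
Qed.

Lemma hterm_smooth i j k : smoothC_on U (hterm i j k).
Proof.
have [[sH _] _] := gcs_H_form G.
have sH' K : smoothC_on U (fun q => gcs_H G c q K).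
  by apply: smoothC_on_subset (sH c K ac) => q /Uc.
have z0 : smoothC_on U (fun=> 0) := smoothC_on_cst oU 0.
have e : hterm i j k = (fun q => if i \in [set k]%SET then 0 else ext_sign [set i]%SET [set k]%SET *
   (if j \in i |: [set k]%SET then 0 else ext_sign [set j]%SET (i |: [set k]%SET) *
     gcs_H G c q (j |: (i |: [set k]%SET)))).
  by apply/funext => q; rewrite /hterm !contract_delta.
rewrite e; case: (i \in _) => //; case: (j \in _).
  by apply: (smoothC_on_ext oU _ z0) => q _; rewrite mulr0.
by do 2![apply: smoothC_on_mul => //; first exact: smoothC_on_cst].
Qed.

(* [d(rho_2/rho_0) = H]: involutivity for the frame [e_i - i_(e_i) rho_2 / rho_0] of [L]. *)
Lemma eps_closed i j k : (forall q, U q -> rho q finset.set0 != 0) -> forall q, U q ->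
  let e i j q := cmp2 (rho q) i j / rho q finset.set0 in
  pderivC c i (e j k) q + pderivC c j (e k i) q + pderivC c k (e i j) q = hterm i j k q.
Proof.
move=> r0 q Uq e.
have se a b : smoothC_on U (e a b).
  by apply: smoothC_on_mul => //; [exact: smoothC_cmp2|exact: smoothC_on_inv].
pose z a q : 'cV[C]_4 := \col_l (- cmp2 (rho q) a l / rho q finset.set0).
pose u a q : 'cV[C]_(4 + 4) := col_mx (delta_mx a 0) (z a q).
have zE a l : (fun q => z a q l 0) = (fun q => - e a l q).
  by apply/funext => q'; rewrite mxE mulNr.
have su a l : smoothC_on U (fun q => u a q l 0).
  rewrite -(splitK l); case: (fintype.split l) => l' /=.
    apply: (smoothC_on_ext oU _ (smoothC_on_cst oU ((delta_mx a 0 : 'cV[C]_4) l' 0))) => q' _.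
    by rewrite col_mxEu.
  apply: (smoothC_on_ext oU _ (smoothC_on_opp oU (se a l'))) => q' _.
  by rewrite col_mxEd -[RHS]/((fun q => z a q l' 0) q') zE.
have eu a q' : U q' -> in_eigen (gcs_J G c q') (u a q').
  by move=> Uq'; case: (canonical_ev Uq' (r0 _ Uq')) => h _; exact: h.
(* The bracket of two frame sections lies in L and has no vector part, so it vanishes by
   [eigen_cotangent]; its [k]-th component is the claim. *)
have := gcs_involutive ac oU Uc (su i) (su j) (eu i) (eu j) Uq.
rewrite dorfman_frame => /(eigen_cotangent (crho Uq) (r0 _ Uq)) /colP/(_ k).
rewrite !mxE !zE.
have N a b l : pderivC c l (fun q => - e a b q) q = - pderivC c l (e a b) q.
  exact: (pderivC_opp l oU ac Uq (Uc Uq) (se a b)).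
rewrite !N -/(hterm i j k q).
have -> : e k i = (fun q => - e i k q).
  by apply/funext => q'; rewrite /e cmp2_skew mulNr.
rewrite N.
by move=> h; apply/eqP; rewrite -subr_eq0 -oppr_eq0 -h; apply/eqP; ring.
Qed.

End Closed4.

(** * The logarithmic frame *)

Section NonVanishing.
Context {R : realType} {n : nat}.
Local Notation V := 'rV[R]_n.
Local Notation C := R[i].

Lemma open_smoothc_neq0 (W : set V) (f : V -> C) : open W -> smoothc W f ->
  open (W `&` [set x | f x != 0]).
Proof.
move=> oW [s1 s2].
pose g x := complex.Re (f x) * complex.Re (f x) + complex.Im (f x) * complex.Im (f x).
have sg : smooth W g by apply: smooth_add => //; exact: smooth_mul.
have e : W `&` [set x | f x != 0] = W `&` g @^-1` [set t | t != 0].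
  by apply/seteqP; split=> x [Wx h]; split=> //; move: h; rewrite /= -sqr_norm_eq0.
rewrite e openE => x [Wx h]; rewrite /interior; apply: filterI; first exact: open_nbhs_nbhs.
exact: (smooth_cont sg Wx (open_nbhs_nbhs (conj (@open_neq _ 0) h))).
Qed.

End NonVanishing.

Section R4.
Context {R : realType}.
Local Notation V := 'rV[R]_4.
Local Notation C := R[i].

Definition z1 : V -> C := zc o0 o1.
Definition z2 : V -> C := zc o2 o3.
Definition zz x := z1 x * z2 x.

Lemma smoothc_z W : open W -> smoothc W z1 * smoothc W z2 * smoothc W zz.
Proof.
move=> oW; have h1 : smoothc W z1 by exact: smoothc_zc.
have h2 : smoothc W z2 by exact: smoothc_zc.
by split=> //; exact: smoothc_mul.
Qed.

Lemma o_neq : (o0 == o1 = false) * (o0 == o2 = false) * (o0 == o3 = false) * (o1 == o0 = false) *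
  (o1 == o2 = false) * (o1 == o3 = false) * (o2 == o0 = false) * (o2 == o1 = false) *
  (o2 == o3 = false) * (o3 == o0 = false) * (o3 == o1 = false) * (o3 == o2 = false).
Proof. by rewrite -!val_eqE /= !val_o. Qed.

Lemma dense_z2 (U : set V) x : open U -> U x -> exists y, [/\ U y, z1 y = z1 x & z2 y != 0].
Proof.
move=> oU Ux; have [y [Uy zy e]] := dense_zc o2 o3 oU Ux; exists y; split=> //.
by rewrite /z1 /zc !e ?o_neq.
Qed.

Lemma dense_z1 (U : set V) x : open U -> U x -> exists y, [/\ U y, z2 y = z2 x & z1 y != 0].
Proof.
move=> oU Ux; have [y [Uy zy e]] := dense_zc o0 o1 oU Ux; exists y; split=> //.
by rewrite /z2 /zc !e ?o_neq.
Qed.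

Lemma dense_zz (U : set V) x : open U -> U x -> exists2 y, U y & zz y != 0.
Proof.
move=> oU Ux; have [y [Uy _ y2]] := dense_z2 oU Ux.
have [y' [Uy' e y1]] := dense_z1 oU Uy; exists y' => //.
by rewrite /zz mulf_neq0// e.
Qed.

Lemma eq_off_zz W (f f' : V -> C) : open W -> smoothc W f -> smoothc W f' ->
  (forall x, W x -> zz x != 0 -> f x = f' x) -> forall x, W x -> f x = f' x.
Proof.
move=> oW sf sf' h x Wx; apply/eqP; rewrite -subr_eq0; apply/eqP.
apply: (smoothc_lim0 (smoothc_sub oW sf sf') Wx) => U oU Ux.
have [y [Uy Wy] hy] := dense_zz (openI oU oW) (conj Ux Wx).
by exists y => //; rewrite h// subrr.
Qed.

(** [al] may vanish on z_2 = 0 only, and this leaves points of z_1 = 0 with [al] nonzero arbitrarily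
    near, by [dense_z2]. *)
Lemma division1 r m (al S T : V -> C) : 0 < r -> smoothc (bal r) al -> smoothc (bal r) S ->
  smoothc (bal r) T -> (forall x, z2 x != 0 -> al x != 0) ->
  (forall x, bal r x -> ((z1 x)^*)%C ^+ m * (al x * S x) = z1 x * T x) ->
  exists2 q, smoothc (bal r) q & forall x, bal r x -> S x = z1 x * q x.
Proof.
move=> r0 sal sS sT hal e.
have ab : o0 != o1 by rewrite o_neq.
apply: (division ab sal sS sT e) => x U Wx zx oU Ux; have [y [Uy e1 y2]] := dense_z2 oU Ux.
by exists y; split=> //; [rewrite -zx; exact: e1|exact: hal].
Qed.

Lemma division2 r m (al S T : V -> C) : 0 < r -> smoothc (bal r) al -> smoothc (bal r) S ->
  smoothc (bal r) T -> (forall x, z1 x != 0 -> al x != 0) ->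
  (forall x, bal r x -> ((z2 x)^*)%C ^+ m * (al x * S x) = z2 x * T x) ->
  exists2 q, smoothc (bal r) q & forall x, bal r x -> S x = z2 x * q x.
Proof.
move=> r0 sal sS sT hal e.
have ab : o2 != o3 by rewrite o_neq.
apply: (division ab sal sS sT e) => x U Wx zx oU Ux; have [y [Uy e1 y1]] := dense_z1 oU Ux.
by exists y; split=> //; [rewrite -zx; exact: e1|exact: hal].
Qed.

(* rows of [Qm]: d/dz1, d/dz2, d/dz1bar, d/dz2bar; [Tm] is its inverse *)
Definition Qm : 'M[C]_4 := \matrix_(i, j) (2^-1 * nth 0 (nth [::]
  [:: [:: 1; - 'i%C; 0; 0]; [:: 0; 0; 1; - 'i%C]; [:: 1; 'i%C; 0; 0]; [:: 0; 0; 1; 'i%C]] i) j).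

Definition Tm : 'M[C]_4 := \matrix_(i, j) nth 0 (nth [::]
  [:: [:: 1; 0; 1; 0]; [:: 'i%C; 0; - 'i%C; 0]; [:: 0; 1; 0; 1]; [:: 0; 'i%C; 0; - 'i%C]] i) j.

Lemma ii : ('i%C : C) * 'i%C = -1. Proof. by rewrite -expr2 sqr_i. Qed.

Lemma TQ : Tm *m Qm = 1%:M.
Proof.
apply/matrixP; apply: ord4_cases; apply: ord4_cases;
  rewrite mxE sum4 /Tm /Qm !mxE !val_o /= ?o_neq /= ?eqxx;
  rewrite !(mul0r, mulr0, addr0, add0r, mul1r, mulr1);
  apply: eqReIm; rewrite ?cReD ?cImD ?cReM ?cImM ?cReN ?cImN ?cReV ?cImV /=; by field.
Qed.

Definition dgz x : 'M[C]_4 := \matrix_(i, j)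
  if i == j then nth 0 [:: z1 x; z2 x; (z1 x)^*%C; (z2 x)^*%C] i else 0.

(* r d/dr and d/dtheta for the two complex coordinates *)
Definition Lam (x : V) : 'M[R]_4 := \matrix_(i, j) nth 0 (nth [::]
  [:: [:: x 0 o0; x 0 o1; 0; 0]; [:: - x 0 o1; x 0 o0; 0; 0];
      [:: 0; 0; x 0 o2; x 0 o3]; [:: 0; 0; - x 0 o3; x 0 o2]] i) j.

(** r d/dr = z d/dz + zbar d/dzbar and d/dtheta = i (z d/dz - zbar d/dzbar), so the real and the
    complex logarithmic frames differ by the constant matrix [Tm]. *)
Lemma LamE x : cplx_mx (Lam x) = Tm *m dgz x *m Qm.
Proof.
suff <- : cplx_mx (Lam x) *m Tm = Tm *m dgz x by rewrite -mulmxA TQ mulmx1.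
apply/matrixP; apply: ord4_cases; apply: ord4_cases;
  rewrite mxE [RHS]mxE !sum4 /Tm !mxE !val_o /= !o_neq /= ?eqxx /z1 /z2 /zc;
  rewrite !(mul0r, mulr0, addr0, add0r, mul1r, mulr1, rmorph0, rmorphN);
  apply: eqReIm; rewrite ?cReD ?cImD ?cReM ?cImM ?cReN ?cImN /=; by ring.
Qed.

Section LogFrame.
(** In the application [A] holds the components of rho_2 in a chart where rho_0 = g z_1 z_2, and [H]
    those of the three-form. *)
Variables (r0 : R) (A : 'I_4 -> 'I_4 -> V -> C) (g : V -> C) (H : 'I_4 -> 'I_4 -> 'I_4 -> V -> C).
Hypothesis r0_gt0 : 0 < r0.
Local Notation W := (bal r0 : set V).
Hypothesis sA : forall i j, smoothc W (A i j).
Hypothesis skA : forall i j x, A j i x = - A i j x.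
Hypothesis sg : smoothc W g.
Hypothesis g0 : forall x, W x -> g x != 0.
Hypothesis sH : forall i j k, smoothc W (H i j k).
Hypothesis closedA : forall i j k x, W x -> zz x != 0 ->
  dc i (fun y => A j k y / (g y * zz y)) x + dc j (fun y => A k i y / (g y * zz y)) x +
  dc k (fun y => A i j y / (g y * zz y)) x = H i j k x.
Let oW : open W := open_bal r0.
Local Notation cx := (smoothc_cst oW).

Definition Bm x : 'M[C]_4 := \matrix_(i, j) (A i j x / g x).
Definition rhom x : 'M[C]_4 := Qm *m Bm x *m Qm^T.

Lemma rhomE x m n : rhom x m n = \sum_j (\sum_k Qm m k * (A k j x / g x)) * Qm n j.
Proof.
rewrite mxE; apply: eq_bigr => j _; rewrite [_^T _ _]mxE [(_ *m _) _ _]mxE; congr (_ * _).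
by apply: eq_bigr => k _; rewrite [Bm _ _ _]mxE.
Qed.

Lemma s_rhom m n : smoothc W (fun x => rhom x m n).
Proof.
apply: (smoothc_ext oW (fun x _ => esym (rhomE x m n))).
apply: smoothc_sum => // j _; apply: smoothc_mul => //; last exact: cx.
apply: smoothc_sum => // k _; apply: smoothc_mul => //; first exact: cx.
by apply: smoothc_mul => //; exact: smoothc_inv.
Qed.

Lemma skew_rhom x m n : rhom x n m = - rhom x m n.
Proof.
rewrite !rhomE -sumrN; under eq_bigr do rewrite mulr_suml.
rewrite exchange_big; apply: eq_bigr => j _; rewrite mulr_suml -sumrN.
by apply: eq_bigr => k _; rewrite (skA j k); ring.
Qed.

Lemma diag_rhom x m : rhom x m m = 0.
Proof.
by have /eqP := skew_rhom x m m; rewrite -subr_eq0 opprK -mulr2n mulrn_eq0 => /eqP.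
Qed.

Definition Dm m (f : V -> C) x : C := \sum_i Qm m i * dc i f x.

Lemma s_Dm m f : smoothc W f -> smoothc W (Dm m f).
Proof.
move=> sf; apply: smoothc_sum => // i _; apply: smoothc_mul => //; first exact: cx.
exact: smoothc_dc.
Qed.

Lemma dc_z1 i x : dc i z1 x = ((o0 == i)%:R +i* (o1 == i)%:R)%C. Proof. exact: dc_zc. Qed.
Lemma dc_z2 i x : dc i z2 x = ((o2 == i)%:R +i* (o3 == i)%:R)%C. Proof. exact: dc_zc. Qed.

Lemma dc_zz i x : W x -> dc i zz x = z1 x * dc i z2 x + dc i z1 x * z2 x.
Proof. by move=> Wx; have [[h1 h2] _] := smoothc_z oW; exact: (dc_mul oW Wx i h1 h2). Qed.

Lemma Dm_zz m x : W x -> Dm m zz x = nth 0 [:: z2 x; z1 x; 0; 0] m.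
Proof.
move=> Wx; rewrite /Dm sum4 !dc_zz// !dc_z1 !dc_z2 !o_neq !eqxx /=.
have e1 : ((true%:R : R) +i* false%:R)%C = 1 by [].
have e2 : ((false%:R : R) +i* true%:R)%C = 'i%C by [].
have e3 : ((false%:R : R) +i* false%:R)%C = 0 by [].
rewrite e1 e2 e3 /Qm !mxE !val_o /=; move: (z1 x) (z2 x) => a b.
move: m; apply: ord4_cases; rewrite !val_o /=;
  rewrite !(mul0r, mulr0, addr0, add0r, mul1r, mulr1) ?mulrN ?mulNr.
- by have -> : 2^-1 * b - 2^-1 * 'i%C * ('i%C * b) = 2^-1 * b * (1 - 'i%C * 'i%C); [ring|rewrite ii; field].
- by have -> : 2^-1 * a - 2^-1 * 'i%C * (a * 'i%C) = 2^-1 * a * (1 - 'i%C * 'i%C); [ring|rewrite ii; field].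
- by have -> : 2^-1 * b + 2^-1 * 'i%C * ('i%C * b) = 2^-1 * b * (1 + 'i%C * 'i%C); [ring|rewrite ii; field].
- by have -> : 2^-1 * a + 2^-1 * 'i%C * (a * 'i%C) = 2^-1 * a * (1 + 'i%C * 'i%C); [ring|rewrite ii; field].
Qed.

Definition Xm m n l x : C :=
  Dm m (fun y => rhom y n l) x + Dm n (fun y => rhom y l m) x + Dm l (fun y => rhom y m n) x.

Definition Hm m n l x : C := \sum_i \sum_j \sum_k Qm m i * Qm n j * Qm l k * H i j k x.

Lemma s_Xm m n l : smoothc W (Xm m n l).
Proof.
by apply: smoothc_add => //; [apply: smoothc_add => //|]; apply: s_Dm; exact: s_rhom.
Qed.

Lemma s_Hm m n l : smoothc W (Hm m n l).
Proof.
do 3![apply: smoothc_sum => // ? _].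
by apply: smoothc_mul => //; exact: cx.
Qed.

(* the closedness of [rho/F], with denominators cleared, in the frame [Qm] *)
Lemma frame_closed m n l x : W x ->
  zz x * Xm m n l x - (Dm m zz x * rhom x n l + Dm n zz x * rhom x l m + Dm l zz x * rhom x m n) =
  zz x ^+ 2 * Hm m n l x.
Proof.
have szz : smoothc W zz by case: (smoothc_z oW).
have sDzz k : smoothc W (Dm k zz) by exact: s_Dm.
(* Both sides are smooth, so the identity need only be checked off the divisor, where the quotient
   exists. *)
move: x; apply: (eq_off_zz oW).
- apply: smoothc_sub => //; first by apply: smoothc_mul => //; exact: s_Xm.
  by apply: smoothc_add => //; [apply: smoothc_add => //|]; apply: smoothc_mul => //; exact: s_rhom.
- by apply: smoothc_mul => //; [exact: smoothc_exp|exact: s_Hm].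
move=> x Wx zx.
pose W' := W `&` [set y | zz y != 0].
have oW' : open W' by exact: open_smoothc_neq0.
have W'x : W' x by [].
have sub : W' `<=` W by move=> y [].
have z0 y : W' y -> zz y != 0 by case.
have szz' : smoothc W' zz by exact: smoothc_subset szz.
have szi := smoothc_inv oW' z0 szz'.
have se i j : smoothc W' (fun y => A i j y / (g y * zz y)).
  apply: smoothc_mul => //; first exact: smoothc_subset (sA i j).
  apply: smoothc_inv => // [y [Wy zy]|]; first by rewrite mulf_neq0// g0.
  by apply: smoothc_mul => //; exact: smoothc_subset sg.
have sr a b : smoothc W' (fun y => rhom y a b) by exact: smoothc_subset (s_rhom a b).
(* d_i (rho_ab / F) in two ways *)
have E i a b : \sum_j \sum_k Qm a j * Qm b k * dc i (fun y => A j k y / (g y * zz y)) x =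
    (zz x * dc i (fun y => rhom y a b) x - rhom x a b * dc i zz x) / zz x ^+ 2.
  transitivity (dc i (fun y => rhom y a b * (zz y)^-1) x).
    transitivity (dc i (fun y => \sum_j \sum_k Qm a j * Qm b k * (A j k y / (g y * zz y))) x).
      rewrite (dc_sum oW' W'x) => [|j _]; last first.
        by apply: smoothc_sum => // k _; apply: smoothc_mul => //; exact: smoothc_cst.
      apply: eq_bigr => j _; rewrite (dc_sum oW' W'x) => [|k _]; last first.
        by apply: smoothc_mul => //; exact: smoothc_cst.
      by apply: eq_bigr => k _; rewrite (dc_scale oW' W'x).
    apply: (dc_ext oW' W'x) => y [Wy zy]; rewrite rhomE exchange_big mulr_suml; apply: eq_bigr => k _.
    rewrite !mulr_suml; apply: eq_bigr => j _.
    by have gy := g0 Wy; field; rewrite zy gy.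
  rewrite (dc_mul oW' W'x i (sr a b) szi) (dc_inv oW' W'x i z0 szz').
  by field.
have S a b d : \sum_i Qm a i * \sum_j \sum_k Qm b j * Qm d k * dc i (fun y => A j k y / (g y * zz y)) x =
    (zz x * Dm a (fun y => rhom y b d) x - rhom x b d * Dm a zz x) / zz x ^+ 2.
  under eq_bigr do rewrite E mulrA.
  by rewrite -mulr_suml; congr (_ / _); rewrite /Dm !mulr_sumr -sumrB; apply: eq_bigr => i _; ring.
have C3 : \sum_i Qm m i * \sum_j \sum_k Qm n j * Qm l k * dc i (fun y => A j k y / (g y * zz y)) x +
   \sum_i Qm n i * \sum_j \sum_k Qm l j * Qm m k * dc i (fun y => A j k y / (g y * zz y)) x +
   \sum_i Qm l i * \sum_j \sum_k Qm m j * Qm n k * dc i (fun y => A j k y / (g y * zz y)) x = Hm m n l x.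
  have T (f : 'I_4 -> 'I_4 -> 'I_4 -> C) a b d : \sum_i Qm a i * \sum_j \sum_k Qm b j * Qm d k * f i j k =
      \sum_i \sum_j \sum_k Qm a i * Qm b j * Qm d k * f i j k.
    apply: eq_bigr => i _; rewrite mulr_sumr; apply: eq_bigr => j _; rewrite mulr_sumr.
    by apply: eq_bigr => k _; ring.
  rewrite !(T (fun i j k => dc i (fun y => A j k y / (g y * zz y)) x)).
  (* The three sums are cyclic shifts of each other; relabelling aligns them with the three terms of
     [closedA]. *)
  have cyc (F : 'I_4 -> 'I_4 -> 'I_4 -> C) :
      \sum_i \sum_j \sum_k F i j k = \sum_i \sum_j \sum_k F j k i.
    rewrite [RHS]exchange_big; apply: eq_bigr => i _.
    by rewrite [RHS]exchange_big.
  rewrite [X in _ + X + _]cyc [X in _ + _ + X]cyc [X in _ + _ + X]cyc.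
  rewrite -!big_split; apply: eq_bigr => i _; rewrite -!big_split; apply: eq_bigr => j _.
  rewrite -!big_split; apply: eq_bigr => k _; rewrite -(closedA i j k Wx zx) /=; ring.
move: C3; rewrite !S => C3.
rewrite /Xm -C3; field; exact: zx.
Qed.

Let szz : smoothc W zz.
Proof. by case: (smoothc_z oW). Qed.
Let sz1 : smoothc W z1.
Proof. by case: (smoothc_z oW) => -[]. Qed.
Let sz2 : smoothc W z2.
Proof. by case: (smoothc_z oW) => -[]. Qed.

Let sY m n l : smoothc W (fun x => Xm m n l x - zz x * Hm m n l x).
Proof.
by apply: smoothc_sub => //; [exact: s_Xm|apply: smoothc_mul => //; exact: s_Hm].
Qed.

(** Closedness in the directions z_1, z_2 and an antiholomorphic one says that z_2 rho_1j - z_1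
    rho_0j is a smooth multiple of z_1 z_2. So z_1 divides z_2 rho_1j, hence rho_1j, and cancelling
    z_1 shows that z_2 divides rho_0j. *)
Lemma rhom_mixed (j : 'I_4) : (2 <= j)%N -> exists a b, [/\ smoothc W a, smoothc W b,
  forall x, W x -> rhom x o0 j = z2 x * a x & forall x, W x -> rhom x o1 j = z1 x * b x].
Proof.
move=> j2; have Dj x : W x -> Dm j zz x = 0.
  by move=> Wx; rewrite Dm_zz//; case: j j2 => -[|[|[|[|]]]].
pose Y x := Xm o0 o1 j x - zz x * Hm o0 o1 j x.
have E x : W x -> z2 x * rhom x o1 j = z1 x * (rhom x o0 j + z2 x * Y x).
  move=> Wx; have := frame_closed o0 o1 j Wx; rewrite (Dm_zz o0 Wx) (Dm_zz o1 Wx) (Dj x Wx) !val_o /= mul0r addr0.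
  rewrite (skew_rhom x o0 j) /Y /zz => /eqP; rewrite subr_eq => /eqP h.
  apply/eqP; rewrite -subr_eq0; apply/eqP.
  have -> : z2 x * rhom x o1 j - z1 x * (rhom x o0 j + z2 x * (Xm o0 o1 j x - z1 x * z2 x * Hm o0 o1 j x)) =
    ((z1 x * z2 x) ^+ 2 * Hm o0 o1 j x + (z2 x * rhom x o1 j + z1 x * - rhom x o0 j)) - z1 x * z2 x * Xm o0 o1 j x by ring.
  by rewrite -h subrr.
have sT : smoothc W (fun x => rhom x o0 j + z2 x * Y x).
  by apply: smoothc_add => //; [exact: s_rhom|apply: smoothc_mul => //; exact: sY].
have [b sb eb] : exists2 b, smoothc W b & forall x, W x -> rhom x o1 j = z1 x * b x.
  by apply: (division1 (m := 0) r0_gt0 sz2 (s_rhom o1 j) sT) => // x Wx; rewrite expr0 mul1r E.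
exists (fun x => b x - Y x), b; split=> //; first by apply: smoothc_sub => //; exact: sY.
apply: (eq_off_zz oW) => [||x Wx]; first exact: s_rhom.
  by apply: smoothc_mul => //; apply: smoothc_sub => //; exact: sY.
rewrite /zz mulf_eq0 negb_or => /andP[x1 x2].
apply: (mulfI x1); apply/eqP; rewrite -subr_eq0; apply/eqP.
have := E x Wx; rewrite eb// => h.
have -> : z1 x * rhom x o0 j - z1 x * (z2 x * (b x - Y x)) =
  z1 x * (rhom x o0 j + z2 x * Y x) - z2 x * (z1 x * b x) by ring.
by rewrite -h subrr.
Qed.

(** Closedness with both antiholomorphic directions and z_1, respectively z_2, gives divisibility by
    z_1, respectively z_2; [division1] combines the two. *)
Lemma rhom_bar : exists2 k, smoothc W k & forall x, W x -> rhom x o2 o3 = zz x * k x.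
Proof.
pose Y x := Xm o0 o2 o3 x - zz x * Hm o0 o2 o3 x.
pose Y' x := Xm o1 o2 o3 x - zz x * Hm o1 o2 o3 x.
have E1 : forall x, W x -> rhom x o2 o3 = z1 x * Y x.
  apply: (eq_off_zz oW) => [||x Wx zx]; first exact: s_rhom.
    by apply: smoothc_mul => //; exact: sY.
  move: (zx); rewrite /zz mulf_eq0 negb_or => /andP[x1 x2].
  have := frame_closed o0 o2 o3 Wx; rewrite !Dm_zz// !val_o /= !mul0r !addr0 => /eqP.
  rewrite subr_eq => /eqP h; apply: (mulfI x2); rewrite /Y mulrA [z2 x * z1 x]mulrC -/(zz x) mulrBr h; ring.
have E2 : forall x, W x -> rhom x o2 o3 = z2 x * Y' x.
  apply: (eq_off_zz oW) => [||x Wx zx]; first exact: s_rhom.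
    by apply: smoothc_mul => //; exact: sY.
  move: (zx); rewrite /zz mulf_eq0 negb_or => /andP[x1 x2].
  have := frame_closed o1 o2 o3 Wx; rewrite !Dm_zz// !val_o /= !mul0r !addr0 => /eqP.
  rewrite subr_eq => /eqP h; apply: (mulfI x1); rewrite /Y' mulrA -/(zz x) mulrBr h; ring.
have [k sk ek] : exists2 k, smoothc W k & forall x, W x -> Y' x = z1 x * k x.
  apply: (division1 (m := 0) r0_gt0 sz2 (sY o1 o2 o3) (sY o0 o2 o3)) => // x Wx.
  by rewrite expr0 mul1r -E2 ?E1.
by exists k => // x Wx; rewrite E2// ek// /zz mulrCA mulrA.
Qed.

Definition dz m x : C := nth 0 [:: z1 x; z2 x; (z1 x)^*%C; (z2 x)^*%C] (m : 'I_4).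
Definition cc : C := rhom 0 o0 o1.

Let s1c : smoothc W (fun x => (z1 x)^*%C). Proof. exact: smoothc_conj. Qed.
Let s2c : smoothc W (fun x => (z2 x)^*%C). Proof. exact: smoothc_conj. Qed.

Lemma z0E : (z1 (0 : V) = 0) * (z2 (0 : V) = 0).
Proof. by split; rewrite /z1 /z2 /zc !mxE. Qed.

(** In the complex logarithmic frame rho_2 / rho_0 has smooth coefficients, and at the origin only
    the one on the pair (z_1, z_2) survives. That value is the constant c of the normal form. *)
Lemma frame_smooth m n : exists2 N, smoothc W N & [/\
  forall x, W x -> zz x * N x = dz m x * dz n x * rhom x m n,
  N 0 = cc * (((m == o0) && (n == o1))%:R - ((m == o1) && (n == o0))%:R) &
  rhom 0 m n = cc * (((m == o0) && (n == o1))%:R - ((m == o1) && (n == o0))%:R)].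
Proof.
pose P m n := exists2 N, smoothc W N & [/\ forall x, W x -> zz x * N x = dz m x * dz n x * rhom x m n,
  N 0 = cc * (((m == o0) && (n == o1))%:R - ((m == o1) && (n == o0))%:R) &
  rhom 0 m n = cc * (((m == o0) && (n == o1))%:R - ((m == o1) && (n == o0))%:R)].
rewrite -/(P m n).
have W0 : W 0 by exact: bal0.
have Psym m' n' : P m' n' -> P n' m'.
  move=> [N sN [e1 e2 e3]]; exists (fun x => - N x); first exact: smoothc_opp.
  split=> [x Wx||]; first by rewrite mulrN e1// (skew_rhom x m' n'); ring.
    by rewrite e2 -mulrN opprB andbC [(m' == o0) && _]andbC.
  by rewrite skew_rhom e3 -mulrN opprB andbC [(m' == o0) && _]andbC.
have Pdiag m' : P m' m'.
  have z0 : ((m' == o0) && (m' == o1))%:R - ((m' == o1) && (m' == o0))%:R = 0 :> C.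
    by rewrite andbC subrr.
  by exists (fun=> 0); [exact: cx|split=> [x Wx||]; rewrite ?z0 ?diag_rhom ?mulr0].
have P01 : P o0 o1.
  exists (fun x => rhom x o0 o1); first exact: s_rhom.
  split=> [x Wx||]; first by rewrite /dz !val_o.
    by rewrite !eqxx !o_neq /= subr0 mulr1.
  by rewrite !eqxx !o_neq /= subr0 mulr1.
have mixed (j : 'I_4) : (2 <= j)%N -> P o0 j /\ P o1 j.
  move=> j2; have [a [b [sa sb ea eb]]] := rhom_mixed j2.
  have jn : (j == o0 = false) * (j == o1 = false).
    by split; apply/negbTE; rewrite -val_eqE /= val_o; case: (val j) j2 => [|[|]].
  have sdj : smoothc W (dz j) by case: j j2 {ea eb jn} => -[|[|[|[|//]]]] h //= _.
  have z0 : dz j 0 = 0 by move: j {j2 ea eb jn sdj}; apply: ord4_cases; rewrite /dz !z0E !conjc0 !val_o.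
  split.
    exists (fun x => dz j x * a x); first exact: smoothc_mul.
    split=> [x Wx||]; first by rewrite ea// /dz !val_o /= /zz; ring.
      by rewrite z0 mul0r !jn andbF !o_neq /= subr0 mulr0.
    by rewrite ea// z0E mul0r !jn !o_neq /= andbF subr0 mulr0.
  exists (fun x => dz j x * b x); first exact: smoothc_mul.
  split=> [x Wx||]; first by rewrite eb// /dz !val_o /= /zz; ring.
    by rewrite z0 mul0r !jn !o_neq /= andbF subr0 mulr0.
  by rewrite eb// z0E mul0r !jn !o_neq /= andbF subr0 mulr0.
have P23 : P o2 o3.
  have [k sk ek] := rhom_bar.
  exists (fun x => (z1 x)^*%C * (z2 x)^*%C * k x); first by apply: smoothc_mul => //; exact: smoothc_mul.
  split=> [x Wx||]; first by rewrite ek// /dz !val_o /=; ring.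
    by rewrite z0E conjc0 !mul0r !o_neq /= subr0 mulr0.
  by rewrite ek// /zz z0E !mul0r !o_neq /= subr0 mulr0.
have [P02 P12] := mixed o2 (eq_leq (esym val_o.1.2)).
have [P03 P13] : P o0 o3 /\ P o1 o3 by apply: mixed; rewrite val_o.
by move: m n; apply: ord4_cases; apply: ord4_cases; rewrite ?Pdiag//; apply: Psym.
Qed.

(** The components of dz_1 /\ dz_2 in the real coordinates. *)
Definition Th i j : C := Tm i o0 * Tm j o1 - Tm i o1 * Tm j o0.

Definition Nm m n : V -> C := s2val (cid2 (frame_smooth m n)).

Lemma NmP m n : smoothc W (Nm m n) /\ [/\ forall x, W x -> zz x * Nm m n x = dz m x * dz n x * rhom x m n,
  Nm m n 0 = cc * (((m == o0) && (n == o1))%:R - ((m == o1) && (n == o0))%:R) &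
  rhom 0 m n = cc * (((m == o0) && (n == o1))%:R - ((m == o1) && (n == o0))%:R)].
Proof. by split; [exact: s2valP (cid2 (frame_smooth m n))|exact: s2valP' (cid2 (frame_smooth m n))]. Qed.

Lemma sum_Th i j : \sum_m \sum_n Tm i m * Tm j n *
  (cc * (((m == o0) && (n == o1))%:R - ((m == o1) && (n == o0))%:R)) = cc * Th i j.
Proof. by rewrite /Th sum4 !sum4 !eqxx !o_neq /=; ring. Qed.

Lemma A0E i j : A i j 0 = g 0 * (cc * Th i j).
Proof.
have W0 : W 0 by exact: bal0.
have e : Bm 0 = Tm *m rhom 0 *m Tm^T.
  by rewrite /rhom !mulmxA TQ mul1mx -mulmxA -trmx_mul TQ trmx1 mulmx1.
have := congr1 (fun K : 'M[C]_4 => K i j) e; rewrite mxE => h.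
rewrite -[A i j 0](divfK (g0 W0)) mulrC h; congr (_ * _); rewrite -sum_Th.
rewrite mxE exchange_big; apply: eq_bigr => n _; rewrite mxE mulr_suml.
apply: eq_bigr => m _; rewrite [_^T _ _]mxE; have [_ [_ _ ->]] := NmP m n; ring.
Qed.

(** The matrix of omega in the frame [Lam], in a form that makes sense on the divisor as well. *)
Definition Om x : 'M[R]_4 := \matrix_(a, b) complex.Im (\sum_m \sum_n Tm a m * Tm b n * Nm m n x).

Lemma s_Om a b : smooth W (fun x => Om x a b).
Proof.
have [_ h] : smoothc W (fun x => \sum_m \sum_n Tm a m * Tm b n * Nm m n x).
  apply: smoothc_sum => // m _; apply: smoothc_sum => // n _.
  by apply: smoothc_mul => //; [exact: cx|case: (NmP m n)].
by apply: (smooth_ext oW _ h) => x _; rewrite [RHS]mxE.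
Qed.

Definition om x : 'M[R]_4 := \matrix_(i, j) complex.Im (A i j x / (g x * zz x)).

Lemma ImZ (u v : R) (w : C) : complex.Im (u%:C%C * w * v%:C%C) = u * complex.Im w * v.
Proof. by case: w => p q /=; ring. Qed.

Lemma OmE x : W x -> zz x != 0 -> Om x = Lam x *m om x *m (Lam x)^T.
Proof.
move=> Wx zx; apply/matrixP => a b; rewrite [LHS]mxE.
have e : \sum_m \sum_n Tm a m * Tm b n * Nm m n x =
   (cplx_mx (Lam x) *m ((zz x)^-1 *: Bm x) *m (cplx_mx (Lam x))^T) a b.
  rewrite LamE !trmx_mul.
  have -> : Tm *m dgz x *m Qm *m ((zz x)^-1 *: Bm x) *m (Qm^T *m ((dgz x)^T *m Tm^T)) =
     (zz x)^-1 *: (Tm *m dgz x *m rhom x *m (dgz x)^T *m Tm^T).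
    by rewrite -scalemxAr -!scalemxAl /rhom !mulmxA.
  have dE (K : 'M[C]_4) m n : (dgz x *m K *m (dgz x)^T) m n = dz m x * dz n x * K m n.
    rewrite mxE (bigD1 n)//= [X in _ + X]big1 ?addr0 => [|k /negbTE kn]; last first.
      by rewrite [_^T _ _]mxE [dgz _ _ _]mxE eq_sym kn mulr0.
    rewrite [_^T _ _]mxE [dgz x n n]mxE eqxx mxE (bigD1 m)//= big1 ?addr0 => [|k /negbTE km]; last first.
      by rewrite [dgz _ _ _]mxE eq_sym km mul0r.
    by rewrite [dgz x m m]mxE eqxx /dz; ring.
  have -> : Tm *m dgz x *m rhom x *m (dgz x)^T *m Tm^T = Tm *m (dgz x *m rhom x *m (dgz x)^T) *m Tm^T.
    by rewrite !mulmxA.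
  rewrite mxE [(_ *m Tm^T) a b]mxE mulr_sumr exchange_big; apply: eq_bigr => n _.
  rewrite [(Tm *m _) a n]mxE mulr_suml mulr_sumr; apply: eq_bigr => m _.
  rewrite dE [_^T _ _]mxE; have [_ [h _ _]] := NmP m n; rewrite -h//; field; exact: zx.
rewrite e mxE cImS [RHS]mxE; apply: eq_bigr => j _.
rewrite [(_ *m om x) a j]mxE [(cplx_mx _ *m _) a j]mxE mulr_suml cImS mulr_suml; apply: eq_bigr => i _.
rewrite [_^T _ _]mxE [(Lam x)^T _ _]mxE [cplx_mx _ _ _]mxE [cplx_mx _ _ _]mxE [om _ _ _]mxE.
rewrite [(_ *: Bm x) _ _]mxE [Bm _ _ _]mxE ImZ; congr (_ * complex.Im _ * _).
by have gx := g0 Wx; field; rewrite zx gx.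
Qed.

(** The components of Im (c (dz_2/z_2 - dz_1/z_1)) in the logarithmic frame are constants: dz/z
    takes the values 1 and i on r d/dr and d/dtheta. *)
Definition eta0 : 'rV[R]_4 := \row_a nth 0 [:: - complex.Im cc; - complex.Re cc; complex.Im cc; complex.Re cc] a.

Definition etav x : 'rV[R]_4 := \row_j complex.Im (cc * (dc j z2 x / z2 x - dc j z1 x / z1 x)).

Lemma Om0E a b : Om 0 a b = complex.Im (cc * Th a b).
Proof.
rewrite mxE -sum_Th; congr complex.Im; apply: eq_bigr => m _; apply: eq_bigr => n _.
by have [_ [_ -> _]] := NmP m n.
Qed.

Lemma Om0 : Om 0 = let q := complex.Im cc in let p := complex.Re cc in \matrix_(i, j) nth 0 (nth [::]
  [:: [:: 0; 0; q; p]; [:: 0; 0; p; - q]; [:: - q; - p; 0; 0]; [:: - p; q; 0; 0]] i) j.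
Proof.
apply/matrixP; apply: ord4_cases; apply: ord4_cases; rewrite Om0E [RHS]mxE /Th /Tm !mxE !val_o /=;
  case: cc => u v /=; ring.
Qed.

Lemma Om0_sqr : cc != 0 ->
  Om 0 *m (- (complex.Re cc ^+ 2 + complex.Im cc ^+ 2)^-1 *: Om 0) = 1%:M.
Proof.
rewrite -sqr_norm_eq0 => s0.
rewrite -scalemxAr; apply/matrixP; apply: ord4_cases; apply: ord4_cases;
  rewrite mxE mxE sum4 Om0 !mxE !val_o /= ?o_neq ?eqxx /=; move: s0;
  move: (complex.Re cc) (complex.Im cc) => p q s0; field; exact: s0.
Qed.

Lemma etav_Lam x : zz x != 0 -> etav x *m (Lam x)^T = eta0.
Proof.
rewrite /zz mulf_eq0 negb_or => /andP[x1 x2]; apply/rowP => a; rewrite mxE sum4 !mxE.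
rewrite !dc_z1 !dc_z2 !o_neq !eqxx.
have e1 : ((true%:R : R) +i* false%:R)%C = 1 by [].
have e2 : ((false%:R : R) +i* true%:R)%C = 'i%C by [].
have e3 : ((false%:R : R) +i* false%:R)%C = 0 by [].
rewrite e1 e2 e3 !mul0r !subr0 !sub0r !mul1r.
move: x1 x2; rewrite -!sqr_norm_eq0 /z1 /z2 /zc /= => x1 x2.
move: a; apply: ord4_cases; rewrite !val_o /=; case: cc => u v /=; field; by rewrite ?x1 ?x2.
Qed.

Lemma Lam_inj x (v : 'rV[R]_4) : zz x != 0 -> v *m (Lam x)^T = 0 -> v = 0.
Proof.
rewrite /zz mulf_eq0 negb_or => /andP[]; rewrite -!sqr_norm_eq0 /z1 /z2 /zc /= => x1 x2 h.
have e a : \sum_j v 0 j * Lam x a j = 0.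
  have := congr1 (fun w : 'rV[R]_4 => w 0 a) h; rewrite mxE [RHS]mxE => h'; rewrite -[RHS]h'.
  by apply: eq_bigr => j _; rewrite [_^T _ _]mxE.
have := e o0; have := e o1; have := e o2; have := e o3; rewrite !sum4 !mxE !val_o /=.
move=> h3 h2 h1 h0; apply/rowP; apply: ord4_cases; rewrite [RHS]mxE.
- apply: (mulIf x1); rewrite mul0r; transitivity (x 0 o0 * (v 0 o0 * x 0 o0 + v 0 o1 * x 0 o1 + v 0 o2 * 0 + v 0 o3 * 0)
    - x 0 o1 * (v 0 o0 * - x 0 o1 + v 0 o1 * x 0 o0 + v 0 o2 * 0 + v 0 o3 * 0)); first by ring.
  by rewrite h0 h1; ring.
- apply: (mulIf x1); rewrite mul0r; transitivity (x 0 o1 * (v 0 o0 * x 0 o0 + v 0 o1 * x 0 o1 + v 0 o2 * 0 + v 0 o3 * 0)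
    + x 0 o0 * (v 0 o0 * - x 0 o1 + v 0 o1 * x 0 o0 + v 0 o2 * 0 + v 0 o3 * 0)); first by ring.
  by rewrite h0 h1; ring.
- apply: (mulIf x2); rewrite mul0r; transitivity (x 0 o2 * (v 0 o0 * 0 + v 0 o1 * 0 + v 0 o2 * x 0 o2 + v 0 o3 * x 0 o3)
    - x 0 o3 * (v 0 o0 * 0 + v 0 o1 * 0 + v 0 o2 * - x 0 o3 + v 0 o3 * x 0 o2)); first by ring.
  by rewrite h2 h3; ring.
- apply: (mulIf x2); rewrite mul0r; transitivity (x 0 o3 * (v 0 o0 * 0 + v 0 o1 * 0 + v 0 o2 * x 0 o2 + v 0 o3 * x 0 o3)
    + x 0 o2 * (v 0 o0 * 0 + v 0 o1 * 0 + v 0 o2 * - x 0 o3 + v 0 o3 * x 0 o2)); first by ring.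
  by rewrite h2 h3; ring.
Qed.

Lemma smooth_Lam U a j : open U -> smooth U (fun x => Lam x a j).
Proof.
move=> oU; have f (y : V -> R) : (forall x, y x = Lam x a j) -> smooth U y -> smooth U (fun x => Lam x a j).
  by move=> h; apply: (smooth_ext oU) => x _; exact: h.
have c (k : 'I_4) := smooth_coord oU k; have nc (k : 'I_4) := smooth_opp oU (c k); have z := smooth_cst oU 0.
move: a j f; apply: ord4_cases; apply: ord4_cases => f;
  first [by apply: (f _ _ z) => x; rewrite mxE !val_o
  | by apply: (f _ _ (c o0)) => x; rewrite mxE !val_o
  | by apply: (f _ _ (c o1)) => x; rewrite mxE !val_o
  | by apply: (f _ _ (c o2)) => x; rewrite mxE !val_o
  | by apply: (f _ _ (c o3)) => x; rewrite mxE !val_o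
  | by apply: (f _ _ (nc o1)) => x; rewrite mxE !val_o
  | by apply: (f _ _ (nc o3)) => x; rewrite mxE !val_o].
Qed.

(** The hypothesis is equivalent to c being nonzero, by [A0E]. Then [Om] is invertible near 0, and
    i_E omega = eta can be solved smoothly in the logarithmic frame. *)
Lemma log_frame : (exists i j, A i j 0 != 0) ->
  exists (rho : R) (E : V -> V) (k1 k2 : V -> C), [/\ cc != 0, 0 < rho <= r0, smoothv (bal rho) E, E 0 = 0 &
    forall i j, 'D_(delta_mx 0 j) (fun x => E x 0 i) 0 = (i == j)%:R] /\
   [/\ smoothc (bal rho) k1 /\ smoothc (bal rho) k2, k1 0 = 1 /\ k2 0 = 1,
    forall x, \sum_i (E x 0 i)%:C%C * dc i z1 x = z1 x * k1 x,
    forall x, \sum_i (E x 0 i)%:C%C * dc i z2 x = z2 x * k2 x &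
    forall x j, bal rho x -> zz x != 0 -> \sum_i E x 0 i * complex.Im (A i j x / (g x * zz x)) =
       complex.Im (cc * (dc j z2 x / z2 x - dc j z1 x / z1 x))].
Proof.
move=> [i0 [j0 Aij]].
have c0 : cc != 0 by apply: contraNneq Aij => e; rewrite A0E e mul0r mulr0.
have W0 : W 0 by exact: bal0.
have uO : Om 0 \in unitmx by have [] := mulmx1_unit (Om0_sqr c0).
have sdet : smooth W (fun x => \det (Om x)).
  by apply: smooth_det => // a b; exact: s_Om.
have d0 : \det (Om 0) != 0 by rewrite -unitfE -unitmxE.
have cd := smooth_cont sdet W0.
have /nbhs_normP[r2 /= r20 hr2] := cd _ (open_nbhs_nbhs (conj (@open_neq _ 0) d0)).
pose rho := Num.min r0 r2.
have rho_gt0 : 0 < rho by rewrite lt_min r0_gt0.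
have rr0 : bal rho `<=` (W : set V) by move=> v; rewrite /bal /= lt_min => /andP[].
have uOx x : bal rho x -> Om x \in unitmx.
  rewrite /bal /= lt_min => /andP[_ xr]; rewrite unitmxE unitfE; apply: hr2.
  by rewrite /= sub0r normrN.
have oR := open_bal rho : open (bal rho : set V).
pose e x : 'rV[R]_4 := eta0 *m invmx (Om x).
pose E x := e x *m Lam x.
have si i k : smooth (bal rho) (fun x => invmx (Om x) i k).
  by apply: smooth_invmx => // a b; exact: smooth_subset rr0 (s_Om a b).
have se a : smooth (bal rho) (fun x => e x 0 a).
  apply: (smooth_ext oR _ (smooth_sum oR (P := predT) (index_enum _)
    (fun k _ => smooth_mul oR (smooth_cst oR (eta0 0 k)) (si k a)))) => x _.
  by rewrite mxE.
(* At the origin the solution is r_1 d/dr_1 + r_2 d/dr_2, the Euler field; the right-hand side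
   [eta0] is chosen for this. *)
have e0 : e 0 = \row_a nth 0 [:: 1; 0; 1; 0] a.
  have -> : e 0 = eta0 *m (- (complex.Re cc ^+ 2 + complex.Im cc ^+ 2)^-1 *: Om 0).
    by rewrite /e; congr (_ *m _); rewrite -[LHS]mulmx1 -(Om0_sqr c0) mulmxA mulVmx// mul1mx.
  have s0 := c0; rewrite -sqr_norm_eq0 in s0.
  apply/rowP; apply: ord4_cases; rewrite mxE sum4 Om0 !mxE !val_o /=; move: s0;
  move: (complex.Re cc) (complex.Im cc) => p q s0; field; exact: s0.
(* E differs from the Euler field by products of two factors that vanish at 0, so its linear part is
   the identity. *)
have EE x i : E x 0 i = x 0 i + \sum_a (e x 0 a - e 0 0 a) * Lam x a i.
  rewrite mxE -[LHS]add0r; under [in RHS]eq_bigr do rewrite mulrBl.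
  rewrite sumrB addrA addrAC; congr (_ + _); rewrite e0 sum4 !mxE !val_o /=.
  by move: i; apply: ord4_cases; rewrite !val_o /=; ring.
(* r d/dr and d/dtheta multiply the coordinate z by 1 and by i. *)
exists rho, E, (fun x => (e x 0 o0 +i* e x 0 o1)%C), (fun x => (e x 0 o2 +i* e x 0 o3)%C).
have b0 : bal rho (0 : V) by exact: bal0.
have Lam0 : Lam 0 = 0.
  by apply/matrixP; apply: ord4_cases; apply: ord4_cases; rewrite !mxE !val_o /= ?oppr0.
split; split=> //.
- by rewrite rho_gt0 ge_min lexx.
- move=> i; apply: (smooth_ext oR _ (smooth_sum oR (P := predT) (index_enum _)
    (fun k _ => smooth_mul oR (se k) (smooth_Lam k i oR)))) => x _.
  by rewrite [RHS]mxE.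
- by rewrite /E Lam0 mulmx0.
- move=> i j.
  have -> : (fun x => E x 0 i) = (fun x : V => x 0 i) + \sum_a (fun x => (e x 0 a - e 0 0 a) * Lam x a i).
    by apply/funext => x; rewrite EE /GRing.add /= fct_sumE.
  have sd a : smooth (bal rho) (fun x => e x 0 a - e 0 0 a).
    by apply: smooth_sub => //; exact: smooth_cst.
  have sm a : smooth (bal rho) (fun x => (e x 0 a - e 0 0 a) * Lam x a i).
    by apply: smooth_mul => //; exact: smooth_Lam.
  have dd f : smooth (bal rho) f -> derivable f 0 (delta_mx 0 j).
    by move=> sf; apply: diff_derivable; exact: smooth_diff sf b0.
  rewrite deriveD; last 2 first.
  + exact/dd/smooth_coord.
  + by apply: derivable_sum => a; exact: dd.
  rewrite derive_coord derive_sum; last by move=> a; exact: dd.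
  rewrite big1 ?addr0// => a _.
  rewrite (deriveM (dd _ (sd a)) (dd _ (smooth_Lam a i oR))) Lam0 subrr mxE.
  by rewrite scale0r scale0r addr0.
- by split; split=> /=.
- by split; rewrite e0 !mxE !val_o.
- move=> x; rewrite sum4 !dc_z1 !o_neq !eqxx.
  rewrite [E x]lock; apply: eqReIm; rewrite ?cReD ?cImD ?cReM ?cImM -lock ![E x _ _]mxE !sum4 !mxE !val_o /z1 /zc /=; ring.
- move=> x; rewrite sum4 !dc_z2 !o_neq !eqxx.
  rewrite [E x]lock; apply: eqReIm; rewrite ?cReD ?cImD ?cReM ?cImM -lock ![E x _ _]mxE !sum4 !mxE !val_o /z2 /zc /=; ring.
- move=> x j Rx zx; have Wx := rr0 _ Rx.
  suff h : E x *m om x = etav x.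
    have := congr1 (fun w : 'rV[R]_4 => w 0 j) h; rewrite [RHS]mxE mxE => <-.
    by apply: eq_bigr => i _; rewrite [om _ _ _]mxE.
  apply/eqP; rewrite -subr_eq0; apply/eqP; apply: (Lam_inj zx).
  rewrite mulmxBl etav_Lam// /E -!mulmxA [Lam x *m _]mulmxA -OmE// /e.
  by rewrite mulVmx ?uOx// mulmx1 subrr.
Qed.

End LogFrame.

End R4.

(** * Linearising coordinates *)

Section Radial.
Context {R : realType} {n : nat}.
Local Notation V := 'rV[R]_n.
Local Notation C := R[i].

(** The primitive m(v) is the integral of f(t v) / t over [0,1], smooth because f(0) = 0. Then m(s
    y) is the integral up to s along the ray of y, and is differentiated in s. *)
Lemma radial_primitive r (f : V -> R) : 0 < r -> smooth (bal r) f -> f 0 = 0 ->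
  exists2 m, smooth (bal r) m & forall v, bal r v -> \sum_j v 0 j * 'D_(delta_mx 0 j) m v = f v.
Proof.
move=> r0 sf f0; have oW : open (bal r : set V) := open_bal r.
pose q (t : R) (y : V) := \sum_j y 0 j * had j f (clamp t *: y).
have cq k : ck k (bal r) q.
  apply: ck_sum => // j _; apply: ck_mul => //; first exact: ck_coord.
  apply: (@ck_comp R n n k (bal r) (bal r) (fun=> 0)
    (fun u y => clamp u *: y) (fun _ : R => had j f)) => //.
  - by move=> t; exact: cvg_cst.
  - by move=> u y hy; apply: bal_ray => //; rewrite clamp_ge0 clamp_le1.
  - move=> i; have hc : ck k (bal r) (fun u (_ : V) => clamp u).
      by apply: ck_t => //; exact: continuous_clamp.
    by apply: ck_ext (ck_mul oW hc (ck_coord oW k i)) => // s x _; rewrite mxE.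
  - exact: (smooth_had j r0 sf k).
pose m y := ip (q^~ y) 1.
have sm : smooth (bal r) m.
  by move=> k; exact: (ck_fix 1 oW (ck_ip oW (cvx_bal r) (cq k))).
exists m => // v hv.
have cont y : bal r y -> continuous (q^~ y).
  by move=> hy; exact: (jc_sl (ck_jc (cq 0%N)) hy).
have [c [c1 hc]] : exists c : R, 1 < c /\ bal r (c *: v).
  have [v0|vn] := eqVneq v 0.
    by exists 2; split; [lra|rewrite v0 scaler0; exact: bal0].
  have nv : 0 < `|v| by rewrite normr_gt0.
  have hv' : `|v| < r by exact: hv.
  exists ((1 + r / `|v|) / 2); split.
    by rewrite ltr_pdivlMr// mul1r (_ : 2 = 1 + 1)// ltrD2l ltr_pdivlMr// mul1r.
  rewrite /bal /= normrZ ger0_norm; last by rewrite divr_ge0// addr_ge0// divr_ge0 ?ltW.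
  have -> : (1 + r / `|v|) / 2 * `|v| = (`|v| + r) / 2 by field; rewrite gt_eqF.
  by rewrite ltr_pdivrMr// mulr_natr mulr2n ltrD2r.
have c0 : c != 0 by rewrite gt_eqF// (lt_trans _ c1).
have c0' : 0 < c by rewrite (lt_trans _ c1).
pose y := c *: v; pose s := c^-1.
have s01 : 0 < s < 1 by rewrite invr_gt0 c0' invf_lt1.
have vE : v = s *: y by rewrite /y scalerA mulVf// scale1r.
have d1 := is_derive_ip (cont _ hc) s01.
have d2 : is_derive s 1 (fun t : R => m (t *: y)) (q s y).
  apply: near_eq_is_derive d1; move: s01 => /andP[s0 s1].
  near=> t.
  have ht : 0 <= t <= 1.
    apply/andP; split; near: t.
      by apply: filterS (lt_nbhsr s0) => z /ltW.
    by apply: filterS (lt_nbhsl s1) => z /ltW.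
  rewrite -[t in LHS]mulr1 -ip_dilate ?ler01 ?lexx//; last exact: cont.
  apply: eq_ip.
  - move=> z; apply: cvgM; first exact: cvg_cst.
    have c2 : continuous (fun z : R => t * z) by move=> x; apply: cvgM; [exact: cvg_cst|exact: cvg_id].
    exact: (continuous_compR c2 (cont _ hc)).
  - by apply: cont; exact: bal_ray.
  - move=> z /andP[z0 z1]; rewrite /q mulr_sumr; apply: eq_bigr => j _.
    move: ht => /andP[t0 t1].
    rewrite [clamp z]clamp_id ?z0// [clamp (t * z)]clamp_id ?mulr_ge0 ?mulr_ile1//.
  by rewrite [(t *: y) 0 j]mxE [z *: (t *: y)]scalerA mulrA [z * t]mulrC.
have dm : differentiable m (s *: y) by rewrite -vE; exact: smooth_diff sm hv.
have e : \sum_j y 0 j * 'D_(delta_mx 0 j) m (s *: y) = q s y.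
  by rewrite -(@derive_val _ _ _ _ _ _ _ d2) -(@derive_val _ _ _ _ _ _ _ (is_derive_ray dm)).
have qE : q s y = c * f v.
  rewrite (had_eq sf hv) f0 add0r /q mulr_sumr; apply: eq_bigr => j _.
  rewrite clamp_id; last by case/andP: s01 => /ltW -> /ltW ->.
  by rewrite -vE mxE -mulrA [had _ _ _ * _]mulrC.
apply: (mulfI c0); rewrite -qE -e mulr_sumr -vE; apply: eq_bigr => j _.
by rewrite mulrA [y 0 j]mxE.
Unshelve. all: by end_near. Qed.

Definition eul (f : V -> C) (v : V) : C := \sum_j (v 0 j)%:C%C * dc j f v.

Lemma smoothc_comp m (W : set V) (W' : set 'rV[R]_m) (Y : V -> 'rV[R]_m) f : open W -> open W' ->
  (forall x, W x -> W' (Y x)) -> smoothv W Y -> smoothc W' f -> smoothc W (fun x => f (Y x)).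
Proof.
by move=> oW oW' h sY [s1 s2]; split; [exact: (smooth_comp oW oW' h sY s1)|exact: (smooth_comp oW oW' h sY s2)].
Qed.

Lemma dc_comp m (W : set V) (W' : set 'rV[R]_m) (Y : V -> 'rV[R]_m) f x j : W x ->
  (forall x, W x -> W' (Y x)) -> smoothv W Y -> smoothc W' f ->
  dc j (fun x => f (Y x)) x = \sum_k dc k f (Y x) * ('D_(delta_mx 0 j) (fun x => Y x 0 k) x)%:C%C.
Proof.
move=> Wx h sY [s1 s2]; have dY k := smooth_diff (sY k) Wx.
apply: eqReIm; rewrite ?cReS ?cImS /dc /=.
  rewrite -[fun y => complex.Re _]/((fun y => complex.Re (f y)) \o Y) derive_comp_rV//; last exact: smooth_diff s1 (h _ Wx).
  by apply: eq_bigr => k _; rewrite mulr0 subr0.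
rewrite -[fun y => complex.Im _]/((fun y => complex.Im (f y)) \o Y) derive_comp_rV//; last exact: smooth_diff s2 (h _ Wx).
by apply: eq_bigr => k _; rewrite mulr0 add0r.
Qed.

Definition cexp (f : V -> C) x : C :=
  ((expR (complex.Re (f x)) * cos (complex.Im (f x)))%R +i* (expR (complex.Re (f x)) * sin (complex.Im (f x)))%R)%C.

Lemma cexp_neq0 f x : cexp f x != 0.
Proof.
rewrite -sqr_norm_eq0 /= !exprMn -mulrDr cos2Dsin2 mulr1 sqrf_eq0.
by rewrite gt_eqF// expR_gt0.
Qed.

Lemma smoothc_cexp W f : open W -> smoothc W f -> smoothc W (cexp f).
Proof.
move=> oW [s1 s2]; have [c s] := smooth_trig oW s2.
by split; apply: smooth_mul => //; exact: smooth_expR.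
Qed.

Lemma dc_cexp W f j x : W x -> smoothc W f -> dc j (cexp f) x = cexp f x * dc j f x.
Proof.
move=> Wx [s1 s2].
have [d1 e1] := is_derive_chain1 (delta_mx 0 j) (smooth_diff s1 Wx) (is_derive_expR _).
have [d2 e2] := is_derive_chain1 (delta_mx 0 j) (smooth_diff s2 Wx) (is_derive_cos _).
have [d3 e3] := is_derive_chain1 (delta_mx 0 j) (smooth_diff s2 Wx) (is_derive_sin _).
apply: eqReIm; rewrite ?cReM ?cImM /dc /=.
  rewrite (deriveM (diff_derivable d1) (diff_derivable d2)) e1 e2 /GRing.scale/=; ring.
rewrite (deriveM (diff_derivable d1) (diff_derivable d3)) e1 e3 /GRing.scale/=; ring.
Qed.

Lemma eul_Re f v : complex.Re (eul f v) = \sum_j v 0 j * 'D_(delta_mx 0 j) (fun x => complex.Re (f x)) v.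
Proof. by rewrite /eul cReS; apply: eq_bigr => j _; rewrite cReM /dc /= mul0r subr0. Qed.

Lemma eul_Im f v : complex.Im (eul f v) = \sum_j v 0 j * 'D_(delta_mx 0 j) (fun x => complex.Im (f x)) v.
Proof. by rewrite /eul cImS; apply: eq_bigr => j _; rewrite cImM /dc /= mul0r addr0. Qed.

(* Dividing by the exponential of a radial primitive of [k - 1] makes [W] homogeneous. *)
Lemma eul_linear_unit r (W k : V -> C) : 0 < r -> smoothc (bal r) W -> smoothc (bal r) k ->
  W 0 = 0 -> k 0 = 1 -> (forall v, bal r v -> eul W v = W v * k v) ->
  exists q, [/\ smoothc (bal r) q, forall v, q v != 0, q 0 = 1 &
    forall v, bal r v -> W v = q v * \sum_j dc j W 0 * (v 0 j)%:C%C].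
Proof.
move=> r0 sW [sk1 sk2] W0 k0 hE; have oW : open (bal r : set V) := open_bal r.
have b0 : bal r (0 : V) by exact: bal0.
have sk3 : smooth (bal r) (fun v => complex.Re (k v) - 1).
  by apply: smooth_sub => //; exact: smooth_cst.
have k30 : complex.Re (k 0) - 1 = 0 by rewrite k0 subrr.
have k20 : complex.Im (k 0) = 0 by rewrite k0.
have [m1 sm1 e1] := radial_primitive r0 sk3 k30.
have [m2 sm2 e2] := radial_primitive r0 sk2 k20.
pose m v : C := (m1 v +i* m2 v)%C.
have sm : smoothc (bal r) m by [].
have em v : bal r v -> eul m v = k v - 1.
  move=> hv; apply: eqReIm; rewrite ?cReD ?cImD ?cReN ?cImN.
    by rewrite eul_Re /= e1.
  by rewrite eul_Im /= e2// subr0.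
have sU := smoothc_cexp oW sm.
have hU v : bal r v -> cexp m v != 0 by move=> _; exact: cexp_neq0.
have sUi := smoothc_inv oW hU sU.
pose F v := W v * (cexp m v)^-1.
have sF : smoothc (bal r) F by exact: smoothc_mul.
have dF j v : bal r v -> dc j F v = dc j W v / cexp m v - F v * dc j m v.
  move=> hv; rewrite (dc_mul oW hv j sW sUi) (dc_inv oW hv j hU sU) (dc_cexp j hv sm) /F.
  have := cexp_neq0 m v; move: (cexp m v) => u u0; field; exact: u0.
have eF v : bal r v -> eul F v = F v.
  move=> hv; rewrite /eul; under eq_bigr do rewrite (dF _ _ hv) mulrBr mulrA [X in _ - X]mulrCA.
  rewrite sumrB -mulr_suml -mulr_sumr -/(eul W v) -/(eul m v) hE// em// /F.
  have := cexp_neq0 m v; move: (cexp m v) => u u0; field; exact: u0.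
have [sF1 sF2] := sF.
have lF v : bal r v -> F v = \sum_j dc j F 0 * (v 0 j)%:C%C.
  move=> hv; apply: eqReIm.
    rewrite cReS (euler_linear sF1) ?hv// => [|w hw].
      by apply: eq_bigr => j _; rewrite cReM /dc /= mulr0 subr0.
    by rewrite -eul_Re eF.
  rewrite cImS (euler_linear sF2) ?hv// => [|w hw].
    by apply: eq_bigr => j _; rewrite cImM /dc /= mulr0 add0r.
  by rewrite -eul_Im eF.
exists (fun v => cexp m v / cexp m 0); split.
- by apply: smoothc_mul => //; exact: smoothc_cst.
- by move=> v; rewrite mulf_neq0 ?invr_neq0// cexp_neq0.
- by rewrite divff// cexp_neq0.
- move=> v hv; have := lF v hv.
  under eq_bigr do rewrite (dF _ _ b0) /F W0 !mul0r subr0 mulrAC.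
  rewrite -mulr_suml /F => h.
  have u0 := cexp_neq0 m v; have u1 := cexp_neq0 m 0.
  rewrite -[W v](divfK u0) h; field; exact: u1.
Qed.

End Radial.

Section RadialForms.
Context {R : realType} {n : nat}.
Local Notation V := 'rV[R]_n.

Lemma dlog_sub_closed (W : set V) (f1 f2 : V -> R[i]) c i j x : open W -> W x ->
  smoothc W f1 -> smoothc W f2 -> (forall y, W y -> f1 y != 0) -> (forall y, W y -> f2 y != 0) ->
  dc i (fun y => c * (dc j f2 y / f2 y - dc j f1 y / f1 y)) x =
  dc j (fun y => c * (dc i f2 y / f2 y - dc i f1 y / f1 y)) x.
Proof.
move=> oW Wx s1 s2 n1 n2.
have sl k f : (forall y, W y -> f y != 0) -> smoothc W f -> smoothc W (fun y => dc k f y / f y).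
  by move=> f0 sf; apply: smoothc_mul => //; [exact: smoothc_dc|exact: smoothc_inv].
have e k l : dc k (fun y => c * (dc l f2 y / f2 y - dc l f1 y / f1 y)) x =
    c * (dc k (fun y => dc l f2 y / f2 y) x - dc k (fun y => dc l f1 y / f1 y) x).
  rewrite (dc_scale oW Wx k c (smoothc_sub oW (sl l f2 n2 s2) (sl l f1 n1 s1))).
  by rewrite (dc_sub oW Wx k (sl l f2 n2 s2) (sl l f1 n1 s1)).
by rewrite !e (dlog_closed oW i j n1 s1 Wx) (dlog_closed oW i j n2 s2 Wx).
Qed.

(* Cartan's formula: [L_E om = d(i_E om)] for a closed two-form and the Euler field *)
Lemma closed_radial (W : set V) (om : 'I_n -> 'I_n -> V -> R) x l j : open W -> W x ->
  (forall i j, smooth W (om i j)) -> (forall i j y, om j i y = - om i j y) ->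
  (forall i, 'D_(delta_mx 0 i) (om j l) x + 'D_(delta_mx 0 j) (om l i) x + 'D_(delta_mx 0 l) (om i j) x = 0) ->
  'D_(delta_mx 0 l) (fun y : V => \sum_i y 0 i * om i j y) x =
  'D_(delta_mx 0 j) (fun y : V => \sum_i y 0 i * om i l y) x ->
  \sum_i x 0 i * 'D_(delta_mx 0 i) (om l j) x = - 2 * om l j x.
Proof.
move=> oW Wx som sk cl e.
have dd f k : smooth W f -> derivable f x (delta_mx 0 k).
  by move=> sf; exact: diff_derivable (smooth_diff sf Wx).
have D a b : 'D_(delta_mx 0 a) (fun y : V => \sum_i y 0 i * om i b y) x =
    om a b x + \sum_i x 0 i * 'D_(delta_mx 0 a) (om i b) x.
  have -> : (fun y : V => \sum_i y 0 i * om i b y) = \sum_i (fun y : V => y 0 i * om i b y).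
    by apply/funext => y; rewrite fct_sumE.
  rewrite derive_sum => [|i]; last by apply: dd; apply: smooth_mul => //; exact: smooth_coord.
  under eq_bigr do rewrite (deriveM (dd _ _ (smooth_coord oW _)) (dd _ _ (som _ _))) derive_coord.
  rewrite big_split /= addrC; congr (_ + _).
  rewrite (bigD1 a)//= big1 => [|i ia]; first by rewrite eqxx /GRing.scale/= mulr1 addr0.
  by rewrite (negbTE ia) scaler0.
move: e; rewrite !D (sk l j) => /eqP; rewrite -subr_eq0 => /eqP e.
have E : \sum_i x 0 i * 'D_(delta_mx 0 i) (om l j) x =
   \sum_i x 0 i * 'D_(delta_mx 0 l) (om i j) x - \sum_i x 0 i * 'D_(delta_mx 0 j) (om i l) x.
  rewrite -sumrB; apply: eq_bigr => i _; rewrite -mulrBr; congr (_ * _).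
  have N a b k : 'D_(delta_mx 0 k) (om a b) x = - 'D_(delta_mx 0 k) (om b a) x.
    by rewrite -deriveN; [congr ('D__ _ x); apply/funext => y; rewrite sk|exact: dd].
  have := cl i; rewrite (N l i j); move: ('D_(delta_mx 0 i) (om j l) x) (N j l i) => a Na.
  rewrite Na; move=> /eqP; rewrite -addrA addr_eq0 => /eqP h; rewrite -[RHS]addrC; rewrite -[LHS]opprK h; ring.
rewrite E; apply/eqP; rewrite -subr_eq0; apply/eqP; rewrite -[RHS]e; ring.
Qed.

(** t^2 f(t v) has zero derivative on (0,1]. The end of the ray may lie outside [W], so the value
    comes from a limit. *)
Lemma ray_homogeneous (W : set V) (f : V -> R) v L : open W -> smooth W f ->
  (forall t : R, 0 < t <= 1 -> W (t *: v)) ->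
  (forall x, W x -> \sum_i x 0 i * 'D_(delta_mx 0 i) f x = - 2 * f x) ->
  t ^+ 2 * f (t *: v) @[t --> (0 : R)^'+] --> L -> f v = L.
Proof.
move=> oW sf hv hE hL.
have := @ray_const R (fun t : R => t ^+ 2 * f (t *: v)) L; rewrite expr1n mul1r scale1r; apply=> // t ht.
have d2 := is_derive_ray (smooth_diff sf (hv t ht)).
have d1 : is_derive t 1 (fun t : R => t ^+ 2) (t *+ 2).
  have := @is_deriveX R R id 2 t 1 1 (is_derive_id _ _).
  by move=> h; apply: (is_derive_eq h); rewrite /= /GRing.scale /= mulr1 mulr_natl expr1.
apply: (is_derive_eq (is_deriveM d1 d2)).
change (t ^+ 2 * (\sum_j v 0 j * 'D_(delta_mx 0 j) f (t *: v)) + f (t *: v) * (t *+ 2) = 0).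
have t0 : t != 0 by case/andP: ht => /gt_eqF ->.
have h : t * (\sum_j v 0 j * 'D_(delta_mx 0 j) f (t *: v)) = - 2 * f (t *: v).
  rewrite -[RHS](hE _ (hv t ht)) big_distrr /=; apply: eq_bigr => j _.
  by rewrite [(t *: v) 0 j]mxE mulrA.
transitivity (t * (t * \sum_i v 0 i * 'D_(delta_mx 0 i) f (t *: v)) + f (t *: v) * (t *+ 2)); first by ring.
by rewrite h; ring.
Qed.

End RadialForms.

(** * The normal form in linearising coordinates *)

Section NormalForm.
Context {R : realType}.
Local Notation V := 'rV[R]_4.
Local Notation C := R[i].

Variables (r rho : R) (psi E : V -> V) (A : 'I_4 -> 'I_4 -> V -> C) (g k1 k2 : V -> C) (c : C).
Variable h : 'I_4 -> 'I_4 -> 'I_4 -> V -> C.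
Hypothesis r0 : 0 < r.
Hypothesis spsi : smoothv (bal r) psi.
Hypothesis psiW : forall v, bal r v -> bal rho (psi v).
Hypothesis psi0 : psi 0 = 0.
Hypothesis dpsi0 : forall i j, 'D_(delta_mx 0 j) (fun v => psi v 0 i) 0 = (i == j)%:R.
Hypothesis psiE : forall v i, bal r v ->
  \sum_j v 0 j * 'D_(delta_mx 0 j) (fun v => psi v 0 i) v = E (psi v) 0 i.
Hypothesis sk1 : smoothc (bal rho) k1.
Hypothesis sk2 : smoothc (bal rho) k2.
Hypothesis k10 : k1 0 = 1.
Hypothesis k20 : k2 0 = 1.
Hypothesis E1 : forall x, \sum_i (E x 0 i)%:C%C * dc i z1 x = z1 x * k1 x.
Hypothesis E2 : forall x, \sum_i (E x 0 i)%:C%C * dc i z2 x = z2 x * k2 x.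
Hypothesis Eom : forall x j, bal rho x -> zz x != 0 ->
  \sum_i E x 0 i * complex.Im (A i j x / (g x * zz x)) =
  complex.Im (c * (dc j z2 x / z2 x - dc j z1 x / z1 x)).
Hypothesis sA : forall i j, smoothc (bal rho) (A i j).
Hypothesis skA : forall i j x, A j i x = - A i j x.
Hypothesis sg : smoothc (bal rho) g.
Hypothesis g0 : forall x, bal rho x -> g x != 0.
Hypothesis A0 : forall i j, A i j 0 = g 0 * (c * Th i j).

Let Dpsi i j v : C := ('D_(delta_mx 0 j) (fun v => psi v 0 i) v)%:C%C.

Definition Az i j v : C := \sum_k \sum_l Dpsi k i v * A k l (psi v) * Dpsi l j v.

Hypothesis clAz : forall i j k v, bal r v -> zz (psi v) != 0 ->
  dc i (fun y => Az j k y / (g (psi y) * zz (psi y))) v +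
  dc j (fun y => Az k i y / (g (psi y) * zz (psi y))) v +
  dc k (fun y => Az i j y / (g (psi y) * zz (psi y))) v = h i j k v.
Hypothesis hreal : forall i j k v, bal r v -> zz (psi v) != 0 -> complex.Im (h i j k v) = 0.

Let oW : open (bal r : set V) := open_bal r.
Let oR : open (bal rho : set V) := open_bal rho.
Let b0 : bal r (0 : V). Proof. exact: bal0. Qed.

Let sDpsi i j : smoothc (bal r) (Dpsi i j).
Proof. by apply: smoothc_real => //; exact: smooth_der (spsi i). Qed.

Let spull f : smoothc (bal rho) f -> smoothc (bal r) (fun v => f (psi v)).
Proof. exact: smoothc_comp. Qed.

Let s_Az i j : smoothc (bal r) (Az i j).
Proof.
apply: smoothc_sum => // k _; apply: smoothc_sum => // l _.
by apply: smoothc_mul => //; apply: smoothc_mul => //; exact: spull.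
Qed.

Lemma skAz i j v : Az j i v = - Az i j v.
Proof.
rewrite /Az exchange_big -sumrN; apply: eq_bigr => l _; rewrite -sumrN; apply: eq_bigr => k _.
by rewrite (skA l k); ring.
Qed.

Let Dpsi0 i j : Dpsi i j 0 = (i == j)%:R.
Proof. by rewrite /Dpsi dpsi0; case: (_ == _). Qed.

Lemma Az0 i j : Az i j 0 = g 0 * (c * Th i j).
Proof.
rewrite -A0 /Az (bigD1 i)//= [X in _ + X]big1 => [|k ki]; last first.
  by apply: big1 => l _; rewrite Dpsi0 (negbTE ki) !mul0r.
rewrite addr0 (bigD1 j)//= big1 => [|l lj]; last by rewrite [Dpsi l j 0]Dpsi0 (negbTE lj) mulr0.
by rewrite !Dpsi0 !eqxx addr0 mul1r mulr1 psi0.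
Qed.

Let sz : smoothc (bal rho) z1 * smoothc (bal rho) z2 * smoothc (bal rho) zz.
Proof. exact: smoothc_z. Qed.

Let dcpsi f j v : smoothc (bal rho) f -> bal r v ->
  dc j (fun v => f (psi v)) v = \sum_k dc k f (psi v) * Dpsi k j v.
Proof. by move=> sf hv; exact: (dc_comp j hv psiW spsi sf). Qed.

Let eulpsi f v : smoothc (bal rho) f -> bal r v ->
  eul (fun v => f (psi v)) v = \sum_k (E (psi v) 0 k)%:C%C * dc k f (psi v).
Proof.
move=> sf hv; rewrite /eul; under eq_bigr do rewrite dcpsi// mulr_sumr.
rewrite exchange_big; apply: eq_bigr => k _; rewrite -(psiE k hv) rmorph_sum mulr_suml.
by apply: eq_bigr => j _; rewrite rmorphM /= /Dpsi; ring.
Qed.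

(** E z = z k turns into the Euler equation of [eul_linear_unit] for z o psi. The linear part of z o
    psi is z, because [psi] is tangent to the identity at 0. *)
Let zunit (z k : V -> C) (a b : 'I_4) : z = zc a b -> smoothc (bal rho) z -> smoothc (bal rho) k -> k 0 = 1 ->
  (forall x, \sum_i (E x 0 i)%:C%C * dc i z x = z x * k x) -> a != b ->
  exists q, [/\ smoothc (bal r) q, forall v, q v != 0, q 0 = 1 &
    forall v, bal r v -> z (psi v) = q v * z v].
Proof.
move=> ez s sk k0 hE ab.
have [||v hv|q [sq q0 q1 hq]] := eul_linear_unit r0 (spull s) (spull sk).
- by rewrite psi0 ez /zc !mxE.
- by rewrite psi0.
- by rewrite eulpsi.
exists q; split=> // v hv; rewrite hq//; congr (_ * _).
transitivity (\sum_j dc j z 0 * (v 0 j)%:C%C).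
  apply: eq_bigr => j _; congr (_ * _); rewrite dcpsi// psi0 (bigD1 j)//= Dpsi0 eqxx mulr1.
  by rewrite big1 ?addr0// => i ij; rewrite Dpsi0 (negbTE ij) mulr0.
rewrite ez; under eq_bigr do rewrite dc_zc.
rewrite (bigD1 a)//= (bigD1 b)/=; last by rewrite eq_sym.
rewrite !eqxx [b == a]eq_sym (negbTE ab) big1 => [|i /andP[ia ib]].
  by apply: eqReIm; rewrite /zc ?cReD ?cImD ?cReM ?cImM /=; ring.
rewrite ![_ == i]eq_sym (negbTE ia) (negbTE ib).
by apply: eqReIm; rewrite ?cReM ?cImM /=; ring.
Qed.

Let omz i j v : R := complex.Im (Az i j v / (g (psi v) * zz (psi v))).

(** [psi] carries the Euler field to E, so contraction with the Euler field is the pullback of i_E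
    omega. *)
Lemma omz_contract j v : bal r v -> zz (psi v) != 0 ->
  \sum_i v 0 i * omz i j v =
  complex.Im (c * (dc j (fun v => z2 (psi v)) v / z2 (psi v) - dc j (fun v => z1 (psi v)) v / z1 (psi v))).
Proof.
move=> hv zv; set s := g (psi v) * zz (psi v).
have -> : \sum_i v 0 i * omz i j v =
    \sum_l (\sum_k E (psi v) 0 k * complex.Im (A k l (psi v) / s)) * 'D_(delta_mx 0 j) (fun v => psi v 0 l) v.
  have e i : omz i j v = \sum_k \sum_l 'D_(delta_mx 0 i) (fun v => psi v 0 k) v *
      complex.Im (A k l (psi v) / s) * 'D_(delta_mx 0 j) (fun v => psi v 0 l) v.
    rewrite /omz /Az -/s mulr_suml cImS; apply: eq_bigr => k _; rewrite mulr_suml cImS.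
    apply: eq_bigr => l _; rewrite /Dpsi -ImZ; congr complex.Im; ring.
  under eq_bigr do rewrite e mulr_sumr.
  rewrite exchange_big; under eq_bigr do under eq_bigr do rewrite mulr_sumr.
  under eq_bigr do rewrite exchange_big.
  rewrite exchange_big; apply: eq_bigr => l _; rewrite mulr_suml; apply: eq_bigr => k _.
  rewrite -(psiE k hv) !mulr_suml; apply: eq_bigr => i _; ring.
under eq_bigr do rewrite (Eom _ (psiW hv) zv).
rewrite !dcpsi//; try by case: sz => -[].
rewrite !mulr_suml -sumrB mulr_sumr cImS; apply: eq_bigr => l _.
have := ImZ 1 ('D_(delta_mx 0 j) (fun v => psi v 0 l) v) (c * (dc l z2 (psi v) / z2 (psi v) - dc l z1 (psi v) / z1 (psi v))).
rewrite mul1r => <-; congr complex.Im; rewrite /Dpsi; ring.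
Qed.

Lemma normal_form : exists (u : V -> C) (b : 'I_4 -> 'I_4 -> V -> R),
  [/\ smoothc (bal r) u, forall v, bal r v -> u v != 0,
      forall i j, smooth (bal r) (b i j), forall i j v, bal r v -> b j i v = - b i j v &
      forall v, bal r v -> g (psi v) * zz (psi v) = u v * zz v] /\
  forall i j v, bal r v -> Az i j v = u v * (c * Th i j + zz v * (b i j v)%:C%C).
Proof.
have [[sz1 sz2] szz] := sz.
have [q1 [sq1 q10 q1E z1E]] := zunit (z := z1) erefl sz1 sk1 k10 E1 (negbT o_neq.1.1.1.1.1.1.1.1.1.1.1).
have [q2 [sq2 q20 q2E z2E]] := zunit (z := z2) erefl sz2 sk2 k20 E2 (negbT o_neq.1.1.1.2).
pose u v := g (psi v) * q1 v * q2 v.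
have su : smoothc (bal r) u.
  by apply: smoothc_mul => //; apply: smoothc_mul => //; exact: spull.
have u0 v : bal r v -> u v != 0 by move=> hv; rewrite !mulf_neq0// g0//; exact: psiW.
have zzE v : bal r v -> zz (psi v) = q1 v * q2 v * zz v.
  by move=> hv; rewrite /zz z1E// z2E//; ring.
have sE v : bal r v -> g (psi v) * zz (psi v) = u v * zz v.
  by move=> hv; rewrite zzE// /u; ring.
have u0E : u 0 = g 0 by rewrite /u psi0 q1E q2E !mulr1.
pose W : set V := bal r `&` [set v | zz (psi v) != 0].
have oW' : open W by apply: open_smoothc_neq0 => //; exact: spull.
have sub : W `<=` bal r by move=> v [].
have Wz v : bal r v -> zz v != 0 -> W v.
  by move=> hv zv; split=> //; change (zz (psi v) != 0); rewrite zzE//; exact: (mulf_neq0 (mulf_neq0 (q10 v) (q20 v)) zv).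
pose s v := g (psi v) * zz (psi v).
have s0 v : W v -> s v != 0 by move=> [hv zv]; rewrite mulf_neq0// g0//; exact: psiW.
have ss : smoothc W s.
  by apply: (smoothc_subset sub); apply: smoothc_mul => //; exact: spull.
have sq i j : smoothc W (fun v => Az i j v / s v).
  by apply: smoothc_mul => //; [exact: smoothc_subset (s_Az i j)|exact: smoothc_inv].
have som i j : smooth W (omz i j) by case: (sq i j).
have skom i j v : omz j i v = - omz i j v by rewrite /omz skAz mulNr cImN.
have clom i j k v : W v ->
  'D_(delta_mx 0 i) (omz j k) v + 'D_(delta_mx 0 j) (omz k i) v + 'D_(delta_mx 0 k) (omz i j) v = 0.
  by move=> [hv zv]; rewrite -(hreal i j k hv zv) -clAz// !cImD.
have sf1 : smoothc W (fun v => z1 (psi v)) by apply: (smoothc_subset sub); exact: spull.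
have sf2 : smoothc W (fun v => z2 (psi v)) by apply: (smoothc_subset sub); exact: spull.
have f10 v : W v -> z1 (psi v) != 0 by move=> [_]; rewrite /= /zz mulf_eq0 negb_or => /andP[].
have f20 v : W v -> z2 (psi v) != 0 by move=> [_]; rewrite /= /zz mulf_eq0 negb_or => /andP[].
pose eta j v := c * (dc j (fun v => z2 (psi v)) v / z2 (psi v) - dc j (fun v => z1 (psi v)) v / z1 (psi v)).
have cleta i j v : W v -> dc i (eta j) v = dc j (eta i) v.
  by move=> Wv; exact: dlog_sub_closed oW' Wv sf1 sf2 f10 f20.
have Deta j l v : W v -> 'D_(delta_mx 0 l) (fun y : V => \sum_i y 0 i * omz i j y) v = complex.Im (dc l (eta j) v).
  move=> Wv; rewrite /dc /=; apply: near_eq_derive; apply: (near_open oW' Wv) => y [hy zy].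
  by rewrite omz_contract.
have eulom l j v : W v -> \sum_i v 0 i * 'D_(delta_mx 0 i) (omz l j) v = - 2 * omz l j v.
  move=> Wv; have e : 'D_(delta_mx 0 l) (fun y : V => \sum_i y 0 i * omz i j y) v =
      'D_(delta_mx 0 j) (fun y : V => \sum_i y 0 i * omz i l y) v.
    exact: (etrans (Deta j l v Wv) (etrans (congr1 (@complex.Im R) (cleta l j v Wv)) (esym (Deta l j v Wv)))).
  exact: (closed_radial oW' Wv som skom (fun i => clom i j l v Wv) e).
(* The components have degree -2 along rays, so each is determined by the limit of t^2 omz(t v) at t
   = 0. *)
have omE l j v : bal r v -> zz v != 0 -> omz l j v = complex.Im (c * Th l j / zz v).
  move=> hv zv.
  have zzt (t : R) : zz (t *: v) = (t ^+ 2)%:C%C * zz v.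
    by apply: eqReIm; rewrite /zz /z1 /z2 /zc !mxE ?cReM ?cImM /=; ring.
  apply: (ray_homogeneous oW' (som l j)) => [t /andP[t0 t1]|x Wx|]; last 2 first.
  - exact: eulom.
  (* Since zz(t v) = t^2 zz(v), the limit is that of F(t v), and [F] is smooth at the origin
     although [omz] is singular there. *)
  - pose F y := complex.Im (Az l j y / (u y * zz v)).
    have sF : smooth (bal r) F.
      suff [] : smoothc (bal r) (fun y => Az l j y / (u y * zz v)) by [].
      apply: smoothc_mul => //; apply: smoothc_inv => // [y hy|]; first by rewrite mulf_neq0// u0.
      by apply: smoothc_mul => //; exact: smoothc_cst.
    have F0 : F 0 = complex.Im (c * Th l j / zz v).
      rewrite /F Az0 u0E; congr complex.Im; have g00 : g 0 != 0 by rewrite -u0E u0.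
      by field; rewrite zv g00.
    rewrite -F0; have cF : F (t *: v) @[t --> (0 : R)^'+] --> F 0.
      have h0 : t *: v @[t --> (0 : R)^'+] --> (0 : V).
        apply: cvg_at_right_filter; rewrite -[X in _ --> X](scale0r v).
        by apply: cvgZr_tmp; exact: cvg_id.
      have h1 : F x @[x --> (0 : V)] --> F 0 by exact: (smooth_cont sF b0).
      exact: (cvg_comp _ _ h0 h1).
    apply: cvg_trans cF; apply: near_eq_cvg; near=> t.
    have t0 : 0 < t by near: t; exact: nbhs_right_gt.
    have t1 : t <= 1 by near: t; exact: nbhs_right_le.
    have ht : bal r (t *: v) by apply: bal_ray => //; rewrite ltW.
    rewrite /F /omz sE// zzt.
    have tn : (t ^+ 2)%:C%C != 0 :> C by rewrite eq_complex /= negb_and expf_neq0// gt_eqF.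
    have -> : Az l j (t *: v) / (u (t *: v) * ((t ^+ 2)%:C%C * zz v)) =
       ((t ^+ 2)^-1)%:C%C * (Az l j (t *: v) / (u (t *: v) * zz v)) * 1%:C%C.
      have -> : ((t ^+ 2)^-1)%:C%C = ((t ^+ 2)%:C%C)^-1 :> C by rewrite fmorphV.
      have := u0 _ ht; move: (u (t *: v)) (zz v) ((t ^+ 2)%:C%C) (Az l j (t *: v)) tn zv.
      by move=> a b d e tn zv ut; field; rewrite tn zv ut.
    by rewrite ImZ mulr1 mulrA divff ?mul1r// expf_neq0// gt_eqF.
  apply: Wz; first by apply: bal_ray => //; rewrite ltW.
  by rewrite zzt mulf_neq0// eq_complex /= negb_and expf_neq0// gt_eqF.
(* The quotient of [S] by zz is the future b: by [omE] it is real off the divisor. *)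
pose S i j v := Az i j v / u v - c * Th i j.
have sS i j : smoothc (bal r) (S i j).
  apply: smoothc_sub => //; last exact: smoothc_cst.
  by apply: smoothc_mul => //; exact: smoothc_inv.
have skS i j v : S j i v = - S i j v by rewrite /S skAz /Th; ring.
have zz_sm : smoothc (bal r) zz by case: (smoothc_z oW).
have realS i j v : bal r v -> zz v != 0 -> complex.Im (S i j v / zz v) = 0.
  move=> hv zv; rewrite /S mulrBl cImD cImN -omE// /omz sE//.
  by rewrite -[_ / u v / _]mulrA -[(u v)^-1 / zz v]invfM subrr.
have [[sz1' sz2'] szz'] := smoothc_z oW.
(* Reality of S / zz with denominators cleared, which is the kind of identity that [division1] and
   [division2] accept, with m = 1. *)
have conjS i j v : bal r v -> (zz v)^*%C * S i j v = zz v * (S i j v)^*%C.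
  move=> hv; have [z0|zv] := eqVneq (zz v) 0; first by rewrite z0 conjc0 !mul0r.
  have := realS i j v hv zv; move: (S i j v) (zz v) zv => a z z0 ha.
  rewrite -(divfK z0 a) rmorphM /=; move: (a / z) ha => [w w'] /= ->.
  by rewrite oppr0; ring.
have div i j : exists2 b, smooth (bal r) b & forall v, bal r v -> S i j v = zz v * (b v)%:C%C.
  have sc := smoothc_conj oW (sS i j).
  have c0 (z : C) : z != 0 -> z^*%C != 0 by move=> z0; rewrite conjc_eq0.
  have [q sq' qE] : exists2 q, smoothc (bal r) q & forall v, bal r v -> S i j v = z1 v * q v.
    apply: (division1 (m := 1) r0 (smoothc_conj oW sz2') (sS i j) (smoothc_mul oW sz2' sc)) => [v|v hv].
      exact: c0.
    by rewrite expr1 !mulrA -conjS// rmorphM.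
  have [b sb bE] : exists2 b, smoothc (bal r) b & forall v, bal r v -> q v = z2 v * b v.
    apply: (division2 (m := 1) (al := fun=> 1) r0 (smoothc_cst oW _) sq' (smoothc_conj oW sq')) => [v _|]; first exact: oner_neq0.
    under eq_forall do rewrite expr1 mul1r.
    apply: (eq_off_zz oW) => [||v hv zv].
    - by apply: smoothc_mul => //; exact: smoothc_conj.
    - by apply: smoothc_mul => //; exact: smoothc_conj.
    have cM (x y : C) : (x * y)^*%C = x^*%C * y^*%C by exact: rmorphM.
    have := conjS i j v hv; rewrite !qE// /zz !cM.
    move: zv; rewrite /zz mulf_eq0 negb_or => /andP[y1 y2] e.
    apply: (mulfI (mulf_neq0 y1 (c0 _ y1))).
    by move: e; move: (z1 v) (z2 v) (q v) => x y w e; transitivity (x^*%C * y^*%C * (x * w)); [ring|rewrite e; ring].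
  have Ib v : bal r v -> complex.Im (b v) = 0.
    move=> hv; have sI : smoothc (bal r) (fun v => (complex.Im (b v))%:C%C).
      by apply: smoothc_real => //; case: sb.
    have := eq_off_zz oW sI (smoothc_cst oW 0) => /(_ _ v hv) e; suff /(congr1 (@complex.Re R)) : (complex.Im (b v))%:C%C = 0 :> C by [].
    apply: e => x hx zx; have := realS i j x hx zx; rewrite qE// bE// mulrA -/(zz x) mulrAC divff// mul1r.
    by move=> ->.
  exists (fun v => complex.Re (b v)); first by case: sb.
  move=> v hv; rewrite qE// bE// mulrA; congr (_ * _).
  by apply: eqReIm; rewrite //= Ib.
pose b i j := s2val (cid2 (div i j)).
have sb i j : smooth (bal r) (b i j) by exact: s2valP (cid2 (div i j)).
have bE i j v : bal r v -> S i j v = zz v * (b i j v)%:C%C by exact: s2valP' (cid2 (div i j)) v.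
exists u, b; split.
  split=> // i j v hv.
  have sC k l : smoothc (bal r) (fun v => (b k l v)%:C%C) by apply: smoothc_real.
  have := eq_off_zz oW (sC j i) (smoothc_opp oW (sC i j)) => /(_ _ v hv) e.
  suff /(congr1 (@complex.Re R)) : (b j i v)%:C%C = - (b i j v)%:C%C :> C by [].
  apply: e => x hx zx; apply: (mulfI zx); rewrite mulrN -!bE//.
move=> i j v hv; rewrite -bE// /S; have := u0 v hv => uv; field; exact: uv.
Unshelve. all: by end_near. Qed.

End NormalForm.

(** * Adapted charts and the normal form *)

Section AdaptedChart.
Context {R : realType} {M : smooth_manifold R 4}.
Local Notation C := R[i].

Lemma wedge_conj_det c q (f1 f2 : M -> C) : let N := \matrix_(i < 4, j < 4) pderivC c j (nth f1
    [:: f1; fun x => (f1 x)^*%C; f2; fun x => (f2 x)^*%C] i) q in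
  wedge (wedge (dfun c f1 q) (dfun c (fun x => (f1 x)^*%C) q))
        (wedge (dfun c f2 q) (dfun c (fun x => (f2 x)^*%C) q)) = ev 0 (fun _ _ => 0) (\det N).
Proof.
move=> N; rewrite /dfun !wedge_covec2 wedge_ev det4.
apply: ev_ext => [|i j|]; rewrite ?mul0r ?mulr0 ?add0r//.
have e k : (row k N)^T = \col_i pderivC c i (nth f1 [:: f1; fun x => (f1 x)^*%C; f2; fun x => (f2 x)^*%C] k) q.
  by apply/colP => i; rewrite [LHS]mxE [LHS]mxE [LHS]mxE [RHS]mxE.
by rewrite !e !val_o.
Qed.

(** The wedge condition says that the real and imaginary parts of f_1 and f_2 have invertible
    Jacobian at p, so the inverse function theorem makes them coordinates. *)
Lemma crossing_chart (U : set M) (f1 f2 : M -> C) p : open U -> U p -> smoothC_on U f1 -> smoothC_on U f2 ->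
  f1 p = 0 -> f2 p = 0 -> (forall c, atlas c -> chart_dom c p ->
    wedge (wedge (dfun c f1 p) (dfun c (fun x => (f1 x)^*%C) p))
          (wedge (dfun c f2 p) (dfun c (fun x => (f2 x)^*%C) p)) != 0) ->
  exists (w : mchart M) (r : R), [/\ atlas w /\ chart_dom w p, 0 < r /\ chart_img w = bal r,
    chart_dom w `<=` U, chart_map w p = 0 &
    forall q, chart_dom w q -> f1 q = z1 (chart_map w q) /\ f2 q = z2 (chart_map w q)].
Proof.
move=> oU Up s1 s2 f1p f2p hw; have [c ac cp] := atlas_cover p.
pose W := chart_map c @` (U `&` chart_dom c).
have oW : open W by exact: image_open.
have [s1r s1i] := (smoothC_onE _ oU).1 s1 c ac; have [s2r s2i] := (smoothC_onE _ oU).1 s2 c ac.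
pose fs k := nth (fun=> 0) [:: fun q => complex.Re (f1 q); fun q => complex.Im (f1 q);
  fun q => complex.Re (f2 q); fun q => complex.Im (f2 q)] k.
pose wv (x : 'rV[R]_4) : 'rV[R]_4 := \row_(i < 4) fs i (chart_inv c x).
have wvE x i : wv x 0 i = fs i (chart_inv c x) by rewrite mxE.
have swv : smoothv W wv.
  move=> i; have e : (fun x => wv x 0 i) = (fun x => fs i (chart_inv c x)).
    by apply/funext => x; rewrite wvE.
  by rewrite e; move: i {e}; apply: ord4_cases; rewrite /fs !val_o.
have Wx0 : W (chart_map c p) by exists p.
have w0 : wv (chart_map c p) = 0.
  by apply/rowP => i; rewrite wvE mxE invmapK//; move: i; apply: ord4_cases; rewrite /fs !val_o /= ?f1p ?f2p.
have uJ : jacmx wv (chart_map c p) \in unitmx.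
  rewrite unitmxE unitfE; apply: contraNneq (hw c ac cp) => d0.
  rewrite wedge_conj_det; set N := \matrix_(i, j) _.
  (* [P] passes from the real and imaginary parts to the functions and their conjugates. *)
  pose P : 'M[C]_4 := \matrix_(i, j) nth 0 (nth [::] [:: [:: 1; 'i%C; 0; 0]; [:: 1; - 'i%C; 0; 0];
    [:: 0; 0; 1; 'i%C]; [:: 0; 0; 1; - 'i%C]] i) j.
  have NE : N = P *m cplx_mx (jacmx wv (chart_map c p)).
    have jE i j : jacmx wv (chart_map c p) i j = pderiv c j (fs i) p.
      have e : (fun x => wv x 0 i) = fs i \o chart_inv c by apply/funext => x; rewrite wvE.
      by rewrite mxE e.
    apply/matrixP => i j; rewrite mxE [RHS]mxE sum4 ![cplx_mx _ _ _]mxE !jE.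
    move: i; apply: ord4_cases; rewrite !mxE !val_o /fs /= ?(pderivC_conj oU ac Up cp _ s1)
      ?(pderivC_conj oU ac Up cp _ s2) /pderivC /=;
      move: (pderiv c j (fun q => complex.Re (f1 q)) p) (pderiv c j (fun q => complex.Im (f1 q)) p)
        (pderiv c j (fun q => complex.Re (f2 q)) p) (pderiv c j (fun q => complex.Im (f2 q)) p) => x1 y1 x2 y2;
      rewrite !(mul0r, add0r, addr0, mul1r); by apply: eqReIm; rewrite ?cReD ?cImD ?cReM ?cImM /=; ring.
  have -> : \det N = 0.
    by rewrite NE det_mulmx /cplx_mx det_map_mx d0 rmorph0 mulr0.
  by apply/eqP; apply: ext4P => b0 b1 b2 b3; rewrite !ffunE !in_st; case: b0; case: b1; case: b2; case: b3.
case: (inverse_function oW Wx0 swv w0 uJ) => r [] O [] phi [] r0 Op OW D.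
have Wc : O `<=` chart_img c by move=> x /OW[q [_ cq] <-]; exists q.
have [aw iw] := atlas_new_chart ac Wc D.
exists (new_chart c O wv phi), r; split=> //.
- move=> q [cq /OW[q' [Uq' cq'] e]].
  by rewrite -(invmapK ac cq) -e invmapK.
- move=> q [cq Oq]; split; apply: eqReIm; rewrite /= wvE /fs !val_o /= invmapK//.
Qed.

End AdaptedChart.

(** * The spinor in charts adapted to the crossing *)

Section LocalModel.
Context {R : realType} {M : smooth_manifold R 4} (G : gen_complex_structure M).
Local Notation C := R[i].
Variables (U0 : set M) (rho : diff_form M).
Hypothesis hrho : canonical_trivialisation G U0 rho.

Let frho : is_form U0 rho. Proof. by case: hrho => -[]. Qed.
Let crho c q : atlas c -> U0 q -> chart_dom c q -> in_canonical G c q (rho c q).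
Proof. by case: hrho => -[_ h _]; exact: h. Qed.

Lemma smoothC_rho c V K : atlas c -> V `<=` U0 -> V `<=` chart_dom c -> smoothC_on V (fun q => rho c q K).
Proof. by move=> ac VU Vc; apply: smoothC_on_subset (frho.1 c K ac) => q Vq; split; [exact: VU|exact: Vc]. Qed.

(** [eps_closed] in the coordinates of [c], with a formula [s] for rho_0. It is applied both to the
    crossing chart and to the linearising one. *)
Lemma chart_closed c (s : M -> C) i j k x : atlas c -> chart_dom c `<=` U0 ->
  (forall q, chart_dom c q -> rho c q finset.set0 = s q) -> chart_img c x -> s (chart_inv c x) != 0 ->
  dc i (fun y => cmp2 (rho c (chart_inv c y)) j k / s (chart_inv c y)) x +
  dc j (fun y => cmp2 (rho c (chart_inv c y)) k i / s (chart_inv c y)) x +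
  dc k (fun y => cmp2 (rho c (chart_inv c y)) i j / s (chart_inv c y)) x = hterm G c i j k (chart_inv c x).
Proof.
move=> ac cU sE cx sx.
have [dx mx] := chart_img_inv (atlas_chart ac) cx.
have od := dom_open ac.
pose U := chart_dom c `&` [set q | rho c q finset.set0 != 0].
have oU : open U by apply: open_neq0 => //; exact: smoothC_rho.
have Uc : U `<=` chart_dom c by move=> q [].
have UU : U `<=` U0 by move=> q /Uc/cU.
have Ux : U (chart_inv c x) by split=> //=; rewrite sE.
have sr K : smoothC_on U (fun q => rho c q K) by exact: smoothC_rho.
have cr q : U q -> in_canonical G c q (rho c q) by move=> Uq; apply: crho => //; [exact: UU|exact: Uc].
have := eps_closed ac oU Uc sr cr i j k (fun q (h : U q) => h.2) Ux.
move=> /= <-.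
have E a b l : dc l (fun y => cmp2 (rho c (chart_inv c y)) a b / s (chart_inv c y)) x =
    pderivC c l (fun q => cmp2 (rho c q) a b / rho c q finset.set0) (chart_inv c x).
  rewrite /pderivC /pderiv mx.
  apply: (dc_ext (img_open ac) cx) => y cy /=.
  by have [dy _] := chart_img_inv (atlas_chart ac) cy; rewrite sE.
by rewrite !E.
Qed.

(* At a zero of [rho_0] where also [rho_2] vanishes only the top degree part could survive,
   and [L] would be contained in [T^*]. *)
Lemma spinor_two_form_neq0 c q : atlas c -> chart_dom c q -> U0 q -> rho c q finset.set0 = 0 ->
  (forall i, rho c q [set i]%SET = 0) -> (forall K : {set 'I_4}, #|K| = 3%N -> rho c q K = 0) ->
  exists i j, cmp2 (rho c q) i j != 0.
Proof.
move=> ac cq Uq r0 r1 r3; apply: contrapT => h.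
have c0 i j : cmp2 (rho c q) i j = 0.
  by apply/eqP/negPn/negP => n; apply: h; exists i, j.
set w := rho c q; set t := w (st true true true true).
have wE : w = ev 0 (fun _ _ => 0) t.
  by rewrite {1}/w (ev_eta r1 r3) r0; apply: ev_ext.
have hom : homog 4 w.
  move=> K; rewrite wE (st_eta K) card_st ffunE !in_st.
  by case: (o0 \in K); case: (o1 \in K); case: (o2 \in K); case: (o3 \in K).
have t0 : t != 0.
  apply: contraNneq (hrho.2 c q ac Uq cq) => e; rewrite -/w wE e.
  by apply/eqP; apply: ext4P => b0 b1 b2 b3; rewrite !ffunE !in_st; case: b0; case: b1; case: b2; case: b3.
(* The projection of this tangent vector to L has e_0 as the real part of its vector part, so it
   cannot annihilate a nonzero top form. *)
pose v0 : 'cV[R]_(4 + 4) := delta_mx (lshift 4 o0) 0.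
have := crho ac Uq cq (in_eigen_proj G (cplx_mx v0) ac cq); set v := _ - _ => hv.
have v1 : complex.Re (usubmx v o0 0) = 1.
  rewrite /v -cplx_mxM !mxE !eqxx /= mul0r mul1r subr0; ring.
have := congr1 (fun u : ext R 4 => u (st false true true true)) hv; rewrite -/w.
rewrite /clifford ffunE [RHS]ffunE (homog_wedge (@homog_covec _ _ _) hom) ?card_st// addr0.
rewrite ffunE (bigD1 o0) ?in_st//= big1 => [|i /andP[i1 i2]]; last first.
  by move: i i1 i2; apply: ord4_cases; rewrite ?in_st// eqxx.
have -> : o0 |: st false true true true = st true true true true.
  by apply/setP; apply: ord4_cases; rewrite finset.in_setU1 !in_st ?o_neq ?eqxx.
rewrite -/t addr0 => /eqP; rewrite !mulf_eq0 (negbTE t0) orbF signr_eq0 /= => /eqP e.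
by move: v1; rewrite e /= => /eqP; rewrite eq_sym oner_eq0.
Qed.

Variables (U : set M) (g f1 f2 : M -> C) (p : M).
Hypotheses (oU : open U) (Up : U p) (UU0 : U `<=` U0).
Hypotheses (sg : smoothC_on U g) (sf1 : smoothC_on U f1) (sf2 : smoothC_on U f2).
Hypothesis g0 : forall q, U q -> g q != 0.
Hypothesis rhoE : forall c q, atlas c -> chart_dom c q -> U q -> rho c q finset.set0 = g q * (f1 q * f2 q).
Hypotheses (f1p : f1 p = 0) (f2p : f2 p = 0).
Hypothesis crossing : forall c, atlas c -> chart_dom c p ->
  wedge (wedge (dfun c f1 p) (dfun c (fun x => (f1 x)^*%C) p))
        (wedge (dfun c f2 p) (dfun c (fun x => (f2 x)^*%C) p)) != 0.

(** Off the divisor the spinor is of the form [ev], so a coefficient on which [ev] is constant keeps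
    its value on the divisor by continuity. It is used for the odd degrees, with value 0. *)
Lemma rho_zeros_dense w r (x : 'rV[R]_4) K t : atlas w -> chart_dom w `<=` U -> chart_img w = bal r ->
  (forall q, chart_dom w q -> f1 q = z1 (chart_map w q) /\ f2 q = z2 (chart_map w q)) ->
  (forall s a u, ev s a u K = t :> C) -> bal r x -> rho w (chart_inv w x) K = t.
Proof.
move=> aw wU iw fE evK hx.
have od := dom_open aw; have sr : smoothC_on (chart_dom w) (fun q => rho w q K).
  by apply: smoothC_rho => // q /wU/UU0.
have := (smoothC_on_chart _ aw od (@subset_refl _ _)).1 sr; rewrite -/(chart_img w) iw => sr'.
apply: (eq_off_zz (open_bal r) sr' (smoothc_cst (open_bal r) t) _ hx) => y hy zy /=.
have cy : chart_img w y by rewrite iw.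
have [dy my] := chart_img_inv (atlas_chart aw) cy.
have cr q : chart_dom w q -> in_canonical G w q (rho w q).
  by move=> dq; apply: crho => //; exact/UU0/wU.
have r0 : rho w (chart_inv w y) finset.set0 != 0.
  rewrite rhoE//; last exact: wU.
  have [-> ->] := fE _ dy; rewrite my; apply: mulf_neq0 => //; exact/g0/wU.
have [_ ->] := canonical_ev aw (@subset_refl _ _) cr dy r0.
exact: evK.
Qed.

Lemma normal_chart : exists (z : mchart M) (u : M -> C) (b : 'I_4 -> 'I_4 -> M -> R) (c : C),
  [/\ atlas z /\ chart_dom z p, chart_dom z `<=` U, c != 0,
      smoothC_on (chart_dom z) u & forall q, chart_dom z q -> u q != 0] /\
  [/\ forall i j, smooth_on (chart_dom z) (b i j), forall i j q, chart_dom z q -> b j i q = - b i j q,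
      forall q, chart_dom z q -> rho z q finset.set0 = u q * zz (chart_map z q) &
      forall i j q, chart_dom z q ->
        cmp2 (rho z q) i j = u q * (c * Th i j + zz (chart_map z q) * (b i j q)%:C%C)].
Proof.
have [w [r0 [[aw wp] [r0_gt0 iw] wU mp fE]]] := crossing_chart oU Up sf1 sf2 f1p f2p crossing.
have od := dom_open aw; have oB := open_bal r0 : open (bal r0 : set 'rV[R]_4).
have wU0 : chart_dom w `<=` U0 by move=> q /wU/UU0.
have iwP x : bal r0 x -> chart_dom w (chart_inv w x) /\ chart_map w (chart_inv w x) = x.
  by rewrite -iw; exact: chart_img_inv (atlas_chart aw).
have tochart (f : M -> C) : smoothC_on (chart_dom w) f -> smoothc (bal r0) (fun x => f (chart_inv w x)).
  by move=> /(smoothC_on_chart _ aw od (@subset_refl _ _)); rewrite -/(chart_img w) iw.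
pose A i j x := cmp2 (rho w (chart_inv w x)) i j.
pose gw x := g (chart_inv w x).
pose H i j k x := hterm G w i j k (chart_inv w x).
have sr K : smoothC_on (chart_dom w) (fun q => rho w q K) by exact: smoothC_rho.
have sA i j : smoothc (bal r0) (A i j) by apply: (tochart (fun q => cmp2 (rho w q) i j)); exact: smoothC_cmp2.
have skA i j x : A j i x = - A i j x by exact: cmp2_skew.
have sgw : smoothc (bal r0) gw by apply: tochart; exact: smoothC_on_subset sg.
have gw0 x : bal r0 x -> gw x != 0 by move=> /iwP[/wU/g0].
have sH i j k : smoothc (bal r0) (H i j k) by apply: tochart; exact: hterm_smooth.
have wE q : chart_dom w q -> rho w q finset.set0 = g q * zz (chart_map w q).
  by move=> dq; rewrite rhoE//; [have [-> ->] := fE q dq|exact: wU].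
have clA i j k x : bal r0 x -> zz x != 0 ->
    dc i (fun y => A j k y / (gw y * zz y)) x + dc j (fun y => A k i y / (gw y * zz y)) x +
    dc k (fun y => A i j y / (gw y * zz y)) x = H i j k x.
  move=> hx zx; have cx : chart_img w x by rewrite iw.
  have [dx mx] := iwP x hx.
  have s0 : g (chart_inv w x) * zz (chart_map w (chart_inv w x)) != 0.
    by rewrite mx; exact: mulf_neq0 (gw0 x hx) zx.
  rewrite /H -(chart_closed i j k aw wU0 wE cx s0).
  have E a b l : dc l (fun y => A a b y / (gw y * zz y)) x =
     dc l (fun y => cmp2 (rho w (chart_inv w y)) a b / (g (chart_inv w y) * zz (chart_map w (chart_inv w y)))) x.
    by apply: (dc_ext oB hx) => y hy; have [_ ->] := iwP y hy.
  by rewrite !E.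
have b0 : bal r0 (0 : 'rV[R]_4) by exact: bal0.
have inv0 : chart_inv w 0 = p by rewrite -mp invmapK.
(* At p the degree-zero part and the odd part vanish, so a zero two-form part would contradict
   [spinor_two_form_neq0]; this is where c becomes nonzero. *)
have hA : exists i j, A i j 0 != 0.
  rewrite /A inv0; apply: (spinor_two_form_neq0 aw wp (UU0 Up)).
  - by rewrite rhoE// f1p mul0r mulr0.
  - move=> i; rewrite -inv0; apply: (rho_zeros_dense aw wU iw fE _ b0) => s a u.
    by move: i; apply: ord4_cases; rewrite ?set1_st ffunE !in_st.
  - move=> K K3; rewrite -inv0; apply: (rho_zeros_dense aw wU iw fE _ b0) => s a u.
    move: K3; rewrite (st_eta K) card_st ffunE !in_st.
    by case: (o0 \in K); case: (o1 \in K); case: (o2 \in K); case: (o3 \in K).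
have A0 := A0E r0_gt0 sA skA sgw gw0 sH clA.
have [rh [E [k1 [k2 [[c0 /andP[rh0 rhr] sE E0 dE0] [[sk1 sk2] [k10 k20] E1 E2 Eom]]]]]] :=
  log_frame r0_gt0 sA skA sgw gw0 sH clA hA.
set c := cc A gw in c0 A0 Eom.
case: (linearize rh0 sE E0 dE0) => r [] O [] psi [] zf [] r_gt0 D [Orh psi0] dpsi0 psiE.
have sub : bal rh `<=` (bal r0 : set 'rV[R]_4) by move=> v hv; exact: lt_le_trans hv rhr.
have Ow : O `<=` chart_img w by move=> v /Orh/sub; rewrite iw.
have [az iz] := atlas_new_chart aw Ow (diffeo_sym D).
set z := new_chart w O zf psi in az iz.
have [_ oO spsi szf psiO zfB zfK psiK] := D.
have psiW v : bal r v -> bal rh (psi v) by move=> /psiO/Orh.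
have oz := dom_open az; have oBr := open_bal r : open (bal r : set 'rV[R]_4).
have zp : chart_dom z p.
  by split=> //=; rewrite mp -psi0; apply: psiO; exact: bal0.
have zw : chart_dom z `<=` chart_dom w by move=> q [].
have zU : chart_dom z `<=` U by move=> q /zw/wU.
have zU0 : chart_dom z `<=` U0 by move=> q /zU/UU0.
have izP v : bal r v -> chart_dom z (chart_inv z v) /\ chart_map z (chart_inv z v) = v.
  by rewrite -iz; exact: chart_img_inv (atlas_chart az).
have mz q : chart_dom z q -> bal r (chart_map z q).
  by move=> dq; rewrite -iz; exists q.
have psiz q : chart_dom z q -> psi (chart_map z q) = chart_map w q.
  by move=> [_ /= Oq]; rewrite psiK.
have invz v : chart_inv z v = chart_inv w (psi v) by [].
have wpsi v : bal r v -> chart_map w (chart_inv w (psi v)) = psi v.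
  by move=> /psiW/sub/iwP[].
have jE q i j : chart_dom z q -> jac z w q i j = 'D_(delta_mx 0 j) (fun v => psi v 0 i) (chart_map z q).
  move=> dq; rewrite mxE /pderiv; apply: near_eq_derive.
  by apply: (near_open oBr (mz q dq)) => v hv; rewrite /= wpsi.
have AzE q i j : chart_dom z q -> cmp2 (rho z q) i j = Az psi A i j (chart_map z q).
  move=> dq; have dq' := zw _ dq.
  rewrite (frho.2 z w q az aw (zU0 q dq) dq dq') cmp2_pull mxE /Az exchange_big.
  apply: eq_bigr => l _; rewrite mxE mulr_suml; apply: eq_bigr => k _.
  by rewrite [_^T _ _]mxE [cplx_mx _ _ _]mxE [cplx_mx _ _ _]mxE !jE// /A psiz// invmapK.
have sz q : chart_dom z q -> rho z q finset.set0 = g q * zz (chart_map w q).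
  by move=> dq; rewrite (frho.2 z w q az aw (zU0 q dq) dq (zw q dq)) ext_pull0 wE//; exact: zw.
have clz i j k v : bal r v -> zz (psi v) != 0 ->
    dc i (fun y => Az psi A j k y / (gw (psi y) * zz (psi y))) v +
    dc j (fun y => Az psi A k i y / (gw (psi y) * zz (psi y))) v +
    dc k (fun y => Az psi A i j y / (gw (psi y) * zz (psi y))) v = hterm G z i j k (chart_inv z v).
  move=> hv zv; have cv : chart_img z v by rewrite iz.
  have s0 : g (chart_inv z v) * zz (chart_map w (chart_inv z v)) != 0.
    rewrite invz wpsi//; apply: mulf_neq0 => //; apply: gw0; exact/sub/psiW.
  rewrite -(chart_closed i j k az zU0 sz cv s0).
  have E' a b l : dc l (fun y => Az psi A a b y / (gw (psi y) * zz (psi y))) v =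
     dc l (fun y => cmp2 (rho z (chart_inv z y)) a b / (g (chart_inv z y) * zz (chart_map w (chart_inv z y)))) v.
    apply: (dc_ext oBr hv) => y hy; have [dy my] := izP y hy.
    by rewrite AzE// my invz wpsi.
  by rewrite !E'.
have hreal i j k v : bal r v -> zz (psi v) != 0 -> complex.Im (hterm G z i j k (chart_inv z v)) = 0.
  by move=> hv _; have [dv _] := izP v hv; exact: (hterm_real G az (@subset_refl _ _) i j k dv).
have sA' i j := smoothc_subset sub (sA i j).
have [u [b [[su u0 sb skb uE] hb]]] := normal_form r_gt0 spsi psiW psi0 dpsi0 psiE sk1 sk2 k10 k20 E1 E2 Eom
  sA' skA (smoothc_subset sub sgw) (fun x hx => gw0 x (sub x hx)) A0 clz hreal.
exists z, (fun q => u (chart_map z q)), (fun i j q => b i j (chart_map z q)), c; split; split=> //.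
- apply/(smoothC_on_chart _ az oz) => //; rewrite -/(chart_img z) iz.
  by apply: (smoothc_ext oBr _ su) => v hv /=; have [_] := izP v hv => /= ->.
- by move=> q dq; apply: u0; exact: mz.
- move=> i j; apply/(smooth_on_chart _ az oz) => //; rewrite -/(chart_img z) iz.
  by apply: (smooth_ext oBr _ (sb i j)) => v hv /=; have [_] := izP v hv => /= ->.
- by move=> i j q dq; rewrite skb//; exact: mz.
- move=> q dq; rewrite sz// -(psiz q dq) -uE; last exact: mz.
  by congr (_ * _); rewrite /gw psiz// invmapK//; exact: zw.
- by move=> i j q dq; rewrite AzE// hb//; exact: mz.
Qed.

End LocalModel.

(** * Two-forms and spinors prescribed in one chart *)

Section SpinorFields.
Context {R : realType} {M : smooth_manifold R 4}.
Local Notation C := R[i].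
Implicit Types (z c d : mchart M) (q : M).

Lemma smoothC_ev U (s t : M -> C) (a : 'I_4 -> 'I_4 -> M -> C) K : open U -> smoothC_on U s ->
  (forall i j, smoothC_on U (a i j)) -> smoothC_on U t ->
  smoothC_on U (fun q => ev (s q) (fun i j => a i j q) (t q) K).
Proof.
move=> oU ss sa st'; have s0 := smoothC_on_cst oU 0.
have e f : smoothC_on U f -> (forall q, f q = ev (s q) (fun i j => a i j q) (t q) K) ->
    smoothC_on U (fun q => ev (s q) (fun i j => a i j q) (t q) K).
  by move=> sf h; apply: (smoothC_on_ext oU _ sf) => q _.
rewrite (st_eta K) in e *; move: e.
case: (o0 \in K); case: (o1 \in K); case: (o2 \in K); case: (o3 \in K) => e;
  first [by apply: (e _ ss) => q; rewrite ffunE !in_st | by apply: (e _ st') => q; rewrite ffunE !in_st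
   | by apply: (e _ s0) => q; rewrite ffunE !in_st | by apply: (e _ (sa o0 o1)) => q; rewrite ffunE !in_st
   | by apply: (e _ (sa o0 o2)) => q; rewrite ffunE !in_st | by apply: (e _ (sa o0 o3)) => q; rewrite ffunE !in_st
   | by apply: (e _ (sa o1 o2)) => q; rewrite ffunE !in_st | by apply: (e _ (sa o1 o3)) => q; rewrite ffunE !in_st
   | by apply: (e _ (sa o2 o3)) => q; rewrite ffunE !in_st].
Qed.

(** A form needs components in every chart; those prescribed in [z] are transported to [c] by the
    Jacobian. *)
Definition chart_form2 z (b : 'I_4 -> 'I_4 -> M -> R) : diff_form M := fun c q =>
  ext_pull (cplx_mx (jac c z q)) (ev 0 (fun i j => (b i j q)%:C%C) 0).

Section Form2.
Variables (z : mchart M) (b : 'I_4 -> 'I_4 -> M -> R).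
Hypothesis skb : forall i j q, chart_dom z q -> b j i q = - b i j q.

Definition bmx c q : 'M[R]_4 := (jac c z q)^T *m (\matrix_(i, j) b i j q) *m jac c z q.

Lemma bmxE c q i j : bmx c q i j = \sum_l (\sum_k jac c z q k i * b k l q) * jac c z q l j.
Proof.
rewrite [LHS]mxE; apply: eq_bigr => l _; congr (_ * _); rewrite mxE; apply: eq_bigr => k _.
by rewrite [_^T _ _]mxE; congr (_ * _); rewrite mxE.
Qed.

Lemma chart_form2E c q : chart_dom z q ->
  chart_form2 z b c q = ev 0 (fun i j => (bmx c q i j)%:C%C) 0.
Proof.
move=> dq; rewrite /chart_form2 ext_pull_ev => [|i j]; last by rewrite skb// rmorphN.
apply: ev_ext => // i j.
have -> : \matrix_(i, j) (b i j q)%:C%C = cplx_mx (\matrix_(i, j) b i j q).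
  by apply/matrixP => k l; rewrite !mxE.
by rewrite /cplx_mx matrix.map_trmx -!map_mxM mxE.
Qed.

Hypotheses (az : atlas z) (sb : forall i j, smooth_on (chart_dom z) (b i j)).

Lemma smooth_bmx c i j : atlas c -> smooth_on (chart_dom z `&` chart_dom c) (fun q => bmx c q i j).
Proof.
move=> ac; have oU : open (chart_dom z `&` chart_dom c) by apply: openI; exact: dom_open.
suff [h _] : smoothC_on (chart_dom z `&` chart_dom c) (fun q => (bmx c q i j)%:C%C) by [].
have sJ k l : smoothC_on (chart_dom z `&` chart_dom c) (fun q => (jac c z q k l)%:C%C).
  by apply: smoothC_on_real => //; rewrite setIC; exact: smooth_on_jac.
have sb' k l : smoothC_on (chart_dom z `&` chart_dom c) (fun q => (b k l q)%:C%C).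
  by apply: smoothC_on_real => //; apply: smooth_on_subset (sb k l) => q [].
have h : smoothC_on (chart_dom z `&` chart_dom c)
    (fun q => \sum_l (\sum_k (jac c z q k i)%:C%C * (b k l q)%:C%C) * (jac c z q l j)%:C%C).
  apply: smoothC_on_sum => // l _; apply: smoothC_on_mul => //.
  by apply: smoothC_on_sum => // k _; exact: smoothC_on_mul.
apply: (smoothC_on_ext oU _ h) => q _.
rewrite bmxE rmorph_sum; apply: eq_bigr => l _; rewrite rmorphM; congr (_ * _).
by rewrite rmorph_sum; apply: eq_bigr => k _; rewrite rmorphM.
Qed.

Lemma chart_form2_form : is_kform 2 (chart_dom z) (chart_form2 z b) /\ real_form (chart_dom z) (chart_form2 z b).
Proof.
split; first split; first split.
- move=> c K ac; have oU : open (chart_dom z `&` chart_dom c) by apply: openI; exact: dom_open.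
  have h : smoothC_on (chart_dom z `&` chart_dom c) (fun q => ev 0 (fun i j => (bmx c q i j)%:C%C) 0 K).
    apply: (smoothC_ev (s := fun=> 0) (t := fun=> 0)) => //; try exact: smoothC_on_cst.
    by move=> i j; apply: smoothC_on_real => //; exact: smooth_bmx.
  by apply: (smoothC_on_ext oU _ h) => q [dq _]; rewrite chart_form2E.
- move=> c d q ac ad dq cq ddq.
  rewrite !chart_form2E// ext_pull_ev => [|i j].
    apply: ev_ext => // i j.
    have -> : \matrix_(i, j) (bmx d q i j)%:C%C = cplx_mx (bmx d q).
      by apply/matrixP => k l; rewrite !mxE.
    rewrite /cplx_mx matrix.map_trmx -!map_mxM [RHS]mxE; congr (_%:C%C).
    by rewrite /bmx (jac_comp ac ad az cq ddq dq) trmx_mul !mulmxA.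
  rewrite -rmorphN; congr (_%:C%C).
  have e : (bmx d q)^T = - bmx d q.
    rewrite /bmx !trmx_mul trmxK mulmxA -mulNmx -mulmxN; congr (_ *m _ *m _).
    by apply/matrixP => k l; rewrite !mxE skb.
  by have := congr1 (fun K : 'M[R]_4 => K i j) e; rewrite [LHS]mxE [RHS]mxE.
- move=> c q K ac dq cq; rewrite chart_form2E// (st_eta K) card_st ffunE !in_st.
  by case: (o0 \in K); case: (o1 \in K); case: (o2 \in K); case: (o3 \in K).
- move=> c q K ac dq cq; rewrite chart_form2E// (st_eta K) ffunE !in_st.
  by case: (o0 \in K); case: (o1 \in K); case: (o2 \in K); case: (o3 \in K).
Qed.

End Form2.

Definition zrow c z (k : 'I_4) (l : 'I_4) q : 'cV[C]_4 := \col_i (jac c z q k i +i* jac c z q l i)%C.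

Lemma dfun_zcoord c z q : dfun c (zcoord1 z) q = covec (zrow c z o0 o1 q) /\
  dfun c (zcoord2 z) q = covec (zrow c z o2 o3 q).
Proof. by split; congr covec; apply/colP => i; rewrite !mxE. Qed.

Lemma normal_spinorE z l b c q : (forall i j q, chart_dom z q -> b j i q = - b i j q) -> chart_dom z q ->
  let B i j := (bmx z b c q i j)%:C%C in let s := l * zz (chart_map z q) in
  let t := th (zrow c z o0 o1 q) (zrow c z o2 o3 q) in
  normal_spinor z l (chart_form2 z b) c q =
  ev s (fun i j => s * B i j + t i j) (s * (pf2 B B / 2) + pf2 B t).
Proof.
move=> skb dq B s t; rewrite /normal_spinor chart_form2E//.
by have [-> ->] := dfun_zcoord c z q; rewrite -mulrA -/(zz _) spinor_ev.
Qed.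

(** Naturality of dz_1 /\ dz_2: its components in the chart [c] are computed from the constant ones
    in the chart [z]. *)
Lemma Th_pull c z q i j : \sum_k \sum_l (jac c z q k i)%:C%C * Th k l * (jac c z q l j)%:C%C =
  th (zrow c z o0 o1 q) (zrow c z o2 o3 q) i j :> C.
Proof.
have e k : \sum_l (jac c z q l k)%:C%C * Tm l o0 = zrow c z o0 o1 q k 0 /\
    \sum_l (jac c z q l k)%:C%C * Tm l o1 = zrow c z o2 o3 q k 0.
  rewrite /zrow; move: (jac c z q) => J; rewrite !sum4 /Tm !mxE !val_o /=.
  by split; apply: eqReIm; rewrite ?cReD ?cImD ?cReM ?cImM /=; ring.
rewrite /th; have [<- <-] := e i; have [<- <-] := e j; rewrite /Th sum4 !sum4; ring.
Qed.

End SpinorFields.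

Theorem theorem5p3 (R : realType) (M : smooth_manifold R 4)
    (G : gen_complex_structure M) (G_stable : stable G)
    (p : M) (Dp : crossing_locus G p) :
  exists z : mchart M,
    [/\ atlas z, chart_dom z p,
        divisor_ideal (chart_dom z) (anticanonical_section G) =
          principal_ideal (chart_dom z) (fun q => zcoord1 z q * zcoord2 z q) &
        exists (l : R[i]) (B : diff_form M),
          [/\ is_kform 2 (chart_dom z) B, real_form (chart_dom z) B &
              canonical_trivialisation G (chart_dom z) (normal_spinor z l B)]].
Proof.
have [a0 [U [g [f1 [f2 [[oU Up Ua] [sg sf1 sf2] g0 sE [f1p f2p cr]]]]]]] := crossing_generators G_stable Dp.
have [oU0 hrho] := svalP a0; set U0 := (sval a0).1 in oU0 hrho; set rho := (sval a0).2 in hrho.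
have [[frho crho] nrho] := hrho.
have rhoE c q : atlas c -> chart_dom c q -> U q -> rho c q finset.set0 = g q * (f1 q * f2 q).
  by move=> ac cq Uq; rewrite -(form0E frho ac cq (Ua q Uq)) -sE.
have [z [u [b [c [[[az zp] zU c0 su u0] [sb skb r0E r2E]]]]]] :=
  normal_chart hrho oU Up Ua sg sf1 sf2 g0 rhoE f1p f2p cr.
have oz := dom_open az.
have zU0 : chart_dom z `<=` U0 by move=> q /zU/Ua.
have zzE q : zcoord1 z q * zcoord2 z q = zz (chart_map z q) by [].
have sE' q : chart_dom z q -> anticanonical_section G a0 q = u q * zz (chart_map z q).
  by move=> dq; rewrite -r0E// -(form0E frho az dq (zU0 q dq)).
exists z; split=> //.
(* In the frame [a0] the section is u z_1 z_2 with [u] a unit on the chart domain, so both ideals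
   are generated by it; the cocycle extends a coefficient in this frame to a dual section. *)
- have [[hE [ss scomp] _] _] := G_stable.
  apply/seteqP; split=> h.
    move=> [t [st tt] ht]; exists (fun q => u q * t a0 q).
      apply: smoothC_on_mul => //; apply: smoothC_on_subset (st a0) => q dq; split=> //.
      exact: zU0.
    by move=> q dq; rewrite (ht a0 q dq (zU0 q dq)) sE'// zzE mulrAC.
  move=> [k sk hk].
  have sphi : smoothC_on (chart_dom z) (fun q => k q / u q).
    by apply: smoothC_on_mul => //; exact: smoothC_on_inv.
  exists (fun a q => lb_trans a0 a q * (k q / u q)).
    exact: (dual_section_local hE oz zU0 sphi).
  move=> a q dq aq; rewrite hk// zzE.
  have := scomp a0 a q I (zU0 q dq) aq; rewrite sE'// => e.
  have uq := u0 q dq; apply: (mulfI uq).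
  have -> : u q * (anticanonical_section G a q * (lb_trans a0 a q * (k q / u q))) =
     k q * (lb_trans a0 a q * anticanonical_section G a q).
    by field; exact: uq.
  by rewrite -e mulrCA.
pose l := c^-1; pose B := chart_form2 z b; exists l, B.
have [kB rB] := chart_form2_form skb az sb; split=> //.
(* The nowhere zero factor between rho and the normalised spinor; it is independent of the chart in
   which components are taken. *)
pose kap q := l / u q.
have l0 : l != 0 by rewrite invr_eq0.
have kap0 q : chart_dom z q -> kap q != 0 by move=> dq; rewrite mulf_neq0// invr_eq0 u0.
have skap : smoothC_on (chart_dom z) kap.
  by apply: smoothC_on_mul => //; [exact: smoothC_on_cst|exact: smoothC_on_inv].
have szz : smoothC_on (chart_dom z) (fun q => zz (chart_map z q)).
  apply/(smoothC_on_chart _ az oz) => //.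
  have oi := img_open az; have [_ szz] := smoothc_z oi.
  by apply: (smoothc_ext oi _ szz) => x cx /=; have [_ ->] := chart_img_inv (atlas_chart az) cx.
have snorm d K : atlas d -> smoothC_on (chart_dom z `&` chart_dom d) (fun q => normal_spinor z l B d q K).
  move=> ad; have oW : open (chart_dom z `&` chart_dom d) by apply: openI => //; exact: dom_open.
  pose Bq i j q : R[i] := (bmx z b d q i j)%:C%C; pose s q := l * zz (chart_map z q).
  pose t i j q := th (zrow d z o0 o1 q) (zrow d z o2 o3 q) i j.
  have ss : smoothC_on (chart_dom z `&` chart_dom d) s.
    apply: smoothC_on_mul => //; first exact: smoothC_on_cst.
    by apply: smoothC_on_subset szz => q [].
  have sB i j : smoothC_on (chart_dom z `&` chart_dom d) (Bq i j).
    by apply: smoothC_on_real => //; exact: smooth_bmx.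
  have srow k k' i : smoothC_on (chart_dom z `&` chart_dom d) (fun q => zrow d z k k' q i 0).
    have sJ m : smooth_on (chart_dom z `&` chart_dom d) (fun q => jac d z q m i).
      by rewrite setIC; exact: smooth_on_jac.
    have h : smoothC_on (chart_dom z `&` chart_dom d) (fun q => (jac d z q k i +i* jac d z q k' i)%C).
      by split; exact: sJ.
    by apply: (smoothC_on_ext oW _ h) => q _; rewrite [RHS]mxE.
  have st i j : smoothC_on (chart_dom z `&` chart_dom d) (t i j).
    apply: smoothC_on_add => //; last apply: smoothC_on_opp => //; exact: smoothC_on_mul.
  have spf (x y : 'I_4 -> 'I_4 -> M -> R[i]) : (forall i j, smoothC_on (chart_dom z `&` chart_dom d) (x i j)) ->
      (forall i j, smoothC_on (chart_dom z `&` chart_dom d) (y i j)) ->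
      smoothC_on (chart_dom z `&` chart_dom d) (fun q => pf2 (fun i j => x i j q) (fun i j => y i j q)).
    move=> sx sy; rewrite /pf2.
    have m i j k k' := smoothC_on_mul oW (sx i j) (sy k k').
    by do ![apply: smoothC_on_add => //]; do ?[apply: smoothC_on_opp => //]; exact: m.
  have h : smoothC_on (chart_dom z `&` chart_dom d) (fun q => ev (s q) (fun i j => s q * Bq i j q + t i j q)
     (s q * (pf2 (fun i j => Bq i j q) (fun i j => Bq i j q) / 2) +
      pf2 (fun i j => Bq i j q) (fun i j => t i j q)) K).
    apply: smoothC_ev => //.
      by move=> i j; apply: smoothC_on_add => //; exact: smoothC_on_mul.
    apply: smoothC_on_add => //; last exact: spf.
    apply: smoothC_on_mul => //; apply: smoothC_on_mul => //; last exact: smoothC_on_cst.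
    exact: spf.
  by apply: (smoothC_on_ext oW _ h) => q [dq _]; rewrite normal_spinorE.
have srho d K : atlas d -> smoothC_on (chart_dom z `&` chart_dom d) (fun q => rho d q K).
  by move=> ad; apply: smoothC_on_subset (frho.1 d K ad) => q [/zU0].
have cmpE d q i j : atlas d -> chart_dom z q -> chart_dom d q -> cmp2 (rho d q) i j =
    u q * (c * th (zrow d z o0 o1 q) (zrow d z o2 o3 q) i j + zz (chart_map z q) * (bmx z b d q i j)%:C%C).
  move=> ad dq ddq; rewrite (frho.2 d z q ad az (zU0 q dq) ddq dq) cmp2_pull -Th_pull.
  have -> : (bmx z b d q i j)%:C%C = \sum_k \sum_m (jac d z q k i)%:C%C * (b k m q)%:C%C * (jac d z q m j)%:C%C.
    rewrite bmxE rmorph_sum exchange_big; apply: eq_bigr => m _.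
    by rewrite rmorphM rmorph_sum mulr_suml; apply: eq_bigr => k _; rewrite rmorphM.
  transitivity (\sum_k \sum_m (jac d z q k i)%:C%C * cmp2 (rho z q) k m * (jac d z q m j)%:C%C).
    rewrite mxE exchange_big; apply: eq_bigr => m _; rewrite mxE mulr_suml; apply: eq_bigr => k _.
    by rewrite [_^T _ _]mxE [cplx_mx _ _ _]mxE [cplx_mx _ _ _]mxE.
  rewrite !mulr_sumr -big_split mulr_sumr; apply: eq_bigr => k _.
  rewrite !mulr_sumr -big_split mulr_sumr; apply: eq_bigr => m _.
  by rewrite r2E//=; ring.
(* Off the divisor rho is determined by its parts of degree zero and two ([canonical_ev]). These
   match by construction, and the degree-four part follows by computation. *)
have off d q : atlas d -> chart_dom z q -> chart_dom d q -> zz (chart_map z q) != 0 ->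
    normal_spinor z l B d q = ext_scale (kap q) (rho d q).
  move=> ad dq ddq zq; have dE : rho d q finset.set0 = u q * zz (chart_map z q).
    by rewrite (frho.2 d z q ad az (zU0 q dq) ddq dq) ext_pull0 r0E.
  have oW : open (chart_dom z `&` chart_dom d) by apply: openI => //; exact: dom_open.
  have uq := u0 q dq.
  have n0 : rho d q finset.set0 != 0 by rewrite dE mulf_neq0.
  have crq q' : (chart_dom z `&` chart_dom d) q' -> in_canonical G d q' (rho d q').
    by move=> [/zU0 h1 h2]; exact: crho.
  have [_ ->] := canonical_ev ad (@subIsetr _ _ _) crq (conj dq ddq) n0.
  rewrite ext_scale_ev normal_spinorE// dE /kap /l.
  apply: ev_ext => [|i j|].
  - by field; rewrite c0 uq.
  - by rewrite cmpE//; field; rewrite c0 uq.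
  - rewrite /pf2 !cmpE// /th; move: (bmx z b d q) (zrow d z o0 o1 q) (zrow d z o2 o3 q) => b' x y.
    by move: zq c0 uq => zq c1 uq; field; rewrite c1 uq zq.
(* Both sides are smooth in every coefficient and agree off the divisor, which is nowhere dense. *)
have key d q : atlas d -> chart_dom z q -> chart_dom d q ->
    normal_spinor z l B d q = ext_scale (kap q) (rho d q).
  move=> ad dq ddq; apply/ffunP => K; rewrite [RHS]ffunE.
  have oW : open (chart_dom z `&` chart_dom d) by apply: openI => //; exact: dom_open.
  have Wz : chart_dom z `&` chart_dom d `<=` chart_dom z by move=> ? [].
  have s1 := (smoothC_on_chart _ az oW Wz).1 (snorm d K ad).
  have s2' : smoothC_on (chart_dom z `&` chart_dom d) (fun q => kap q * rho d q K).
    by apply: smoothC_on_mul => //; [exact: smoothC_on_subset skap|exact: srho].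
  have s2 := (smoothC_on_chart _ az oW Wz).1 s2'.
  have oI := chart_image_open (atlas_chart az) oW Wz.
  have := eq_off_zz oI s1 s2 _ (imageP _ (conj dq ddq)); rewrite /= invmapK//; apply=> x [q' [dq' ddq'] <-] zx.
  by rewrite invmapK// off// [LHS]ffunE.
split.
  split; last by move=> d q ad dq ddq v hv; rewrite key// cliffordZ crho//; [apply/ffunP => K; rewrite !ffunE mulr0|exact: zU0].
  split=> [d K ad|d d' q ad ad' dq ddq ddq']; first exact: snorm.
  by rewrite !key// ext_pullZ (frho.2 d d' q)//; exact: zU0.
move=> d q ad dq ddq; rewrite key//; apply: contraNneq (nrho d q ad (zU0 q dq) ddq) => e.
apply/eqP/ffunP => K; have := congr1 (fun w : ext R 4 => w K) e; rewrite !ffunE => /eqP.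
by rewrite mulf_eq0 (negbTE (kap0 q dq)) => /eqP.
Qed.
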